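(* In the setting described in the context ($\mathfrak h$, $p$, $\sigma$, $\Lambda$, $\varepsilon$, and an $\mathfrak h^{[0]}$-diagonalizable Fock space $V$), assume that (i) $m_s=m_s(\alpha,\beta)=(\sigma^{-s}\alpha|\beta)\in\mathbb Z$ for all $\alpha,\beta\in\Lambda$ and $0\le s\le p-1$; (ii) $\varepsilon(\alpha,\beta)\varepsilon(\beta,\alpha)^{-1}=(-1)^{(\alpha|\alpha)(\beta|\beta)+p(\alpha^{[0]}|\beta^{[0]})}\,\omega^{-\sum_{s=1}^{p-1}s\,m_s}$ for all $\alpha,\beta\in\Lambda$, where $\omega=\exp(2\pi i/p)$. Then for all $\alpha,\beta\in\Lambda$ the vertex operators $X_\alpha,X_\beta\in\mathcal F\{V\}$ are local (in the super sense, $X_\alpha$ having parity $(\alpha|\alpha)\bmod 2$) of order $$N(\alpha,\beta)=\max\big(\{-m_s: m_s<0,\ 0\le s\le p-1\}\cup\{0\}\big).$$ The operators $X_\alpha$, $\alpha\in\Lambda$, generate the lattice vertex superalgebra $\mathfrak V=\mathfrak V_\Lambda\subset\mathcal F\{V\}$, which does not depend on the grading $\mathfrak h=\bigoplus_\lambda\mathfrak h^{[\lambda]}$ of $\mathfrak h$. The products of the generators are given by $$X_\alpha{}_{(-(\alpha|\beta)-n-1)}X_\beta=\varkappa(\alpha,\beta)\,\frac1{n!}\big(D-\beta(-1)\big)^{n}X_{\alpha+\beta}\qquad(n\ge0),$$ and $X_\alpha{}_{(n)}X_\beta=0$ if $n\ge-(\alpha|\beta)$, where $$\varkappa(\alpha,\beta)=\varepsilon(\alpha,\beta)\,p^{-(\alpha|\beta)}\prod_{s=1}^{p-1}(1-\omega^s)^{m_s}.$$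 Here $D=\frac{d}{dz}$ and $\beta(-1)x=\tilde\beta_{(-1)}x$.
   Context: Ground field $\mathbb C$. Lattice data. $\mathfrak h$ is a complex vector space of finite dimension $l$ with a nondegenerate symmetric bilinear form $(\cdot|\cdot)$; $p\ge1$ is an integer; $\mathfrak h=\bigoplus_{\lambda\in\{0,\frac1p,\dots,\frac{p-1}p\}}\mathfrak h^{[\lambda]}$ is a grading by the cyclic group $\frac1p\mathbb Z/\mathbb Z$ with $(\mathfrak h^{[\lambda]}|\mathfrak h^{[\mu]})=0$ unless $\lambda+\mu\in\mathbb Z$. For $n\in\frac1p\mathbb Z$, $\mathfrak h^{[n]}$ is the component of class $n\bmod\mathbb Z$, and $h^{[n]}$ is the projection of $h\in\mathfrak h$ to it; $h'=h-h^{[0]}$. $\sigma:\mathfrak h\to\mathfrak h$ is the isometry acting on $\mathfrak h^{[\lambda]}$ by $e^{2\pi i\lambda}$ (so $\sigma^p=1$). $\Lambda\subset\mathfrak h$ is a lattice of rank $l$ (the $\mathbb Z$-span of a $\mathbb C$-basis of $\mathfrak h$) which agrees with the grading in the sense that $\operatorname{rk}\Lambda^{[\lambda]}=\dim\mathfrak h^{[\lambda]}$ for every $\lambda$, where $\Lambda^{[\lambda]}$ is the degree-$\lambda$ part of $\Lambda$ (its image under the projection to $\mathfrak h^{[\lambda]}$, with $\operatorname{rk}$ the dimension of the span). $\varepsilon:\Lambda\times\Lambda\to\mathbb C^\times$ is a 2-cocycle, and $R$ is the associative algebra with basis $e(\alpha)$, $\alpha\in\Lambda$, and product $e(\alpha)e(\beta)=\varepsilon(\alpha,\beta)e(\alpha+\beta)$.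 Heisenberg algebra. $H$ is the Lie algebra spanned by a central element $\mathsf c$ and symbols $a(n)$, $n\in\frac1p\mathbb Z$, $a\in\mathfrak h^{[n]}$ (linear in $a$), with $[a(m),b(n)]=\delta_{m+n,0}\,m\,(a|b)\,\mathsf c$. For arbitrary $a\in\mathfrak h$ put $a(n)=a^{[n]}(n)$ and $\tilde a(z)=\sum_{n\in\frac1p\mathbb Z}a(n)z^{-n-1}$. Fock space $V$: a vector space that is an $R$-module (unital) and an $H$-module which is restricted (for each $v$ and $a$, $a(n)v=0$ for $n\gg0$), with $\mathsf c=\mathrm{id}$ and $[h(n),e(\alpha)]=\delta_{n,0}(h|\alpha)e(\alpha)$ for $n\in\frac1p\mathbb Z$, $h\in\mathfrak h^{[n]}$; $\mathfrak h^{[0]}$-diagonalizable means $V=\bigoplus_{\xi\in(\mathfrak h^{[0]})^*}V_\xi$, with $h(0)=\xi(h)$ on $V_\xi$ for $h\in\mathfrak h^{[0]}$. Generalized vertex operators. $\mathcal F\{V\}$ is the linear span of series $\sum_{n\in\lambda+\mathbb Z}\alpha(n)z^{-n-1}$ ($\lambda\in\mathbb C$, $\alpha(n)\in\mathfrak{gl}(V)$) such that for each $v\in V$, $\alpha(\lambda+j)v=0$ for integers $j\gg0$; $\mathcal F(V)$ is the subspace of those with integer powers of $z$ only; $\mathbf 1\in\mathcal F(V)$ is the identity operator times $z^0$. The vertex operator $X_\alpha\in\mathcal F\{V\}$, $\alpha\in\Lambda$, is $$X_\alpha(z)=e(\alpha)E_-(\alpha,z)E_+(\alpha,z)\,z^{\alpha(0)}z^{-(\alpha'|\alpha')/2},\qquad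 E_\pm(\alpha,z)=\exp\sum_{n\in\frac1p\mathbb Z,\ n\gtrless0}-\frac{\alpha(n)}nz^{-n},$$ where $z^{\alpha(0)}$ acts on $V_\xi$ as $z^{\xi(\alpha^{[0]})}$. Operators $\alpha,\beta$ of parities $p(\alpha),p(\beta)\in\{0,1\}$ are local of order $N$ if $(z-w)^N\big(\alpha(w)\beta(z)-(-1)^{p(\alpha)p(\beta)}\beta(z)\alpha(w)\big)=0$. For local $\alpha_0,\beta_0\in\mathcal F(V)$ and $n\in\mathbb Z$: $$(\alpha_0{}_{(n)}\beta_0)(m)=\sum_{s\ge0}(-1)^s\tbinom ns\alpha_0(n-s)\beta_0(m+s)-(-1)^{p(\alpha_0)p(\beta_0)}\sum_{s\le n}(-1)^s\tbinom n{n-s}\beta_0(m+s)\alpha_0(n-s);$$ for $\alpha=z^\lambda\alpha_0$, $\beta=z^\mu\beta_0$ with $\lambda,\mu\in\mathbb C$, $\alpha_{(n)}\beta=\sum_{j\ge0}\binom\lambda j(\alpha_0{}_{(n+j)}\beta_0)z^{\lambda+\mu-j}$, extended bilinearly. The operators $\tilde a$ have even parity. The vertex superalgebra generated by the $X_\alpha$ is the smallest subspace of $\mathcal F\{V\}$ containing $\mathbf 1$ and all $X_\alpha$ and closed under all products $(n)$, $n\in\mathbb Z$. A vertex superalgebra is a $\mathbb Z/2$-graded space with bilinear products $(n)$, $n\in\mathbb Z$, and $\mathbf 1$ such that, with $Da:=a_{(-2)}\mathbf 1$: $a_{(n)}b=0$ for $n\gg0$; $\mathbf 1_{(n)}a=\delta_{n,-1}a$;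 $a_{(n)}\mathbf 1=0$ for $n\ge0$ and $=\frac1{(-n-1)!}D^{-n-1}a$ for $n<0$; $(a_{(n)}b)_{(m)}c=\sum_{i\ge0}(-1)^i\binom nia_{(n-i)}(b_{(m+i)}c)-(-1)^{p(a)p(b)}\sum_{i\le n}(-1)^i\binom n{n-i}b_{(m+i)}(a_{(n-i)}c)$; $a_{(m)}(b_{(n)}c)-(-1)^{p(a)p(b)}b_{(n)}(a_{(m)}c)=\sum_{i\ge0}\binom mi(a_{(i)}b)_{(m+n-i)}c$.
   Formalization: Added: for all α and v, E_+(α,z)v is a finite sum, and for each α the weights ξ(α^[0]) of V lie in finitely many cosets of Z; both are needed for X_α∈F{V} but do not follow from restricted and diagonalizable. Independence of the grading is stated for nonzero Fock spaces. *)

(* Defs.v *)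
From HB Require Import structures.
From mathcomp Require Import all_boot all_order all_algebra.
From mathcomp Require Import complex.
From mathcomp Require Import all_classical all_reals all_analysis.

Set Implicit Arguments.
Unset Strict Implicit.
Unset Printing Implicit Defensive.

Import Order.TTheory GRing.Theory Num.Theory.
Local Open Scope classical_set_scope.
Local Open Scope ring_scope.
Local Open Scope complex_scope.

(* The ground field is the field R[i] of complex numbers over a model R of the
   real numbers. The sums \sum_(i \in A) F i below are over classical sets A
   and are meant for families with finitely many nonzero terms; they take the
   value 0 on families with infinitely many nonzero terms. *)

Section Numbers.
Variable R : realType.
Local Notation C := R[i].

Definition is_int (x : C) : Prop := exists k : int, x = k%:~R.

(* The integer equal to x; it is 0 if x is not an integer. *)
Definition toint (x : C) : int := xget 0 [set k : int | x = k%:~R].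

(* The binomial coefficient x (x - 1) ... (x - k + 1) / k!, for any x. *)
Definition gbin (x : C) (k : nat) : C :=
  (\prod_(i < k) (x - i%:R)) / (k`!)%:R.

(* A set of representatives of C / Z. *)
Definition strip : set C := [set x | 0 <= complex.Re x < 1].

Definition is_subspace (M : lmodType C) (S : set M) : Prop :=
  S 0 /\ forall (c : C) (x y : M), S x -> S y -> S (c *: x + y).

End Numbers.

Section VertexSuperalgebra.
Variable R : realType.
Local Notation C := R[i].

(* The Z/2-graded space is given by its homogeneous components S false (even)
   and S true (odd), which are independent subspaces of an ambient space M;
   the n-th product is given by its restrictions pr p q n to S p x S q. *)
Record vertex_superalgebra (M : lmodType C) (S : bool -> set M)
    (pr : bool -> bool -> int -> M -> M -> M) (vac : M) : Prop := {
  vsa_subspace : forall p, is_subspace (S p);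
  vsa_direct : forall x, S false x -> S true x -> x = 0;
  vsa_vac : S false vac;
  vsa_closed : forall p q n a b, S p a -> S q b -> S (p (+) q) (pr p q n a b);
  vsa_linearl : forall p q n (c : C) a a' b, S p a -> S p a' -> S q b ->
    pr p q n (c *: a + a') b = c *: pr p q n a b + pr p q n a' b;
  vsa_linearr : forall p q n (c : C) a b b', S p a -> S q b -> S q b' ->
    pr p q n a (c *: b + b') = c *: pr p q n a b + pr p q n a b';
  vsa_trunc : forall p q a b, S p a -> S q b ->
    exists N : int, forall n, N <= n -> pr p q n a b = 0;
  vsa_vacl : forall p a n, S p a ->
    pr false p n vac a = if n == -1 then a else 0;
  vsa_vacr_ge0 : forall p a n, S p a -> 0 <= n -> pr p false n a vac = 0;
  vsa_vacr_lt0 : forall p a (k : nat), S p a ->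
    pr p false (- k%:Z - 1) a vac =
      ((k`!)%:R : C)^-1 *: iter k (fun x => pr p false (-2) x vac) a;
  vsa_assoc : forall p q r a b c (n m : int), S p a -> S q b -> S r c ->
    pr (p (+) q) r m (pr p q n a b) c =
      \sum_(i \in [set: nat]) ((-1) ^+ i * gbin (n%:~R : C) i) *:
         pr p (q (+) r) (n - i%:Z) a (pr q r (m + i%:Z) b c)
      - (-1) ^+ (p && q) *: \sum_(i \in [set i : int | i <= n])
         ((-1) ^ i * gbin (n%:~R : C) `|n - i|%N) *:
         pr q (p (+) r) (m + i) b (pr p r (n - i) a c);
  vsa_comm : forall p q r a b c (m n : int), S p a -> S q b -> S r c ->
    pr p (q (+) r) m a (pr q r n b c)
      - (-1) ^+ (p && q) *: pr q (p (+) r) n b (pr p r m a c) =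
    \sum_(i \in [set: nat]) gbin (m%:~R : C) i *:
       pr (p (+) q) r (m + n - i%:Z) (pr p q i%:Z a b) c
}.

Record vsa_isomorphism (M M' : lmodType C)
    (S : bool -> set M) (pr : bool -> bool -> int -> M -> M -> M) (vac : M)
    (S' : bool -> set M') (pr' : bool -> bool -> int -> M' -> M' -> M')
    (vac' : M') (phi : M -> M') : Prop := {
  iso_linear : forall p (c : C) x y, S p x -> S p y ->
    phi (c *: x + y) = c *: phi x + phi y;
  iso_inj : forall p x, S p x -> phi x = 0 -> x = 0;
  iso_image : forall p, phi @` S p = S' p;
  iso_vac : phi vac = vac';
  iso_prod : forall p q n a b, S p a -> S q b ->
    phi (pr p q n a b) = pr' p q n (phi a) (phi b)
}.

End VertexSuperalgebra.

Section Fields.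
Variables (R : realType) (V : lmodType R[i]).
Local Notation C := R[i].

(* a : C -> V -> V stands for the series \sum_n a(n) z^(-n-1), with n in C. *)
Definition series_in_coset (lam : C) (a : C -> V -> V) : Prop :=
  [/\ forall n, linear (a n),
      forall n v, ~ is_int (n - lam) -> a n v = 0
    & forall v, exists N : int, forall j : int, N <= j ->
        a (lam + j%:~R) v = 0].

(* Membership in F{V}. *)
Definition gen_vertex_operator (a : C -> V -> V) : Prop :=
  exists (k : nat) (lam : 'I_k -> C) (f : 'I_k -> C -> V -> V),
    (forall i, series_in_coset (lam i) (f i)) /\ a = \sum_(i < k) f i.

Definition vac_op : C -> V -> V := fun n v => if n == -1 then v else 0.

(* d/dz *)
Definition ddz (a : C -> V -> V) : C -> V -> V :=
  fun n v => - n *: a (n - 1) v.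

(* (z-w)^N (a(w) b(z) - (-1)^(pa pb) b(z) a(w)) = 0, read off at
   w^(-n-1) z^(-m-1). *)
Definition local (pa pb : bool) (N : nat) (a b : C -> V -> V) : Prop :=
  forall (n m : C) (v : V),
    \sum_(s < N.+1) ((-1) ^+ s * ('C(N, s))%:R) *:
      (a (n + s%:R) (b (m + (N - s)%:R) v)
       - (-1) ^+ (pa && pb) *: b (m + (N - s)%:R) (a (n + s%:R) v)) = 0.

(* The n-th product of series with integer powers, indexed by int. *)
Definition int_prod (pa pb : bool) (n : int) (a b : int -> V -> V) :
    int -> V -> V := fun m v =>
  \sum_(s \in [set: nat]) ((-1) ^+ s * gbin (n%:~R : C) s) *:
     a (n - s%:Z) (b (m + s%:Z) v)
  - (-1) ^+ (pa && pb) *: \sum_(s \in [set s : int | s <= n])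
     ((-1) ^ s * gbin (n%:~R : C) `|n - s|%N) *: b (m + s) (a (n - s) v).

(* z^lam a0 *)
Definition zpow_mul (lam : C) (a0 : int -> V -> V) : C -> V -> V :=
  fun n v => if `[< is_int (n + lam) >] then a0 (toint (n + lam)) v else 0.

(* The a0 with integer powers such that z^lam a0 is the part of a with powers
   of z in lam + Z. Thus a is the sum over lam in strip of
   z^lam (coset_part lam a). *)
Definition coset_part (lam : C) (a : C -> V -> V) : int -> V -> V :=
  fun k v => a (k%:~R - lam) v.

(* The bilinear extension of
   (z^lam a0)_(n) (z^mu b0) = \sum_j binom(lam, j) (a0_(n+j) b0) z^(lam+mu-j). *)
Definition op_prod (pa pb : bool) (n : int) (a b : C -> V -> V) :
    C -> V -> V := fun k v =>
  \sum_(lm \in @strip R `*` @strip R) \sum_(j \in [set: nat])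
     gbin lm.1 j *:
     zpow_mul (lm.1 + lm.2 - j%:R)
       (int_prod pa pb (n + j%:Z) (coset_part lm.1 a) (coset_part lm.2 b)) k v.

(* Formal power series \sum_k f_k t^k with operator coefficients. *)
Definition ps_one : nat -> V -> V := fun k v => if k == 0%N then v else 0.

Definition ps_mul (f g : nat -> V -> V) : nat -> V -> V :=
  fun k v => \sum_(i < k.+1) f i (g (k - i)%N v).

(* exp f, for f without constant term: f^m contributes to t^k only if m <= k. *)
Definition ps_exp (f : nat -> V -> V) : nat -> V -> V :=
  fun k v => \sum_(m < k.+1) ((m`!)%:R : C)^-1 *: iter m (ps_mul f) ps_one k v.

End Fields.

Record lattice_data (R : realType) (l : nat) (h : vectType R[i]) := LatticeData {
  bform : h -> h -> R[i];
  bform_linear : forall b, scalar (bform^~ b);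
  bform_sym : forall a b, bform a b = bform b a;
  bform_nondeg : forall a, (forall b, bform a b = 0) -> a = 0;
  lbasis : l.-tuple h;
  lbasisP : basis_of fullv lbasis
}.

Definition in_lattice (R : realType) (l : nat) (h : vectType R[i])
    (L : lattice_data l h) : set h :=
  [set x | exists c : 'I_l -> int, x = \sum_(i < l) tnth (lbasis L) i *~ c i].

(* grade i is the component of degree i / p. *)
Record cyclic_grading (R : realType) (l : nat) (h : vectType R[i])
    (L : lattice_data l h) := CyclicGrading {
  gord : nat;
  gord_gt0 : (0 < gord)%N;
  grade : 'I_gord -> {vspace h};
  grade_direct : directv (\sum_i grade i)%VS;
  grade_full : fullv = (\sum_i grade i)%VS;
  grade_orth : forall (i j : 'I_gord) a b, a \in grade i -> b \in grade j ->
    ~~ (gord %| i + j)%N -> bform L a b = 0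
}.

Arguments grade {R l h L} _ _.
Arguments bform {R l h} _ _ _.

Section Grading.
Variables (R : realType) (l : nat) (h : vectType R[i]) (L : lattice_data l h).
Variable G : cyclic_grading L.
Local Notation C := R[i].
Local Notation p := (gord G).

Fact class_subproof (k : int) : (`|(k %% p)%Z|%N < p)%N.
Proof.
have p0 : (p%:Z != 0) by rewrite -lt0n gord_gt0.
by rewrite -ltz_nat gez0_abs ?modz_ge0 // ltz_pmod // ltz_nat gord_gt0.
Qed.

(* The class of k / p modulo Z. *)
Definition gclass (k : int) : 'I_p := Ordinal (class_subproof k).

Definition gproj (i : 'I_p) : 'End(h) := sumv_pi_for (grade_full G) i.

Definition gpart0 (a : h) : h := gproj (gclass 0) a.
Definition gprime (a : h) : h := a - gpart0 a.

Definition lattice_agrees : Prop :=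
  forall i : 'I_p,
    \dim <<[seq gproj i b | b <- lbasis L]>>%VS = \dim (grade G i).

(* exp (2 pi i / p) *)
Definition omega : C :=
  cos (2 * pi / p%:R) +i* sin (2 * pi / p%:R).

Definition sigma : 'End(h) := \sum_(i < p) omega ^+ i *: gproj i.

(* (sigma^(-s) a | b) *)
Definition pairing (s : nat) (a b : h) : C :=
  bform L (iter s (sigma^-1)%VF a) b.

Definition mpair (s : nat) (a b : h) : int := toint (pairing s a b).

Definition integral_pairings : Prop :=
  forall a b, in_lattice L a -> in_lattice L b ->
  forall s, (s < p)%N -> is_int (pairing s a b).

Definition cocycle_condition (eps : h -> h -> C) : Prop :=
  forall a b, in_lattice L a -> in_lattice L b ->
    eps a b / eps b a =
      (-1) ^ (toint (bform L a a) * toint (bform L b b)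
              + toint (p%:R * bform L (gpart0 a) (gpart0 b)))
      * omega ^ (- \sum_(1 <= s < p) s%:Z * mpair s a b).

Definition lparity (a : h) : bool := odd `|toint (bform L a a)|%N.

Definition locality_order (a b : h) : nat :=
  \max_(s < p | mpair s a b < 0) `|mpair s a b|%N.

Definition kappa (eps : h -> h -> C) (a b : h) : C :=
  eps a b * p%:R ^ (- toint (bform L a b))
  * \prod_(1 <= s < p) (1 - omega ^+ s) ^ mpair s a b.

End Grading.

Definition cocycle (R : realType) (l : nat) (h : vectType R[i])
    (L : lattice_data l h) (eps : h -> h -> R[i]) : Prop :=
  (forall a b, in_lattice L a -> in_lattice L b -> eps a b != 0) /\
  (forall a b c, in_lattice L a -> in_lattice L b -> in_lattice L c ->
     eps a b * eps (a + b) c = eps b c * eps a (b + c)).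

(* fe a is the action of e(a), for a in the lattice; fh k a is the action of
   a(k/p), extended to all a in h by a(n) = a^[n](n). The unit of the algebra
   spanned by the e(a) is eps(0,0)^(-1) e(0). *)
Record fock_space (R : realType) (l : nat) (h : vectType R[i])
    (L : lattice_data l h) (G : cyclic_grading L) (eps : h -> h -> R[i])
    (V : lmodType R[i]) := FockSpace {
  fe : h -> V -> V;
  fh : int -> h -> V -> V;
  fe_linear : forall a, in_lattice L a -> linear (fe a);
  fe_mul : forall a b v, in_lattice L a -> in_lattice L b ->
    fe a (fe b v) = eps a b *: fe (a + b) v;
  fe_unit : forall v, (eps 0 0)^-1 *: fe 0 v = v;
  fh_linear : forall k a, linear (fh k a);
  fh_linear_vec : forall k v, linear (fun a => fh k a v);
  fh_proj : forall k a v, fh k a v = fh k (gproj (gclass G k) a) v;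
  fh_comm : forall k m a b v,
    a \in grade G (gclass G k) -> b \in grade G (gclass G m) ->
    fh k a (fh m b v) - fh m b (fh k a v) =
      (if k + m == 0 then k%:~R / (gord G)%:R * bform L a b else 0) *: v;
  fh_restricted : forall v a, exists N : int, forall k, N <= k -> fh k a v = 0;
  fh_fe : forall k a b v,
    a \in grade G (gclass G k) -> in_lattice L b ->
    fh k a (fe b v) - fe b (fh k a v) =
      (if k == 0 then bform L a b else 0) *: fe b v
}.

Section VertexOperators.
Variables (R : realType) (l : nat) (h : vectType R[i]) (L : lattice_data l h).
Variables (G : cyclic_grading L) (eps : h -> h -> R[i]) (V : lmodType R[i]).
Variable F : fock_space G eps V.
Local Notation C := R[i].
Local Notation p := (gord G).
Local Notation h0 := (grade G (gclass G 0)).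

(* The dual of h^[0]. *)
Definition weight : Type := 'Hom(subvs_of h0, C^o).

Definition weight_space (xi : weight) : set V :=
  [set v | forall a : subvs_of h0, fh F 0 (vsval a) v = xi a *: v].

(* xi (a^[0]) *)
Definition weight_at (xi : weight) (a : h) : C := xi (vsproj h0 (gpart0 G a)).

Definition weight_decomposition (v : V)
    (s : seq (V * 'Hom(subvs_of h0, C^o))) : Prop :=
  (forall w, w \in s -> weight_space w.2 w.1) /\ v = \sum_(w <- s) w.1.

(* V is the sum of its weight spaces; the sum is direct because the weight
   spaces are simultaneous eigenspaces. *)
Definition h0_diagonalizable : Prop :=
  forall v, exists s, weight_decomposition v s.

(* \sum_(n in sg * N/p, n <> 0) - a(n)/n z^(-n), as a power series in
   z^(-sg/p), for sg = 1, -1. *)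
Definition E_exponent (sg : int) (a : h) : nat -> V -> V :=
  fun j v => if j == 0%N then 0
    else - ((sg * j%:Z)%:~R / p%:R : C)^-1 *: fh F (sg * j%:Z) a v.

(* E_plus a j is the coefficient of z^(-j/p) in E_+(a, z), and E_minus a j is
   the coefficient of z^(j/p) in E_-(a, z). *)
Definition E_plus (a : h) : nat -> V -> V := ps_exp (E_exponent 1 a).
Definition E_minus (a : h) : nat -> V -> V := ps_exp (E_exponent (-1) a).

(* X_a(n) on the weight space of xi: the terms of
   e(a) E_-(a,z) E_+(a,z) z^(xi(a^[0]) - (a'|a')/2) at z^(-n-1). *)
Definition X_on_weight (a : h) (xi : weight) (n : C) (v : V) : V :=
  \sum_(ij \in [set ij : nat * nat |
      ij.1%:R / p%:R - ij.2%:R / p%:R + weight_at xi a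
        - bform L (gprime G a) (gprime G a) / 2 = - n - 1])
    fe F a (E_minus a ij.1 (E_plus a ij.2 v)).

Definition X_op (a : h) : C -> V -> V := fun n v =>
  \sum_(w <- xget [::] [set s | weight_decomposition v s])
    X_on_weight a w.2 n w.1.

(* The vertex operators are meaningful and lie in F{V}: each E_+(a,z)v is a
   finite sum, so that E_-(a,z)E_+(a,z)v is defined, and the powers of z which
   occur in X_a lie in finitely many cosets of Z. *)
Definition vertex_operators_defined : Prop :=
  forall a, in_lattice L a ->
    (forall v, exists N : nat, forall j, (N <= j)%N -> E_plus a j v = 0) /\
    (exists cs : seq C, forall (xi : weight) (v : V),
       weight_space xi v -> v != 0 ->
       exists2 c, c \in cs & is_int (weight_at xi a - c)).

(* The field \sum_n a(n) z^(-n-1), n in (1/p) Z. *)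
Definition heis_op (a : h) : C -> V -> V := fun n v =>
  if `[< is_int (p%:R * n) >] then fh F (toint (p%:R * n)) a v else 0.

(* The components of the smallest graded subspace that contains 1 and the X_a
   and is closed under all products. *)
Inductive lattice_vsa : bool -> (C -> V -> V) -> Prop :=
| lvsa_vac : lattice_vsa false (@vac_op R V)
| lvsa_X a : in_lattice L a -> lattice_vsa (lparity L a) (X_op a)
| lvsa_0 q : lattice_vsa q 0
| lvsa_lin q (c : C) x y :
    lattice_vsa q x -> lattice_vsa q y -> lattice_vsa q (c *: x + y)
| lvsa_prod q r n x y :
    lattice_vsa q x -> lattice_vsa r y ->
    lattice_vsa (q (+) r) (op_prod q r n x y).

(* (D - b(-1)) x, for x of parity q *)
Definition D_minus (b : h) (q : bool) (x : C -> V -> V) : C -> V -> V :=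
  ddz x - op_prod false q (-1) (heis_op b) x.

End VertexOperators.

(* Main.v *)
(* For local fields a, b the products a_(n) b are the Taylor coefficients in w, at
   w = z, of (w - z)^N a(w) b(z), for any sufficiently large N. Applied to three
   fields, this gives the lemma of Dong and the Borcherds identities for every family
   of pairwise local fields with complex exponents.

   Normal ordering of X_a(w) X_b(z) produces the kernel \prod_s (1 - omega^s t)^(m_s)
   with t = (z/w)^(1/p). Since (w - z)^N = \prod_s (w^(1/p) - omega^s z^(1/p))^N, the
   kernel of (w - z)^N X_a(w) X_b(z) is a polynomial in t. The substitution t -> 1/t
   turns it into the kernel of the opposite product up to a scalar, which is the one
   in the cocycle condition, whence locality; and the order of vanishing at t = 1 and
   the leading coefficient there give the first nonzero product of X_a and X_b, with
   kappa(a,b). The remaining products follow from D X_b = b(-1) X_b.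

   The operator products of the X_a and of the Heisenberg fields involve the grading
   only through kappa. Two gradings give cocycles kappa, kappa' whose quotient is
   symmetric, hence the coboundary of some c because the lattice is free. The fields
   (X_a, c_a X'_a) on V x V' generate a vertex algebra that is the graph of an
   isomorphism, because both algebras are simple: they are spanned by Heisenberg
   descendants of the X_a, and any element can be moved to a nonzero multiple of the
   identity by charge operators, annihilation operators and products with X_(-a). *)

Require Import Defs.
From HB Require Import structures.
From mathcomp Require Import all_boot all_order all_algebra.
From mathcomp Require Import complex.
From mathcomp Require Import all_classical all_reals all_analysis.
From mathcomp Require Import ring lra zify.
Set Implicit Arguments.
Unset Strict Implicit.
Unset Printing Implicit Defensive.
Import Order.TTheory GRing.Theory Num.Theory.
Local Open Scope classical_set_scope.
Local Open Scope ring_scope.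
Local Open Scope complex_scope.

(** * Finitely supported sums and binomial coefficients *)

(** A sum over an infinite family is 0 by convention, so no rearrangement is free. Locality serves
    here as much for finiteness as for commutation: (w - z)^N a(w) b(z) v has exponents bounded
    below in both variables, and only such a series may be restricted to w = z.

    The n-th product is defined by splitting fields into cosets of the integers, with chosen
    representatives. The identity [gbin_add] absorbs the correction terms of that definition, and
    what remains is a Taylor coefficient whose binomial coefficients have complex upper entries;
    representatives play no part after [op_prod_tau].

    The hard identity is the one for (a_(n) b)_(m) c. The variable x of a is expanded at the moving
    point y, where the correlation function still has a pole along x = z. Hence [tau_comp] admits
    powers (x - z)^i with negative i.

    For the independence of the grading, images prescribed on the X_a do not yet define a map, since
    the relations among their iterated products are not listed anywhere. Simplicity replaces a
    presentation: it forces the algebra generated by the pairs to be a graph in both directions. *)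

Section FiniteSums.

(** Every rearrangement of the sums of the statement needs finite support. A list that contains the
    support is enough; it may be too long and may have repetitions. *)
Definition fin (T : choiceType) (U : nmodType) (f : T -> U) : Prop :=
  exists s : seq T, forall x, f x <> 0 -> x \in s.

Definition fsum (T : choiceType) (U : nmodType) (f : T -> U) : U :=
  \sum_(x \in [set: T]) f x.

Lemma fsumE (T : choiceType) (U : nmodType) (s : seq T) (f : T -> U) :
  (forall x, f x <> 0 -> x \in s) -> fsum f = \sum_(x <- undup s) f x.
Proof.
move=> sf; rewrite /fsum (fsbigE (undup s)) ?undup_uniq //.
  by apply: eq_bigl => x; rewrite in_setT.
by move=> x _; rewrite mem_undup => xs; apply: contrapT => /sf; exact/negP.
Qed.

Lemma fsum_fst (T : choiceType) (U : nmodType) (A : set T) (f : T -> U) :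
  \sum_(x \in A) f x = fsum (fun x => if `[< A x >] then f x else 0).
Proof.
rewrite /fsum fsbig_mkcond; apply: eq_fsbigr => x _; rewrite /patch.
by congr (if _ then _ else _); apply/idP/idP; rewrite inE => /asboolP.
Qed.

Lemma eq_fsum (T : choiceType) (U : nmodType) (f g : T -> U) :
  f =1 g -> fsum f = fsum g.
Proof. by move=> fg; apply: eq_fsbigr => x _. Qed.

Lemma fsum0 (T : choiceType) (U : nmodType) (f : T -> U) :
  (forall x, f x = 0) -> fsum f = 0.
Proof. by move=> f0; apply: fsbig1 => x _. Qed.

Lemma fin_sub (T : choiceType) (U U' : nmodType) (f : T -> U) (g : T -> U') :
  fin f -> (forall x, f x = 0 -> g x = 0) -> fin g.
Proof. by move=> [s sf] fg; exists s => x gx; apply: sf => /fg. Qed.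

Lemma fin_comp (T T' : choiceType) (U : nmodType) (f : T' -> U) (h : T -> T')
    (k : T' -> T) : cancel h k -> fin f -> fin (f \o h).
Proof.
by move=> hk [s sf]; exists (map k s) => x /sf/(map_f k); rewrite hk.
Qed.

Lemma finD (T : choiceType) (U : nmodType) (f g : T -> U) :
  fin f -> fin g -> fin (fun x => f x + g x).
Proof.
move=> [s sf] [t tg]; exists (s ++ t) => x fg; rewrite mem_cat.
have [fx|/eqP/sf->//] := eqVneq (f x) 0.
by rewrite tg ?orbT // => gx; apply: fg; rewrite fx gx addr0.
Qed.

Lemma fin_sum (T I : choiceType) (U : nmodType) (r : seq I)
    (f : I -> T -> U) :
  (forall i, i \in r -> fin (f i)) -> fin (fun x => \sum_(i <- r) f i x).
Proof.
elim: r => [_|i r IH H]; first by exists [::] => x; rewrite big_nil.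
have h : fin (fun x => f i x + \sum_(i <- r) f i x).
  by apply: finD; [apply: H; rewrite mem_head|apply: IH => j jr; apply: H; rewrite inE jr orbT].
by apply: fin_sub h _ => x; rewrite big_cons.
Qed.

Lemma fsumD (T : choiceType) (U : nmodType) (f g : T -> U) :
  fin f -> fin g -> fsum (fun x => f x + g x) = fsum f + fsum g.
Proof.
move=> [s sf] [t tg].
rewrite !(@fsumE _ _ (s ++ t)) ?big_split // => x; rewrite mem_cat.
- by move/tg->; rewrite orbT.
- by move/sf->.
have [fx|/eqP/sf->//] := eqVneq (f x) 0.
by rewrite fx add0r => /tg->; rewrite orbT.
Qed.

Lemma fsum_sum (T I : choiceType) (U : nmodType) (r : seq I)
    (f : I -> T -> U) :
  (forall i, i \in r -> fin (f i)) ->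
  fsum (fun x => \sum_(i <- r) f i x) = \sum_(i <- r) fsum (f i).
Proof.
elim: r => [_|i r IH H].
  by rewrite big_nil; apply: fsum0 => x; rewrite big_nil.
rewrite big_cons -IH; last by move=> j jr; apply: H; rewrite inE jr orbT.
rewrite -fsumD; first by apply: eq_fsum => x; rewrite big_cons.
  by apply: H; rewrite mem_head.
by apply: fin_sum => j jr; apply: H; rewrite inE jr orbT.
Qed.

Lemma fsum_morph (T : choiceType) (U U' : nmodType) (g : U -> U') (f : T -> U) :
  {morph g : x y / x + y} -> g 0 = 0 -> fin f ->
  g (fsum f) = fsum (fun x => g (f x)).
Proof.
move=> gD g0 [s sf]; rewrite !(@fsumE _ _ s) ?(big_morph g gD g0) // => x gx.
by apply: sf => fx; apply: gx; rewrite fx.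
Qed.

Lemma fsum_bij (T T' : choiceType) (U : nmodType) (f : T' -> U) (h : T -> T') :
  bijective h -> fsum f = fsum (fun x => f (h x)).
Proof. exact: reindex_fsbigT. Qed.

Lemma fsum_shift (T : zmodType) (U : nmodType) (c : T) (f : T -> U) :
  fsum f = fsum (fun x => f (x + c)).
Proof. by apply: fsum_bij; exists (+%R^~ (- c)) => x; rewrite ?addrK ?addrNK. Qed.

Lemma fsum_refl (T : zmodType) (U : nmodType) (c : T) (f : T -> U) :
  fsum f = fsum (fun x => f (c - x)).
Proof.
by apply: fsum_bij; exists (fun x => c - x) => x; rewrite opprB addrC subrK.
Qed.

Lemma fin_shift (T : zmodType) (U : nmodType) (c : T) (f : T -> U) :
  fin f -> fin (fun x => f (x + c)).
Proof. by apply: (fin_comp (addrK c)). Qed.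

Lemma fsum1 (T : choiceType) (U : nmodType) (x0 : T) (f : T -> U) :
  (forall x, x <> x0 -> f x = 0) -> fsum f = f x0.
Proof.
move=> h; rewrite (@fsumE _ _ [:: x0]) /= ?big_seq1 // => x fx.
by rewrite inE; apply/eqP; apply: contrapT => /h.
Qed.

Lemma fsum_exch (T T' : choiceType) (U : nmodType) (s : seq T) (s' : seq T')
    (f : T -> T' -> U) :
  (forall x y, f x y <> 0 -> x \in s /\ y \in s') ->
  fsum (fun x => fsum (f x)) = fsum (fun y => fsum (f^~ y)).
Proof.
move=> h.
rewrite (@fsumE _ _ s) => [|x fx]; last first.
  apply: contrapT => xs; apply: fx; apply: fsum0 => y.
  by apply: contrapT => /h[].
rewrite (@fsumE _ _ s') => [|y fy]; last first.
  apply: contrapT => ys; apply: fy; apply: fsum0 => x.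
  by apply: contrapT => /h[].
under eq_bigr do rewrite (fsumE (fun y fxy => (h _ y fxy).2)).
rewrite exchange_big /=.
by apply: eq_bigr => y _; rewrite (fsumE (fun x fxy => (h x y fxy).1)).
Qed.

Lemma fsum_nat (U : nmodType) (N : nat) (f : nat -> U) :
  (forall i, (N <= i)%N -> f i = 0) -> fsum f = \sum_(i < N) f i.
Proof.
move=> h; rewrite (@fsumE _ _ (iota 0 N)) => [|x fx].
  by rewrite undup_id ?iota_uniq // -(big_mkord xpredT) /index_iota subn0.
by rewrite mem_iota /= add0n ltnNge; apply/negP => /h.
Qed.

Lemma fin_nat (U : nmodType) (N : nat) (f : nat -> U) :
  (forall i, (N <= i)%N -> f i = 0) -> fin f.
Proof.
move=> h; exists (iota 0 N) => x fx.
by rewrite mem_iota /= add0n ltnNge; apply/negP => /h.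
Qed.

End FiniteSums.

Section FiniteSumsZ.

Lemma fsumZ (K : nzRingType) (T : choiceType) (U : lmodType K) (c : K) (f : T -> U) :
  fin f -> c *: fsum f = fsum (fun x => c *: f x).
Proof. by move=> ff; apply: fsum_morph; rewrite ?scaler0 // => x y; rewrite scalerDr. Qed.

Lemma fsumN (T : choiceType) (U : zmodType) (f : T -> U) :
  fin f -> - fsum f = fsum (fun x => - f x).
Proof. by move=> ff; apply: fsum_morph; rewrite ?oppr0 // => x y; rewrite opprD. Qed.

Lemma finN (T : choiceType) (U : zmodType) (f : T -> U) :
  fin f -> fin (fun x => - f x).
Proof. by move=> ff; apply: fin_sub ff _ => x ->; rewrite oppr0. Qed.

Lemma finZ (K : nzRingType) (T : choiceType) (U : lmodType K) (c : T -> K) (f : T -> U) :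
  fin f -> fin (fun x => c x *: f x).
Proof. by move=> ff; apply: fin_sub ff _ => x ->; rewrite scaler0. Qed.

Lemma fsumB (T : choiceType) (U : zmodType) (f g : T -> U) :
  fin f -> fin g -> fsum (fun x => f x - g x) = fsum f - fsum g.
Proof. by move=> ff fg; rewrite fsumD ?fsumN //; exact: finN. Qed.

Section Lin.
Variables (K : nzRingType) (U U' : lmodType K) (f : U -> U').
Hypothesis fl : linear f.

Lemma linD x y : f (x + y) = f x + f y.
Proof. by have := fl 1 x y; rewrite !scale1r. Qed.

Lemma lin0 : f 0 = 0.
Proof. by apply: (addIr (f 0)); rewrite -linD !add0r. Qed.

Lemma linZ c x : f (c *: x) = c *: f x.
Proof. by have := fl c x 0; rewrite addr0 lin0 addr0. Qed.

Lemma linN x : f (- x) = - f x.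
Proof. by rewrite -scaleN1r linZ scaleN1r. Qed.

Lemma linB x y : f (x - y) = f x - f y.
Proof. by rewrite linD linN. Qed.

Lemma lin_sum I (r : seq I) (P : pred I) F :
  f (\sum_(i <- r | P i) F i) = \sum_(i <- r | P i) f (F i).
Proof. exact: (big_morph f linD lin0). Qed.

Lemma lin_fsum (T : choiceType) (F : T -> U) :
  fin F -> f (fsum F) = fsum (fun x => f (F x)).
Proof. by apply: fsum_morph; [exact: linD|exact: lin0]. Qed.

End Lin.

End FiniteSumsZ.

Section Binomials.
Variable R : realType.
Local Notation C := R[i].

Lemma natf_neq0 (k : nat) : (k.+1%:R : C) != 0.
Proof. by rewrite pnatr_eq0. Qed.

Lemma gbin0 (x : C) : gbin x 0 = 1.
Proof. by rewrite /gbin big_ord0 fact0 divr1. Qed.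

Lemma gbinSl (x : C) k : k.+1%:R * gbin x k.+1 = (x - k%:R) * gbin x k.
Proof.
rewrite /gbin big_ord_recr /= factS natrM invfM.
have := natf_neq0 k; have : ((k`!)%:R : C) != 0 by rewrite pnatr_eq0 -lt0n fact_gt0.
move: (\prod_(_ < _) _) (x - _) (k`!)%:R k.+1%:R => a b c d c0 d0.
by field; rewrite c0 d0.
Qed.

Lemma gbin1 (x : C) : gbin x 1 = x.
Proof. by have := gbinSl x 0; rewrite gbin0 mul1r mulr1 subr0. Qed.

Lemma mulIn (k : nat) (a b : C) : k.+1%:R * a = k.+1%:R * b -> a = b.
Proof. exact: (mulfI (natf_neq0 k)). Qed.

(** Multiplication by n+1 = i + (n+1-i) lets [gbinSl] lower the index of one factor in each half of
    the sum. This is Vandermonde's identity for complex arguments; it absorbs the correction terms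
    of products with non-integer exponents. *)
Lemma gbin_add (x y : C) n :
  gbin (x + y) n = \sum_(i < n.+1) gbin x i * gbin y (n - i).
Proof.
elim: n => [|n IH]; first by rewrite big_ord1 !gbin0 mulr1.
apply: (@mulIn n); rewrite gbinSl IH !mulr_sumr.
have -> : \sum_(i < n.+2) n.+1%:R * (gbin x i * gbin y (n.+1 - i)) =
  \sum_(i < n.+2) (i%:R * gbin x i) * gbin y (n.+1 - i) +
  \sum_(i < n.+2) gbin x i * ((n.+1 - i)%:R * gbin y (n.+1 - i)).
  rewrite -big_split /=; apply: eq_bigr => i _.
  have -> : n.+1%:R = i%:R + (n.+1 - i)%:R :> C.
    by rewrite -natrD subnKC // -ltnS.
  by ring.
rewrite [X in _ = X + _]big_ord_recl /= !mul0r add0r.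
rewrite [X in _ = _ + X]big_ord_recr /= subnn mul0r mulr0 addr0.
rewrite -big_split /=; apply: eq_bigr => i _.
have il : (i <= n)%N by rewrite -ltnS.
rewrite /bump /= add1n subSS gbinSl subSn // gbinSl natrB //.
by ring.
Qed.

Lemma gbin_pascal (x : C) k : gbin (x + 1) k.+1 = gbin x k.+1 + gbin x k.
Proof.
rewrite gbin_add !big_ord_recr /= subnn gbin0 mulr1 subSnn gbin1 mulr1.
rewrite big1 ?add0r 1?addrC // => i _.
have -> : (k.+1 - i = (k - i).-1.+2)%N by have := ltn_ord i; lia.
apply/eqP; rewrite mulf_eq0; apply/orP; right; apply/eqP.
apply: (@mulIn (k - i).-1.+1); rewrite gbinSl mulr0.
elim: (k - i).-1 => [|m IH]; first by rewrite gbin1 subrr mul0r.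
by apply: (@mulIn m.+1); rewrite mulrCA gbinSl IH !mulr0.
Qed.

Lemma gbin_nat (n k : nat) : gbin (n%:R : C) k = 'C(n, k)%:R.
Proof.
elim: n k => [|n IH] [|k]; rewrite ?gbin0 ?bin0 //.
  rewrite bin0n /=; elim: k => [|k IH]; first by rewrite gbin1.
  by apply: (@mulIn k.+1); rewrite gbinSl IH !mulr0.
by rewrite -addn1 natrD gbin_pascal !IH addn1 binS natrD.
Qed.

Lemma gbin_neg (m k : nat) :
  gbin (- 1 - m%:R : C) k = (-1) ^+ k * 'C(m + k, m)%:R.
Proof.
elim: k => [|k IH]; first by rewrite gbin0 addn0 binn mulr1.
apply: (@mulIn k); rewrite gbinSl IH.
have /(congr1 (fun n => n%:R : C)) : (k.+1 * 'C(m + k.+1, m) = (m + k).+1 * 'C(m + k, m))%N.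
  have := mul_bin_down (m + k).+1 m; rewrite /= -addnS addnC addnK addnC.
  by rewrite mulnC => <-; rewrite addnS.
rewrite !natrM exprS => e.
have -> : k.+1%:R * (-1 * (-1) ^+ k * 'C(m + k.+1, m)%:R) = - (-1) ^+ k * (k.+1%:R * 'C(m + k.+1, m)%:R) :> C by ring.
by rewrite e -addnS natrD -addn1 natrD; ring.
Qed.

(** For natural x both sides count the choices of i elements with d marked ones among them. It
    serves the composition of Taylor coefficients in [tau_comp0]. *)
Lemma gbin_tri (x : C) (i d : nat) : (d <= i)%N ->
  'C(i, d)%:R * gbin x i = gbin x d * gbin (x - d%:R) (i - d).
Proof.
move=> /subnKC <-; move: (i - d)%N => {i} j; rewrite addKn.
elim: j => [|j IH]; first by rewrite addn0 binn gbin0 mul1r mulr1.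
apply: (@mulIn j); rewrite [RHS]mulrCA gbinSl mulrCA [RHS]mulrCA -IH.
have /(congr1 (fun n => n%:R : C)) : (j.+1 * 'C(d + j.+1, d) = (d + j).+1 * 'C(d + j, d))%N.
  have := mul_bin_down (d + j).+1 d; rewrite /= -addnS addnC addnK addnC.
  by rewrite mulnC => <-; rewrite addnS.
rewrite !natrM => e.
rewrite mulrCA mulrA e addnS -mulrA mulrCA gbinSl natrD; ring.
Qed.

Lemma gbin_nat_small (n k : nat) : (n < k)%N -> gbin (n%:R : C) k = 0.
Proof. by move=> h; rewrite gbin_nat bin_small. Qed.

End Binomials.

Section MoreSums.

Lemma fsum_sub (T T' : choiceType) (U : nmodType) (h : T -> T') (F : T' -> U) :
  injective h -> (forall y, F y <> 0 -> exists x, y = h x) ->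
  fsum F = fsum (fun x => F (h x)).
Proof.
move=> hi hF; rewrite /fsum -(fsbig_image setT h); last by move=> x y _ _ /hi.
symmetry; apply: fsbig_widen => // y [_ /= ny].
by apply: contrapT => /hF[x xy]; apply: ny; exists x.
Qed.

Lemma fin_inj (T T' : choiceType) (U : nmodType) (h : T -> T') (F : T' -> U) :
  injective h -> fin F -> fin (fun x => F (h x)).
Proof.
move=> hi [s sF].
(* The list has one chosen preimage for each listed value that has any; by injectivity it is the
   only one. *)
exists (pmap (fun y => if pselect (exists x, h x = y) is left e then Some (sval (cid e)) else None) s) => x Fx.
rewrite mem_pmap; apply/mapP; exists (h x); first exact: sF.
case: pselect => [e|[]]; last by exists x.
by congr Some; apply: hi; case: cid.
Qed.

Lemma fsum_part (T T' : choiceType) (U : nmodType) (g : T -> T') (F : T -> U) :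
  fin F -> fsum F = fsum (fun y => fsum (fun x => if g x == y then F x else 0)).
Proof.
move=> [s sF]; rewrite (@fsum_exch _ _ _ (map g s) s) => [|y x]; last first.
  by case: eqP => // <- /sF xs; split=> //; apply: map_f.
apply: eq_fsum => x; rewrite (@fsum1 _ _ (g x)) ?eqxx // => y yx.
by case: eqP => // e; case: yx.
Qed.

Lemma fsum_int (U : nmodType) (F : int -> U) : fin F ->
  fsum F = fsum (fun i : nat => F i%:Z) + fsum (fun i : nat => F (-1 - i%:Z)).
Proof.
move=> fF; have -> : fsum F = fsum (fun j : int => (if 0 <= j then F j else 0) + (if 0 <= j then 0 else F j)).
  by apply: eq_fsum => j; case: ifP; rewrite ?addr0 ?add0r.
rewrite fsumD; try by apply: fin_sub fF _ => j ->; case: ifP.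
congr (_ + _).
  rewrite (@fsum_sub _ _ _ Posz) => [|i j [] //|[] j //]; last by exists j.
  by apply: eq_fsum.
rewrite (@fsum_sub _ _ _ (fun i : nat => - 1 - i%:Z)) => [|i j /eqP|[] j //].
- by apply: eq_fsum => i; case: ifP => //; lia.
- by move=> /eqP; lia.
by exists j; rewrite NegzE; lia.
Qed.

Lemma fsum_natS (U : nmodType) (F : nat -> U) : fin F ->
  fsum F = F 0%N + fsum (fun i => F i.+1).
Proof.
move=> fF; have -> : fsum F = fsum (fun j => (if j == 0%N then F j else 0) + (if j == 0%N then 0 else F j)).
  by apply: eq_fsum => j; case: ifP; rewrite ?addr0 ?add0r.
rewrite fsumD; try by apply: fin_sub fF _ => j ->; case: ifP.
congr (_ + _); first by rewrite (@fsum1 _ _ 0%N) // => x /eqP/negPf->.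
rewrite (@fsum_sub _ _ _ S) => [|i j [] //|[|j] //]; last by exists j.
by apply: eq_fsum.
Qed.

End MoreSums.

Section Integers.
Variable R : realType.
Local Notation C := R[i].

Lemma toint_int (k : int) : toint (k%:~R : C) = k.
Proof.
by rewrite /toint; case: xgetP => [j _ /= /intr_inj -> //|/(_ k) []].
Qed.

Lemma tointK (x : C) : is_int x -> (toint x)%:~R = x.
Proof. by move=> [k ->]; rewrite toint_int. Qed.

Lemma is_int_int k : is_int (k%:~R : C).
Proof. by exists k. Qed.

Lemma is_intD (x y : C) : is_int x -> is_int y -> is_int (x + y).
Proof. by move=> [k ->] [j ->]; exists (k + j); rewrite intrD. Qed.

Lemma is_intN (x : C) : is_int x -> is_int (- x).
Proof. by move=> [k ->]; exists (- k); rewrite intrN. Qed.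

Lemma is_intB (x y : C) : is_int x -> is_int y -> is_int (x - y).
Proof. by move=> ? ?; apply: is_intD => //; exact: is_intN. Qed.

Lemma is_int_nat k : is_int (k%:R : C).
Proof. by exists k%:Z; rewrite -pmulrn. Qed.

Lemma Re_int (k : int) : complex.Re (k%:~R : C) = k%:~R.
Proof.
have -> : (k%:~R : C) = (k%:~R)%:C by rewrite rmorph_int.
by [].
Qed.

Lemma ReD (x y : C) : complex.Re (x + y) = complex.Re x + complex.Re y.
Proof. by case: x y => [a b] [c d]. Qed.

Definition rep (x : C) : C := x - (Num.floor (complex.Re x))%:~R.

Lemma rep_strip x : strip (rep x).
Proof.
rewrite /strip /= /rep -intrN ReD Re_int intrN.
have := Num.Theory.floor_itv (complex.Re x).
rewrite intrD => /andP[h1 h2].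
by rewrite subr_ge0 h1 ltrBlDr addrC.
Qed.

Lemma strip_inj (x y : C) : strip x -> strip y -> is_int (x - y) -> x = y.
Proof.
move=> /andP[x0 x1] /andP[y0 y1] [k e].
have : complex.Re x = complex.Re y + k%:~R by rewrite -Re_int -ReD -e addrC subrK.
move=> ek; have : (k%:~R : R) < 1%:~R by rewrite mulr1z; lra.
have : ((-1)%:~R : R) < k%:~R by rewrite intrN mulr1z; lra.
rewrite !ltr_int => h1 h2; have k0 : k = 0 by lia.
by move: e; rewrite k0 => /eqP; rewrite subr_eq0 => /eqP.
Qed.

Lemma rep_int x : is_int (x - rep x).
Proof. by rewrite /rep opprB addrC subrK; apply: is_int_int. Qed.

End Integers.

(** * Products of fields with integer exponents *)

Section IntegerProducts.
Variables (R : realType) (U : lmodType R[i]).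
Local Notation C := R[i].
Implicit Types A B g : int -> int -> U.

(* [A m n] and [B m n] stand for the two orders of a product of the modes [m] of
   the first and [n] of the second factor; [dlt] is then multiplication by [w - z],
   and [itp n] is the [n]-th product of fields with integer exponents. *)
Definition dlt A : int -> int -> U := fun m n => A (m + 1) n - A m (n + 1).

Definition itp (n : int) A B (m : int) : U :=
  fsum (fun i : nat => ((-1) ^+ i * gbin (n%:~R : C) i) *: A (n - i%:Z) (m + i%:Z))
  - fsum (fun i : nat => ((-1) ^ (n - i%:Z) * gbin (n%:~R : C) i) *: B i%:Z (m + n - i%:Z)).

Definition truncr A := exists n0 : int, forall m n, n0 <= n -> A m n = 0.
Definition truncl A := exists m0 : int, forall m n, m0 <= m -> A m n = 0.

Lemma truncr_dlt A : truncr A -> truncr (dlt A).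
Proof. by move=> [n0 h]; exists n0 => m n hn; rewrite /dlt !h ?subr0 //; lia. Qed.

Lemma truncl_dlt A : truncl A -> truncl (dlt A).
Proof. by move=> [n0 h]; exists n0 => m n hn; rewrite /dlt !h ?subr0 //; lia. Qed.

Lemma fin_truncr (A : int -> int -> U) (c : nat -> C) (f : nat -> int) (m : int) :
  truncr A -> fin (fun i : nat => c i *: A (f i) (m + i%:Z)).
Proof.
move=> [n0 h]; apply: (@fin_nat _ `|n0 - m|%N) => i hi.
by rewrite h ?scaler0 //; lia.
Qed.

Lemma fin_truncl (A : int -> int -> U) (c : nat -> C) (f : nat -> int) (k : nat) :
  truncl A -> fin (fun i : nat => c i *: A (i + k)%N%:Z (f i)).
Proof.
move=> [n0 h]; apply: (@fin_nat _ `|n0|%N) => i hi.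
by rewrite h ?scaler0 //; lia.
Qed.

Lemma gbin_int_pascal (n : int) k :
  gbin (n%:~R : C) k.+1 = gbin ((n - 1)%:~R : C) k.+1 + gbin ((n - 1)%:~R : C) k.
Proof. by rewrite -gbin_pascal intrD intrN mulr1z subrK. Qed.

(** Formally (w-z)^n = (w-z)^(n-1) (w-z) in both expansions: Pascal's rule splits each binomial
    coefficient, and a shift of the index joins the halves into differences. The truncation
    conditions make the split sums finite. *)
Lemma itp_dlt n A B m : truncr A -> truncl B ->
  itp n A B m = itp (n - 1) (dlt A) (dlt B) m.
Proof.
move=> tA tB; rewrite /itp; congr (_ - _).
  rewrite fsum_natS; last exact: fin_truncr.
  pose f (i : nat) := ((-1) ^+ i * gbin ((n - 1)%:~R : C) i) *: A (n - i%:Z) (m + i%:Z).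
  pose f' (i : nat) := ((-1) ^+ i * gbin ((n - 1)%:~R : C) i) *: A (n - i.+1%:Z) (m + i.+1%:Z).
  have ff : fin f by exact: fin_truncr.
  have ff' : fin f'.
    have [n0 h] := tA.
    by apply: (@fin_nat _ `|n0 - m|%N) => i hi; rewrite /f' h ?scaler0 //; lia.
  transitivity (fsum f - fsum f').
    rewrite (fsum_natS ff) /f expr0 !gbin0 -addrA; congr (_ + _).
    rewrite -fsumB //; last by apply: fin_inj ff => i j [].
    apply: eq_fsum => i; rewrite /f' gbin_int_pascal -scalerBl; congr (_ *: _).
    by rewrite !exprS; ring.
  rewrite -fsumB //; apply: eq_fsum => i; rewrite -scalerBr /dlt.
  congr (_ *: (A _ _ - A _ _)); lia.
rewrite fsum_natS; last first.
  by apply: fin_sub (fin_truncl (fun i => ((-1) ^ (n - i%:Z) * gbin (n%:~R : C) i)) (fun i => m + n - i%:Z) 0 tB) _ => i; rewrite addn0.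
pose f (i : nat) := ((-1) ^ (n - i%:Z) * gbin ((n - 1)%:~R : C) i) *: B i%:Z (m + n - i%:Z).
pose f' (i : nat) := ((-1) ^ (n - i.+1%:Z) * gbin ((n - 1)%:~R : C) i) *: B i.+1%:Z (m + n - i.+1%:Z).
have ff : fin f.
  have [n0 h] := tB.
  by apply: (@fin_nat _ `|n0|%N) => i hi; rewrite /f h ?scaler0 //; lia.
have ff' : fin f'.
  have [n0 h] := tB.
  by apply: (@fin_nat _ `|n0|%N) => i hi; rewrite /f' h ?scaler0 //; lia.
transitivity (fsum f + fsum f').
  rewrite (fsum_natS ff) /f !gbin0 -addrA; congr (_ + _).
  rewrite -fsumD //; last by apply: fin_inj ff => i j [].
  apply: eq_fsum => i; rewrite /f' gbin_int_pascal -scalerDl; congr (_ *: _).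
  by ring.
rewrite -fsumD //; apply: eq_fsum => i; rewrite /f /f' /dlt scalerBr addrC; congr (_ + _).
  congr (_ *: B _ _); [congr ((-1) ^ _ * _)| |]; lia.
rewrite -scaleNr; congr (_ *: B _ _); last by lia.
have -> : n - i%:Z = (n - 1 - i%:Z) + 1 by lia.
by rewrite expfzDr ?oppr_eq0 ?oner_eq0 // expr1z; ring.
Qed.

Lemma itp_iter N n A B m : truncr A -> truncl B ->
  itp n A B m = itp (n - N%:Z) (iter N dlt A) (iter N dlt B) m.
Proof.
elim: N n A B => [|N IH] n A B tA tB; first by rewrite subr0.
rewrite (itp_dlt n m tA tB) (IH (n - 1) _ _ (truncr_dlt tA) (truncl_dlt tB)) !iterSr.
by have -> : n - 1 - N%:Z = n - N.+1%:Z by lia.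
Qed.

(** The power (w-z)^k is a polynomial, so its two expansions agree and [g] enters twice with
    opposite signs. *)
Lemma itp_same_ge0 (k : nat) g m : itp k%:Z g g m = 0.
Proof.
have hz i : (k < i)%N -> gbin (k%:~R : C) i = 0.
  by move=> ki; rewrite -pmulrn gbin_nat_small.
rewrite /itp !(@fsum_nat _ k.+1) => [|i hi|i hi]; try by rewrite hz ?mulr0 ?scale0r.
rewrite [X in _ - X](reindex_inj rev_ord_inj) /=; apply/eqP; rewrite subr_eq0; apply/eqP.
apply: eq_bigr => i _; rewrite subSS.
have il : (i <= k)%N by rewrite -ltnS.
have -> : k%:Z - (k - i)%N%:Z = i%:Z by lia.
rewrite -!pmulrn !gbin_nat bin_sub //.
by congr (_ *: g _ _); lia.
Qed.

(** The two expansions of (w-z)^(-1-d) differ by a divided derivative of the delta function, which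
    extracts a Taylor coefficient at w = z. The first sum of [itp] gives the terms with j >= d, the
    second those with j < 0, and [gbin j d] vanishes in between. *)
Lemma itp_same_lt0 (d : nat) g m : truncr g -> truncl g ->
  itp (- 1 - d%:Z) g g m =
  fsum (fun j : int => gbin (j%:~R : C) d *: g (- 1 - j) (m - d%:Z + j)).
Proof.
move=> tr tl.
have ff : fin (fun j : int => gbin (j%:~R : C) d *: g (- 1 - j) (m - d%:Z + j)).
  have [n0 h0] := tr; have [m0 h1] := tl.
  pose b := (`|n0| + `|m0| + `|m| + d)%N.
  exists ([seq i%:Z | i <- iota 0 b.+1] ++ [seq - 1 - i%:Z | i <- iota 0 b.+1]) => j fj.
  have [jb|jb] := leP j b%:Z; last by case: fj; rewrite h0 ?scaler0 //; lia.
  have [jb'|jb'] := leP (- 1 - b%:Z) j; last by case: fj; rewrite h1 ?scaler0 //; lia.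
  rewrite mem_cat; apply/orP; case: j jb jb' {fj} => j jb jb'; [left|right].
    by apply: map_f; rewrite mem_iota /=; lia.
  by apply/mapP; exists j; rewrite ?mem_iota /=; lia.
have sg (i : nat) : (-1) ^+ i * gbin ((- 1 - d%:Z)%:~R : C) i = 'C(d + i, d)%:R.
  rewrite intrB intrN mulr1z -[(Posz d)%:~R]pmulrn gbin_neg mulrA -exprD addnn -mul2n exprM sqrrN expr1n.
  by rewrite expr1n mul1r.
rewrite (fsum_int ff) /itp; congr (_ + _).
  have e : forall N (F : nat -> U), fin F -> fsum F = \sum_(i < N) F i + fsum (fun i : nat => F (N + i)%N).
    elim=> [|N IH] F fF; first by rewrite big_ord0 add0r.
    rewrite fsum_natS // big_ord_recl -addrA IH //; last by apply: fin_inj fF => i k [].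
  rewrite [RHS](e d); last by apply: fin_inj ff => i k [].
  rewrite [X in _ = X + _]big1 => [|i _]; last by rewrite -pmulrn gbin_nat_small ?scale0r.
  rewrite add0r; apply: eq_fsum => i.
  by rewrite sg -pmulrn gbin_nat PoszD; congr (_ *: g _ _); lia.
rewrite fsumN; last first.
  by apply: fin_sub (fin_truncl (fun i => ((-1) ^ (- 1 - d%:Z - i%:Z) * gbin ((-1 - d%:Z)%:~R : C) i)) (fun i => m + (- 1 - d%:Z) - i%:Z) 0 tl) _ => i; rewrite addn0.
apply: eq_fsum => i; rewrite -scaleNr; congr (_ *: g _ _); [|lia|lia].
have -> : (- 1 - i%:Z)%:~R = - 1 - i%:R :> C by rewrite intrB intrN mulr1z -pmulrn.
rewrite gbin_neg.
have -> : (-1) ^ (- 1 - d%:Z - i%:Z) = (-1) * (-1) ^+ d * (-1) ^+ i :> C.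
  have h (k : nat) : (-1) ^ (- k%:Z) = (-1) ^+ k :> C.
    by rewrite -exprnN -exprVn invrN1.
  have -> : - 1 - d%:Z - i%:Z = - (1 + d + i)%N%:Z by lia.
  by rewrite h !exprD expr1.
transitivity ((-1) ^+ d * ((-1) ^+ i * gbin ((- 1 - d%:Z)%:~R : C) i)); first by ring.
by rewrite sg [(d + i)%N]addnC -[in LHS]bin_sub ?leq_addl // addnK.
Qed.

End IntegerProducts.

(** * Series in w and z with complex exponents *)

(* A formal series [\sum A x y w^x z^y] is the function [A] of its exponents. *)
Section Series.
Variables (R : realType) (V : lmodType R[i]).
Local Notation C := R[i].
Implicit Types A B F : C -> C -> V.

(* [x] is an exponent allowed by finitely many lower bounds [ds], one for each
   coset of the integers that occurs. *)
Definition lbd (ds : seq C) (x : C) : Prop :=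
  exists2 d, d \in ds & exists j : nat, x = d + j%:R.

Lemma lbd_catl ds ds' x : lbd ds x -> lbd (ds ++ ds') x.
Proof. by move=> [d dd h]; exists d; rewrite ?mem_cat ?dd. Qed.

Lemma lbd_catr ds ds' x : lbd ds' x -> lbd (ds ++ ds') x.
Proof. by move=> [d dd h]; exists d; rewrite ?mem_cat ?dd ?orbT. Qed.

Lemma lbd_nat ds x k : lbd ds x -> lbd ds (x + k%:R).
Proof. by move=> [d dd [j ->]]; exists d => //; exists (j + k)%N; rewrite natrD addrA. Qed.

Lemma lbd_shift ds x c : lbd ds x -> lbd [seq d + c | d <- ds] (x + c).
Proof.
by move=> [d dd [j ->]]; exists (d + c); [apply: map_f | exists j; rewrite addrAC].
Qed.

Lemma lbd_add ds ds' x y : lbd ds x -> lbd ds' y ->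
  lbd [seq d + d' | d <- ds, d' <- ds'] (x + y).
Proof.
move=> [d dd [j ->]] [d' dd' [j' ->]]; exists (d + d').
  by apply/allpairsP; exists (d, d').
by exists (j + j')%N; rewrite natrD; ring.
Qed.

(** A lower bound on the exponent c - n is an upper bound on the mode n; this yields the truncation
    conditions of the integer products. *)
Lemma lbd_bound ds (c : C) : exists n0 : int, forall n : int,
  lbd ds (c - n%:~R) -> n < n0.
Proof.
elim: ds => [|d ds [n0 IH]]; first by exists 0 => n [d].
(* If c - d is not an integer, [toint] returns 0, but then no exponent c - n lies above d. *)
exists (Num.max n0 (toint (c - d) + 1)) => n [d'].
rewrite inE => /orP[/eqP->|dd] [j e]; rewrite lt_max.
  apply/orP; right; have -> : c - d = (n + j%:Z)%:~R.
    rewrite intrD -[(Posz j)%:~R]pmulrn; have -> : c = d + j%:R + n%:~R by rewrite -e subrK.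
    by ring.
  by rewrite toint_int; lia.
by rewrite IH //; exists d' => //; exists j.
Qed.

(** Both exponents are bounded below, so each line x + y = u meets the support in finitely many
    points ([reg2_fs2]) and the value at w = z makes sense. *)
Definition reg2 A : Prop := exists ds, forall x y, A x y <> 0 -> lbd ds x /\ lbd ds y.

Definition fs2 A : Prop := forall u, fin (fun x => A x (u - x)).

Lemma lbd_fin ds ds' (u : C) : exists s : seq C, forall x, lbd ds x -> lbd ds' (u - x) -> x \in s.
Proof.
have h d d' : exists s : seq C, forall x, lbd [:: d] x -> lbd [:: d'] (u - x) -> x \in s.
  exists [seq d + j%:R | j <- iota 0 (absz (toint (u - d - d' : C))).+1] => x [e].
  rewrite inE => /eqP-> {e} [j ->] [e]; rewrite inE => /eqP-> {e} [j' e].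
  have -> : u - d - d' = (j + j')%N%:Z%:~R.
    by rewrite -pmulrn natrD -[u](subrK (d + j%:R)) e; ring.
  by rewrite toint_int; apply/mapP; exists j; rewrite // mem_iota /=; lia.
elim: ds => [|d ds [s IH]]; first by exists [::] => x [].
have [t ht] : exists s : seq C, forall x, lbd [:: d] x -> lbd ds' (u - x) -> x \in s.
  elim: ds' {IH} => [|d' ds' [t ht]]; first by exists [::] => x _ [].
  have [t' ht'] := h d d'; exists (t ++ t') => x hx [d'']; rewrite inE mem_cat => /orP[/eqP->|dd] hj.
    by rewrite ht' ?orbT //; exists d'; rewrite ?mem_head.
  by rewrite ht //; exists d''.
exists (s ++ t) => x [d'']; rewrite inE mem_cat => /orP[/eqP->|dd] hj hx.
  by rewrite ht ?orbT //; exists d; rewrite ?mem_head.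
by rewrite IH //; exists d''.
Qed.

Lemma reg2_fs2 A : reg2 A -> fs2 A.
Proof.
move=> [ds h] u; have [s hs] := lbd_fin ds ds u.
by exists s => x /h[]; exact: hs.
Qed.

(* Multiplication by [w - z]. *)
Definition md A : C -> C -> V := fun x y => A (x - 1) y - A x (y - 1).

Lemma fs2_md A : fs2 A -> fs2 (md A).
Proof.
move=> h u; apply: finD; last first.
  by apply: finN; apply: fin_sub (h (u - 1)) _ => x; rewrite addrAC.
apply: fin_sub (fin_shift (-1) (h (u - 1))) _ => x.
by rewrite opprD opprK addrA [u - 1 - x]addrAC subrK.
Qed.

Lemma fs2N A : fs2 A -> fs2 (fun x y => - A x y).
Proof. by move=> hA u; apply: finN. Qed.

Lemma fs2_iter N A : fs2 A -> fs2 (iter N md A).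
Proof. by move=> h; elim: N => // N; exact: fs2_md. Qed.

(* [\sum_u (tau k A u) z^u] is the value at [w = z] of the [k]-th divided
   derivative of [A] in [w]. *)
Definition tau (k : nat) A (u : C) : V :=
  fsum (fun x => gbin x k *: A x (u + k%:R - x)).

(** A multiple of w - z vanishes at w = z. With the value 0 in negative orders this becomes the case
    k = 0 of [tauz_md], and orders can be lowered without case distinctions. *)
Definition tauz (k : int) A (u : C) : V := if k is Posz n then tau n A u else 0.

Lemma eq_tauz k A B : (forall x y, A x y = B x y) -> tauz k A =1 tauz k B.
Proof. by move=> h; case: k => // k u; apply: eq_fsum => x; rewrite h. Qed.

Lemma tauzD k A B u : fs2 A -> fs2 B ->
  tauz k (fun x y => A x y + B x y) u = tauz k A u + tauz k B u.
Proof.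
case: k => k hA hB; rewrite /= ?addr0 //.
by rewrite -fsumD; [apply: eq_fsum => x; rewrite scalerDr|exact: finZ|exact: finZ].
Qed.

Lemma tauzN k A u : fs2 A -> tauz k (fun x y => - A x y) u = - tauz k A u.
Proof.
case: k => k hA; rewrite /= ?oppr0 //.
by rewrite fsumN; [apply: eq_fsum => x; rewrite scalerN|exact: finZ].
Qed.

Lemma tauzB k A B u : fs2 A -> fs2 B ->
  tauz k (fun x y => A x y - B x y) u = tauz k A u - tauz k B u.
Proof. by move=> hA hB; rewrite tauzD ?tauzN //; exact: fs2N. Qed.

Lemma tauzZ k c A u : fs2 A -> tauz k (fun x y => c *: A x y) u = c *: tauz k A u.
Proof.
case: k => k hA; rewrite /= ?scaler0 //.
by rewrite fsumZ; [apply: eq_fsum => x; rewrite scalerA mulrC -scalerA|exact: finZ].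
Qed.

Lemma tauz0 k A u : (forall x y, A x y = 0) -> tauz k A u = 0.
Proof. by case: k => k h //=; apply: fsum0 => x; rewrite h scaler0. Qed.

Lemma tauz_md k A u : fs2 A -> tauz k (md A) u = tauz (k - 1) A u.
Proof.
case: k => [k|k] hA; last by have -> : Negz k - 1 = Negz k.+1 by lia.
have fS (c : C -> C) (u' : C) : fin (fun x => c x *: A x (u' - x)) by exact: finZ.
rewrite /= /tau /md.
transitivity (fsum (fun x => gbin (x + 1) k *: A x (u + k%:R - 1 - x))
    - fsum (fun x => gbin x k *: A x (u + k%:R - 1 - x))).
  rewrite [in X in X - _](fsum_shift (-1)) -fsumB //; last first.
    by apply: fin_sub (fin_shift (-1) (fS (fun x => gbin (x + 1) k) (u + k%:R - 1))) _.
  apply: eq_fsum => x; rewrite subrK scalerBr; congr (_ *: A _ _ - _ *: A _ _); ring.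
rewrite -fsumB //; case: k => [|k].
  by rewrite fsum0 // => x; rewrite !gbin0 subrr.
have -> : k.+1%:Z - 1 = k by lia.
rewrite /tauz; apply: eq_fsum => x.
rewrite -scalerBl gbin_pascal addrC addKr; congr (_ *: A _ _).
by rewrite -[k.+1%:R]natr1; ring.
Qed.

Lemma tauz_iter k N A u : fs2 A -> tauz k (iter N md A) u = tauz (k - N%:Z) A u.
Proof.
move=> hA; elim: N k => [|N IH] k; first by rewrite subr0.
by rewrite iterS tauz_md ?IH; [congr (tauz _ _ _); lia|exact: fs2_iter].
Qed.

Lemma iter_md_ext N A B : (forall x y, A x y = B x y) ->
  forall x y, iter N md A x y = iter N md B x y.
Proof. by move=> h; elim: N => //= N IH x y; rewrite /md !IH. Qed.

Lemma iter_mdD N A B x y :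
  iter N md (fun x y => A x y + B x y) x y = iter N md A x y + iter N md B x y.
Proof. by elim: N x y => //= N IH x y; rewrite /md !IH; rewrite opprD addrACA. Qed.

Lemma iter_mdZ N c A x y :
  iter N md (fun x y => c *: A x y) x y = c *: iter N md A x y.
Proof. by elim: N x y => //= N IH x y; rewrite /md !IH scalerBr. Qed.

Lemma iter_mdN N A x y :
  iter N md (fun x y => - A x y) x y = - iter N md A x y.
Proof. by elim: N x y => //= N IH x y; rewrite /md !IH opprB opprK addrC. Qed.

Lemma iter_mdB N A B x y :
  iter N md (fun x y => A x y - B x y) x y = iter N md A x y - iter N md B x y.
Proof. by rewrite iter_mdD iter_mdN. Qed.

Lemma iter_md0 N A x y : (forall x y, A x y = 0) -> iter N md A x y = 0.
Proof. by move=> h; elim: N x y => //= N IH x y; rewrite /md !IH subrr. Qed.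

Lemma iter_mdE N A x y : iter N md A x y =
  \sum_(s < N.+1) ((-1) ^+ s * 'C(N, s)%:R : C) *: A (x - (N - s)%:R) (y - s%:R).
Proof.
elim: N x y => [|N IH] x y; first by rewrite big_ord1 bin0 expr0 mulr1 scale1r !subr0.
rewrite iterS /md !IH.
rewrite big_ord_recl [RHS]big_ord_recl /= !subr0 !bin0 expr0 mulr1 !scale1r -addrA.
congr (_ + _); first by congr (A _ _); rewrite !subn0 -natr1; ring.
rewrite [RHS]big_ord_recr /= /bump /= !add1n binn subnn.
transitivity (\sum_(i < N) ((-1) ^+ i.+1 * 'C(N, i.+1)%:R : C) *: A (x - (N - i)%:R) (y - i.+1%:R)
   - \sum_(i < N.+1) ((-1) ^+ i * 'C(N, i)%:R : C) *: A (x - (N - i)%:R) (y - i.+1%:R)).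
  congr (_ - _); apply: eq_bigr => i _; congr (_ *: A _ _).
  - have -> : (N - i = (N - i.+1).+1)%N by have := ltn_ord i; lia.
    by rewrite -[in RHS]natr1; ring.
  by rewrite -[i.+1%:R]natr1; ring.
rewrite [X in _ - X]big_ord_recr /= subnn binn opprD addrA -sumrB.
congr (_ + _).
  apply: eq_bigr => i _; rewrite subSS -scalerBl; congr (_ *: _).
  by rewrite binS natrD exprS; ring.
by rewrite -scaleNr exprS; congr (_ *: _); ring.
Qed.

End Series.

(** * Fields, locality, and products as Taylor coefficients *)

Section Fields.
Variables (R : realType) (V : lmodType R[i]).
Local Notation C := R[i].
Implicit Types a b : C -> V -> V.

(** An intrinsic form of membership in F{V}, without a chosen decomposition into cosets; [isfld_gen]
    recovers the decomposition. *)
Definition isfld a : Prop :=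
  [/\ forall n, linear (a n),
      exists cs : seq C, forall n v, a n v <> 0 -> exists2 c, c \in cs & is_int (n - c)
    & forall v, exists ds, forall x, a (- x - 1) v <> 0 -> lbd ds x].

(* A mode [n] is the coefficient of [z^(-n-1)], hence the exponent [x] belongs to
   the mode [-x-1]. *)
Definition prod2 a b (v : V) : C -> C -> V := fun x y => a (- x - 1) (b (- y - 1) v).
Definition prod2' a b (v : V) : C -> C -> V := fun x y => b (- y - 1) (a (- x - 1) v).

(** As an identity between iterates of [md], locality can be multiplied further and combined with
    other factors. Reversing the sum accounts for the sign (-1)^N in the proof. *)
Lemma localP pa pb N a b : local pa pb N a b <->
  forall v x y, iter N (@md R V) (prod2 a b v) x y =
    iter N (@md R V) (fun x y => (-1) ^+ (pa && pb) *: prod2' a b v x y) x y.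
Proof.
have E v x y : iter N (@md R V) (prod2 a b v) x y -
    iter N (@md R V) (fun x y => (-1) ^+ (pa && pb) *: prod2' a b v x y) x y =
    (-1) ^+ N *: \sum_(s < N.+1) ((-1) ^+ s * ('C(N, s))%:R) *:
      (a (- x - 1 + s%:R) (b (- y - 1 + (N - s)%:R) v)
       - (-1) ^+ (pa && pb) *: b (- y - 1 + (N - s)%:R) (a (- x - 1 + s%:R) v)).
  rewrite -iter_mdB iter_mdE scaler_sumr (reindex_inj rev_ord_inj) /=.
  apply: eq_bigr => s _; rewrite subSS.
  have sN : (s <= N)%N by rewrite -ltnS.
  rewrite subKn // bin_sub // scalerA mulrA; congr (_ *: _).
    rewrite -signr_odd oddB // signr_addb !signr_odd; ring.
  by congr (a _ (b _ _) - _ *: b _ (a _ _)); ring.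
split=> [h v x y|h n m v].
  by apply/eqP; rewrite -subr_eq0 E h scaler0.
have := E v (- n - 1) (- m - 1); rewrite h subrr !opprB !opprK => /esym/eqP.
have -> : 1 + n - 1 = n by ring.
have -> : 1 + m - 1 = m by ring.
by rewrite scaler_eq0 signr_eq0 /= => /eqP.
Qed.

(** In a(w) b(z) v only the exponents of z are bounded below, in b(z) a(w) v only those of w. After
    multiplication by (w-z)^N the two are equal up to sign, so both bounds hold at once. *)
Lemma local_reg2 pa pb N a b v : isfld a -> isfld b -> local pa pb N a b ->
  reg2 (iter N (@md R V) (prod2 a b v)).
Proof.
move=> [la _ ha] [lb _ hb] /localP h.
have [da hda] := ha v; have [db hdb] := hb v.
exists (da ++ db) => x y Fxy; split.
  move: Fxy; rewrite h iter_mdE => Fxy.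
  have : exists s : 'I_N.+1, a (- (x - (N - s)%:R) - 1) v <> 0.
    apply: contrapT => /forallNP hs; apply: Fxy; apply: big1 => s _.
    by move: (hs s) => /contrapT; rewrite /prod2' => ->; rewrite lin0 // !scaler0.
  move=> [s /hda hs]; apply: lbd_catl.
  by have := lbd_nat (N - s)%N hs; rewrite subrK.
move: Fxy; rewrite iter_mdE => Fxy.
have : exists s : 'I_N.+1, b (- (y - s%:R) - 1) v <> 0.
  apply: contrapT => /forallNP hs; apply: Fxy; apply: big1 => s _.
  by move: (hs s) => /contrapT; rewrite /prod2 => ->; rewrite lin0 // !scaler0.
move=> [s /hdb hs]; apply: lbd_catr.
by have := lbd_nat s hs; rewrite subrK.
Qed.

Lemma isfld_truncr a b v lam mu : isfld a -> isfld b ->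
  truncr (fun m n : int => a (m%:~R - lam) (b (n%:~R - mu) v)).
Proof.
move=> [la _ _] [lb _ hb]; have [ds h] := hb v.
have [n0 hn] := lbd_bound ds (mu - 1); exists n0 => m n hle.
have -> : b (n%:~R - mu) v = 0; last exact: lin0.
apply: contrapT => bn; have := hn n; rewrite ltNge hle => hf; suff: false by [].
apply: hf; apply: h; have -> : - (mu - 1 - n%:~R) - 1 = n%:~R - mu by ring.
by [].
Qed.

Lemma isfld_truncl a b v lam mu (c : C) : isfld a -> isfld b ->
  truncl (fun m n : int => c *: b (n%:~R - mu) (a (m%:~R - lam) v)).
Proof.
move=> fa fb; have [n0 h] := isfld_truncr v mu lam fb fa; exists n0 => m n hm.
by rewrite h ?scaler0.
Qed.

Lemma int_prod_itp pa pb n a b v lam mu m : isfld a -> isfld b ->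
  int_prod pa pb n (coset_part lam a) (coset_part mu b) m v =
  itp n (fun m n : int => a (m%:~R - lam) (b (n%:~R - mu) v))
    (fun m n : int => (-1) ^+ (pa && pb) *: b (n%:~R - mu) (a (m%:~R - lam) v)) m.
Proof.
move=> fa fb; rewrite /int_prod /itp /coset_part; congr (_ - _).
rewrite fsum_fst (@fsum_sub _ _ _ (fun i : nat => n - i%:Z)); first last.
- by move=> j; case: asboolP => //= jn _; exists `|n - j|%N; lia.
- by move=> i j; lia.
have [m0 h] := isfld_truncl v lam mu 1 fa fb.
rewrite fsumZ; last first.
  apply: (@fin_nat _ `|m0|%N) => i hi; case: ifP => // _.
  move: (h i%:Z (m + (n - i%:Z))); rewrite scale1r.
  have -> : n - (n - i%:Z) = i%:Z by lia.
  by move=> ->; rewrite ?scaler0 //; lia.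
apply: eq_fsum => i; rewrite asboolT /=; last by lia.
have -> : n - (n - i%:Z) = i%:Z by lia.
by rewrite !scalerA mulrC; congr (_ *: b _ _); congr (_%:~R - _); lia.
Qed.

Lemma iter_dlt_md N (lam mu : C) (A : C -> C -> V) m n :
  iter N (@dlt R V) (fun m n : int => A (lam - m%:~R - 1) (mu - n%:~R - 1)) m n =
  iter N (@md R V) A (lam - m%:~R - 1) (mu - n%:~R - 1).
Proof.
elim: N m n => // N IH m n; rewrite !iterS {1}/dlt !IH !intrD mulr1z.
set G := iter N _ A; rewrite /md.
by congr (G _ _ - G _ _); ring.
Qed.

Section ProductFormula.
Variables (pa pb : bool) (N : nat) (a b : C -> V -> V) (v : V).
Hypotheses (fa : isfld a) (fb : isfld b) (hl : local pa pb N a b).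
Let F := iter N (@md R V) (prod2 a b v).

(** After N steps of [itp_iter] both orders of the factors have become the same series, and
    [itp_same_ge0] or [itp_same_lt0] applies to the remaining index n - N. *)
Lemma int_prod_tau n lam mu m :
  int_prod pa pb n (coset_part lam a) (coset_part mu b) m v =
  if N%:Z - 1 - n is Posz d
  then fsum (fun r : int => gbin (r%:~R : C) d *: F (lam + r%:~R) (mu - m%:~R + d%:R - r%:~R - 1))
  else 0.
Proof.
pose g := fun m n : int => F (lam - m%:~R - 1) (mu - n%:~R - 1).
rewrite int_prod_itp // (itp_iter N _ _ (isfld_truncr _ _ _ fa fb) (isfld_truncl _ _ _ _ fa fb)).
have -> : iter N (@dlt R V) (fun m n : int => a (m%:~R - lam) (b (n%:~R - mu) v)) = g.
  apply/funext => m'; apply/funext => n'; rewrite /g /F -iter_dlt_md; congr (iter _ _ _ _ _).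
  by apply/funext => ?; apply/funext => ?; rewrite /prod2; congr (a _ (b _ _)); ring.
have -> : iter N (@dlt R V) (fun m n : int => (-1) ^+ (pa && pb) *: b (n%:~R - mu) (a (m%:~R - lam) v)) = g.
  apply/funext => m'; apply/funext => n'; rewrite /g /F; move/localP: hl => ->.
  rewrite -iter_dlt_md; congr (iter _ _ _ _ _).
  by apply/funext => ?; apply/funext => ?; rewrite /prod2'; congr (_ *: b _ (a _ _)); ring.
have [ds hF] := local_reg2 v fa fb hl.
case E: (N%:Z - 1 - n) => [d|k]; last first.
  have -> : n - N%:Z = k by move: E; rewrite NegzE; lia.
  exact: itp_same_ge0.
have -> : n - N%:Z = - 1 - d%:Z by lia.
rewrite itp_same_lt0.
- apply: eq_fsum => r; rewrite /g; congr (_ *: F _ _).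
    by rewrite intrD !intrN mulr1z; ring.
  by rewrite !intrD !intrN -[(Posz d)%:~R]pmulrn; ring.
- have [n0 h] := lbd_bound ds (mu - 1); exists n0 => m' n' hn; apply: contrapT => /hF[_].
  by rewrite addrAC => /h; lia.
have [n0 h] := lbd_bound ds (lam - 1); exists n0 => m' n' hn; apply: contrapT => /hF[].
by rewrite addrAC => /h; lia.
Qed.

(** By [gbin_add] the sum over j in the definition merges [gbin lam j] and the binomials of integers
    r into binomials of the full exponents lam + r. Each exponent lies over exactly one
    representative, so the sum over representatives is the sum over all exponents. *)
Lemma op_prod_tau n k : op_prod pa pb n a b k v = tauz (N%:Z - 1 - n) F (- k - 1).
Proof.
have fF : fs2 F by apply: reg2_fs2; exact: local_reg2 fa fb hl.
rewrite /op_prod; under eq_fsbigr => lm _.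
  rewrite -/(fsum _).
  over.
have tv (j : nat) lm m : N%:Z - 1 - n < j%:Z -> int_prod pa pb (n + j%:Z) (coset_part lm.1 a) (coset_part lm.2 b) m v = 0.
  by move=> h; rewrite int_prod_tau; case E: (N%:Z - 1 - _) => [d|//]; lia.
case ED: (N%:Z - 1 - n) => [D|D] /=; last first.
  apply: fsbig1 => lm _; apply: fsum0 => j; rewrite /zpow_mul.
  by case: ifP; rewrite ?scaler0 // tv ?scaler0 //; lia.
pose f x := gbin x D *: F x (- k - 1 + D%:R - x).
have ff : fin f by apply: finZ; apply: fF.
have S lm : fsum (fun j : nat => gbin lm.1 j *: zpow_mul (lm.1 + lm.2 - j%:R)
     (int_prod pa pb (n + j%:Z) (coset_part lm.1 a) (coset_part lm.2 b)) k v) =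
   if `[< is_int (k + (lm.1 + lm.2)) >] then fsum (fun r : int => f (lm.1 + r%:~R)) else 0.
  case: lm => lam mu /=; rewrite (@fsum_nat _ D.+1) => [|j hj]; last first.
    by rewrite /zpow_mul; case: ifP; rewrite ?scaler0 // (tv j (lam, mu)) ?scaler0 //; lia.
  case: asboolP => hi; last first.
    apply: big1 => j _; rewrite /zpow_mul; case: asboolP; rewrite ?scaler0 // => hj.
    by case: hi; have := is_intD hj (is_int_nat R j); rewrite -addrA subrK.
  rewrite /f; under [RHS]eq_fsum => r do rewrite gbin_add scaler_suml.
  have fi : fin (fun r : int => F (lam + r%:~R) (- k - 1 + D%:R - (lam + r%:~R))).
    by apply: (fin_inj _ (fF (- k - 1 + D%:R))) => r r' /addrI/intr_inj.
  rewrite fsum_sum; last by move=> i _; apply: finZ.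
  apply: eq_bigr => j _; rewrite /zpow_mul.
  have hj : is_int (k + (lam + mu - j%:R)).
    by rewrite addrA; apply: is_intB => //; apply: is_int_nat.
  rewrite asboolT // int_prod_tau (tointK hj).
  have jD : (j <= D)%N by rewrite -ltnS.
  have -> : N%:Z - 1 - (n + (j : nat)%:Z) = (D - j)%N by lia.
  rewrite fsumZ; last first.
    have [s hs] := fi; exists s => r /eqP; rewrite scaler_eq0 negb_or => /andP[_ /eqP hF].
    apply: hs; move: hF; congr (F _ _ <> 0).
    by rewrite natrB //; ring.
  apply: eq_fsum => r; rewrite scalerA; congr (_ *: F _ _).
  by rewrite natrB //; ring.
under eq_fsbigr => lm _ do rewrite S.
(* The sum of the two exponents is fixed modulo the integers, so the first representative determines
   the second. *)
rewrite fsum_fst (@fsum_sub _ _ _ (fun lam : C => (lam, rep (- k - lam)))); first last.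
- move=> [lam mu]; case: asboolP => // -[/= hl1 hl2]; case: asboolP => // hi _.
  exists lam; congr (_, _); apply: strip_inj => //; first exact: rep_strip.
  have := is_intD hi (rep_int (- k - lam)); congr is_int; ring.
- by move=> x y [].
rewrite /tau -/f (fsum_part (@rep R) ff); apply: eq_fsum => lam /=.
case: asboolP => [[/= hl1 hl2]|hn].
  rewrite asboolT; last first.
    have := is_intN (rep_int (- k - lam)); congr is_int; ring.
  rewrite [RHS](@fsum_sub _ _ _ (fun r : int => lam + r%:~R)); first last.
  - move=> x; case: eqP => // xl _; exists (toint (x - lam)).
    by rewrite tointK -?xl; [ring|exact: rep_int].
  - by move=> r r' /addrI/intr_inj.
  apply: eq_fsum => r; rewrite ifT //; apply/eqP; apply: strip_inj => //; first exact: rep_strip.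
  have := is_intD (is_intN (rep_int (lam + r%:~R))) (is_int_int R r); congr is_int; ring.
rewrite fsum0 // => x; case: eqP => // xl; case: hn; split=> /=; last exact: rep_strip.
by rewrite -xl; exact: rep_strip.
Qed.

End ProductFormula.

End Fields.

Lemma subACA (U : zmodType) (a b c d : U) : a - b - (c - d) = a - c - (b - d).
Proof. by rewrite opprB [d - c]addrC addrACA opprB [- b + d]addrC. Qed.

(** * Series in three variables and the Borcherds identities *)

Section ThreeVariables.
Variables (R : realType) (V : lmodType R[i]).
Local Notation C := R[i].
Local Notation ser3 := (C -> C -> C -> V).
Implicit Types (A : C -> C -> V) (B F : ser3).

(* Multiplication by the three differences of the variables; [ty] and [tx] are
   Taylor coefficients of [y] at [z] and of [x] at [y]. *)
Definition mxy B : ser3 := fun x y z => B (x - 1) y z - B x (y - 1) z.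
Definition mxz B : ser3 := fun x y z => B (x - 1) y z - B x y (z - 1).
Definition myz B : ser3 := fun x y z => B x (y - 1) z - B x y (z - 1).

Definition ty (j : int) B : C -> C -> V := fun x z => tauz j (B x) z.
Definition tx (d : int) B : C -> C -> V := fun y z => tauz d (fun x y' => B x y' z) y.

Definition fsy B := forall x, fs2 (B x).
Definition fsx B := forall z, fs2 (fun x y => B x y z).

Lemma mxyxz B : mxy (mxz B) = mxz (mxy B).
Proof. by do 3![apply/funext => ?]; exact: subACA. Qed.
Lemma mxyyz B : mxy (myz B) = myz (mxy B).
Proof. by do 3![apply/funext => ?]; exact: subACA. Qed.
Lemma mxzyz B : mxz (myz B) = myz (mxz B).
Proof. by do 3![apply/funext => ?]; exact: subACA. Qed.

Lemma iter_com (T : Type) (f g : T -> T) : (forall x, f (g x) = g (f x)) ->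
  forall M N x, iter M f (iter N g x) = iter N g (iter M f x).
Proof.
move=> h M N x; elim: M => //= M ->; elim: N => //= N IH; by rewrite h IH.
Qed.

Lemma mxz_sum B x y z : mxz B x y z = mxy B x y z + myz B x y z.
Proof. by rewrite /mxz /mxy /myz addrA subrK. Qed.

Lemma iter_myz N B x : iter N myz B x = iter N (@md R V) (B x).
Proof. by elim: N => //= N IH; apply/funext => y; apply/funext => z; rewrite /myz IH. Qed.

Lemma iter_mxy N B x y z : iter N mxy B x y z = iter N (@md R V) (fun x y => B x y z) x y.
Proof. by elim: N x y z => //= N IH x y z; rewrite /mxy /md !IH. Qed.

Lemma iter_mxz N B x y z : iter N mxz B x y z = iter N (@md R V) (fun x z => B x y z) x z.
Proof. by elim: N x y z => //= N IH x y z; rewrite /mxz /md !IH. Qed.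

Lemma fsy_mxy B : fsy B -> fsy (mxy B).
Proof.
move=> h x u; apply: finD; first exact: h.
by apply: finN; apply: fin_sub (fin_shift (-1) (h x (u - 1))) _ => y;
   rewrite (_ : u - 1 - (y - 1) = u - y) //; ring.
Qed.

Lemma fsy_mxz B : fsy B -> fsy (mxz B).
Proof.
move=> h x u; apply: finD; first exact: h.
by apply: finN; apply: fin_sub (h x (u - 1)) _ => y; rewrite addrAC.
Qed.

Lemma fsy_myz B : fsy B -> fsy (myz B).
Proof. by move=> h x; exact: fs2_md. Qed.

Lemma fsx_mxy B : fsx B -> fsx (mxy B).
Proof. by move=> h z; exact: (fs2_md (h z)). Qed.

Lemma fsx_mxz B : fsx B -> fsx (mxz B).
Proof.
move=> h z u; apply: finD; last by apply: finN; exact: h.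
by apply: fin_sub (fin_shift (-1) (h z (u - 1))) _ => x;
   rewrite (_ : u - 1 - (x - 1) = u - x) //; ring.
Qed.

Lemma fsx_myz B : fsx B -> fsx (myz B).
Proof.
move=> h z u; apply: finD; last by apply: finN; exact: h.
by apply: fin_sub (h z (u - 1)) _ => y; rewrite addrAC.
Qed.

Lemma md_ty j B x z : fsy B -> md (ty j B) x z = ty j (mxz B) x z.
Proof.
move=> h; rewrite /md /ty /mxz tauzB //.
  by congr (_ - _); case: j => // j; apply: eq_fsum => y; congr (_ *: B _ _ _); ring.
by move=> u; apply: fin_sub (h x (u - 1)) _ => y; rewrite addrAC.
Qed.

Lemma ty_myz j B x z : fsy B -> ty j (myz B) x z = ty (j - 1) B x z.
Proof. by move=> h; rewrite /ty -tauz_md. Qed.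

(** Here x - z = (x - y) + (y - z), and y - z lowers the order of a Taylor coefficient at y = z. In
    the same way [md_txE] uses y - z = (x - z) - (x - y). *)
Lemma md_tyE j B x z : fsy B ->
  md (ty j B) x z = ty j (mxy B) x z + ty (j - 1) B x z.
Proof.
move=> h; rewrite md_ty // -ty_myz // /ty -tauzD; last first.
- exact: fsy_myz.
- exact: fsy_mxy.
by apply: eq_tauz => y z'; exact: mxz_sum.
Qed.

Lemma md_tx d B y z : fsx B -> md (tx d B) y z = tx d (myz B) y z.
Proof.
move=> h; rewrite /md /tx /myz tauzB //.
  by congr (_ - _); case: d => // d; apply: eq_fsum => x; congr (_ *: B _ _ _); ring.
by move=> u; apply: fin_sub (h z (u - 1)) _ => x; rewrite addrAC.
Qed.

Lemma tx_mxy d B y z : fsx B -> tx d (mxy B) y z = tx (d - 1) B y z.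
Proof. by move=> h; rewrite /tx -tauz_md. Qed.

Lemma md_txE d B y z : fsx B ->
  md (tx d B) y z = tx d (mxz B) y z - tx (d - 1) B y z.
Proof.
move=> h; rewrite md_tx // -tx_mxy // /tx -tauzB; last first.
- exact: fsx_mxy.
- exact: fsx_mxz.
by apply: eq_tauz => x y'; rewrite mxz_sum addrAC subrr add0r.
Qed.

Lemma iter_md_ty N j B : fsy B -> iter N (@md R V) (ty j B) = ty j (iter N mxz B).
Proof.
elim: N B => // N IH B h; rewrite !iterSr -IH; last exact: fsy_mxz.
by congr (iter _ _ _); apply/funext => x; apply/funext => z; exact: md_ty.
Qed.

Lemma iter_md_tx N j B : fsx B -> iter N (@md R V) (tx j B) = tx j (iter N myz B).
Proof.
elim: N B => // N IH B h; rewrite !iterSr -IH; last exact: fsx_myz.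
by congr (iter _ _ _); apply/funext => x; apply/funext => z; exact: md_tx.
Qed.

Definition reg3 F := exists ds, forall x y z, F x y z <> 0 ->
  [/\ lbd ds x, lbd ds y & lbd ds z].

Section Good.
Variables (G3 : ser3 -> Prop) (G2 : (C -> C -> V) -> Prop).
Hypotheses (G2md : forall A, G2 A -> G2 (md A))
  (G2D : forall A A', G2 A -> G2 A' -> G2 (fun x y => A x y + A' x y))
  (G20 : G2 (fun _ _ => 0)).

(** Each factor x - z either supplies one of the P factors x - y that make [B] good, or lowers the
    order j by one; P + j factors exhaust both. The predicates are vanishing in [dong] and
    regularity in [good_ty_reg]. *)
Lemma good_ty (Gty : forall j B, G3 B -> G2 (ty j B)) P (K : nat) (j : int) B :
  fsy B -> G3 (iter P mxy B) -> P%:Z <= K%:Z -> P%:Z + j <= K%:Z -> G2 (iter K (@md R V) (ty j B)).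
Proof.
have [n] := ubnP (P + K); elim: n P K j B => // n IH P K j B hn hB hG hP hK.
have [j0|j0] := ltP j 0.
  have -> : ty j B = (fun _ _ => 0) by apply/funext => x; apply/funext => z; case: j j0 {hK}.
  elim: K {IH hn hP hK} => // K IH.
  by rewrite iterS; exact: G2md.
case: P => [|P] in hn hG hP hK *.
  elim: K {IH hn hP hK} => [|K IH]; first exact: Gty.
  by rewrite iterS; exact: G2md.
case: K => [|K] in hn hP hK *; first by lia.
rewrite iterSr.
have -> : md (ty j B) = (fun x z => ty j (mxy B) x z + ty (j - 1) B x z).
  by apply/funext => x; apply/funext => z; exact: md_tyE.
have -> : iter K (@md R V) (fun x z => ty j (mxy B) x z + ty (j - 1) B x z) =
  (fun x z => iter K (@md R V) (ty j (mxy B)) x z + iter K (@md R V) (ty (j - 1) B) x z).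
  by apply/funext => x; apply/funext => z; exact: iter_mdD.
apply: G2D; first by apply: (IH P); rewrite ?iterSr in hG *; [lia|exact: fsy_mxy|by []|lia|lia].
(* In the other case the two bounds leave only j = 0, and the coefficient of order j - 1 is zero. *)
have [PK|PK] := leqP P.+1 K; first by apply: (IH P.+1); [lia|by []|by []|lia|lia].
have -> : ty (j - 1) B = (fun _ _ => 0).
  apply/funext => x; apply/funext => z; have : j - 1 < 0 by lia.
  by case: (j - 1).
elim: K {IH hn hP hK PK} => // K IH.
by rewrite iterS; exact: G2md.
Qed.

Hypothesis G2N : forall A, G2 A -> G2 (fun x y => - A x y).

Lemma good_tx (Gtx : forall j B, G3 B -> G2 (tx j B)) P (K : nat) (j : int) B :
  fsx B -> G3 (iter P mxz B) -> P%:Z <= K%:Z -> P%:Z + j <= K%:Z -> G2 (iter K (@md R V) (tx j B)).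
Proof.
have [n] := ubnP (P + K); elim: n P K j B => // n IH P K j B hn hB hG hP hK.
have [j0|j0] := ltP j 0.
  have -> : tx j B = (fun _ _ => 0) by apply/funext => x; apply/funext => z; case: j j0 {hK}.
  elim: K {IH hn hP hK} => // K IH.
  by rewrite iterS; exact: G2md.
case: P => [|P] in hn hG hP hK *.
  elim: K {IH hn hP hK} => [|K IH]; first exact: Gtx.
  by rewrite iterS; exact: G2md.
case: K => [|K] in hn hP hK *; first by lia.
rewrite iterSr.
have -> : md (tx j B) = (fun x z => tx j (mxz B) x z + - tx (j - 1) B x z).
  by apply/funext => x; apply/funext => z; exact: md_txE.
have -> : iter K (@md R V) (fun x z => tx j (mxz B) x z + - tx (j - 1) B x z) =
  (fun x z => iter K (@md R V) (tx j (mxz B)) x z + - iter K (@md R V) (tx (j - 1) B) x z).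
  by apply/funext => x; apply/funext => z; exact: iter_mdB.
apply: G2D; first by apply: (IH P); rewrite ?iterSr in hG *; [lia|exact: fsx_mxz|by []|lia|lia].
apply: G2N.
have [PK|PK] := leqP P.+1 K; first by apply: (IH P.+1); [lia|by []|by []|lia|lia].
have -> : tx (j - 1) B = (fun _ _ => 0).
  apply/funext => x; apply/funext => z; have : j - 1 < 0 by lia.
  by case: (j - 1).
elim: K {IH hn hP hK PK} => // K IH.
by rewrite iterS; exact: G2md.
Qed.

End Good.

Lemma reg2_md A : reg2 A -> reg2 (md A).
Proof.
move=> [ds h]; exists ds => x y; rewrite /md => hA.
have [e|/eqP/h[h1 h2]] := eqVneq (A (x - 1) y) 0; last first.
  by split=> //; have := lbd_nat 1 h1; rewrite subrK.
have /h[h1 h2] : A x (y - 1) <> 0 by move=> e'; apply: hA; rewrite e e' subrr.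
by split=> //; have := lbd_nat 1 h2; rewrite subrK.
Qed.

Lemma reg2D A A' : reg2 A -> reg2 A' -> reg2 (fun x y => A x y + A' x y).
Proof.
move=> [ds h] [ds' h']; exists (ds ++ ds') => x y hA.
have [e|/eqP/h[h1 h2]] := eqVneq (A x y) 0; last by split; exact: lbd_catl.
have /h'[h1 h2] : A' x y <> 0 by move=> e'; apply: hA; rewrite e e' addr0.
by split; exact: lbd_catr.
Qed.

Lemma reg2N A : reg2 A -> reg2 (fun x y => - A x y).
Proof. by move=> [ds h]; exists ds => x y hA; apply: h => e; apply: hA; rewrite e oppr0. Qed.

Lemma reg20 : reg2 (fun _ _ => 0 : V).
Proof. by exists [::]. Qed.

Lemma tauz_neq0 j A u : tauz j A u <> 0 -> exists x, A x (u + j%:~R - x) <> 0.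
Proof.
move=> h; apply: contrapT => /forallNP hn; apply: h; case: j hn => // j hn.
by apply: fsum0 => x; move: (hn x) => /contrapT; rewrite -pmulrn => ->; rewrite scaler0.
Qed.

Lemma lbd_sub_int ds (x : C) (j : int) : lbd ds (x + j%:~R) -> lbd [seq d - j%:~R | d <- ds] x.
Proof. by move=> /(@lbd_shift _ _ _ (- j%:~R)); rewrite addrK. Qed.

Lemma reg3_ty j F : reg3 F -> reg2 (ty j F).
Proof.
move=> [ds h]; exists (ds ++ [seq d - j%:~R | d <- [seq d + d' | d <- ds, d' <- ds]]).
move=> x z /tauz_neq0[y /h[h1 h2 h3]]; split; first exact: lbd_catl.
by apply: lbd_catr; apply: lbd_sub_int; have := lbd_add h2 h3; rewrite addrC subrK.
Qed.

Lemma reg3_tx j F : reg3 F -> reg2 (tx j F).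
Proof.
move=> [ds h]; exists (ds ++ [seq d - j%:~R | d <- [seq d + d' | d <- ds, d' <- ds]]).
move=> x z /tauz_neq0[y /h[h1 h2 h3]]; split; last exact: lbd_catl.
by apply: lbd_catr; apply: lbd_sub_int; have := lbd_add h1 h2; rewrite addrC subrK.
Qed.

Lemma reg3_dom F w : reg3 F -> exists s : seq C,
  forall x y, F x y (w - x - y) <> 0 -> x \in s /\ y \in s.
Proof.
move=> [ds h]; have [s hs] := lbd_fin ds [seq d + d' | d <- ds, d' <- ds] w.
exists s => x y /h[h1 h2 h3]; split; apply: hs => //.
  by have := lbd_add h2 h3; rewrite addrC subrK.
by have := lbd_add h1 h3; rewrite (_ : x + (w - x - y) = w - y) //; ring.
Qed.

Lemma tauz_exch i j F u : reg3 F ->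
  tauz i (ty j F) u = tauz j (fun y z => tauz i (fun x z' => F x y z') z) u.
Proof.
move=> rF; case: i => i; last first.
  by rewrite (@tauz0 _ _ j).
case: j => j; last by rewrite tauz0.
have [s hs] := reg3_dom (u + i%:R + j%:R) rF.
rewrite /= /tau.
transitivity (fsum (fun x => fsum (fun y => (gbin x i * gbin y j) *: F x y (u + i%:R + j%:R - x - y)))).
  apply: eq_fsum => x; rewrite fsumZ; last first.
    by apply: finZ; exists s => y h; apply: (hs x y _).2; move: h; congr (F _ _ _ <> 0); ring.
  by apply: eq_fsum => y; rewrite scalerA; congr (_ *: F _ _ _); ring.
rewrite (@fsum_exch _ _ _ s s) => [|x y /eqP]; last first.
  by rewrite scaler_eq0 negb_or => /andP[_ /eqP]; apply: hs.
apply: eq_fsum => y; rewrite fsumZ; last first.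
  by apply: finZ; exists s => x h; apply: (hs x y _).1; move: h; congr (F _ _ _ <> 0); ring.
by apply: eq_fsum => x; rewrite scalerA mulrC; congr (_ *: F _ _ _); ring.
Qed.

End ThreeVariables.

(** * Composition of Taylor coefficients *)

Section Composition.
Variables (R : realType) (V : lmodType R[i]).
Local Notation C := R[i].
Variables (F : C -> C -> C -> V) (u : C).
Hypothesis rF : reg3 F.

(** Let F = (x-z)^P B and expand B in terms (x-z)^i (y-z)^j with i >= -P. The Taylor coefficient of
    order d in x at y turns such a term into [gbin i d] (y-z)^(i-d+j), and order r0 in y at z
    selects j = r0 + d - i. *)
Definition tau_comp (P : nat) (d r0 : int) : V := if d is Posz d' then
  fsum (fun i : int => gbin (i%:~R : C) d' *: tauz (i + P%:Z) (ty (r0 + d - i) F) u)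
  else 0.

Lemma fin_tau_comp P (d r0 : int) : fin (fun i : int => tauz (i + P%:Z) (ty (r0 + d - i) F) u).
Proof.
pose b := (P + absz (r0 + d)).+1.
exists ([seq i%:Z - P%:Z | i <- iota 0 b.+1]) => i hi.
have h1 : 0 <= i + P%:Z by rewrite leNgt; apply/negP => h; apply: hi; case: (i + P%:Z) h.
have h2 : 0 <= r0 + d - i.
  by rewrite leNgt; apply/negP => h; apply: hi; rewrite tauz0 // => x z; rewrite /ty; case: (r0 + d - i) h.
apply/mapP; exists (absz (i + P%:Z)); last by lia.
by rewrite mem_iota /=; rewrite /b; lia.
Qed.

(** Pascal's rule for [gbin i d] after a shift of i. It is the counterpart of [md_txE], and the two
    together drive the induction in [tx_comp]. *)
Lemma tau_comp_rec P d r0 : 0 <= d ->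
  tau_comp P d r0 = tau_comp P.+1 d (r0 - 1) + tau_comp P.+1 (d - 1) r0.
Proof.
case: d => // d _; rewrite /tau_comp.
have e1 : fsum (fun i : int => gbin (i%:~R : C) d *: tauz (i + P%:Z) (ty (r0 + d%:Z - i) F) u) =
  fsum (fun i : int => gbin (i%:~R + 1 : C) d *: tauz (i + P.+1%:Z) (ty (r0 + d%:Z - 1 - i) F) u).
  rewrite (fsum_shift 1); apply: eq_fsum => i; rewrite intrD mulr1z.
  have -> : i + 1 + P%:Z = i + P.+1%:Z by lia.
  by have -> : r0 + d%:Z - (i + 1) = r0 + d%:Z - 1 - i by lia.
rewrite e1 {e1}.
have ff : fin (fun i : int => tauz (i + P.+1%:Z) (ty (r0 + d%:Z - 1 - i) F) u).
  have -> : r0 + d%:Z - 1 = (r0 - 1) + d%:Z by lia.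
  exact: fin_tau_comp.
case: d ff => [|d] ff.
  by rewrite [X in _ = _ + X]/= [RHS]addr0; apply: eq_fsum => i; rewrite !gbin0 [r0 - 1 + _]addrAC.
have -> : d.+1%:Z - 1 = d by lia.
rewrite /= [X in _ = X + _](eq_fsum (g := fun i : int => gbin (i%:~R : C) d.+1 *: tauz (i + P.+1%:Z) (ty (r0 + d.+1%:Z - 1 - i) F) u)); last first.
  by move=> i; rewrite [r0 - 1 + _]addrAC.
rewrite [X in _ = _ + X](eq_fsum (g := fun i : int => gbin (i%:~R : C) d *: tauz (i + P.+1%:Z) (ty (r0 + d.+1%:Z - 1 - i) F) u)); last first.
  by move=> i; have -> : r0 + d.+1%:Z - 1 - i = r0 + d%:Z - i by lia.
rewrite -fsumD; try exact: finZ.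
by apply: eq_fsum => i; rewrite gbin_pascal scalerDl.
Qed.

(** Without poles this is Taylor's formula. By [gbin_tri] and [gbin_add] the coefficients of each
    [F x y] sum to [gbin x d * gbin (x + y - d) r0], and x + y - d is the exponent of y after the
    coefficient of order d in x has been taken at x = y. *)
Lemma tau_comp0 d r0 : tau_comp 0 d r0 = tauz r0 (tx d F) u.
Proof.
case: d => d; last by rewrite tauz0.
case: r0 => r0; last first.
  apply: fsum0 => -[i|i]; rewrite addr0 /= ?scaler0 //.
  have [id|di] := ltnP i d; first by rewrite -pmulrn gbin_nat_small ?scale0r.
  have -> : (Negz r0 + d%:Z - i%:Z) = Negz (r0 + (i - d))%N by rewrite !NegzE; lia.
  by rewrite /tau fsum0 ?scaler0 // => x; rewrite scaler0.
rewrite /tau_comp; set w := u + r0%:R + d%:R.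
have [s hs] := reg3_dom w rF.
pose G (i : nat) x y := (gbin (i%:~R : C) d * gbin x i * (gbin y (r0 + d - i)%N)) *: F x y (w - x - y).
have e1 : fsum (fun i : int => gbin (i%:~R : C) d *: tauz (i + 0) (ty (r0%:Z + d%:Z - i) F) u) =
   \sum_(k < (r0 + d).+1) fsum (fun x => fsum (fun y => G k x y)).
  rewrite (@fsum_sub _ _ _ Posz); first last.
  - by move=> [i|i]; [exists i|rewrite addr0 scaler0].
  - by move=> i j [].
  rewrite (@fsum_nat _ (r0 + d).+1) => [|i hi]; last first.
    rewrite tauz0 ?scaler0 // => x z; rewrite /ty.
    by case E: (_ - _) => [k|//]; lia.
  apply: eq_bigr => k _; rewrite addr0 /= /tau.
  have hk : r0%:Z + d%:Z - k%:Z = (r0 + d - k)%N by have := ltn_ord k; lia.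
  rewrite hk /ty /= /tau.
  rewrite fsumZ; last first.
    exists s => x hx; apply: contrapT => hn; apply: hx; rewrite fsum0 ?scaler0 // => y.
    have [e|/eqP e] := eqVneq (F x y (u + (k:nat)%:R - x + (r0 + d - k)%:R - y)) 0; first by rewrite e scaler0.
    case: hn; apply: (hs x y _).1; move: e; congr (F _ _ _ <> 0).
    have -> : (r0 + d - k)%:R = r0%:R + d%:R - (k:nat)%:R :> C by rewrite natrB ?natrD // -ltnS.
    by rewrite /w; ring.
  apply: eq_fsum => x; rewrite fsumZ; last first.
    apply: finZ; exists s => y hx; apply: (hs x y _).2; move: hx; congr (F _ _ _ <> 0).
    have -> : (r0 + d - k)%:R = r0%:R + d%:R - (k:nat)%:R :> C by rewrite natrB ?natrD // -ltnS.
    by rewrite /w; ring.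
  rewrite fsumZ; last first.
    apply: finZ; apply: finZ; exists s => y hx; apply: (hs x y _).2; move: hx; congr (F _ _ _ <> 0).
    have -> : (r0 + d - k)%:R = r0%:R + d%:R - (k:nat)%:R :> C by rewrite natrB ?natrD // -ltnS.
    by rewrite /w; ring.
  apply: eq_fsum => y; rewrite /G !scalerA mulrA; congr (_ *: F _ _ _).
  have -> : (r0 + d - k)%:R = r0%:R + d%:R - (k:nat)%:R :> C by rewrite natrB ?natrD // -ltnS.
  by rewrite /w; ring.
rewrite e1 {e1}.
have fG (k : nat) : forall x y, G k x y <> 0 -> x \in s /\ y \in s.
  by move=> x y /eqP; rewrite /G scaler_eq0 negb_or => /andP[_ /eqP]; exact: hs.
rewrite -(@fsum_sum _ _ _ _ (fun (k : 'I_(r0 + d).+1) x => fsum (fun y => G k x y))); last first.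
  move=> k _; exists s => x hx; apply: contrapT => hn; apply: hx; apply: fsum0 => y.
  by apply: contrapT => /fG[].
transitivity (fsum (fun x => fsum (fun y => (gbin x d * gbin (x + y - d%:R) r0) *: F x y (w - x - y)))).
  apply: eq_fsum => x; rewrite -fsum_sum; last by move=> k _; exists s => y /fG[].
  apply: eq_fsum => y; rewrite /G -scaler_suml; congr (_ *: _).
  rewrite -(big_mkord xpredT (fun k => gbin (k%:~R : C) d * gbin x k * gbin y (r0 + d - k)%N)).
  rewrite (big_cat_nat (n := d)) //=; last by rewrite leqW ?leq_addl.
  rewrite big_nat big1 ?add0r => [|k /andP[_ kd]]; last first.
    by rewrite -pmulrn gbin_nat_small // !mul0r.
  rewrite -[X in index_iota X]add0n big_addn big_mkord.
  have -> : ((r0 + d).+1 - d = r0.+1)%N by lia.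
  have -> : x + y - d%:R = (x - d%:R) + y by ring.
  rewrite gbin_add mulr_sumr; apply: eq_bigr => k _.
  have kr : (k <= r0)%N by rewrite -ltnS.
  rewrite -pmulrn gbin_nat gbin_tri ?leq_addl // addnK mulrA.
  by congr (_ * gbin _ _); lia.
rewrite /= /tau.
transitivity (fsum (fun x => fsum (fun y => (gbin x d * gbin y r0) *: F x (y + d%:R - x) (u + r0%:R - y)))).
  apply: eq_fsum => x; rewrite [RHS](fsum_shift (x - d%:R)); apply: eq_fsum => y.
  by rewrite addrA addrAC -addrA; congr ((_ * gbin _ _) *: F _ _ _); rewrite /w; ring.
have hs' x y : F x (y + d%:R - x) (u + r0%:R - y) <> 0 ->
    x \in s /\ y \in [seq x' + y' - d%:R | x' <- s, y' <- s].
  move=> h; have [xs ys] : x \in s /\ y + d%:R - x \in s.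
    by apply: hs; move: h; congr (F _ _ _ <> 0); rewrite /w; ring.
  split=> //; apply/allpairsP; exists (x, y + d%:R - x); split=> //=; ring.
rewrite (@fsum_exch _ _ _ s [seq x' + y' - d%:R | x' <- s, y' <- s]) => [|x y /eqP]; last first.
  by rewrite scaler_eq0 negb_or => /andP[_ /eqP]; exact: hs'.
apply: eq_fsum => y; rewrite /tx /= /tau fsumZ; last first.
  by apply: finZ; exists s => x /hs'[].
by apply: eq_fsum => x; rewrite scalerA mulrC.
Qed.

End Composition.

(** * Dong's lemma and the Borcherds identities for three fields *)

Section Triples.
Variables (R : realType) (V : lmodType R[i]).
Local Notation C := R[i].
Local Notation ser3 := (C -> C -> C -> V).
Implicit Types (A : C -> C -> V) (B F : ser3) (a b c : C -> V -> V).

Lemma mxy_lin : linear (@mxy R V).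
Proof.
move=> k B B'; apply/funext => x; apply/funext => x0; apply/funext => x1.
rewrite /mxy; transitivity (k *: (B (x - 1) x0 x1 - B x (x0 - 1) x1) + (B' (x - 1) x0 x1 - B' x (x0 - 1) x1)); last by [].
by rewrite scalerBr addrACA -opprD.
Qed.

Lemma mxz_lin : linear (@mxz R V).
Proof.
move=> k B B'; apply/funext => x; apply/funext => x0; apply/funext => x1.
rewrite /mxz; transitivity (k *: (B (x - 1) x0 x1 - B x x0 (x1 - 1)) + (B' (x - 1) x0 x1 - B' x x0 (x1 - 1))); last by [].
by rewrite scalerBr addrACA -opprD.
Qed.

Lemma myz_lin : linear (@myz R V).
Proof.
move=> k B B'; apply/funext => x; apply/funext => x0; apply/funext => x1.
rewrite /myz; transitivity (k *: (B x (x0 - 1) x1 - B x x0 (x1 - 1)) + (B' x (x0 - 1) x1 - B' x x0 (x1 - 1))); last by [].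
by rewrite scalerBr addrACA -opprD.
Qed.

Lemma iter_lin (U : lmodType C) (f : U -> U) N : linear f -> linear (iter N f).
Proof. by move=> lf; elim: N => [|N IH] k x y //=; rewrite IH lf. Qed.

Definition lbp (pr : C -> C -> C -> C) B := exists ds, forall x y z,
  B x y z <> 0 -> lbd ds (pr x y z).

Definition shiftable (pr : C -> C -> C -> C) := forall x y z,
  [/\ pr (x - 1) y z = pr x y z \/ pr (x - 1) y z = pr x y z - 1,
      pr x (y - 1) z = pr x y z \/ pr x (y - 1) z = pr x y z - 1
    & pr x y (z - 1) = pr x y z \/ pr x y (z - 1) = pr x y z - 1].

Lemma sub_neq0 (U : zmodType) (a b : U) : a - b <> 0 -> a <> 0 \/ b <> 0.
Proof.
have [->|/eqP ha _] := eqVneq a 0; last by left.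
by rewrite sub0r => h; right=> e; apply: h; rewrite e oppr0.
Qed.

Lemma lbp_op pr B : shiftable pr -> lbp pr B ->
  [/\ lbp pr (mxy B), lbp pr (mxz B) & lbp pr (myz B)].
Proof.
move=> sh [ds h].
have k x y : lbd ds x -> x = y \/ x = y - 1 -> lbd ds y.
  by move=> hx [<-//|e]; have := lbd_nat 1 hx; rewrite e subrK.
by split; exists ds => x y z /sub_neq0[/h hx|/h hx]; case: (sh x y z) => s1 s2 s3; apply: k hx _.
Qed.

Lemma lbp_iter pr N B : shiftable pr -> lbp pr B ->
  [/\ lbp pr (iter N (@mxy R V) B), lbp pr (iter N (@mxz R V) B) & lbp pr (iter N (@myz R V) B)].
Proof.
by move=> sh h; split; elim: N => // N /(lbp_op sh)[].
Qed.

Lemma iter_md_lin (f : V -> V) N A x y : linear f ->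
  iter N (@md R V) (fun x y => f (A x y)) x y = f (iter N (@md R V) A x y).
Proof. by move=> lf; elim: N x y => // N IH x y; rewrite !iterS {1}/md !IH -linB. Qed.

Lemma iterC_xz_xy M N B : iter M (@mxz R V) (iter N (@mxy R V) B) = iter N (@mxy R V) (iter M (@mxz R V) B).
Proof. by apply: iter_com => x; rewrite mxyxz. Qed.
Lemma iterC_yz_xy M N B : iter M (@myz R V) (iter N (@mxy R V) B) = iter N (@mxy R V) (iter M (@myz R V) B).
Proof. by apply: iter_com => x; rewrite mxyyz. Qed.
Lemma iterC_yz_xz M N B : iter M (@myz R V) (iter N (@mxz R V) B) = iter N (@mxz R V) (iter M (@myz R V) B).
Proof. by apply: iter_com => x; rewrite mxzyz. Qed.

Lemma modeK (x : C) : - (- x - 1) - 1 = x.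
Proof. by ring. Qed.

Lemma isfld_op_prod (q r : bool) (N : nat) b c n : isfld b -> isfld c -> local q r N b c ->
  isfld (op_prod q r n b c).
Proof.
move=> fb fc hbc; have [lb [cb hcb] _] := fb; have [lc [cc hcc] _] := fc.
have fF v := reg2_fs2 (local_reg2 v fb fc hbc).
split.
- move=> k c0 v w; rewrite !(op_prod_tau _ fb fc hbc).
  rewrite -tauzZ // -tauzD //; last first.
    by move=> u; apply: fin_sub (fF v u) _ => x ->; rewrite scaler0.
  apply: eq_tauz => x y; rewrite -iter_mdZ -iter_mdD; apply: iter_md_ext => x' y'.
  by rewrite /prod2 lc lb.
- exists [seq x + y | x <- cb, y <- cc] => k v.
  rewrite (op_prod_tau _ fb fc hbc) => /tauz_neq0[x].
  rewrite iter_mdE => hs.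
  have [s] : exists s : 'I_N.+1, prod2 b c v (x - (N - s)%:R) (- k - 1 + (N%:Z - 1 - n)%:~R - x - s%:R) <> 0.
    apply: contrapT => /forallNP hn; apply: hs; apply: big1 => s _.
    by move: (hn s) => /contrapT ->; rewrite scaler0.
  rewrite /prod2 => h.
  have [x0 x0b i1] := hcb _ _ h.
  have hy : c (- (- k - 1 + (N%:Z - 1 - n)%:~R - x - s%:R) - 1) v <> 0.
    by move=> e; apply: h; rewrite e (lin0 (lb _)).
  have [y0 y0c i2] := hcc _ _ hy.
  exists (x0 + y0); first by apply/allpairsP; exists (x0, y0).
  have := is_intD (is_intD i1 i2) (is_int_int R (N%:Z - 1 - n - (N - s)%N%:Z - s%:Z + 1)).
  congr is_int; rewrite !intrD !intrN !mulr1z -!pmulrn.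
  by ring.
move=> v; have [ds h] := local_reg2 v fb fc hbc.
exists [seq d - (N%:Z - 1 - n)%:~R | d <- [seq d + d' | d <- ds, d' <- ds]] => x.
rewrite (op_prod_tau _ fb fc hbc) modeK => /tauz_neq0[y /h[h1 h2]].
by apply: lbd_sub_int; have := lbd_add h1 h2; rewrite addrC subrK.
Qed.

Section OneTriple.
Variables (p q r : bool) (N : nat) (a b c : C -> V -> V).
Hypotheses (fa : isfld a) (fb : isfld b) (fc : isfld c).
Hypotheses (hab : local p q N a b) (hac : local p r N a c) (hbc : local q r N b c).

Section Vector.
Variable v : V.

Let B0 : ser3 := fun x y z => a (- x - 1) (b (- y - 1) (c (- z - 1) v)).
Let B1 : ser3 := fun x y z => b (- y - 1) (a (- x - 1) (c (- z - 1) v)).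
Let B2 : ser3 := fun x y z => b (- y - 1) (c (- z - 1) (a (- x - 1) v)).
Local Notation DXY := (iter N (@mxy R V)).
Local Notation DXZ := (iter N (@mxz R V)).
Local Notation DYZ := (iter N (@myz R V)).
(* The order of the factors no longer matters here, so the modes of all iterated
   products of [a], [b], [c] are Taylor coefficients of this one series. *)
Definition reg_abc : ser3 := DXY (DXZ (DYZ B0)).
Local Notation F := reg_abc.

Let la n : linear (a n). Proof. by case: fa. Qed.
Let lb n : linear (b n). Proof. by case: fb. Qed.
Let lc n : linear (c n). Proof. by case: fc. Qed.

Lemma DYZ_B0 x y z : DYZ B0 x y z = a (- x - 1) (iter N (@md R V) (prod2 b c v) y z).
Proof. by rewrite iter_myz -iter_md_lin. Qed.

Lemma DXZ_B1 x y z : DXZ B1 x y z = b (- y - 1) (iter N (@md R V) (prod2 a c v) x z).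
Proof. by rewrite iter_mxz -iter_md_lin. Qed.

Lemma DXY_B0 : DXY B0 = (-1) ^+ (p && q) *: DXY B1.
Proof.
rewrite -(linZ (iter_lin N mxy_lin)); do 3![apply/funext => ?].
by rewrite !iter_mxy; move/localP: hab; apply.
Qed.

Lemma DXZ_B12 : DXZ B1 = (-1) ^+ (p && r) *: DXZ B2.
Proof.
rewrite -(linZ (iter_lin N mxz_lin)); apply/funext => x; apply/funext => y; apply/funext => z.
rewrite DXZ_B1 iter_mxz; move/localP: hac => ->.
rewrite -iter_md_lin //; apply: iter_md_ext => x' z'.
by rewrite (linZ (lb _)).
Qed.

Lemma reg_abcE1 : F = (-1) ^+ (p && q) *: DYZ (DXY (DXZ B1)).
Proof.
rewrite /F -iterC_yz_xz -iterC_yz_xy -iterC_xz_xy DXY_B0.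
by rewrite (linZ (iter_lin N mxz_lin)) (linZ (iter_lin N myz_lin)) iterC_xz_xy.
Qed.

Lemma reg_abcE2 : F = (-1) ^+ (p && (q (+) r)) *: DXY (DXZ (DYZ B2)).
Proof.
rewrite reg_abcE1 DXZ_B12 (linZ (iter_lin N mxy_lin)) (linZ (iter_lin N myz_lin)) scalerA.
rewrite iterC_yz_xy iterC_yz_xz; congr (_ *: _).
by case: (p) (q) (r) => [] [] []; rewrite /= ?expr0 ?expr1 ?mulr1 ?mul1r // mulrNN mulr1.
Qed.

(** An exponent is bounded if its field acts on [v] directly or together with one local partner that
    acts before it. This holds for y and z in the order a b c, and for x in the order b a c. *)
Lemma reg_abc_reg3 : reg3 F.
Proof.
have [ds1 h1] : lbp (fun x _ _ => x) F.
  have sh : shiftable (fun x _ _ => x) by move=> x y z; split; [right|left|left].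
  have h : lbp (fun x _ _ => x) (DXZ B1).
    have [ds h] := local_reg2 v fa fc hac; exists ds => x y z.
    rewrite DXZ_B1 => hh; apply: (h x z _).1 => e; apply: hh.
    by rewrite e lin0.
  have [h' _ _] := lbp_iter N sh h; have [_ _ [ds h'']] := lbp_iter N sh h'.
  exists ds => x y z; rewrite reg_abcE1 => hh; apply: (h'' x y z) => e; apply: hh.
  by transitivity ((-1) ^+ (p && q) *: DYZ (DXY (DXZ B1)) x y z); rewrite // e scaler0.
have [ds2 h2] : lbp (fun _ y _ => y) F.
  have sh : shiftable (fun _ y _ => y) by move=> x y z; split; [left|right|left].
  have h : lbp (fun _ y _ => y) (DYZ B0).
    have [ds h] := local_reg2 v fb fc hbc; exists ds => x y z.
    rewrite DYZ_B0 => hh; apply: (h y z _).1 => e; apply: hh.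
    by rewrite e lin0.
  have [_ h' _] := lbp_iter N sh h.
  by have [] := lbp_iter N sh h'.
have [ds3 h3] : lbp (fun _ _ z => z) F.
  have sh : shiftable (fun _ _ z => z) by move=> x y z; split; [left|left|right].
  have h : lbp (fun _ _ z => z) B0.
    have [_ _ /(_ v)[ds h]] := fc; exists ds => x y z hh; apply: h => e; apply: hh.
    by rewrite /B0 e !lin0.
  have [_ _ h'] := lbp_iter N sh h.
  have [_ h'' _] := lbp_iter N sh h'.
  by have [] := lbp_iter N sh h''.
exists (ds1 ++ (ds2 ++ ds3)) => x y z hF; split.
- by apply: lbd_catl; apply: h1 hF.
- by apply: lbd_catr; apply: lbd_catl; apply: h2 hF.
by apply: lbd_catr; apply: lbd_catr; apply: h3 hF.
Qed.

Lemma fsy_B0 : fsy (DYZ B0).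
Proof.
move=> x u; apply: fin_sub (reg2_fs2 (local_reg2 v fb fc hbc) u) _ => y.
by rewrite DYZ_B0 => ->; rewrite lin0.
Qed.

Lemma fsx_B0 : fsx (DXY B0).
Proof.
move=> z u; apply: fin_sub (reg2_fs2 (local_reg2 (c (- z - 1) v) fa fb hab) u) _ => x.
by rewrite iter_mxy.
Qed.

Lemma fsy_B2 : fsy (DYZ B2).
Proof.
move=> x u; apply: fin_sub (reg2_fs2 (local_reg2 (a (- x - 1) v) fb fc hbc) u) _ => y.
by rewrite iter_myz.
Qed.

Lemma fsy_iter (B : ser3) k : fsy B -> fsy (iter k (@mxz R V) B).
Proof. by move=> h; elim: k => // k; exact: fsy_mxz. Qed.

Lemma fsx_iter (B : ser3) k : fsx B -> fsx (iter k (@myz R V) B).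
Proof. by move=> h; elim: k => // k; exact: fsx_myz. Qed.

Lemma prod2_right n x z :
  prod2 a (op_prod q r n b c) v x z = ty (N%:Z - 1 - n) (DYZ B0) x z.
Proof.
rewrite /prod2 (op_prod_tau _ fb fc hbc) modeK /ty.
case: (N%:Z - 1 - n) => j; rewrite ?lin0 //= lin_fsum //; last first.
  by apply: finZ; exact: (reg2_fs2 (local_reg2 v fb fc hbc)).
by apply: eq_fsum => y; rewrite linZ // DYZ_B0.
Qed.

Lemma prod2'_right n x z :
  prod2' a (op_prod q r n b c) v x z = ty (N%:Z - 1 - n) (DYZ B2) x z.
Proof.
rewrite /prod2' (op_prod_tau _ fb fc hbc) modeK /ty.
by apply: eq_tauz => y z'; rewrite iter_myz.
Qed.

Lemma prod2_left n y z :
  prod2 (op_prod p q n a b) c v y z = tx (N%:Z - 1 - n) (DXY B0) y z.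
Proof.
rewrite /prod2 (op_prod_tau _ fa fb hab) modeK /tx.
by apply: eq_tauz => x y'; rewrite iter_mxy.
Qed.

End Vector.

(** The difference of the two orders is a Taylor coefficient of [W], and by [reg_abcE2] the product
    (x-y)^N (x-z)^N (y-z)^N kills the difference of the two triple products. N factors x - z are
    used as they are; by [good_ty] the K others do the work of (x-y)^N. *)
Lemma dong n (K : nat) : N%:Z <= K%:Z -> N%:Z + (N%:Z - 1 - n) <= K%:Z ->
  local p (q (+) r) (N + K)%N a (op_prod q r n b c).
Proof.
move=> hK hK'; apply/localP => v x z; apply/eqP; rewrite -subr_eq0 -iter_mdB; apply/eqP.
set s := _ ^+ _.
pose B0 : ser3 := fun x y z => a (- x - 1) (b (- y - 1) (c (- z - 1) v)).
pose B2 : ser3 := fun x y z => b (- y - 1) (c (- z - 1) (a (- x - 1) v)).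
pose W : ser3 := iter N (@myz R V) B0 - s *: iter N (@myz R V) B2.
have fW : fsy W.
  move=> x' u; apply: (finD (fsy_B0 v x' u)); apply: finN.
  have h : fin (fun y => iter N (@myz R V) B2 x' y (u - y)) by exact: fsy_B2.
  by apply: fin_sub h _ => y e; transitivity (s *: iter N (@myz R V) B2 x' y (u - y)); rewrite // e scaler0.
have -> : (fun x z => prod2 a (op_prod q r n b c) v x z - s *: prod2' a (op_prod q r n b c) v x z) =
    ty (N%:Z - 1 - n) W.
  apply/funext => x'; apply/funext => z'; rewrite prod2_right prod2'_right.
  rewrite /ty -tauzZ; last exact: fsy_B2.
  rewrite -tauzB //; first exact: fsy_B0.
  by move=> u; apply: fin_sub (fsy_B2 v x' u) _ => y ->; rewrite scaler0.
rewrite addnC iterD iter_md_ty //.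
have := @good_ty _ _ (fun B => B = fun _ _ _ => 0) (fun A => A = fun _ _ => 0).
move=> /(_ _ _ _ _ N K (N%:Z - 1 - n) (iter N (@mxz R V) W)) -> //.
- by move=> A ->; apply/funext => x'; apply/funext => y'; rewrite /md subrr.
- by move=> A A' -> ->; apply/funext => x'; apply/funext => y'; rewrite addr0.
- by move=> j B ->; apply/funext => x'; apply/funext => y'; rewrite /ty tauz0.
- exact: fsy_iter.
have lx := iter_lin N mxz_lin; have ly := iter_lin N mxy_lin.
rewrite /W (linB lx) (linB ly) (linZ lx) (linZ ly).
by rewrite -[X in X - _]/(reg_abc v) reg_abcE2 subrr.
Qed.

Lemma iter_dlt_congr (f g : int -> int -> V) P n0 :
  (forall m n, n0 <= n -> f m n = g m n) ->
  forall m n, n0 <= n -> iter P (@dlt R V) f m n = iter P (@dlt R V) g m n.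
Proof.
move=> h; elim: P => //= P IH m n hn; rewrite /dlt !IH //; lia.
Qed.

Section Modes.
Variables (v : V) (u : C).

Definition modes_reg (m n : int) : V :=
  tauz (N%:Z - 1 - m) (ty (N%:Z - 1 - n) (reg_abc v)) u.

Let val (K : nat) (B : ser3) (m n : int) : V :=
  tauz (K%:Z + N%:Z - 1 - m) (iter K (@md R V) (ty (N%:Z - 1 - n) B)) u.

Lemma good_ty_reg P K (j : int) (B : ser3) : fsy B -> reg3 (iter P (@mxy R V) B) ->
  P%:Z <= K%:Z -> P%:Z + j <= K%:Z -> fs2 (iter K (@md R V) (ty j B)).
Proof.
move=> *; apply: reg2_fs2; apply: (@good_ty _ _ (@reg3 R V) (@reg2 R V) _ _ _ _ P) => //.
- exact: reg2_md.
- exact: reg2D.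
- exact: reg20.
by move=> j' B'; exact: reg3_ty.
Qed.

Lemma val_iter P K (B : ser3) m n : fsy B -> reg3 (iter P (@mxy R V) B) ->
  P%:Z <= K%:Z -> P%:Z + (N%:Z - 1 - n) <= K%:Z ->
  iter P (@dlt R V) (val K B) m n = val K (iter P (@mxy R V) B) m n.
Proof.
elim: P B m n => // P IH B m n hB hG hK hK'; rewrite iterSr [in RHS]iterSr -IH; first last.
- by lia.
- by lia.
- by rewrite -iterSr.
- exact: fsy_mxy.
apply: (@iter_dlt_congr _ _ _ n) => // m' n' hn; rewrite /dlt /val.
set j := N%:Z - 1 - n'.
have -> : N%:Z - 1 - (n' + 1) = j - 1 by rewrite /j; lia.
have f1 : fs2 (iter K (@md R V) (ty j B)).
  by apply: (good_ty_reg hB hG); rewrite /j; lia.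
have f2 : fs2 (iter K (@md R V) (ty (j - 1) B)).
  by apply: (good_ty_reg hB hG); rewrite /j; lia.
have -> : K%:Z + N%:Z - 1 - (m' + 1) = (K%:Z + N%:Z - 1 - m') - 1 by lia.
rewrite -tauz_md // -tauzB //; last exact: fs2_md.
apply: eq_tauz => x z; rewrite -iterS iterSr -iter_mdB; apply: iter_md_ext => x' z'.
by rewrite md_tyE // addrK.
Qed.

(** Multiplication by x - z raises the mode m and multiplication by y - z raises n. Since x - y = (x
    - z) - (y - z), the factor (x-y)^N of [reg_abc] acts on the modes as [iter N dlt]. *)
Lemma iter_dlt_modes m n : iter N (@dlt R V)
   (fun m n => op_prod p (q (+) r) m a (op_prod q r n b c) (- u - 1) v) m n =
  modes_reg m n.
Proof.
pose B0 : ser3 := fun x y z => a (- x - 1) (b (- y - 1) (c (- z - 1) v)).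
pose B := iter N (@mxz R V) (iter N (@myz R V) B0).
(* The order from Dong's lemma grows as the inner mode decreases. Iterating [dlt] at n only reaches
   modes from n upwards, so this [K] serves all of them. *)
pose K := (N + N + `|n|)%N.
have fB : fsy B by apply: fsy_iter; exact: fsy_B0.
have rF := reg_abc_reg3 v.
rewrite (@iter_dlt_congr _ (val K B) _ n) //.
  rewrite val_iter // ?/K; try by lia.
  have -> : iter N (@mxy R V) B = reg_abc v by [].
  rewrite /val tauz_iter; last by apply: reg2_fs2; exact: reg3_ty.
  by congr (tauz _ _ _); lia.
move=> m' n' hn; rewrite (op_prod_tau (N := N + K) _ fa); first last.
- by apply: dong; rewrite /K; lia.
- exact: isfld_op_prod.
rewrite modeK /val PoszD; have -> : N%:Z + K%:Z - 1 - m' = K%:Z + N%:Z - 1 - m' by lia.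
apply: eq_tauz => x z; rewrite addnC iterD.
have -> : prod2 a (op_prod q r n' b c) v = ty (N%:Z - 1 - n') (iter N (@myz R V) B0).
  by apply/funext => x'; apply/funext => z'; rewrite prod2_right.
by rewrite iter_md_ty //; exact: fsy_B0.
Qed.

Lemma good_tx_reg P K (j : int) (B : ser3) : fsx B -> reg3 (iter P (@mxz R V) B) ->
  P%:Z <= K%:Z -> P%:Z + j <= K%:Z -> fs2 (iter K (@md R V) (tx j B)).
Proof.
move=> *; apply: reg2_fs2; apply: (@good_tx _ _ (@reg3 R V) (@reg2 R V) _ _ _ _ _ P) => //.
- exact: reg2_md.
- exact: reg2D.
- exact: reg20.
- exact: reg2N.
by move=> j' B'; exact: reg3_tx.
Qed.

(** Induction on P and d: [md_txE] on the left and [tau_comp_rec] on the right are the same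
    recursion. It starts from [tau_comp0] at P = 0 and from zero at negative d. *)
Lemma tx_comp P K (d r0 : int) (B : ser3) : fsx B -> reg3 (iter P (@mxz R V) B) ->
  P%:Z <= K%:Z -> P%:Z + d <= K%:Z ->
  tauz (K%:Z + r0) (iter K (@md R V) (tx d B)) u = tau_comp (iter P (@mxz R V) B) u P d r0.
Proof.
have neg d' r' B' : tauz (K%:Z + r') (iter K (@md R V) (tx (Negz d') B')) u = 0.
  by rewrite tauz0 // => x y; rewrite iter_md0.
elim: P d r0 B => [|P IHP] d r0 B hB hG hP hK.
  rewrite tauz_iter; last by apply: reg2_fs2; apply: reg3_tx.
  by rewrite addrAC subrr add0r tau_comp0.
case: d hK => [d|d] hK; last exact: neg.
elim: d r0 hK => [|d IHd] r0 hK.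
  have := @tau_comp_rec _ _ (iter P.+1 (@mxz R V) B) u P 0 (r0 + 1) isT.
  rewrite addrK [X in _ + X]/= addr0 => <-; rewrite iterSr -IHP; first last.
  - by lia.
  - by lia.
  - by rewrite -iterSr.
  - exact: fsx_mxz.
  have f1 : fs2 (iter K (@md R V) (tx 0 B)) by apply: good_tx_reg hB hG _ _; lia.
  have -> : K%:Z + r0 = (K%:Z + (r0 + 1)) - 1 by lia.
  rewrite -tauz_md //; apply: eq_tauz => x y.
  rewrite -iterS iterSr; apply: iter_md_ext => x' y'.
  by rewrite md_txE // subr0.
have := @tau_comp_rec _ _ (iter P.+1 (@mxz R V) B) u P d.+1 (r0 + 1) isT.
rewrite addrK; have -> : d.+1%:Z - 1 = d by lia.
move=> e; have -> : tau_comp (iter P.+1 (@mxz R V) B) u P.+1 d.+1 r0 =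
   tau_comp (iter P.+1 (@mxz R V) B) u P d.+1 (r0 + 1) - tau_comp (iter P.+1 (@mxz R V) B) u P.+1 d (r0 + 1).
  by rewrite e addrK.
rewrite -IHd; last by lia.
rewrite iterSr -IHP; first last.
- by lia.
- by lia.
- by rewrite -iterSr.
- exact: fsx_mxz.
have f1 : fs2 (iter K (@md R V) (tx d.+1 B)) by apply: good_tx_reg hB hG _ _; lia.
have f2 : fs2 (iter K (@md R V) (tx d B)) by apply: good_tx_reg hB hG _ _; lia.
apply/eqP; rewrite eq_sym subr_eq; apply/eqP.
have {1}-> : K%:Z + r0 = (K%:Z + (r0 + 1)) - 1 by lia.
rewrite -tauz_md // -tauzD //; last exact: fs2_md.
apply: eq_tauz => x y; rewrite -iterS iterSr -iter_mdD; apply: iter_md_ext => x' y'.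
rewrite md_txE //; have -> : d.+1%:Z - 1 = d by lia.
by rewrite subrK.
Qed.

Lemma op_prod_nested m n (K : nat) : N%:Z <= K%:Z -> N%:Z + (N%:Z - 1 - n) <= K%:Z ->
  local (p (+) q) r (N + K) (op_prod p q n a b) c ->
  op_prod (p (+) q) r m (op_prod p q n a b) c (- u - 1) v =
  tau_comp (reg_abc v) u N (N%:Z - 1 - n) (N%:Z - 1 - m).
Proof.
move=> hK hK' hl; have fab := isfld_op_prod n fa fb hab.
rewrite (op_prod_tau _ fab fc hl) modeK.
pose B0 : ser3 := fun x y z => a (- x - 1) (b (- y - 1) (c (- z - 1) v)).
have -> : prod2 (op_prod p q n a b) c v = tx (N%:Z - 1 - n) (iter N (@mxy R V) B0).
  by apply/funext => y; apply/funext => z; rewrite prod2_left.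
rewrite addnC iterD iter_md_tx; last exact: fsx_B0.
have -> : (K + N)%N%:Z - 1 - m = K%:Z + (N%:Z - 1 - m) by lia.
have e : iter N (@mxz R V) (iter N (@myz R V) (iter N (@mxy R V) B0)) = reg_abc v.
  by rewrite iterC_yz_xy iterC_xz_xy.
rewrite (@tx_comp N) ?e //.
  by apply: fsx_iter; exact: fsx_B0.
exact: reg_abc_reg3.
Qed.

End Modes.

End OneTriple.

Lemma local_le pa pb N M a b : (N <= M)%N -> local pa pb N a b -> local pa pb M a b.
Proof.
move=> /subnKC <- /localP h; apply/localP => v x y; rewrite addnC !iterD.
by apply: iter_md_ext => x' y'; rewrite h.
Qed.

Lemma iter_md_flip N A x y :
  iter N (@md R V) (fun x y => A y x) x y = (-1) ^+ N *: iter N (@md R V) A y x.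
Proof.
elim: N x y => [|N IH] x y; first by rewrite scale1r.
by rewrite !iterS {1}/md !IH -scalerBr exprS -scalerA scaleN1r -scalerN /md opprB.
Qed.

Lemma signM_id (k : bool) : (-1) ^+ k * (-1) ^+ k = 1 :> C.
Proof. by case: k; rewrite /= ?expr1 ?mulrNN ?mulr1. Qed.

Lemma local_sym pa pb N a b : local pa pb N a b -> local pb pa N b a.
Proof.
move=> /localP h; apply/localP => v x y; rewrite iter_mdZ.
have e1 : iter N (@md R V) (prod2 b a v) x y = (-1) ^+ N *: iter N (@md R V) (prod2' a b v) y x.
  exact: iter_md_flip N (prod2' a b v) x y.
have e2 : iter N (@md R V) (prod2' b a v) x y = (-1) ^+ N *: iter N (@md R V) (prod2 a b v) y x.
  exact: iter_md_flip N (prod2 a b v) x y.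
rewrite e1 e2 h iter_mdZ scalerA scalerA andbC mulrAC signM_id mul1r.
by [].
Qed.

Lemma dong_left p q r N a b c n : isfld a -> isfld b -> isfld c ->
  local p q N a b -> local p r N a c -> local q r N b c ->
  exists2 K : nat, (N%:Z <= K%:Z) && (N%:Z + (N%:Z - 1 - n) <= K%:Z) &
    local (p (+) q) r (N + K) (op_prod p q n a b) c.
Proof.
move=> fa fb fc hab hac hbc; exists (N + N + absz n)%N; first by apply/andP; split; lia.
apply: local_sym; apply: dong => //; try exact: local_sym; lia.
Qed.

Lemma op_prodr0 pa pb n a : isfld a -> op_prod pa pb n a (0 : C -> V -> V) = 0.
Proof.
move=> fa; have [la _ _] := fa; have f0 : isfld (0 : C -> V -> V).
  by split=> [k x v w|//|v]; [rewrite scaler0 addr0|exists [::]|exists [::]].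
have hl : local pa pb 0 a 0.
  by apply/localP => v x y; rewrite /= /prod2 /prod2' (lin0 (la _)) scaler0.
apply/funext => k; apply/funext => v; rewrite (op_prod_tau _ fa f0 hl).
by rewrite tauz0 // => x y; rewrite /= /prod2 (lin0 (la _)).
Qed.

Lemma op_prod0l pa pb n a : isfld a -> op_prod pa pb n (0 : C -> V -> V) a = 0.
Proof.
move=> fa; have [la _ _] := fa; have f0 : isfld (0 : C -> V -> V).
  by split=> [k x v w|//|v]; [rewrite scaler0 addr0|exists [::]|exists [::]].
have hl : local pa pb 0 0 a.
  by apply/localP => v x y; rewrite /= /prod2 /prod2' (lin0 (la _)) scaler0.
apply/funext => k; apply/funext => v; rewrite (op_prod_tau _ f0 fa hl).
by rewrite tauz0.
Qed.

Lemma op_prod_trunc pa pb N n a b : isfld a -> isfld b -> local pa pb N a b ->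
  N%:Z <= n -> op_prod pa pb n a b = 0.
Proof.
move=> fa fb hl hn; apply/funext => k; apply/funext => v; rewrite (op_prod_tau _ fa fb hl).
by case E: (N%:Z - 1 - n) => [d|//]; lia.
Qed.

Section Newton.

Lemma iter_dltB (A B : int -> int -> V) N m n :
  iter N (@dlt R V) (fun m n => A m n - B m n) m n = iter N (@dlt R V) A m n - iter N (@dlt R V) B m n.
Proof. by elim: N m n => // N IH m n; rewrite !iterS {1}/dlt !IH subACA. Qed.

Lemma iter_dlt_flip (s : C) (A : int -> int -> V) N m n :
  iter N (@dlt R V) (fun m n => s *: A n m) m n = (s * (-1) ^+ N) *: iter N (@dlt R V) A n m.
Proof.
elim: N m n => [|N IH] m n; first by rewrite mulr1.
rewrite !iterS {1}/dlt !IH -scalerBr exprS mulrCA mulN1r scaleNr -scalerN.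
by rewrite opprB.
Qed.

(** On each line where m + n is constant, [dlt] is the difference operator in m, so J is a
    polynomial in m of degree less than N, written by Newton interpolation at m = 0. For fields it
    says that a series killed by (w-z)^N is a combination of derivatives of the delta function. *)
Lemma newton (J : int -> int -> V) N : (forall m n, iter N (@dlt R V) J m n = 0) ->
  forall m n, J m n =
    \sum_(i < N) gbin (m%:~R : C) i *: iter i (@dlt R V) J 0 (m + n - (i : nat)%:Z).
Proof.
elim: N J => [|N IH] J h m n; first by rewrite big_ord0; exact: (h m n).
pose K m n := \sum_(i < N.+1) gbin (m%:~R : C) i *: iter i (@dlt R V) J 0 (m + n - (i : nat)%:Z).
suff h0 : forall m n, J m n - K m n = 0.
  by apply/eqP; rewrite -subr_eq0; apply/eqP; exact: h0.
have hd m' n' : J (m' + 1) n' - K (m' + 1) n' = J m' (n' + 1) - K m' (n' + 1).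
  apply/eqP; rewrite -subr_eq0 subACA subr_eq0; apply/eqP.
  have -> : J (m' + 1) n' - J m' (n' + 1) = dlt J m' n' by [].
  rewrite (IH (dlt J)); last by move=> m1 n1; rewrite -iterSr h.
  rewrite /K -sumrB big_ord_recl !gbin0 /=.
  have -> : m' + 1 + n' - 0%:Z = m' + (n' + 1) - 0%:Z by lia.
  rewrite subrr add0r; apply: eq_bigr => i _; rewrite /bump /= add1n.
  have -> : m' + 1 + n' - i.+1%:Z = m' + n' - i%:Z by lia.
  have -> : m' + (n' + 1) - i.+1%:Z = m' + n' - i%:Z by lia.
  by rewrite intrD mulr1z gbin_pascal [gbin _ i.+1 + _]addrC -scalerBl addrK add0n -iterS iterSr.
have h00 n' : J 0 n' - K 0 n' = 0.
  rewrite /K big_ord_recl gbin0 scale1r /= add0r subr0 big1 ?addr0 ?subrr // => i _.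
  by rewrite /bump /= add1n (_ : 0%:~R = 0%:R) // gbin_nat_small ?scale0r.
have hp (k : nat) n' : J k%:Z n' - K k%:Z n' = 0.
  elim: k n' => // k IHk n'; have -> : k.+1%:Z = k%:Z + 1 by lia.
  by rewrite hd.
have hn (k : nat) n' : J (- k%:Z) n' - K (- k%:Z) n' = 0.
  elim: k n' => // k IHk n'.
  have -> : n' = (n' - 1) + 1 by lia.
  rewrite -hd; have -> : - k.+1%:Z + 1 = - k%:Z by lia.
  exact: IHk.
move=> [k|k] n'; first exact: hp.
by rewrite NegzE hn.
Qed.

End Newton.

Section Identities.
Variables (p q r : bool) (N : nat) (a b c : C -> V -> V).
Hypotheses (fa : isfld a) (fb : isfld b) (fc : isfld c).
Hypotheses (hab : local p q N a b) (hac : local p r N a c) (hbc : local q r N b c).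
Variables (v : V) (k : C).

Let u : C := - k - 1.
Let A m n := op_prod p (q (+) r) m a (op_prod q r n b c) k v.
Let B m n := (-1) ^+ (p && q) *: op_prod q (p (+) r) n b (op_prod p r m a c) k v.
Let E n m := op_prod (p (+) q) r m (op_prod p q n a b) c k v.
Let g := modes_reg N a b c v u.

Lemma keq : - u - 1 = k.
Proof. by rewrite /u; ring. Qed.

Lemma iter_dlt_A m n : iter N (@dlt R V) A m n = g m n.
Proof. by rewrite /g -(iter_dlt_modes fa fb fc hab hac hbc) keq. Qed.

Lemma reg_abc_flip : reg_abc N a b c v =
  (fun x y z => ((-1) ^+ (p && q) * (-1) ^+ N) *: reg_abc N b a c v y x z).
Proof.
rewrite (reg_abcE1 _ hab); set B1 := fun x y z => _.
pose B0 : ser3 := fun x y z => b (- x - 1) (a (- y - 1) (c (- z - 1) v)).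
pose fl (X : ser3) : ser3 := fun x y z => X y x z.
have f1 M X : iter M (@mxz R V) (fl X) = fl (iter M (@myz R V) X).
  by elim: M => //= M ->.
have f2 M X : iter M (@myz R V) (fl X) = fl (iter M (@mxz R V) X).
  by elim: M => //= M ->.
have f3 M X : iter M (@mxy R V) (fl X) = (-1) ^+ M *: fl (iter M (@mxy R V) X).
  do 3![apply/funext => ?]; rewrite iter_mxy.
  rewrite -[LHS]/(iter M (@md R V) (fun x y => (fun x y => X x y _) y x) _ _).
  by rewrite iter_md_flip -iter_mxy.
have -> : B1 = fl B0 by [].
rewrite f1 f3 (linZ (iter_lin N myz_lin)) f2 scalerA.
by rewrite iterC_xz_xy.
Qed.

(** The triple b, a, c has the same regular series with x and y exchanged, up to the sign in
    [reg_abc_flip], and the Taylor coefficients in x and in y at z commute. *)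
Lemma iter_dlt_B m n : iter N (@dlt R V) B m n = g m n.
Proof.
rewrite /B iter_dlt_flip.
have := iter_dlt_modes fb fa fc (local_sym hab) hbc hac v u n m; rewrite keq => ->.
rewrite /g /modes_reg tauz_exch; last exact: (reg_abc_reg3 fb fa fc (local_sym hab) hbc hac).
rewrite reg_abc_flip -tauzZ; last first.
  apply: reg2_fs2; apply: (@reg3_ty _ _ _ (fun x y z => reg_abc N b a c v y x z)).
  have [ds h] := reg_abc_reg3 fb fa fc (local_sym hab) hbc hac v.
  by exists ds => x y z /h[].
apply: eq_tauz => x z; rewrite /ty -tauzZ //.
have [ds h] := reg_abc_reg3 fb fa fc (local_sym hab) hbc hac v.
by apply: reg2_fs2; exists ds => y z' /h[].
Qed.

Lemma truncr_A : truncr A.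
Proof.
exists N%:Z => m n hn; rewrite /A (op_prod_trunc fb fc hbc hn) op_prodr0 //.
Qed.

Lemma truncl_B : truncl B.
Proof.
exists N%:Z => m n hn; rewrite /B (op_prod_trunc fa fc hac hn) op_prodr0 //.
exact: scaler0.
Qed.

(** Under [iter N dlt] both [A] and [B] become [g], so the right side reduces to a Taylor
    coefficient of [g]. The left side is [tau_comp] of the same regular series, and the two formulas
    agree term by term. *)
Lemma field_assoc n m : E n m = itp n A B m.
Proof.
rewrite (itp_iter N _ _ truncr_A truncl_B).
have -> : iter N (@dlt R V) A = g by apply/funext => x; apply/funext => y; exact: iter_dlt_A.
have -> : iter N (@dlt R V) B = g by apply/funext => x; apply/funext => y; exact: iter_dlt_B.
have [K /andP[hK hK'] hl] := dong_left n fa fb fc hab hac hbc.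
rewrite /E; have := op_prod_nested fa fb fc hab hac hbc v u m hK hK' hl.
rewrite keq => ->; rewrite /tau_comp.
case Ed: (N%:Z - 1 - n) => [d|d]; last first.
  by have -> : n - N%:Z = d%:Z; [lia|rewrite itp_same_ge0].
have -> : n - N%:Z = - 1 - d%:Z by lia.
rewrite itp_same_lt0.
- apply: eq_fsum => i; rewrite /g /modes_reg; congr (_ *: tauz _ (ty _ _) _); lia.
- exists N%:Z => x y hy; rewrite /g /modes_reg tauz0 // => x' z'; rewrite /ty.
  by case e: (_ - y) => [e'|//]; lia.
exists N%:Z => x y hy; rewrite /g /modes_reg.
by case e: (_ - x) => [e'|//]; lia.
Qed.

Lemma field_comm (m n : int) :
  A m n - B m n = \sum_(i < N) gbin (m%:~R : C) i *: E i%:Z (m + n - i%:Z).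
Proof.
rewrite (@newton (fun m n => A m n - B m n) N); last first.
  by move=> x y; rewrite iter_dltB iter_dlt_A iter_dlt_B subrr.
(* The i-th product is thereby a 0-th product of iterates of [dlt], in which only the terms of index
   0 survive; these are the coefficients of Newton's formula. *)
apply: eq_bigr => i _; rewrite field_assoc (itp_iter i _ _ truncr_A truncl_B) subrr.
rewrite iter_dltB; congr (_ *: _).
rewrite /itp !(@fsum1 _ _ 0%N) => [|[|j] // _|[|j] // _]; try by rewrite (_ : 0%:~R = 0%:R) // gbin_nat_small ?mulr0 ?scale0r.
set s := (-1) ^ _; have -> : s = 1 by exact: expr0z.
rewrite !gbin0 !mulr1 expr0 !scale1r.
move: (iter i _ A) (iter i _ B) => X Y.
by congr (X _ _ - Y _ _); lia.
Qed.

End Identities.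

End Triples.

(** * Vertex superalgebras of fields *)

Section FieldAlgebra.
Variables (R : realType) (V : lmodType R[i]).
Local Notation C := R[i].
Local Notation field := (C -> V -> V).
Implicit Types (a b c : field).
Local Notation vac := (@vac_op R V).

Lemma isfld0 : isfld (0 : field).
Proof. by split=> [k x v w|//|v]; [rewrite scaler0 addr0|exists [::]|exists [::]]. Qed.

Lemma isfld_vac : isfld vac.
Proof.
split=> [n k v w||v].
- by rewrite /vac_op; case: ifP => // _; rewrite scaler0 addr0.
- exists [:: 0] => n v; rewrite /vac_op; case: eqP => // -> _.
  by exists 0; rewrite ?mem_head // subr0; exists (-1); rewrite intrN.
exists [:: 0] => u; rewrite /vac_op; case: eqP => // h _; exists 0; rewrite ?mem_head //.
by exists 0%N; apply/eqP; rewrite addr0 -oppr_eq0; apply/eqP; rewrite -[LHS](subrK 1) [X in X + 1]h addNr.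
Qed.

Lemma isfld_lin (k : C) a b : isfld a -> isfld b -> isfld (k *: a + b).
Proof.
move=> [la [ca ha] ta] [lb [cb hb] tb].
have E n v : (k *: a + b) n v = k *: a n v + b n v by [].
have ne n v : (k *: a + b) n v <> 0 -> a n v <> 0 \/ b n v <> 0.
  rewrite E; have [->|/eqP h _] := eqVneq (a n v) 0; last by left.
  by rewrite scaler0 add0r; right.
split=> [n j v w||v].
- by rewrite !E la lb !scalerDr !scalerA addrACA mulrC.
- exists (ca ++ cb) => n v /ne[/ha|/hb] [z zc hz]; exists z => //; by rewrite mem_cat zc ?orbT.
have [da hda] := ta v; have [db hdb] := tb v.
by exists (da ++ db) => u /ne[/hda|/hdb]; [exact: lbd_catl|exact: lbd_catr].
Qed.

Lemma local_linl p q N (k : C) a b c : isfld c -> local p q N a c -> local p q N b c ->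
  local p q N (k *: a + b) c.
Proof.
move=> [lc _ _] /localP ha /localP hb; apply/localP => v x y.
have -> : prod2 (k *: a + b) c v = (fun x y => k *: prod2 a c v x y + prod2 b c v x y) by [].
have -> : (fun x y => (-1) ^+ (p && q) *: prod2' (k *: a + b) c v x y) =
  (fun x y => k *: ((-1) ^+ (p && q) *: prod2' a c v x y) + (-1) ^+ (p && q) *: prod2' b c v x y).
  apply/funext => x'; apply/funext => y'; rewrite /prod2'.
  have -> : (k *: a + b) (- x' - 1) v = k *: a (- x' - 1) v + b (- x' - 1) v by [].
  by rewrite lc scalerDr !scalerA [k * _]mulrC.
by rewrite !iter_mdD !iter_mdZ ha hb !iter_mdZ.
Qed.

Lemma local0l p q N a : isfld a -> local p q N 0 a.
Proof.
move=> [la _ _]; apply/localP => v x y; rewrite !iter_md0 // => x' y'.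
by rewrite /prod2' (lin0 (la _)) scaler0.
Qed.

Lemma local_vac q a : isfld a -> local false q 0 vac a.
Proof.
move=> [la _ _]; apply/localP => v x y; rewrite /= scale1r /prod2 /prod2' /vac_op.
by case: ifP; rewrite ?lin0.
Qed.

Lemma local_max p q r (a b c : field) : (exists N, local p q N a b) -> (exists N, local p r N a c) ->
  (exists N, local q r N b c) ->
  exists N, [/\ local p q N a b, local p r N a c & local q r N b c].
Proof.
move=> [N1 h1] [N2 h2] [N3 h3]; exists (maxn N1 (maxn N2 N3)); split.
- by apply: local_le h1; rewrite leq_maxl.
- by apply: local_le h2; rewrite !leq_max leqnn ?orbT.
by apply: local_le h3; rewrite !leq_max leqnn ?orbT.
Qed.

Lemma op_prod_linl p q n N (k : C) a b c : isfld a -> isfld b -> isfld c ->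
  local p q N a c -> local p q N b c ->
  op_prod p q n (k *: a + b) c = k *: op_prod p q n a c + op_prod p q n b c.
Proof.
move=> fa fb fc hac hbc; apply/funext => j; apply/funext => v.
have E (f g : field) : (k *: f + g) j v = k *: f j v + g j v by [].
rewrite E (op_prod_tau _ fa fc hac) (op_prod_tau _ fb fc hbc).
rewrite (op_prod_tau _ (isfld_lin k fa fb) fc (local_linl k fc hac hbc)).
have f1 := reg2_fs2 (local_reg2 v fa fc hac); have f2 := reg2_fs2 (local_reg2 v fb fc hbc).
rewrite -tauzZ // -tauzD //; last by move=> u; apply: fin_sub (f1 u) _ => x ->; rewrite scaler0.
by apply: eq_tauz => x y; rewrite -iter_mdZ -iter_mdD.
Qed.

Lemma op_prod_linr p q n N (k : C) a b c : isfld a -> isfld b -> isfld c ->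
  local p q N a b -> local p q N a c ->
  op_prod p q n a (k *: b + c) = k *: op_prod p q n a b + op_prod p q n a c.
Proof.
move=> fa fb fc hab hac; apply/funext => j; apply/funext => v; have [la _ _] := fa.
have E (f g : field) : (k *: f + g) j v = k *: f j v + g j v by [].
have hl : local p q N a (k *: b + c).
  by apply: local_sym; apply: local_linl => //; apply: local_sym.
rewrite E (op_prod_tau _ fa fb hab) (op_prod_tau _ fa fc hac).
rewrite (op_prod_tau _ fa (isfld_lin k fb fc) hl).
have f1 := reg2_fs2 (local_reg2 v fa fb hab); have f2 := reg2_fs2 (local_reg2 v fa fc hac).
rewrite -tauzZ // -tauzD //; last by move=> u; apply: fin_sub (f1 u) _ => x ->; rewrite scaler0.
apply: eq_tauz => x y; rewrite -iter_mdZ -iter_mdD; apply: iter_md_ext => x' y'.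
rewrite /prod2; have -> : (k *: b + c) (- y' - 1) v = k *: b (- y' - 1) v + c (- y' - 1) v by [].
by rewrite la.
Qed.

Lemma op_prod_vacl p a n : isfld a -> op_prod false p n vac a = if n == -1 then a else 0.
Proof.
move=> fa; have [la _ _] := fa; apply/funext => k; apply/funext => v.
rewrite (op_prod_tau _ isfld_vac fa (local_vac p fa)) sub0r /=.
have F x y : prod2 vac a v x y = if x == 0 then a (- y - 1) v else 0.
  rewrite /prod2 /vac_op; congr (if _ then _ else _).
  by rewrite -[- x - 1 == _]subr_eq0 opprK subrK oppr_eq0.
case E: (- 1 - n) => [d|d]; last first.
  by case: eqP => // n1; move: E; rewrite n1.
rewrite /= /tau (@fsum1 _ _ 0) => [|x /eqP/negPf hx]; last by rewrite F hx scaler0.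
rewrite F eqxx subr0; case: d E => [|d] E.
  rewrite gbin0 scale1r ifT; last by apply/eqP; lia.
  by congr (a _ v); ring.
by rewrite (_ : 0 = 0%:R) // gbin_nat_small // scale0r ifF //; apply/eqP; lia.
Qed.

(** The identity has only the exponent 0 in z, so a single x contributes: products with it from the
    right are divided derivatives. *)
Lemma op_prod_vacr_tau p n a u v : isfld a -> op_prod p false n a vac (- u - 1) v =
  if - 1 - n is Posz d then gbin (u + d%:R) d *: a (- (u + d%:R) - 1) v else 0.
Proof.
move=> fa; have [la _ _] := fa.
have hl : local p false 0 a vac by apply: local_sym; exact: local_vac.
rewrite (op_prod_tau _ fa isfld_vac hl) sub0r modeK /=.
case: (- 1 - n) => // d /=; rewrite /tau (@fsum1 _ _ (u + d%:R)).
  by congr (_ *: _); rewrite /prod2 /vac_op subrr oppr0 sub0r eqxx.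
move=> x hx; rewrite /prod2 /vac_op; case: eqP => [h|_]; last by rewrite (lin0 (la _)) scaler0.
case: hx; apply/eqP; rewrite eq_sym -subr_eq0; apply/eqP.
transitivity (- (- (u + d%:R - x) - 1) - 1); first by ring.
by rewrite h; ring.
Qed.

Lemma modeN (k : C) : k = - (- k - 1) - 1.
Proof. by ring. Qed.

Lemma op_prod_vacr_ge0 p n a : isfld a -> 0 <= n -> op_prod p false n a vac = 0.
Proof.
move=> fa hn; apply/funext => k; apply/funext => v; rewrite [k]modeN op_prod_vacr_tau //.
by case E: (- 1 - n) => [d|//]; lia.
Qed.

Lemma op_prod_vacr_m2 p a : isfld a -> op_prod p false (-2) a vac = ddz a.
Proof.
move=> fa; apply/funext => k; apply/funext => v; rewrite {1}[k]modeN op_prod_vacr_tau //.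
rewrite (_ : - 1 - (-2) = Posz 1%N) //= gbin1 /ddz.
by congr (_ *: a _ v); ring.
Qed.

Lemma isfld_ddz a : isfld a -> isfld (ddz a).
Proof.
move=> fa; rewrite -(op_prod_vacr_m2 false fa); apply: (isfld_op_prod _ fa isfld_vac).
by apply: local_sym; exact: local_vac.
Qed.

Lemma iter_ddz k a u v : iter k (@ddz R V) a (- u - 1) v =
  ((k`!)%:R * gbin (u + k%:R) k) *: a (- (u + k%:R) - 1) v.
Proof.
elim: k u => [|k IH] u; first by rewrite gbin0 mulr1 scale1r addr0.
rewrite iterS /ddz; have -> : - u - 1 - 1 = - (u + 1) - 1 by ring.
rewrite IH scalerA; congr (_ *: a _ v); last by rewrite -natr1; ring.
have -> : u + 1 + k%:R = u + k.+1%:R by rewrite -natr1; ring.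
have -> : (k.+1`!)%:R * gbin (u + k.+1%:R) k.+1 = (k`!)%:R * (k.+1%:R * gbin (u + k.+1%:R) k.+1).
  by rewrite factS natrM; ring.
by rewrite gbinSl -natr1; ring.
Qed.

Lemma fact_neq0 k : ((k`!)%:R : C) != 0.
Proof. by rewrite pnatr_eq0 -lt0n fact_gt0. Qed.

Lemma op_prod_vacr_lt0 p a (k : nat) : isfld a ->
  op_prod p false (- k%:Z - 1) a vac =
    ((k`!)%:R : C)^-1 *: iter k (fun x => op_prod p false (-2) x vac) a.
Proof.
move=> fa.
have [-> _] : iter k (fun x => op_prod p false (-2) x vac) a = iter k (@ddz R V) a /\ isfld (iter k (@ddz R V) a).
  by elim: k => //= k [-> h]; split; [exact: op_prod_vacr_m2|exact: isfld_ddz].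
apply/funext => j; apply/funext => v.
have E (f : field) : (((k`!)%:R)^-1 *: f) j v = ((k`!)%:R)^-1 *: f j v by [].
rewrite E [j]modeN op_prod_vacr_tau // iter_ddz scalerA mulrA mulVf ?fact_neq0 // mul1r.
by have -> : - 1 - (- k%:Z - 1) = k by lia.
Qed.

Section Derivation.
Variables (p q : bool) (N : nat) (a b : field).
Hypotheses (fa : isfld a) (fb : isfld b) (hab : local p q N a b).

Let hva : local p false N a vac.
Proof. by apply: local_sym; apply: (@local_le _ _ _ _ 0) => //; exact: local_vac. Qed.
Let hvb : local q false N b vac.
Proof. by apply: local_sym; apply: (@local_le _ _ _ _ 0) => //; exact: local_vac. Qed.

(** Since [ddz x] is x_(-2) 1, this is [field_assoc] for the triple a, b, 1. Only i = 0 and i = 1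
    contribute, because b_(n) 1 = 0 for n >= 0. *)
Lemma ddz_op_prod n : ddz (op_prod p q n a b) =
  op_prod p q n a (ddz b) - n%:~R *: op_prod p q (n - 1) a b.
Proof.
have fab := isfld_op_prod n fa fb hab.
rewrite -(op_prod_vacr_m2 (p (+) q) fab).
apply/funext => k; apply/funext => v.
rewrite (field_assoc fa fb isfld_vac hab hva hvb) addbF.
have E (f g : field) : (f - n%:~R *: g) k v = f k v - n%:~R *: g k v by [].
rewrite E /itp addbF [X in _ - X]fsum0 ?subr0; last first.
  by move=> i; rewrite op_prod_vacr_ge0 // op_prodr0 // !scaler0.
rewrite (@fsum_nat _ 2) => [|[|[|i]] // _]; last first.
  by rewrite op_prod_vacr_ge0 ?op_prodr0 ?scaler0 //; lia.
rewrite !big_ord_recl big_ord0 addr0 /= gbin0 gbin1 expr0 mulr1 scale1r subr0.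
rewrite op_prod_vacr_m2 //.
have -> : -2 + (bump 0 0)%:Z = - 0%:Z - 1 by [].
rewrite op_prod_vacr_lt0 //= fact0 invr1 scale1r expr1 mulN1r scaleNr.
by rewrite addr0.
Qed.

End Derivation.

Section Families.

Definition local_family (S : bool -> field -> Prop) : Prop :=
  (forall q x, S q x -> isfld x) /\
  (forall q r x y, S q x -> S r y -> exists N, local q r N x y).

(* Products are formed only when the factors are known to be local: this makes
   pairwise locality of the closure provable by two successive inductions. *)
Inductive lclosure (G : bool -> field -> Prop) : bool -> field -> Prop :=
| lcl_gen q x : G q x -> lclosure G q x
| lcl_0 q : lclosure G q 0
| lcl_lin q (k : C) x y : lclosure G q x -> lclosure G q y -> lclosure G q (k *: x + y)
| lcl_prod q r n N x y : lclosure G q x -> lclosure G r y -> local q r N x y ->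
    lclosure G (q (+) r) (op_prod q r n x y).

Variable G : bool -> field -> Prop.
Hypothesis hG : local_family G.

Lemma lclosure_isfld q x : lclosure G q x -> isfld x.
Proof.
elim=> {q x} [q x /(proj1 hG)//|q|q k x y _ fx _ fy|q r n N x y _ fx _ fy h].
- exact: isfld0.
- exact: isfld_lin.
exact: isfld_op_prod h.
Qed.

Lemma lclosure_local1 r z : isfld z -> (forall q x, G q x -> exists N, local q r N x z) ->
  forall q x, lclosure G q x -> exists N, local q r N x z.
Proof.
move=> fz hz q x; elim=> {q x} [q x /hz//|q|q k x y hx [N1 h1] hy [N2 h2]|q r' n N x y hx h1 hy h2 h].
- by exists 0%N; exact: local0l.
- exists (maxn N1 N2); apply: local_linl => //; [apply: local_le h1|apply: local_le h2].
    exact: leq_maxl.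
  exact: leq_maxr.
have [M [h1' h2' h3']] := local_max (ex_intro _ N h) h1 h2.
have [K _ hK] := dong_left n (lclosure_isfld hx) (lclosure_isfld hy) fz h1' h2' h3'.
by exists (M + K)%N.
Qed.

Lemma lclosure_local : local_family (lclosure G).
Proof.
split; first exact: lclosure_isfld.
move=> q r x y hx hy; move: q x hx; apply: lclosure_local1; first exact: lclosure_isfld hy.
move=> q x gx; have [N h] : exists N, local r q N y x.
  move: r y hy; apply: lclosure_local1; first exact: (proj1 hG) gx.
  by move=> r y gy; apply: (proj2 hG).
by exists N; exact: local_sym.
Qed.

End Families.

Section FamilyAlgebra.
Variable S : bool -> field -> Prop.
Hypotheses (hS : local_family S) (S_vac : S false vac) (S0 : forall q, S q 0).
Hypothesis (S_lin : forall q (k : C) x y, S q x -> S q y -> S q (k *: x + y)).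
Hypothesis (S_prod : forall q r n x y, S q x -> S r y -> S (q (+) r) (op_prod q r n x y)).
Hypothesis (S_direct : forall x, S false x -> S true x -> x = 0).

Let fS q x : S q x -> isfld x. Proof. exact: (proj1 hS). Qed.

Lemma fsum_fun (T : choiceType) (F : T -> field) k v : fin F ->
  fsum F k v = fsum (fun i => F i k v).
Proof. exact: (@fsum_morph _ _ _ (fun f : field => f k v)). Qed.

Lemma local3 p q r a b c : S p a -> S q b -> S r c ->
  exists N, [/\ local p q N a b, local p r N a c & local q r N b c].
Proof. by move=> ha hb hc; apply: local_max; apply: (proj2 hS). Qed.

Lemma family_assoc p q r a b c (n m : int) : S p a -> S q b -> S r c ->
  op_prod (p (+) q) r m (op_prod p q n a b) c =
      \sum_(i \in [set: nat]) ((-1) ^+ i * gbin (n%:~R : C) i) *: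
         op_prod p (q (+) r) (n - i%:Z) a (op_prod q r (m + i%:Z) b c)
      - (-1) ^+ (p && q) *: \sum_(i \in [set i : int | i <= n])
         ((-1) ^ i * gbin (n%:~R : C) `|n - i|%N) *:
         op_prod q (p (+) r) (m + i) b (op_prod p r (n - i) a c).
Proof.
move=> ha hb hc; have [N [hab hac hbc]] := local3 ha hb hc.
have [fa fb fc] := And3 (fS ha) (fS hb) (fS hc).
apply/funext => k; apply/funext => v.
have E (f g : field) (s : C) : (f - s *: g) k v = f k v - s *: g k v by [].
rewrite E (field_assoc fa fb fc hab hac hbc) /itp -/(fsum _) fsum_fun; last first.
  apply: (@fin_nat _ `|N%:Z - m|%N) => i hi.
  by rewrite (op_prod_trunc fb fc hbc) ?op_prodr0 ?scaler0 //; lia.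
congr (_ - _).
rewrite fsum_fst (@fsum_sub _ _ _ (fun i : nat => n - i%:Z)); first last.
- by move=> j; case: asboolP => //= jn _; exists `|n - j|%N; lia.
- by move=> i j; lia.
have fF : fin (fun i : nat => ((-1) ^ (n - i%:Z) * gbin (n%:~R : C) i) *:
         op_prod q (p (+) r) (m + (n - i%:Z)) b (op_prod p r i%:Z a c)).
  apply: (@fin_nat _ N) => i hi.
  by rewrite (op_prod_trunc fa fc hac) ?op_prodr0 ?scaler0 //; lia.
under [in RHS]eq_fsum => i.
  rewrite asboolT /=; last by lia.
  have -> : n - (n - i%:Z) = i%:Z by lia.
  over.
rewrite fsum_fun // fsumZ; last by apply: fin_sub fF _ => i e; rewrite -[LHS]/((_ : field) k v) e.
apply: eq_fsum => i; rewrite [in RHS]addrA.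
have E' (f : field) (s : C) : (s *: f) k v = s *: f k v by [].
by rewrite E' !scalerA mulrC.
Qed.

Lemma family_comm p q r a b c (m n : int) : S p a -> S q b -> S r c ->
  op_prod p (q (+) r) m a (op_prod q r n b c)
      - (-1) ^+ (p && q) *: op_prod q (p (+) r) n b (op_prod p r m a c) =
    \sum_(i \in [set: nat]) gbin (m%:~R : C) i *:
       op_prod (p (+) q) r (m + n - i%:Z) (op_prod p q i%:Z a b) c.
Proof.
move=> ha hb hc; have [N [hab hac hbc]] := local3 ha hb hc.
have [fa fb fc] := And3 (fS ha) (fS hb) (fS hc).
have z i : (N <= i)%N -> gbin (m%:~R : C) i *: op_prod (p (+) q) r (m + n - i%:Z) (op_prod p q i%:Z a b) c = 0.
  by move=> hi; rewrite (op_prod_trunc fa fb hab) // op_prod0l ?scaler0.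
apply/funext => k; apply/funext => v.
rewrite -/(fsum _) fsum_fun; last exact: fin_nat z.
rewrite (@fsum_nat _ N) => [|i hi]; last by rewrite (z i hi).
by rewrite -[LHS]/(_ k v - _ *: _ k v) (field_comm fa fb fc hab hac hbc).
Qed.

Lemma family_vsa : vertex_superalgebra S (@op_prod R V) vac.
Proof.
split.
- by move=> p; split=> [|k x y]; [exact: S0|exact: S_lin].
- exact: S_direct.
- exact: S_vac.
- by move=> p q n a b; exact: S_prod.
- move=> p q n k a a' b ha ha' hb.
  have [N [_ h1 h2]] := local3 ha ha' hb.
  by apply: (op_prod_linl _ _ _ _ _ h1 h2); apply: fS; eassumption.
- move=> p q n k a b b' ha hb hb'.
  have [N [h1 h2 _]] := local3 ha hb hb'.
  by apply: (op_prod_linr _ _ _ _ _ h1 h2); apply: fS; eassumption.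
- move=> p q a b ha hb; have [N h] := proj2 hS _ _ _ _ ha hb.
  by exists N%:Z => n hn; apply: (op_prod_trunc _ _ h hn); apply: fS; eassumption.
- by move=> p a n /fS; exact: op_prod_vacl.
- by move=> p a n /fS; exact: op_prod_vacr_ge0.
- by move=> p a k /fS; exact: op_prod_vacr_lt0.
- by move=> p q r a b c n m ha hb hc; exact: family_assoc.
by move=> p q r a b c m n ha hb hc; exact: family_comm.
Qed.

End FamilyAlgebra.

(** One coset is split off at a time; inside a single coset the finitely many lower bounds reduce to
    one truncation. *)
Lemma isfld_gen a : isfld a -> gen_vertex_operator a.
Proof.
move=> [la [cs hcs] ta]; elim: cs a la hcs ta => [|c cs IH] a la hcs ta.
  exists 0%N, (fun _ => 0), (fun _ _ _ => 0); split; first by case.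
  rewrite big_ord0; apply/funext => n; apply/funext => v.
  by apply: contrapT => /hcs[].
pose a1 : field := fun n v => if `[< is_int (n - c) >] then a n v else 0.
pose a2 : field := fun n v => if `[< is_int (n - c) >] then 0 else a n v.
have la1 n : linear (a1 n).
  by move=> k x y; rewrite /a1; case: ifP => _; [exact: la|rewrite scaler0 addr0].
have [k [lam [f [hf e2]]]] : gen_vertex_operator a2.
  apply: IH.
  - by move=> n k x y; rewrite /a2; case: ifP => _; [rewrite scaler0 addr0|exact: la].
  - move=> n v; rewrite /a2; case: asboolP => // hn /hcs[d].
    by rewrite inE => /orP[/eqP-> //|dc hd]; exists d.
  move=> v; have [ds h] := ta v; exists ds => x; rewrite /a2; case: ifP => // _.
  exact: h.
exists k.+1, (fun i => if unlift ord0 i is Some j then lam j else c),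
  (fun i => if unlift ord0 i is Some j then f j else a1); split.
  move=> i; case: unliftP => [j _|_]; first exact: hf.
  split=> // [n v hn|v]; first by rewrite /a1 asboolF.
  have [ds h] := ta v; have [n0 hn0] := lbd_bound ds (- c - 1).
  exists n0 => j hj; rewrite /a1; case: ifP => // _; apply: contrapT => hne.
  have := hn0 j; rewrite ltNge hj => hf'; suff: false by [].
  apply: hf'; apply: h; move: hne; congr (a _ v <> 0); ring.
rewrite big_ord_recl unlift_none (eq_bigr f) => [|j _]; last by rewrite liftK.
rewrite -e2; apply/funext => n; apply/funext => v.
rewrite -[RHS]/(a1 n v + a2 n v) /a1 /a2; case: ifP; by rewrite ?addr0 ?add0r.
Qed.

End FieldAlgebra.

(** * Exponentials of commuting operators *)

Section Exponentials.
Variables (R : realType) (U : lmodType R[i]).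
Local Notation C := R[i].

(* [E j], for [j] an integer, stands for the coefficient of [t^j] in
   exp (\sum_(i > 0) g i t^i / i), characterized by its logarithmic derivative. *)
Definition expz (g : nat -> U -> U) (E : int -> U -> U) : Prop :=
  [/\ forall v, E 0 v = v, forall j v, j < 0 -> E j v = 0
    & forall (M : nat) (j : int) v, j <= M%:Z ->
        j%:~R *: E j v = \sum_(i < M) g i.+1 (E (j - 1 - i%:Z) v)].

Section PsExp.
Variable f : nat -> U -> U.
Hypotheses (fl : forall i, linear (f i)) (f0 : forall v, f 0 v = 0).
Hypothesis fC : forall i j v, f i (f j v) = f j (f i v).

Let G m (k : int) v := if k is Posz n then iter m (ps_mul f) (@ps_one R U) n v else 0.

Lemma psG_S m (K : nat) (k : int) v : k < K%:Z ->
  G m.+1 k v = \sum_(i < K) f i (G m (k - i%:Z) v).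
Proof.
case: k => k hk; last first.
  by rewrite big1 // => i _; case E: (Negz k - i%:Z) => [d|d]; rewrite ?(lin0 (fl _)) //; lia.
rewrite /= /ps_mul.
have hK : (K = k.+1 + (K - k.+1))%N by lia.
rewrite hK big_split_ord /= [X in _ = _ + X]big1 ?addr0; last first.
  by move=> i _; case E: (_ - _) => [d|d]; rewrite ?(lin0 (fl _)) //; lia.
apply: eq_bigr => i _; congr (f i _).
by have -> : k%:Z - i%:Z = (k - i)%N%:Z by have := ltn_ord i; lia.
Qed.

Lemma psG_gt m (k : int) v : k < m%:Z -> G m k v = 0.
Proof.
elim: m k v => [|m IH] k v hk; first by case: k hk.
rewrite (@psG_S m `|k|.+1); last by lia.
rewrite big1 // => i _; case: i => -[|i] hi; first exact: f0.
by rewrite IH ?(lin0 (fl _)) //=; lia.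
Qed.

(** The rule t d/dt f^(m+1) = (m+1) f^m (t f'), valid because the coefficients of f commute. *)
Lemma psG_deriv m (K : nat) (k : int) v : k < K%:Z ->
  k%:~R *: G m.+1 k v = m.+1%:R *: \sum_(i < K) (i%:R : C) *: f i (G m (k - i%:Z) v).
Proof.
elim: m k v => [|m IH] k v hk.
  rewrite (psG_S _ _ hk) scaler_sumr scale1r; apply: eq_bigr => i _.
  case E: (k - i%:Z) => [[|d]|d]; rewrite /= /ps_one /= ?(lin0 (fl _)) ?scaler0 //.
  by have -> : k = i by lia.
rewrite (psG_S _ _ hk) scaler_sumr.
transitivity (\sum_(i < K) (i%:R : C) *: f i (G m.+1 (k - i%:Z) v) +
   \sum_(i < K) f i ((k - i%:Z)%:~R *: G m.+1 (k - i%:Z) v)).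
  rewrite -big_split /=; apply: eq_bigr => i _.
  by rewrite (linZ (fl _)) -scalerDl; congr (_ *: _); rewrite intrD intrN -pmulrn; ring.
rewrite -[m.+2]addn1 natrD scalerDl scale1r addrC; congr (_ + _).
under eq_bigr => i _ do [rewrite IH; last by lia].
rewrite scaler_sumr.
transitivity (\sum_(i < K) \sum_(j < K) (m.+1%:R * j%:R : C) *: f j (f i (G m (k - i%:Z - j%:Z) v))).
  apply: eq_bigr => i _; rewrite (linZ (fl _)) (lin_sum (fl _)) scaler_sumr.
  by apply: eq_bigr => j _; rewrite (linZ (fl _)) scalerA fC.
rewrite exchange_big /=; apply: eq_bigr => j _.
rewrite (@psG_S m K); last by lia.
rewrite (lin_sum (fl _)) scalerA scaler_sumr; apply: eq_bigr => i _.
by rewrite [k - i%:Z - j%:Z]addrAC.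
Qed.

Definition ps_expz (j : int) v := if j is Posz n then ps_exp f n v else 0.

(** As f has no constant term, the powers m > j do not reach degree j. The cut-off in [ps_exp] can
    therefore be raised to one K common to all degrees in the recursion. *)
Lemma ps_expzE (K : nat) (j : int) v : j < K%:Z ->
  ps_expz j v = \sum_(m < K) ((m`!)%:R : C)^-1 *: G m j v.
Proof.
case: j => j hj /=; last by rewrite big1 // => i _; rewrite scaler0.
have hK : (K = j.+1 + (K - j.+1))%N by lia.
rewrite hK big_split_ord /= [X in _ = _ + X]big1 ?addr0 // => i _.
have := @psG_gt (j.+1 + i) j v; rewrite /G /= => ->; rewrite ?scaler0 //; lia.
Qed.

Lemma expz_ps_exp : expz (fun i v => (i%:R : C) *: f i v) ps_expz.
Proof.
split=> [v|[] //|M j v hj].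
  by rewrite (@ps_expzE 1) // big_ord1 fact0 invr1 scale1r.
rewrite (@ps_expzE M.+2); last by lia.
rewrite scaler_sumr big_ord_recl /= [X in X + _](_ : _ = 0) ?add0r; last first.
  case: j hj => [[|j]|j] hj; rewrite /G /= /ps_one /= ?scaler0 //.
  by rewrite scale0r.
transitivity (\sum_(m < M.+1) \sum_(i < M.+1) ((m`!)%:R : C)^-1 *: ((i%:R : C) *: f i (G m (j - i%:Z) v))).
  apply: eq_bigr => m _; rewrite /bump /= add1n scalerA mulrC -scalerA (@psG_deriv _ M.+1); last by lia.
  rewrite scalerA scaler_sumr; apply: eq_bigr => i _; congr (_ *: _).
  have h1 : ((m`!)%:R : C) != 0 by rewrite pnatr_eq0 -lt0n fact_gt0.
  by rewrite factS natrM invfM mulrC mulrA mulfV ?mul1r // pnatr_eq0.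
rewrite exchange_big big_ord_recl /= big1 ?add0r => [|m _]; last by rewrite scale0r scaler0.
apply: eq_bigr => i _; rewrite /bump /= add1n.
rewrite (@ps_expzE M.+1); last by lia.
rewrite (lin_sum (fl _)) scaler_sumr; apply: eq_bigr => m _.
rewrite (linZ (fl _)) !scalerA mulrC; congr (_ *: f _ (G _ _ _)); lia.
Qed.

End PsExp.

Lemma expz_uniq g (E E' : int -> U -> U) v w : (forall i, linear (g i)) ->
  (forall j, j < 0 -> E j v = 0) -> (forall j, j < 0 -> E' j w = 0) -> E 0 v = E' 0 w ->
  (forall (M : nat) (j : int), j <= M%:Z -> j%:~R *: E j v = \sum_(i < M) g i.+1 (E (j - 1 - i%:Z) v)) ->
  (forall (M : nat) (j : int), j <= M%:Z -> j%:~R *: E' j w = \sum_(i < M) g i.+1 (E' (j - 1 - i%:Z) w)) ->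
  forall j, E j v = E' j w.
Proof.
move=> gl n1 n2 e0 r1 r2 [j|j]; last by rewrite n1 ?n2.
have [n] := ubnP j; elim: n j => // n IH [|j] hj; first exact: e0.
have h : (j.+1%:Z%:~R : C) != 0 by rewrite intr_eq0.
apply: (scalerI h); rewrite (r1 j.+1) // (r2 j.+1) //; apply: eq_bigr => i _.
have -> : j.+1%:Z - 1 - i%:Z = (j - i)%N%:Z by have := ltn_ord i; lia.
by rewrite IH //; lia.
Qed.

Section ExpTheory.
Variables (g : nat -> U -> U) (E : int -> U -> U).
Hypotheses (gl : forall i, linear (g i)) (gE : expz g E).

Lemma expz0 v : E 0 v = v. Proof. by case: gE. Qed.
Lemma expz_lt0 j v : j < 0 -> E j v = 0. Proof. by case: gE => _ h _; exact: h. Qed.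
Lemma expz_rec (M : nat) (j : int) v : j <= M%:Z ->
  j%:~R *: E j v = \sum_(i < M) g i.+1 (E (j - 1 - i%:Z) v).
Proof. by case: gE => _ _; apply. Qed.

Lemma expz_ind (P : int -> Prop) : (forall j, j < 0 -> P j) -> P 0 ->
  (forall j : nat, (forall i : int, i <= j%:Z -> P i) -> P j.+1%:Z) -> forall j, P j.
Proof.
move=> h1 h2 h3 [j|j]; last exact: h1.
suff : forall i : int, i <= j%:Z -> P i by apply.
elim: j => [|j IH] i hi.
  by have [/h1//|] := ltP i 0; move=> hi'; have -> : i = 0 by lia.
have [|hi'] := leP i j%:Z; first exact: IH.
have -> : i = j.+1%:Z by lia.
exact: h3.
Qed.

Lemma expz_lin j : linear (E j).
Proof.
move: j; apply: expz_ind => [j hj k v w|k v w|j IH k v w].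
- by rewrite !expz_lt0 // scaler0 addr0.
- by rewrite !expz0.
have h : (j.+1%:Z%:~R : C) != 0 by rewrite intr_eq0.
apply: (scalerI h); rewrite scalerDr scalerA mulrC -scalerA !(@expz_rec j.+1) //.
rewrite scaler_sumr -big_split /=; apply: eq_bigr => i _.
by rewrite IH ?gl //; lia.
Qed.

(* The case [kap = 0] says that [E j] commutes with what commutes with [g]. *)
Lemma expz_comm (T : U -> U) (m : nat) (kap : C) : linear T -> (0 < m)%N ->
  (forall i v, (0 < i)%N -> T (g i v) - g i (T v) = (if i == m then m%:R * kap else 0) *: v) ->
  forall j v, T (E j v) - E j (T v) = kap *: E (j - m%:Z) v.
Proof.
move=> Tl m0 h; apply: expz_ind => [j hj v|v|j IH v].
- by rewrite !expz_lt0 ?(lin0 Tl) ?subrr ?scaler0 //; lia.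
- by rewrite !expz0 subrr expz_lt0 ?scaler0 //; lia.
have hj : (j.+1%:Z%:~R : C) != 0 by rewrite intr_eq0.
apply: (scalerI hj); rewrite scalerBr -(linZ Tl) !(@expz_rec j.+1) // (lin_sum Tl) -sumrB.
transitivity (\sum_(i < j.+1) (kap *: g i.+1 (E (j.+1%:Z - m%:Z - 1 - i%:Z) v) +
   (if i.+1 == m then m%:R * kap else 0) *: E (j.+1%:Z - 1 - i%:Z) v)).
  apply: eq_bigr => i _; rewrite -h // -(linZ (gl _)).
  have -> : j.+1%:Z - m%:Z - 1 - i%:Z = j.+1%:Z - 1 - i%:Z - m%:Z by lia.
  rewrite -IH; last by lia.
  by rewrite (linB (gl _)) [RHS]addrC addrA subrK.
rewrite big_split /= -scaler_sumr -expz_rec; last by lia.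
have -> : \sum_(i < j.+1) (if i.+1 == m then m%:R * kap else 0) *: E (j.+1%:Z - 1 - i%:Z) v =
   (m%:R * kap) *: E (j.+1%:Z - m%:Z) v.
  have [mj|mj] := leqP m j.+1.
    have hm : (m.-1 < j.+1)%N by lia.
    rewrite (bigD1 (Ordinal hm)) //= prednK // eqxx big1 ?addr0 => [|i hi].
      by congr (_ *: E _ v); lia.
    rewrite ifF ?scale0r //; apply/negP => /eqP e; case/negP: hi; apply/eqP/val_inj => /=; lia.
  rewrite big1 => [|i _]; first by rewrite expz_lt0 ?scaler0 //; lia.
  by rewrite ifF ?scale0r //; apply/negP => /eqP e; have := ltn_ord i; lia.
rewrite !scalerA -scalerDl; congr (_ *: _).
by rewrite intrD intrN -!pmulrn; ring.
Qed.

Lemma expz_com (T : U -> U) : linear T ->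
  (forall i v, (0 < i)%N -> T (g i v) = g i (T v)) -> forall j v, T (E j v) = E j (T v).
Proof.
move=> Tl h j v; apply/eqP; rewrite -subr_eq0; apply/eqP.
rewrite (@expz_comm T 1 0) ?scale0r // => i w i0.
by rewrite h // subrr mulr0; case: ifP; rewrite scale0r.
Qed.

End ExpTheory.

Lemma expz_ext g g' E : expz g E -> (forall i v, (0 < i)%N -> g i v = g' i v) -> expz g' E.
Proof.
move=> [h1 h2 h3] e; split=> // M j v hj; rewrite (h3 M) //.
by apply: eq_bigr => i _; rewrite e.
Qed.

Lemma fin_int (T : nmodType) (lo hi : int) (F : int -> T) :
  (forall i, F i <> 0 -> lo <= i /\ i <= hi) -> fin F.
Proof.
move=> h; exists [seq lo + k%:Z | k <- iota 0 `|hi - lo|.+1] => i /h[h1 h2].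
by apply/mapP; exists `|i - lo|%N; rewrite ?mem_iota /=; lia.
Qed.

Section Convolution.
Variables (g g' : nat -> U -> U) (E E' : int -> U -> U).
Hypotheses (gl : forall i, linear (g i)) (gl' : forall i, linear (g' i)).
Hypotheses (hE : expz g E) (hE' : expz g' E').
Hypothesis hC : forall i j v, (0 < i)%N -> (0 < j)%N -> g i (g' j v) = g' j (g i v).

Let El := expz_lin gl hE.

Lemma fin_conv n v (c : int -> U -> U) : (forall i, c i 0 = 0) ->
  fin (fun i : int => c i (E i (E' (n - i) v))).
Proof.
move=> c0; apply: (@fin_int _ 0 n) => i h; split; rewrite leNgt; apply/negP => hi; apply: h.
  by rewrite (expz_lt0 hE).
by rewrite [X in E i X](expz_lt0 hE') ?(lin0 (El _)) //; lia.
Qed.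

(** The product rule: n = i + (n - i), and each part is expanded by the recursion of its factor. The
    commutation [hC] brings [g'] to the left of [E]. *)
Lemma conv_rec (M : nat) (n : int) v : n <= M%:Z ->
  n%:~R *: fsum (fun i : int => E i (E' (n - i) v)) =
  \sum_(k < M) (g k.+1 (fsum (fun i : int => E i (E' (n - 1 - k%:Z - i) v))) +
     g' k.+1 (fsum (fun i : int => E i (E' (n - 1 - k%:Z - i) v)))).
Proof.
move=> hn.
have f1 n' := @fin_conv n' v (fun _ => id) (fun _ => erefl).
have f2 n' k : fin (fun i : int => g k (E i (E' (n' - i) v))) by exact: (@fin_conv n' v (fun _ => g k) (fun _ => lin0 (gl k))).
have f3 n' k : fin (fun i : int => g' k (E i (E' (n' - i) v))) by exact: (@fin_conv n' v (fun _ => g' k) (fun _ => lin0 (gl' k))).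
rewrite fsumZ //.
transitivity (fsum (fun i : int => \sum_(k < M) g k.+1 (E (i - 1 - k%:Z) (E' (n - i) v)) +
    \sum_(k < M) g' k.+1 (E i (E' (n - 1 - k%:Z - i) v)))).
  apply: eq_fsum => i.
  have -> : n%:~R = i%:~R + (n - i)%:~R :> C by rewrite -intrD; congr (_%:~R); lia.
  rewrite scalerDl; congr (_ + _).
    have [iM|iM] := leP i M%:Z; first exact: (expz_rec hE).
    have z : E' (n - i) v = 0 by apply: (expz_lt0 hE'); lia.
    by rewrite z (lin0 (El _)) scaler0 big1 // => k _; rewrite (lin0 (El _)) (lin0 (gl _)).
  have [i0|i0] := ltP i 0.
    by rewrite (expz_lt0 hE) // scaler0 big1 // => k _; rewrite (expz_lt0 hE) // (lin0 (gl' _)).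
  rewrite -(linZ (El _)) (@expz_rec _ _ hE' M); last by lia.
  rewrite (lin_sum (El _)); apply: eq_bigr => k _.
  rewrite (expz_com gl hE (gl' _)); last by move=> j w j0; rewrite hC.
  by congr (E i (g' _ (E' _ _))); lia.
have fs k : fin (fun i : int => g k.+1 (E (i - 1 - k%:Z) (E' (n - i) v))).
  apply: fin_sub (fin_shift (- 1 - k%:Z) (f2 (n - 1 - k%:Z) k.+1)) _ => i.
  have -> : n - 1 - k%:Z - (i + (- 1 - k%:Z)) = n - i by lia.
  by have -> : i - 1 - k%:Z = i + (- 1 - k%:Z) by lia.
rewrite fsumD; [|by apply: fin_sum|by apply: fin_sum => k _; exact: f3].
rewrite !fsum_sum -?big_split /=; [|by move=> k _; exact: f3|by []].
apply: eq_bigr => k _; rewrite (lin_fsum (gl _)) // (lin_fsum (gl' _)) //; congr (_ + _).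
rewrite (fsum_shift (1 + k%:Z)); apply: eq_fsum => i.
by congr (g _ (E _ (E' _ _))); lia.
Qed.

Lemma expz_conv E'' v : expz (fun i v => g i v + g' i v) E'' ->
  forall n, E'' n v = fsum (fun i : int => E i (E' (n - i) v)).
Proof.
move=> hE''; apply: (@expz_uniq (fun i v => g i v + g' i v) E'' (fun n v => fsum (fun i : int => E i (E' (n - i) v))) v v).
- by move=> i k x y; rewrite gl gl' scalerDr addrACA.
- by move=> j; exact: (expz_lt0 hE'').
- move=> j hj; apply: fsum0 => i; have [i0|i0] := ltP i 0; first exact: (expz_lt0 hE).
  by rewrite [X in E i X](expz_lt0 hE') ?(lin0 (El _)) //; lia.
- rewrite (expz0 hE'') (@fsum1 _ _ 0) => [|i hi]; first by rewrite subr0 (expz0 hE') (expz0 hE).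
  have [i0|i0] := ltP i 0; first exact: (expz_lt0 hE).
  by rewrite [X in E i X](expz_lt0 hE') ?(lin0 (El _)) //; lia.
- by move=> M j; exact: (expz_rec hE'').
by move=> M j; exact: conv_rec.
Qed.

End Convolution.

Section Kernel.
Variables (g : nat -> U -> U) (Em Ep : int -> U -> U) (q : nat -> C) (phi : int -> C).
Hypotheses (gl : forall i, linear (g i)) (hE : expz g Em).
Hypotheses (Epl : forall i, linear (Ep i)) (Ep_lt0 : forall j v, j < 0 -> Ep j v = 0).
Hypothesis EpC : forall i m v, (0 < m)%N ->
  Ep i (g m v) = g m (Ep i v) - q m *: Ep (i - m%:Z) v.
Hypotheses (phi0 : phi 0 = 1) (phi_lt0 : forall j, j < 0 -> phi j = 0).
Hypothesis phi_rec : forall (M : nat) (j : int), j <= M%:Z ->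
  j%:~R * phi j = - \sum_(i < M) q i.+1 * phi (j - 1 - i%:Z).

(** Passing [Ep] over [Em] costs the scalar series phi = exp(- sum q_i t^i / i). In the induction on
    j the recursion of [Em] produces one generator, [EpC] moves it past [Ep], and [phi_rec] collects
    the extra terms. *)
Lemma expz_kernel j i v :
  Ep i (Em j v) = fsum (fun k : int => phi k *: Em (j - k) (Ep (i - k) v)).
Proof.
have ff (j' i' : int) (c : int -> C) : (forall k, k < 0 -> c k = 0) -> fin (fun k : int => c k *: Em (j' - k) (Ep (i' - k) v)).
  move=> hc; apply: (@fin_int _ 0 j') => k h; split; rewrite leNgt; apply/negP => hk; apply: h.
    by rewrite hc ?scale0r.
  by rewrite (expz_lt0 hE) ?scaler0 //; lia.
move: j i; apply: expz_ind => [j hj i|i|j IH i].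
- rewrite (expz_lt0 hE) // (lin0 (Epl _)) fsum0 // => k.
  have [k0|k0] := ltP k 0; first by rewrite phi_lt0 ?scale0r.
  by rewrite (expz_lt0 hE) ?scaler0 //; lia.
- rewrite (expz0 hE) (@fsum1 _ _ 0) => [|k hk]; first by rewrite phi0 scale1r !subr0 (expz0 hE).
  have [k0|k0] := ltP k 0; first by rewrite phi_lt0 ?scale0r.
  by rewrite (expz_lt0 hE) ?scaler0 //; lia.
have hj : (j.+1%:Z%:~R : C) != 0 by rewrite intr_eq0.
apply: (scalerI hj); rewrite -(linZ (Epl _)) (@expz_rec _ _ hE j.+1) // (lin_sum (Epl _)).
pose X (k : int) := Em (j.+1%:Z - k) (Ep (i - k) v).
transitivity (\sum_(m < j.+1) (fsum (fun k : int => phi k *: g m.+1 (Em (j.+1%:Z - k - 1 - m%:Z) (Ep (i - k) v)))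
    - fsum (fun k : int => (q m.+1 * phi (k - 1 - m%:Z)) *: X k))).
  apply: eq_bigr => m _; rewrite EpC // !IH; try by lia.
  congr (_ - _).
    rewrite (lin_fsum (gl _)); last exact: ff.
    by apply: eq_fsum => k; rewrite (linZ (gl _)); congr (_ *: g _ (Em _ _)); lia.
  rewrite fsumZ; last exact: ff.
  rewrite [RHS](fsum_shift (1 + m%:Z)); apply: eq_fsum => k; rewrite scalerA /X.
  have -> : k + (1 + m%:Z) - 1 - m%:Z = k by lia.
  by congr (_ *: Em _ (Ep _ _)); lia.
rewrite sumrB.
have f1 (m : 'I_j.+1) : fin (fun k : int => phi k *: g m.+1 (Em (j.+1%:Z - k - 1 - m%:Z) (Ep (i - k) v))).
  apply: (@fin_int _ 0 j.+1%:Z) => k h; split; rewrite leNgt; apply/negP => hk; apply: h.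
    by rewrite phi_lt0 ?scale0r.
  by rewrite (expz_lt0 hE) ?(lin0 (gl _)) ?scaler0 //; lia.
have f2 (m : 'I_j.+1) : fin (fun k : int => (q m.+1 * phi (k - 1 - m%:Z)) *: X k).
  by apply: ff => k hk; rewrite phi_lt0 ?mulr0 //; lia.
rewrite -!fsum_sum // -fsumB; try by apply: fin_sum.
rewrite fsumZ; last exact: ff.
apply: eq_fsum => k; rewrite -scaler_sumr -scaler_suml.
have [hk|hk] := ltP j.+1%:Z k.
  rewrite /X (expz_lt0 hE); last by lia.
  rewrite !scaler0 subr0 big1 ?scaler0 // => m _.
  by rewrite (expz_lt0 hE) ?(lin0 (gl _)) //; lia.
have [k0|k0] := ltP k 0.
  rewrite phi_lt0 // !scale0r scaler0 big1 ?scale0r ?subr0 // => m _.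
  by rewrite phi_lt0 ?mulr0 //; lia.
rewrite -(expz_rec hE); last by lia.
rewrite -scaleNr -phi_rec // -/(X k) !scalerA -scalerDl; congr (_ *: _).
by rewrite intrD intrN; ring.
Qed.

End Kernel.

End Exponentials.

Lemma one_sub_scaleX (F : fieldType) (z : F) : z != 0 ->
  1 - z *: 'X = (- z)%:P * ('X - z^-1%:P) :> {poly F}.
Proof.
move=> z0; rewrite mulrBr -polyCM mulNr mulfV // !polyCN opprK addrC.
by rewrite mulNr mul_polyC.
Qed.

(** * The grading and the roots of unity *)

Section GradingTheory.
Variables (R : realType) (l : nat) (h : vectType R[i]) (L : lattice_data l h).
Variable G : cyclic_grading L.
Local Notation C := R[i].
Local Notation p := (gord G).
Local Notation bf := (bform L).

Lemma bfDl a b c : bf (a + b) c = bf a c + bf b c.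
Proof. by have := bform_linear L c 1 a b; rewrite scale1r /= mul1r. Qed.

Lemma bfZl k a c : bf (k *: a) c = k * bf a c.
Proof.
have h0 : bf 0 c = 0 by apply: (addIr (bf 0 c)); rewrite -bfDl !add0r.
by have := bform_linear L c k a 0; rewrite addr0 h0 addr0.
Qed.

Lemma bf0l c : bf 0 c = 0. Proof. by rewrite -(scale0r 0) bfZl mul0r. Qed.
Lemma bfC a b : bf a b = bf b a. Proof. exact: bform_sym. Qed.
Lemma bfDr a b c : bf a (b + c) = bf a b + bf a c.
Proof. by rewrite bfC bfDl !(bfC a). Qed.
Lemma bfZr k a c : bf a (k *: c) = k * bf a c.
Proof. by rewrite bfC bfZl bfC. Qed.
Lemma bfNl a c : bf (- a) c = - bf a c.
Proof. by rewrite -scaleN1r bfZl mulN1r. Qed.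
Lemma bfNr a c : bf a (- c) = - bf a c.
Proof. by rewrite bfC bfNl bfC. Qed.
Lemma bf0r c : bf c 0 = 0. Proof. by rewrite bfC bf0l. Qed.
Lemma bf_suml (I : Type) (r : seq I) (P : pred I) F c :
  bf (\sum_(i <- r | P i) F i) c = \sum_(i <- r | P i) bf (F i) c.
Proof. exact: (big_morph (bf^~ c) (fun x y => bfDl x y c) (bf0l c)). Qed.
Lemma bf_sumr (I : Type) (r : seq I) (P : pred I) F c :
  bf c (\sum_(i <- r | P i) F i) = \sum_(i <- r | P i) bf c (F i).
Proof. by rewrite bfC bf_suml; apply: eq_bigr => i _; rewrite bfC. Qed.

Definition hproj (k : int) (a : h) : h := gproj (gclass G k) a.

Lemma gclass_nat (i : 'I_p) : gclass G i%:Z = i.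
Proof. by apply: val_inj; rewrite /= modz_small //; have := ltn_ord i; lia. Qed.

Lemma gclass_eq (k m : int) : (p%:Z %| k - m)%Z -> gclass G k = gclass G m.
Proof.
move=> hd; apply: val_inj => /=; congr absz; apply/eqP.
by rewrite eqz_mod_dvd.
Qed.

Lemma gclass_mod k : (p%:Z %| (gclass G k : nat)%:Z - k)%Z.
Proof.
rewrite -eqz_mod_dvd /= gez0_abs ?modz_mod //.
by rewrite modz_ge0 //; have := gord_gt0 G; lia.
Qed.

Lemma gproj_in (i : 'I_p) a : gproj i a \in grade G i.
Proof. exact: memv_sum_pi. Qed.

Lemma gproj_sum a : \sum_(i < p) gproj i a = a.
Proof. exact: (sumv_pi_sum (grade_full G) (memvf a)). Qed.

Lemma gproj_grade (i j : 'I_p) a : a \in grade G i -> gproj j a = if j == i then a else 0.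
Proof.
move=> ha; have /directv_sum_unique hu := grade_direct G.
have := hu (fun j => gproj j a) (fun j => if j == i then a else 0) (fun j _ => gproj_in j a).
rewrite gproj_sum -big_mkcond big_pred1_eq eqxx => /(_ _)/esym/forallP hh.
by apply/eqP; apply: hh => k _; case: eqP => [->//|_]; exact: mem0v.
Qed.

Lemma hproj_in k a : hproj k a \in grade G (gclass G k).
Proof. exact: gproj_in. Qed.

Lemma hproj_sum a : \sum_(i < p) hproj i%:Z a = a.
Proof. by rewrite -[RHS]gproj_sum; apply: eq_bigr => i _; rewrite /hproj gclass_nat. Qed.

Lemma hprojD k a b : hproj k (a + b) = hproj k a + hproj k b.
Proof. by rewrite /hproj linearD. Qed.

Lemma hproj_eq k m a : (p%:Z %| k - m)%Z -> hproj k a = hproj m a.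
Proof. by move=> hd; rewrite /hproj (gclass_eq hd). Qed.

Definition hpair (k : int) (a b : h) : C := bf (hproj k a) b.

Lemma bf_orth i j a b : a \in grade G i -> b \in grade G j -> bf a b != 0 -> (p %| i + j)%N.
Proof. by move=> ha hb; apply: contraR => hn; apply/eqP; apply: grade_orth ha hb hn. Qed.

Lemma hpair_proj k a b : bf (hproj k a) (hproj (- k) b) = hpair k a b.
Proof.
rewrite /hpair -[in RHS](gproj_sum b) bf_sumr (bigD1 (gclass G (- k))) //= big1 ?addr0 // => i hi.
apply/eqP/negPn/negP => hne; case/negP: hi; apply/eqP.
have := bf_orth (hproj_in k a) (gproj_in i b) hne => hd.
apply: etrans (esym (gclass_nat i)) _; apply: gclass_eq.
have h1 := gclass_mod k.
have hd' : (p%:Z %| (gclass G k : nat)%:Z + (i : nat)%:Z)%Z by rewrite -PoszD; exact: hd.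
by have := rpredB hd' h1; congr (is_true (_ %| _)%Z); lia.
Qed.

Lemma hpairC k a b : hpair k a b = hpair (- k) b a.
Proof. by rewrite -hpair_proj bfC -[in hproj k a](opprK k) hpair_proj. Qed.

Lemma hpair_eq k m a b : (p%:Z %| k - m)%Z -> hpair k a b = hpair m a b.
Proof. by move=> hd; rewrite /hpair (hproj_eq _ hd). Qed.

Lemma hpair_sum a b : \sum_(i < p) hpair i%:Z a b = bf a b.
Proof. by rewrite /hpair -bf_suml hproj_sum. Qed.

Lemma hpairDl k a b c : hpair k (a + b) c = hpair k a c + hpair k b c.
Proof. by rewrite /hpair hprojD bfDl. Qed.

Lemma hpairDr k a b c : hpair k a (b + c) = hpair k a b + hpair k a c.
Proof. by rewrite /hpair bfDr. Qed.

Lemma hpair0 a b : hpair 0 a b = bf (gpart0 G a) (gpart0 G b).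
Proof. by rewrite -hpair_proj oppr0. Qed.

Lemma p_neq0 : (p%:R : C) != 0.
Proof. by rewrite pnatr_eq0 -lt0n gord_gt0. Qed.

Local Notation om := (omega G).

Lemma omegaX k : om ^+ k = cos (2 * pi / p%:R * k%:R) +i* sin (2 * pi / p%:R * k%:R).
Proof.
elim: k => [|k IH]; first by rewrite mulr0 cos0 sin0.
have -> : 2 * pi / p%:R * k.+1%:R = 2 * pi / p%:R * k%:R + 2 * pi / p%:R :> R by rewrite -natr1; ring.
rewrite exprS IH /omega cosD sinD.
by apply/eqP; rewrite eq_complex /=; apply/andP; split; apply/eqP; ring.
Qed.

Lemma p_neq0R : (p%:R : R) != 0.
Proof. by rewrite pnatr_eq0 -lt0n gord_gt0. Qed.

(** If the order m were smaller than p, then cos(2 pi m / p) = 1 would give sin(pi m / p) = 0,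
    although 0 < pi m / p < pi. *)
Lemma omega_prim : p.-primitive_root om.
Proof.
have p0 := gord_gt0 G.
have e1 : om ^+ p = 1.
  rewrite omegaX divfK ?p_neq0R //.
  have -> : 2 * pi = (pi : R) *+ 2 by rewrite mulr_natl.
  by rewrite cos_mulr2n sin_mulr2n cospi sinpi mulr0 mul0rn sqrrN expr1n mulr2n addrK.
have [m hm hd] := prim_order_exists p0 e1.
suff -> : p = m by [].
apply/eqP; rewrite eqn_dvd hd andbT.
have m0 := prim_order_gt0 hm.
have := prim_expr_order hm; rewrite omegaX => /eqP; rewrite eq_complex /= => /andP[/eqP hc _].
have [mp|mp] := ltnP m p; last by have := dvdn_leq p0 hd => hle; have -> : m = p by lia.
have : 0 < sin (pi / p%:R * m%:R : R).
  apply: sin_gt0_pi; rewrite mulr_gt0 ?divr_gt0 ?pi_gt0 ?ltr0n //=.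
  rewrite mulrAC ltr_pdivrMr ?ltr0n // ltr_pM2l ?pi_gt0 //.
  by rewrite ltr_nat.
move: hc; have -> : 2 * pi / p%:R * m%:R = (pi / p%:R * m%:R : R) *+ 2 by rewrite mulr2n; ring.
rewrite cos_mulr2n cos2sin2 => hc hs.
have : sin (pi / p%:R * m%:R : R) ^+ 2 = 0 by move: hc; rewrite mulr2n; lra.
by move=> /eqP; rewrite sqrf_eq0 => /eqP e; move: hs; rewrite e ltxx.
Qed.

Lemma omega_neq0 : om != 0.
Proof.
apply/eqP => e; have := prim_expr_order omega_prim.
by rewrite e expr0n -[_ == _]negbK -lt0n gord_gt0 => /eqP; rewrite eq_sym oner_eq0.
Qed.

Lemma omegaXz_eq1 (k : int) : (om ^ k == 1) = (p%:Z %| k)%Z.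
Proof.
have hn (n : nat) : (om ^+ n == 1) = (p %| n)%N by rewrite -(prim_order_dvd omega_prim).
case: k => k; first by rewrite -exprnP hn.
by rewrite NegzE -exprnN invr_eq1 hn.
Qed.

Lemma omegaXz_eq (k m : int) : (p%:Z %| k - m)%Z -> om ^ k = om ^ m.
Proof.
rewrite -omegaXz_eq1 => /eqP e.
by rewrite -[k](subrK m) expfzDr ?omega_neq0 // e mul1r.
Qed.

Lemma sum_omega (k : int) : \sum_(s < p) om ^ (k * (s : nat)%:Z) = if (p%:Z %| k)%Z then p%:R else 0.
Proof.
have e (s : nat) : om ^ (k * s%:Z) = (om ^ k) ^+ s by rewrite exprnP exprz_exp.
under eq_bigr => s _ do rewrite e.
case: ifP => hk.
  have /eqP -> : om ^ k == 1 by rewrite omegaXz_eq1.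
  rewrite (eq_bigr (fun=> 1)) => [|i _]; last by rewrite expr1n.
  by rewrite sumr_const card_ord.
have hz : om ^ k - 1 != 0 by rewrite subr_eq0 omegaXz_eq1 hk.
apply: (mulfI hz); rewrite mulr0 -subrX1 exprnP exprz_exp mulrC.
apply/eqP; rewrite subr_eq0 omegaXz_eq1; exact: dvdz_mulr.
Qed.

(** The roots of the left side are the powers of the inverse of omega, which is primitive as well;
    the constant is found by evaluation at 0. *)
Lemma prod_one_sub_omega : \prod_(s < p) (1 - om ^+ s *: 'X) = 1 - 'X^p :> {poly C}.
Proof.
have p0 := gord_gt0 G.
have omV : p.-primitive_root om^-1.
  have e1 : om^-1 ^+ p = 1 by rewrite exprVn (prim_expr_order omega_prim) invr1.
  have [m hm hd] := prim_order_exists p0 e1.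
  suff -> : p = m by [].
  apply/eqP; rewrite eqn_dvd hd andbT (prim_order_dvd omega_prim).
  by rewrite -invr_eq1 -exprVn (prim_expr_order hm).
have e0 := factor_Xn_sub_1 omV; rewrite big_mkord in e0.
have e (s : 'I_p) : 1 - om ^+ s *: 'X = (- om ^+ s)%:P * ('X - (om^-1 ^+ s)%:P) :> {poly C}.
  by rewrite exprVn one_sub_scaleX // expf_neq0 ?omega_neq0.
have e1 : \prod_(s < p) (1 - om ^+ s *: 'X) = (\prod_(s < p) (- om ^+ s))%:P * ('X^p - 1) :> {poly C}.
  by rewrite (eq_bigr _ (fun s _ => e s)) big_split /= -rmorph_prod e0.
have := congr1 (fun q : {poly C} => q.[0]) e1.
rewrite horner_prod big1 => [|s _]; last by rewrite !(hornerE, mulr0, subr0).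
rewrite !hornerE expr0n -[_ == _]negbK -lt0n p0 /= sub0r mulrN1 => c1.
have {}c1 : \prod_(s < p) (- om ^+ s) = -1 by rewrite -[LHS]opprK -c1.
by rewrite e1 c1 polyCN mulN1r opprB.
Qed.

(** Cancel 1 - X in [prod_one_sub_omega] and evaluate at 1. This is the origin of the powers of p in
    [kappa]. *)
Lemma prod_omega_sub : \prod_(1 <= s < p) (1 - om ^+ s) = p%:R.
Proof.
have p0 := gord_gt0 G.
have e := prod_one_sub_omega; rewrite -(big_mkord xpredT (fun s => 1 - om ^+ s *: 'X)) big_ltn // expr0 scale1r in e.
have e1 : 1 - 'X^p = (1 - 'X) * \sum_(i < p) 'X^i :> {poly C}.
  by rewrite -[LHS]opprB subrX1 -mulNr opprB.
have hx : 1 - 'X != 0 :> {poly C}.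
  apply/eqP => /(congr1 (fun q : {poly C} => q.[0])).
  by rewrite !hornerE subr0 => /eqP; rewrite oner_eq0.
move: e; rewrite e1 => /(mulfI hx) /(congr1 (fun q : {poly C} => q.[1])).
rewrite horner_prod horner_sum => e2.
rewrite (eq_bigr (fun s => (1 - om ^+ s *: 'X).[1])) ?e2; last by move=> s _; rewrite !(hornerE, mulr1).
rewrite (eq_bigr (fun=> 1)) => [|i _]; last by rewrite !hornerE expr1n.
by rewrite sumr_const card_ord.
Qed.

Lemma one_sub_omega_neq0 s : (1 <= s)%N -> (s < p)%N -> 1 - om ^+ s != 0.
Proof.
move=> s1 s2; rewrite subr_eq0 eq_sym -(expr0 om) (eq_prim_root_expr omega_prim) eqn_mod_dvd // subn0.
by apply/negP => /dvdn_leq; lia.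
Qed.

Lemma sigmaE a : sigma G a = \sum_(i < p) om ^+ i *: gproj i a.
Proof. by rewrite /sigma sum_lfunE; apply: eq_bigr => i _; rewrite scale_lfunE. Qed.

Definition sigma_inv a := \sum_(i < p) (om ^+ i)^-1 *: gproj i a.

Lemma gproj_comb (c : 'I_p -> C) (j : 'I_p) a : gproj j (\sum_(i < p) c i *: gproj i a) = c j *: gproj j a.
Proof.
rewrite linear_sum (bigD1 j) //= big1 ?addr0 => [|i hi].
  by rewrite linearZ /= (gproj_grade _ (gproj_in j a)) eqxx.
by rewrite linearZ /= (gproj_grade _ (gproj_in i a)) eq_sym (negPf hi) scaler0.
Qed.

Lemma omX_neq0 i : om ^+ i != 0.
Proof. by rewrite expf_neq0 ?omega_neq0. Qed.

Lemma sigmaK a : sigma_inv (sigma G a) = a.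
Proof.
rewrite /sigma_inv -[RHS]gproj_sum; apply: eq_bigr => i _.
by rewrite sigmaE gproj_comb scalerA mulVf ?omX_neq0 // scale1r.
Qed.

Lemma sigmaVK a : sigma G (sigma_inv a) = a.
Proof.
rewrite sigmaE -[RHS]gproj_sum; apply: eq_bigr => i _.
by rewrite /sigma_inv gproj_comb scalerA mulfV ?omX_neq0 // scale1r.
Qed.

Lemma sigmaVE a : ((sigma G)^-1)%VF a = sigma_inv a.
Proof.
have h0 : lker (sigma G) == 0%VS by apply/lker0P; exact: can_inj sigmaK.
by rewrite -{1}[a]sigmaVK lker0_lfunK.
Qed.

Lemma iter_sigmaV s a : iter s ((sigma G)^-1)%VF a = \sum_(i < p) om ^ (- ((i : nat) * s)%N%:Z) *: gproj i a.
Proof.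
elim: s => [|s IH].
  by rewrite /= -[LHS]gproj_sum; apply: eq_bigr => i _; rewrite muln0 expr0z scale1r.
rewrite iterS IH sigmaVE /sigma_inv; apply: eq_bigr => i _.
rewrite gproj_comb scalerA exprnN -expfzDr ?omega_neq0 //.
by congr (om ^ _ *: _); rewrite mulnS; lia.
Qed.

Lemma pairingE s a b : pairing G s a b = \sum_(i < p) om ^ (- ((i : nat) * s)%N%:Z) * hpair (i : nat)%:Z a b.
Proof.
rewrite /pairing iter_sigmaV bf_suml; apply: eq_bigr => i _.
by rewrite bfZl /hpair /hproj gclass_nat.
Qed.

(** Fourier inversion of [pairingE], by the orthogonality [sum_omega]. It expresses the contractions
    of the modes through the integers m_s, so that the kernel is a product of powers. *)
Lemma hpair_pairing m a b :
  p%:R * hpair m a b = \sum_(s < p) om ^ (m * (s : nat)%:Z) * pairing G s a b.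
Proof.
under eq_bigr => s _ do rewrite pairingE mulr_sumr.
rewrite exchange_big /=.
transitivity (\sum_(i < p) (\sum_(s < p) om ^ ((m - (i : nat)%:Z) * (s : nat)%:Z)) * hpair (i : nat)%:Z a b).
  rewrite (bigD1 (gclass G m)) //= sum_omega ifT; last first.
    by have := gclass_mod m; rewrite -opprB rpredN.
  rewrite -(hpair_eq _ _ (gclass_mod m)) big1 ?addr0 // => i hi.
  rewrite sum_omega ifF ?mul0r //; apply/negP => hd; case/negP: hi; apply/eqP.
  by rewrite -[LHS]gclass_nat; apply: gclass_eq; rewrite -opprB rpredN.
apply: eq_bigr => i _; rewrite mulr_suml; apply: eq_bigr => s _.
rewrite mulrA -expfzDr ?omega_neq0 //; congr (om ^ _ * _).
by rewrite PoszM; ring.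
Qed.

Lemma pairing0 a b : pairing G 0 a b = bf a b.
Proof. by []. Qed.

(** As [sigma] is an isometry of order p, sigma^(-s) on one side becomes sigma^s = sigma^(-(p-s)) on
    the other. The remainder modulo p covers s = 0. *)
Lemma pairingC s a b : (s < p)%N -> pairing G s b a = pairing G ((p - s) %% p)%N a b.
Proof.
move=> sp; rewrite !pairingE.
have hi : injective (fun i : 'I_p => gclass G (- (i : nat)%:Z)).
  move=> i j e; apply: etrans (esym (gclass_nat i)) _; apply: etrans _ (gclass_nat j); apply: gclass_eq.
  have := rpredB (gclass_mod (- (i : nat)%:Z)) (gclass_mod (- (j : nat)%:Z)).
  by rewrite e; congr (is_true (_ %| _)%Z); lia.
rewrite (reindex_inj hi) /=; apply: eq_bigr => i _.
have hg := gclass_mod (- (i : nat)%:Z).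
rewrite (hpair_eq _ _ hg) -hpairC; congr (_ * _); apply: omegaXz_eq.
have e : (p%:Z %| ((p - s) %% p)%N%:Z + s%:Z)%Z.
  rewrite -PoszD; apply/dvdn_trans; last exact: dvdnn.
  by rewrite /dvdn modnDml subnK 1?ltnW // modnn.
have h1 := dvdz_mulr s%:Z hg; have h2 := dvdz_mull (i : nat)%:Z e.
have := rpredB h2 h1; congr (is_true (_ %| _)%Z).
by rewrite !PoszM; ring.
Qed.

End GradingTheory.

(** Applying [op t] minus the i-th eigenvalue removes the component of i and rescales the others,
    which the induction then extracts from [Q]. Linearity is assumed on [P] only, because products
    are shown linear only between local fields. *)
Lemma eigen_proj (K : fieldType) (W : lmodType K) (P Q : W -> Prop) (T : Type) (I : eqType)
    (op : T -> W -> W) (eig : T -> I -> K) :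
  P 0 -> (forall c x y, P x -> P y -> P (c *: x + y)) ->
  (forall t c x y, P x -> P y -> op t (c *: x + y) = c *: op t x + op t y) ->
  Q 0 -> (forall c x y, Q x -> Q y -> Q (c *: x + y)) -> (forall t x, P x -> Q x -> Q (op t x)) ->
  forall (r : seq I) (y : I -> W), uniq r -> (forall i, i \in r -> P (y i)) ->
  (forall i t, i \in r -> op t (y i) = eig t i *: y i) ->
  (forall i j, i \in r -> j \in r -> i != j -> exists t, eig t i != eig t j) ->
  Q (\sum_(i <- r) y i) -> forall i, i \in r -> Q (y i).
Proof.
move=> P0 Plin opl Q0 Qlin Qop; elim=> [|i r IH] y //= /andP[ir ur] Py ey sep.
have QZ c x : Q x -> Q (c *: x) by move=> qx; rewrite -[_ *: _]addr0; exact: Qlin.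
have QB x z : Q x -> Q z -> Q (x - z) by move=> qx qz; rewrite addrC -scaleN1r; exact: Qlin.
have opD t x z : P x -> P z -> op t (x + z) = op t x + op t z.
  by move=> px pz; have := opl t 1 x z px pz; rewrite !scale1r.
have op0 t : op t 0 = 0 by have := opl t (-1) 0 0 P0 P0; rewrite scaler0 addr0 scaleN1r addNr.
have Psum (s : seq I) : (forall j, j \in s -> P (y j)) -> P (\sum_(j <- s) y j).
  elim: s => [|j s IHs] hs; first by rewrite big_nil.
  rewrite big_cons -[y j]scale1r; apply: Plin; first by apply: hs; rewrite mem_head.
  by apply: IHs => k ks; apply: hs; rewrite inE ks orbT.
have opsum t (s : seq I) : (forall j, j \in s -> P (y j)) -> op t (\sum_(j <- s) y j) = \sum_(j <- s) op t (y j).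
  elim: s => [|j s IHs] hs; first by rewrite !big_nil.
  have hs' : forall k, k \in s -> P (y k) by move=> k ks; apply: hs; rewrite inE ks orbT.
  by rewrite !big_cons opD ?IHs //; [apply: hs; rewrite mem_head|exact: Psum].
move=> e0.
have yr j : j \in r -> Q (y j).
  move=> jr; have ij : i != j by apply: contra ir => /eqP ->.
  have [t ht] := sep i j (mem_head _ _) (mem_behead (s := i :: r) jr) ij.
  have qj : Q ((eig t j - eig t i) *: y j).
    move: j jr {ij ht}; apply: IH => //.
    - move=> k kr; rewrite -[_ *: _]addr0; apply: Plin => //; apply: Py; by rewrite inE kr orbT.
    - move=> k s kr; have Pk : P (y k) by apply: Py; rewrite inE kr orbT.
      by rewrite -[(eig t k - eig t i) *: y k]addr0 opl // op0 addr0 ey ?inE ?kr ?orbT // addr0 !scalerA mulrC.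
    - by move=> k k' kr kr'; apply: sep; rewrite inE ?kr ?kr' orbT.
    have -> : \sum_(k <- r) (eig t k - eig t i) *: y k = op t (\sum_(k <- i :: r) y k) - eig t i *: \sum_(k <- i :: r) y k.
      rewrite opsum // !big_cons ey ?mem_head // scalerDr opprD addrACA subrr add0r scaler_sumr -sumrB.
      apply: eq_big_seq => k kr.
      by rewrite scalerBl ey // inE kr orbT.
    by apply: QB; [apply: Qop => //; exact: Psum|exact: QZ].
  have := QZ (eig t j - eig t i)^-1 _ qj; rewrite scalerA mulVf ?scale1r //.
  by rewrite subr_eq0 eq_sym.
move=> j; rewrite inE => /orP[/eqP->|/yr //].
have -> : y i = \sum_(k <- i :: r) y k - \sum_(k <- r) y k by rewrite big_cons addrK.
apply: QB => //; rewrite big_seq; elim/big_ind: _ => // x z qx qz.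
by rewrite -[x]scale1r; exact: Qlin.
Qed.

Lemma eigen_indep (K : fieldType) (W : lmodType K) (P : W -> Prop) (T : Type) (I : eqType)
    (op : T -> W -> W) (eig : T -> I -> K) :
  P 0 -> (forall c x y, P x -> P y -> P (c *: x + y)) ->
  (forall t c x y, P x -> P y -> op t (c *: x + y) = c *: op t x + op t y) ->
  forall (r : seq I) (y : I -> W), uniq r -> (forall i, i \in r -> P (y i)) ->
  (forall i t, i \in r -> op t (y i) = eig t i *: y i) ->
  (forall i j, i \in r -> j \in r -> i != j -> exists t, eig t i != eig t j) ->
  \sum_(i <- r) y i = 0 -> forall i, i \in r -> y i = 0.
Proof.
move=> P0 Plin opl; apply: (@eigen_proj K W P (fun x => x = 0) T I op eig) => //.
  by move=> c x y -> ->; rewrite scaler0 addr0.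
by move=> t x _ ->; have := opl t (-1) 0 0 P0 P0; rewrite scaler0 addr0 scaleN1r addNr.
Qed.

(** * Fock spaces and vertex operators *)

Section FockTheory.
Variables (R : realType) (l : nat) (h : vectType R[i]) (L : lattice_data l h).
Variables (G : cyclic_grading L) (eps : h -> h -> R[i]) (V : lmodType R[i]).
Variable F : fock_space G eps V.
Local Notation C := R[i].
Local Notation p := (gord G).
Local Notation bf := (bform L).

Lemma lattice0 : in_lattice L 0.
Proof. by exists (fun=> 0); rewrite big1 // => i _; rewrite mulr0z. Qed.

Lemma latticeD a b : in_lattice L a -> in_lattice L b -> in_lattice L (a + b).
Proof.
move=> [c ->] [d ->]; exists (fun i => c i + d i).
by rewrite -big_split /=; apply: eq_bigr => i _; rewrite mulrzDr.
Qed.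

Lemma latticeN a : in_lattice L a -> in_lattice L (- a).
Proof.
move=> [c ->]; exists (fun i => - c i).
by rewrite -sumrN; apply: eq_bigr => i _; rewrite mulrNz.
Qed.

Lemma fh_lin k a : linear (fh F k a). Proof. exact: fh_linear. Qed.
Lemma fe_lin a : in_lattice L a -> linear (fe F a). Proof. exact: fe_linear. Qed.

Lemma fhDv k a b v : fh F k (a + b) v = fh F k a v + fh F k b v.
Proof. by have := fh_linear_vec F k v 1 a b; rewrite !scale1r. Qed.

Lemma fh_commE (k m : int) a b v : fh F k a (fh F m b v) - fh F m b (fh F k a v) =
  (if k + m == 0 then k%:~R / p%:R * hpair G k a b else 0) *: v.
Proof.
rewrite (fh_proj F k a) (fh_proj F m b).
rewrite [X in _ - X](fh_proj F m b) [X in _ - fh F m _ X](fh_proj F k a).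
rewrite fh_comm ?gproj_in //; case: eqP => // /eqP; rewrite addr_eq0 => /eqP ek.
have -> : m = - k by rewrite ek opprK.
by rewrite hpair_proj.
Qed.

Lemma fh_feE (k : int) a b v : in_lattice L b -> fh F k a (fe F b v) - fe F b (fh F k a v) =
  (if k == 0 then hpair G 0 a b else 0) *: fe F b v.
Proof.
move=> hb; rewrite (fh_proj F k a (fe F b v)) (fh_proj F k a v).
by rewrite fh_fe ?gproj_in //; case: eqP => // ->.
Qed.

(** With t = z^(1/p) for E_- and t = z^(-1/p) for E_+, the exponents are the sums of [gm a i] t^i /
    i and of [gp a i] t^i / i. The factor p comes from the division by n = -i/p or n = i/p. *)
Definition gm a (i : nat) v : V := p%:R *: fh F (- i%:Z) a v.
Definition gp a (i : nat) v : V := - p%:R *: fh F i%:Z a v.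
Definition Emz a : int -> V -> V := ps_expz (E_exponent F (-1) a).
Definition Epz a : int -> V -> V := ps_expz (E_exponent F 1 a).

Lemma linZl (U : lmodType C) (f : U -> U) c : linear f -> linear (fun v => c *: f v).
Proof. by move=> fl k x y; rewrite fl scalerDr !scalerA mulrC. Qed.

Lemma gml a i : linear (gm a i). Proof. by apply: linZl; exact: fh_lin. Qed.
Lemma gpl a i : linear (gp a i). Proof. by apply: linZl; exact: fh_lin. Qed.

Lemma E_exponent_lin sg a i : linear (E_exponent F sg a i).
Proof.
move=> k x y; rewrite /E_exponent; case: eqP => _; first by rewrite scaler0 addr0.
by rewrite fh_lin scalerDr !scalerA mulrC.
Qed.

Lemma E_exponent_com sg a b i j v : sg != 0 ->
  E_exponent F sg a i (E_exponent F sg b j v) = E_exponent F sg b j (E_exponent F sg a i v).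
Proof.
move=> s0; rewrite /E_exponent; case: eqP => [_|i0]; case: eqP => [_|j0]; rewrite ?(lin0 (fh_lin _ _)) ?scaler0 //.
rewrite !(linZ (fh_lin _ _)) !scalerA mulrC; congr (_ *: _).
apply/eqP; rewrite -subr_eq0 fh_commE ifF ?scale0r //.
apply/negP; rewrite -mulrDr mulf_eq0 (negPf s0) /=; lia.
Qed.

Lemma expz_Emz a : expz (gm a) (Emz a).
Proof.
apply: expz_ext (expz_ps_exp (E_exponent_lin _ a) _ _) _.
- by [].
- by move=> i j v; exact: E_exponent_com.
move=> i v i0; rewrite /E_exponent /gm ifF; last by apply/negP; lia.
rewrite mulN1r scalerA; congr (_ *: _).
have hi : (i%:R : C) != 0 by rewrite pnatr_eq0 -lt0n.
have hp := p_neq0 G.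
by rewrite intrN -pmulrn; field; rewrite hi hp.
Qed.

Lemma expz_Epz a : expz (gp a) (Epz a).
Proof.
apply: expz_ext (expz_ps_exp (E_exponent_lin _ a) _ _) _.
- by [].
- by move=> i j v; exact: E_exponent_com.
move=> i v i0; rewrite /E_exponent /gp ifF; last by apply/negP; lia.
rewrite mul1r scalerA; congr (_ *: _).
have hi : (i%:R : C) != 0 by rewrite pnatr_eq0 -lt0n.
have hp := p_neq0 G.
by rewrite -pmulrn; field; rewrite hi hp.
Qed.

Lemma Emzl a j : linear (Emz a j). Proof. exact: expz_lin (gml a) (expz_Emz a) j. Qed.
Lemma Epzl a j : linear (Epz a j). Proof. exact: expz_lin (gpl a) (expz_Epz a) j. Qed.
Lemma Emz_lt0 a j v : j < 0 -> Emz a j v = 0. Proof. exact: expz_lt0 (expz_Emz a) j v. Qed.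
Lemma Epz_lt0 a j v : j < 0 -> Epz a j v = 0. Proof. exact: expz_lt0 (expz_Epz a) j v. Qed.

Lemma fh_Emz (k : nat) b a j v : (0 < k)%N ->
  fh F k%:Z b (Emz a j v) - Emz a j (fh F k%:Z b v) = hpair G k%:Z b a *: Emz a (j - k%:Z) v.
Proof.
move=> k0; apply: (expz_comm (gml a) (expz_Emz a) (fh_lin _ _) k0) => i w i0.
rewrite /gm (linZ (fh_lin _ _)) -scalerBr fh_commE scalerA; congr (_ *: _).
have [->|ik] := eqVneq i k.
  by rewrite subrr eqxx -pmulrn mulrA mulrCA mulfV ?mulr1 // p_neq0.
by rewrite ifF ?mulr0 //; apply/negP; move/eqP: ik; lia.
Qed.

Lemma fh_Emz_com (k : int) b a j v : k <= 0 -> fh F k b (Emz a j v) = Emz a j (fh F k b v).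
Proof.
move=> k0; apply: (expz_com (gml a) (expz_Emz a) (fh_lin _ _)) => i w i0.
rewrite /gm (linZ (fh_lin _ _)); congr (_ *: _); apply/eqP; rewrite -subr_eq0 fh_commE.
by rewrite ifF ?scale0r //; apply/negP; lia.
Qed.

Lemma fh_Epz (k : nat) b a j v : (0 < k)%N ->
  fh F (- k%:Z) b (Epz a j v) - Epz a j (fh F (- k%:Z) b v) = hpair G (- k%:Z) b a *: Epz a (j - k%:Z) v.
Proof.
move=> k0; apply: (expz_comm (gpl a) (expz_Epz a) (fh_lin _ _) k0) => i w i0.
rewrite /gp (linZ (fh_lin _ _)) -scalerBr fh_commE scalerA; congr (_ *: _).
have [->|ik] := eqVneq i k.
  rewrite addNr eqxx intrN -pmulrn; have := p_neq0 G; move: (hpair _ _ _ _) => c hp.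
  by field.
by rewrite ifF ?mulr0 //; apply/negP; move/eqP: ik; lia.
Qed.

Lemma fh_Epz_com (k : int) b a j v : 0 <= k -> fh F k b (Epz a j v) = Epz a j (fh F k b v).
Proof.
move=> k0; apply: (expz_com (gpl a) (expz_Epz a) (fh_lin _ _)) => i w i0.
rewrite /gp (linZ (fh_lin _ _)); congr (_ *: _); apply/eqP; rewrite -subr_eq0 fh_commE.
by rewrite ifF ?scale0r //; apply/negP; lia.
Qed.

Lemma fh_fe_com (k : int) b a v : in_lattice L b -> k != 0 -> fe F b (fh F k a v) = fh F k a (fe F b v).
Proof.
by move=> hb /negPf k0; apply/eqP; rewrite eq_sym -subr_eq0 fh_feE // k0 scale0r.
Qed.

Lemma fe_Emz b a j v : in_lattice L b -> fe F b (Emz a j v) = Emz a j (fe F b v).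
Proof.
move=> hb; apply: (expz_com (gml a) (expz_Emz a) (fe_lin hb)) => i w i0.
by rewrite /gm (linZ (fe_lin hb)) fh_fe_com //; lia.
Qed.

Lemma fe_Epz b a j v : in_lattice L b -> fe F b (Epz a j v) = Epz a j (fe F b v).
Proof.
move=> hb; apply: (expz_com (gpl a) (expz_Epz a) (fe_lin hb)) => i w i0.
by rewrite /gp (linZ (fe_lin hb)) fh_fe_com //; lia.
Qed.

Lemma Emz_com a b i j v : Emz a i (Emz b j v) = Emz b j (Emz a i v).
Proof.
apply: (expz_com (gml b) (expz_Emz b) (Emzl a i)) => k w k0.
by rewrite /gm (linZ (Emzl _ _)) fh_Emz_com //; lia.
Qed.

Lemma Epz_com a b i j v : Epz a i (Epz b j v) = Epz b j (Epz a i v).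
Proof.
apply: (expz_com (gpl b) (expz_Epz b) (Epzl a i)) => k w k0.
by rewrite /gp (linZ (Epzl _ _)) fh_Epz_com.
Qed.

Lemma Epz_gm a b i m v : (0 < m)%N ->
  Epz a i (gm b m v) = gm b m (Epz a i v) - (p%:R * hpair G m%:Z a b) *: Epz a (i - m%:Z) v.
Proof.
move=> m0; rewrite /gm (linZ (Epzl _ _)); apply/eqP; rewrite eq_sym subr_eq addrC -subr_eq.
by rewrite -scalerBr fh_Epz // scalerA -hpairC.
Qed.

Lemma gmD a b i v : gm (a + b) i v = gm a i v + gm b i v.
Proof. by rewrite /gm fhDv scalerDr. Qed.
Lemma gpD a b i v : gp (a + b) i v = gp a i v + gp b i v.
Proof. by rewrite /gp fhDv scalerDr. Qed.

Lemma EmzD a b n v : Emz (a + b) n v = fsum (fun i : int => Emz a i (Emz b (n - i) v)).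
Proof.
apply: (expz_conv (gml a) (gml b) (expz_Emz a) (expz_Emz b)).
  move=> i j w i0 j0; rewrite /gm !(linZ (fh_lin _ _)) !scalerA; congr (_ *: _).
  by apply/eqP; rewrite -subr_eq0 fh_commE ifF ?scale0r //; apply/negP; lia.
by apply: expz_ext (expz_Emz (a + b)) _ => i w _; exact: gmD.
Qed.

Lemma EpzD a b n v : Epz (a + b) n v = fsum (fun i : int => Epz a i (Epz b (n - i) v)).
Proof.
apply: (expz_conv (gpl a) (gpl b) (expz_Epz a) (expz_Epz b)).
  move=> i j w i0 j0; rewrite /gp !(linZ (fh_lin _ _)) !scalerA; congr (_ *: _).
  by apply/eqP; rewrite -subr_eq0 fh_commE ifF ?scale0r //; apply/negP; lia.
by apply: expz_ext (expz_Epz (a + b)) _ => i w _; exact: gpD.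
Qed.

Local Notation h0 := (grade G (gclass G 0)).
Local Notation W := (weight G).

Definition bfw (b : h) : subvs_of h0 -> C^o := fun x => bf (vsval x) b.

Fact bfw_linear b : linear (bfw b).
Proof. by move=> k x y; rewrite /bfw linearP bfDl bfZl. Qed.

HB.instance Definition _ b := GRing.isLinear.Build C (subvs_of h0) C^o *:%R (bfw b) (bfw_linear b).

Definition wshift (xi : W) (b : h) : W := xi + linfun (bfw b).

Lemma weight_at_shift xi b a : weight_at (wshift xi b) a = weight_at xi a + hpair G 0 a b.
Proof.
rewrite /weight_at /wshift add_lfunE lfunE /=; congr (_ + _).
by rewrite /bfw vsprojK // gproj_in.
Qed.

Lemma weight_atD (xi : W) a b : weight_at xi (a + b) = weight_at xi a + weight_at xi b.
Proof. by rewrite /weight_at /gpart0 !linearD. Qed.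

Lemma wsE xi v a : weight_space F xi v -> fh F 0 a v = weight_at xi a *: v.
Proof.
by move=> hv; rewrite fh_proj /weight_at -hv vsprojK // gproj_in.
Qed.

Lemma ws_of xi v : (forall a, a \in h0 -> fh F 0 a v = weight_at xi a *: v) -> weight_space F xi v.
Proof.
move=> hv a; rewrite hv ?subvsP // /weight_at /gpart0; congr (xi _ *: v).
by rewrite (gproj_grade _ (subvsP a)) eqxx vsvalK.
Qed.

Lemma ws_lin xi k x y : weight_space F xi x -> weight_space F xi y -> weight_space F xi (k *: x + y).
Proof. by move=> hx hy a; rewrite fh_lin hx hy scalerDr !scalerA mulrC. Qed.

Lemma ws0 xi : weight_space F xi 0.
Proof. by move=> a; rewrite (lin0 (fh_lin _ _)) scaler0. Qed.

Lemma wsZ xi k x : weight_space F xi x -> weight_space F xi (k *: x).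
Proof. by move=> hx; rewrite -[_ *: _]addr0; apply: ws_lin => //; exact: ws0. Qed.

Lemma ws_fh xi k b v : weight_space F xi v -> weight_space F xi (fh F k b v).
Proof.
move=> hv a; have := fh_commE 0 k (vsval a) b v; rewrite mul0r mul0r if_same scale0r.
by move/eqP; rewrite subr_eq0 => /eqP ->; rewrite hv (linZ (fh_lin _ _)).
Qed.

Lemma ws_fe xi b v : in_lattice L b -> weight_space F xi v -> weight_space F (wshift xi b) (fe F b v).
Proof.
move=> hb hv; apply: ws_of => a _; rewrite weight_at_shift scalerDl.
have := fh_feE 0 a v hb; rewrite eqxx => /eqP; rewrite subr_eq => /eqP ->.
by rewrite (wsE _ hv) (linZ (fe_lin hb)) addrC.
Qed.

Lemma ws_Emz xi a j v : weight_space F xi v -> weight_space F xi (Emz a j v).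
Proof.
move=> hv b; have -> : fh F 0 (vsval b) (Emz a j v) = Emz a j (fh F 0 (vsval b) v) by exact: fh_Emz_com.
by rewrite hv (linZ (Emzl _ _)).
Qed.

Lemma ws_Epz xi a j v : weight_space F xi v -> weight_space F xi (Epz a j v).
Proof.
move=> hv b; have -> : fh F 0 (vsval b) (Epz a j v) = Epz a j (fh F 0 (vsval b) v) by exact: fh_Epz_com.
by rewrite hv (linZ (Epzl _ _)).
Qed.

Lemma ws_fsum (T : choiceType) xi (f : T -> V) : (forall i, weight_space F xi (f i)) -> weight_space F xi (fsum f).
Proof.
move=> hf; rewrite /fsum; elim/big_ind: _ => [|x y hx hy|i _]; first exact: ws0.
  by rewrite -[x]scale1r; exact: ws_lin.
exact: hf.
Qed.

(** Grouped by weight, the components vanish separately, since eigenvectors of distinct weights are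
    independent. Hence the decomposition that [xget] selects in [X_op] does not matter
    ([wdec_uniq]). *)
Lemma wdec0 (t : seq (V * W)) (f : W -> V -> V) : (forall xi, linear (f xi)) ->
  (forall w, w \in t -> weight_space F w.2 w.1) -> \sum_(w <- t) w.1 = 0 ->
  \sum_(w <- t) f w.2 w.1 = 0.
Proof.
move=> fl ht h0t; pose r := undup [seq w.2 | w <- t].
have part (g : V * W -> V) : \sum_(w <- t) g w = \sum_(xi <- r) \sum_(w <- t | w.2 == xi) g w.
  rewrite (exchange_big_dep xpredT) //= big_seq [RHS]big_seq; apply: eq_bigr => w wt.
  rewrite big_mkcond (bigD1_seq w.2) ?undup_uniq ?mem_undup ?map_f //= eqxx big1 ?addr0 // => xi.
  by rewrite eq_sym => /negPf ->.
pose y xi := \sum_(w <- t | w.2 == xi) w.1.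
have hy : forall xi, xi \in r -> y xi = 0.
  pose op (a : subvs_of h0) (v : V) := fh F 0 (vsval a) v.
  pose eig (a : subvs_of h0) (xi : 'Hom(subvs_of h0, C^o)) : C := xi a.
  apply: (@eigen_indep C V (fun=> True) (subvs_of h0) 'Hom(subvs_of h0, C^o) op eig).
  - by [].
  - by [].
  - by move=> a c x z _ _; exact: fh_lin.
  - exact: undup_uniq.
  - by [].
  - move=> xi a _; rewrite /op /eig /y (lin_sum (fh_lin _ _)) scaler_sumr big_seq_cond [RHS]big_seq_cond.
    by apply: eq_bigr => w /andP[wt /eqP <-]; exact: ht.
  - move=> xi xi' _ _ hne; apply: contrapT => /forallNP hn; case/negP: hne; apply/eqP/lfunP => a.
    by apply/eqP; apply: contrapT => hc; apply: (hn a); apply/negP.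
  by rewrite /y -part.
rewrite part big1_seq // => xi /andP[_ xir].
rewrite (eq_bigr (fun w => f xi w.1)) => [|w /eqP-> //].
by rewrite -(lin_sum (fl xi)) -/(y xi) (hy xi xir) (lin0 (fl _)).
Qed.

Lemma wdec_uniq (s t : seq (V * W)) (f : W -> V -> V) v : (forall xi, linear (f xi)) ->
  weight_decomposition F v s -> weight_decomposition F v t ->
  \sum_(w <- s) f w.2 w.1 = \sum_(w <- t) f w.2 w.1.
Proof.
move=> fl [hs es] [ht et]; apply/eqP; rewrite -subr_eq0; apply/eqP.
have := @wdec0 (s ++ [seq (- w.1, w.2) | w <- t]) f fl.
rewrite !big_cat !big_map /= !sumrN.
have -> : \sum_(j <- t) f j.2 (- j.1) = - \sum_(w <- t) f w.2 w.1.
  by rewrite -sumrN; apply: eq_bigr => w _; rewrite (linN (fl _)).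
apply; last by rewrite -es -et subrr.
move=> w; rewrite mem_cat => /orP[/hs //|/mapP[w' /ht hw' ->]] /=.
by rewrite -scaleN1r; exact: wsZ.
Qed.

Lemma weight_ind (P : V -> Prop) : h0_diagonalizable F -> P 0 ->
  (forall x y, P x -> P y -> P (x + y)) -> (forall xi v, weight_space F xi v -> P v) ->
  forall v, P v.
Proof.
move=> hd P0 PD Pw v; have [s [hs ->]] := hd v; rewrite big_seq.
by elim/big_ind: _ => // w /hs; exact: Pw.
Qed.

Section LatticeVector.
Variable a : h.
Hypothesis ha : in_lattice L a.
Hypothesis Efin : forall v, exists N : nat, forall j, (N <= j)%N -> E_plus F a j v = 0.

(* The coefficient of [z^(x/p)] in [E_-(a,z) E_+(a,z) v]. *)
Definition EE (v : V) (x : int) : V := fsum (fun j : int => Emz a (x + j) (Epz a j v)).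

Lemma EE_bound v : exists N : nat, forall j : int, N%:Z <= j -> Epz a j v = 0.
Proof. by have [N hN] := Efin v; exists N => -[j|j] hj //; exact: hN. Qed.

Lemma EE_fin v (c : int -> int) (f : V -> V) : f 0 = 0 -> fin (fun j : int => f (Emz a (c j) (Epz a j v))).
Proof.
move=> f0; have [N hN] := EE_bound v; apply: (@fin_int _ 0 N) => j hj; split; rewrite leNgt; apply/negP => hj'; apply: hj.
  by rewrite Epz_lt0 // (lin0 (Emzl _ _)).
by rewrite hN ?(lin0 (Emzl _ _)) //; lia.
Qed.

Lemma EE_lin x : linear (fun v => EE v x).
Proof.
move=> k v w; rewrite /EE fsumZ; last exact: (EE_fin v _ (f := id)).
rewrite -fsumD; last exact: (EE_fin w _ (f := id)).
  by apply: eq_fsum => j; rewrite Epzl Emzl.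
by apply: finZ; exact: (EE_fin v _ (f := id)).
Qed.

Lemma EE_lb v : exists N : nat, forall x, EE v x <> 0 -> - N%:Z <= x.
Proof.
have [N hN] := EE_bound v; exists N => x hx; rewrite leNgt; apply/negP => hx'; apply: hx.
apply: fsum0 => j; have [jN|jN] := leP N%:Z j; first by rewrite hN // (lin0 (Emzl _ _)).
by rewrite Emz_lt0 //; lia.
Qed.

Lemma EE_0 x : EE 0 x = 0. Proof. exact: (lin0 (EE_lin x)). Qed.

(** Positive modes fail to commute only with E_-, negative ones only with E_+; the resulting shift
    of x by k is the same. *)
Lemma fh_EE (k : int) b v x : k != 0 ->
  fh F k b (EE v x) - EE (fh F k b v) x = hpair G k b a *: EE v (x - k).
Proof.
move=> k0; rewrite /EE (lin_fsum (fh_lin _ _)); last exact: (EE_fin v _ (f := id)).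
rewrite -fsumB; [|exact: (EE_fin v _ (lin0 (fh_lin _ _)))|exact: (EE_fin _ _ (f := id))].
rewrite fsumZ; last exact: (EE_fin v _ (f := id)).
case: k k0 => [[//|k]|k] _.
  apply: eq_fsum => j; rewrite -fh_Epz_com // fh_Emz //.
  by congr (_ *: Emz _ _ _); lia.
rewrite NegzE opprK [RHS](fsum_shift (- k.+1%:Z)); apply: eq_fsum => j.
rewrite fh_Emz_com; last by lia.
rewrite -(linB (Emzl _ _)) fh_Epz // (linZ (Emzl _ _)).
by congr (_ *: Emz _ _ _); lia.
Qed.

Lemma fh0_EE b v x : fh F 0 b (EE v x) = EE (fh F 0 b v) x.
Proof.
rewrite /EE (lin_fsum (fh_lin _ _)); last exact: (EE_fin v _ (f := id)).
by apply: eq_fsum => j; rewrite fh_Emz_com // fh_Epz_com.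
Qed.

Lemma fe_EE b v x : in_lattice L b -> fe F b (EE v x) = EE (fe F b v) x.
Proof.
move=> hb; rewrite /EE (lin_fsum (fe_lin hb)); last exact: (EE_fin v _ (f := id)).
by apply: eq_fsum => j; rewrite fe_Emz // fe_Epz.
Qed.

Definition zext (f : int -> V) (y : C) : V := if `[< is_int y >] then f (toint y) else 0.

Definition qf : C := bf (gprime G a) (gprime G a) / 2.

Lemma X_on_weightE xi x v :
  X_on_weight F a xi (- x - 1) v = fe F a (zext (EE v) (p%:R * (x - weight_at xi a + qf))).
Proof.
rewrite /X_on_weight fsum_fst.
set y := p%:R * _; have hp := p_neq0 G.
have cond (ij : nat * nat) : (ij.1%:R / p%:R - ij.2%:R / p%:R + weight_at xi a
        - bf (gprime G a) (gprime G a) / 2 = - (- x - 1) - 1) <-> (ij.1%:Z - ij.2%:Z)%:~R = y.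
  have -> : (ij.1%:Z - ij.2%:Z)%:~R = ij.1%:R - ij.2%:R :> C by rewrite intrD intrN -!pmulrn.
  rewrite /y /qf; move: (weight_at _ _) (bf _ _) => w q.
  split=> [e|e].
    have -> : x = ij.1%:R / p%:R - ij.2%:R / p%:R + w - q / 2 by rewrite e; ring.
    by field.
  have -> : ij.1%:R / p%:R - ij.2%:R / p%:R = (ij.1%:R - ij.2%:R) / p%:R :> C by ring.
  by rewrite e; field.
rewrite /zext; case: asboolP => [[z hz]|hn]; last first.
  rewrite (lin0 (fe_lin ha)); apply: fsum0 => ij; rewrite asboolF // => /cond e; apply: hn.
  by rewrite -e; exact: is_int_int.
have cond' (ij : nat * nat) : (ij.1%:R / p%:R - ij.2%:R / p%:R + weight_at xi a
        - bf (gprime G a) (gprime G a) / 2 = - (- x - 1) - 1) <-> (ij.1%:Z - ij.2%:Z = z).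
  split=> [/cond|e]; first by rewrite hz => /intr_inj.
  by apply/cond; rewrite e hz.
(* For z + j < 0 the absolute value gives a pair outside the index set, and the corresponding term
   of [EE] is zero too. *)
rewrite (@fsum_sub _ _ _ (fun j : nat => (absz (z + j%:Z)%R, j))); first last.
- by move=> [i j]; case: asboolP => // /cond' /= e _; exists j; congr (_, _); lia.
- by move=> i j [].
rewrite hz toint_int /EE (lin_fsum (fe_lin ha)); last exact: (EE_fin v _ (f := id)).
rewrite [RHS](@fsum_sub _ _ _ Posz); first last.
- by move=> [j|j]; [exists j|rewrite Epz_lt0 // (lin0 (Emzl _ _)) (lin0 (fe_lin ha))].
- by move=> i j [].
apply: eq_fsum => j; case: asboolP => [/cond' /= e|hn].
  have -> : z + j%:Z = absz (z + j%:Z)%R by lia.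
  by [].
case E: (z + j%:Z) => [k|k]; last by rewrite /= (lin0 (fe_lin ha)).
by case: hn; apply/cond' => /=; lia.
Qed.

Hypothesis Hdiag : h0_diagonalizable F.

Lemma zext_lin (f g : int -> V) k y : zext (fun x => k *: f x + g x) y = k *: zext f y + zext g y.
Proof. by rewrite /zext; case: ifP => // _; rewrite scaler0 addr0. Qed.

Lemma X_on_weight_lin xi n : linear (X_on_weight F a xi n).
Proof.
move=> k v w; rewrite [n]modeN !X_on_weightE.
rewrite -(fe_lin ha) -zext_lin; congr (fe F a _); rewrite /zext; case: ifP => // _.
exact: EE_lin.
Qed.

Lemma X_opE s n v : weight_decomposition F v s ->
  X_op F a n v = \sum_(w <- s) X_on_weight F a w.2 n w.1.
Proof.
move=> hs; rewrite /X_op; apply: (@wdec_uniq _ s (fun xi => X_on_weight F a xi n) v) => //.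
  by move=> xi; exact: X_on_weight_lin.
have [t ht] := Hdiag v; case: xgetP => [y _ hy //|/(_ t)//].
Qed.

Lemma X_op_ws xi x v : weight_space F xi v ->
  X_op F a (- x - 1) v = fe F a (zext (EE v) (p%:R * (x - weight_at xi a + qf))).
Proof.
move=> hv; rewrite (@X_opE [:: (v, xi)]) ?big_seq1 ?X_on_weightE //.
by split; [move=> w; rewrite inE => /eqP ->|rewrite big_seq1].
Qed.

Lemma X_op_lin n : linear (X_op F a n).
Proof.
move=> k v w; have [s [hs es]] := Hdiag v; have [t [ht et]] := Hdiag w.
rewrite (@X_opE s n v (conj hs es)) (@X_opE t n w (conj ht et)).
rewrite (@X_opE ([seq (k *: u.1, u.2) | u <- s] ++ t)).
  rewrite big_cat big_map /= scaler_sumr; congr (_ + _); apply: eq_bigr => u _.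
  exact: (linZ (X_on_weight_lin _ _)).
split; last by rewrite big_cat big_map /= es et scaler_sumr.
move=> u; rewrite mem_cat => /orP[/mapP[u' /hs hu ->]|/ht //] /=.
exact: wsZ.
Qed.

End LatticeVector.

End FockTheory.

Section FockFields.
Variables (R : realType) (l : nat) (h : vectType R[i]) (L : lattice_data l h).
Variables (G : cyclic_grading L) (eps : h -> h -> R[i]) (V : lmodType R[i]).
Variable F : fock_space G eps V.
Hypotheses (Hdiag : h0_diagonalizable F) (Hdef : vertex_operators_defined F).
Local Notation C := R[i].
Local Notation p := (gord G).
Local Notation bf := (bform L).
Local Notation X := (X_op F).
Local Notation heis := (heis_op F).

Lemma Efin a v : in_lattice L a -> exists N : nat, forall j, (N <= j)%N -> E_plus F a j v = 0.
Proof. by move=> ha; have [h1 _] := Hdef ha; exact: h1. Qed.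

Lemma X_linear a n : in_lattice L a -> linear (X a n).
Proof. by move=> ha; apply: X_op_lin => // v; exact: Efin. Qed.

Lemma X_weight a xi x v : in_lattice L a -> weight_space F xi v ->
  X a (- x - 1) v = fe F a (zext (EE F a v) (p%:R * (x - weight_at xi a + qf G a))).
Proof. by move=> ha; apply: X_op_ws => // w; exact: Efin. Qed.

(** Division of k + N by p with remainder: the exponents in c + Z/p form p cosets of Z, and each
    remainder r supplies one lower bound. *)
Lemma lbd_frac (c : C) (N : nat) (k : int) : - N%:Z <= k ->
  lbd [seq c + ((r : nat)%:R - N%:R) / p%:R | r <- iota 0 p] (c + k%:~R / p%:R).
Proof.
move=> hk; have /eqP ek : (absz (k + N%:Z))%:Z == k + N%:Z by rewrite gez0_abs //; lia.
have hp := p_neq0 G; have p0 := gord_gt0 G.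
have := divn_eq (absz (k + N%:Z)) p; set j := (_ %/ _)%N; set r := (_ %% _)%N => ej.
exists (c + (r%:R - N%:R) / p%:R); first by apply/mapP; exists r; rewrite // mem_iota /= add0n ltn_mod.
exists j; have -> : k = (j * p)%N%:Z + r%:Z - N%:Z by lia.
rewrite rmorphB rmorphD /= -!pmulrn natrM; field.
exact: hp.
Qed.

Lemma coset_frac (y : C) : is_int (p%:R * y) -> exists2 r, r \in iota 0 p & is_int (y - r%:R / p%:R).
Proof.
move=> [k hk]; have hp := p_neq0 G; have p0 := gord_gt0 G.
exists (absz (k %% p)%Z); first by rewrite mem_iota /= add0n; exact: (class_subproof G k).
exists (k %/ p)%Z; have := divz_eq k p; set d := (k %/ p)%Z => ek.
have <- : p%:R^-1 * k%:~R = y by rewrite -hk mulKf.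
have -> : ((absz (k %% p)%Z)%:R : C) = (k %% p)%Z%:~R.
  by rewrite [in RHS](_ : (k %% p)%Z = absz (k %% p)%Z) // gez0_abs // modz_ge0; lia.
rewrite {1}ek rmorphD rmorphM /= -pmulrn; field.
exact: hp.
Qed.

Lemma zextP (f : int -> V) y : zext f y <> 0 -> exists2 k : int, y = k%:~R & f k <> 0.
Proof.
rewrite /zext; case: asboolP => // -[k ->]; rewrite toint_int => hk; by exists k.
Qed.

Lemma zext_int f (z : int) : zext f (z%:~R : C) = f z :> V.
Proof. by rewrite /zext asboolT ?toint_int //; exact: is_int_int. Qed.

Lemma isfld_X a : in_lattice L a -> isfld (X a).
Proof.
move=> ha; split; first by move=> n; exact: X_linear.
- have [_ [cs hcs]] := Hdef ha.
  exists [seq - (c - qf G a + (r : nat)%:R / p%:R) | c <- cs, r <- iota 0 p] => n v hn.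
  have [xi [w [hw hn']]] : exists xi w, weight_space F xi w /\ X a n w <> 0.
    apply: contrapT => hno; apply: hn; move: v.
    apply: (weight_ind Hdiag); first exact: (lin0 (X_linear _ ha)).
    - by move=> x y hx hy; rewrite (linD (X_linear _ ha)) hx hy addr0.
    - by move=> xi v hv; apply: contrapT => hx; apply: hno; exists xi, v.
  have w0 : w != 0 by apply/eqP => w0; apply: hn'; rewrite w0 (lin0 (X_linear _ ha)).
  have [c hc [m hm]] := hcs _ _ hw w0.
  move: hn'; rewrite [n]modeN (X_weight _ ha hw); set x := - n - 1 => hx.
  have : is_int (p%:R * (x - weight_at xi a + qf G a)).
    rewrite /zext in hx; move: hx; case: asboolP => // _; by rewrite (lin0 (fe_lin _ ha)).
  move=> /coset_frac[r hr [j hj]].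
  exists (- (c - qf G a + r%:R / p%:R)); first by apply/allpairsP; exists (c, r).
  exists (- j - m - 1); rewrite !rmorphB rmorphN /= -hj -hm /x; ring.
- move=> v; move: v; apply: (weight_ind Hdiag).
  + by exists [::] => x; rewrite (lin0 (X_linear _ ha)).
  + move=> x y [ds hx] [ds' hy]; exists (ds ++ ds') => z; rewrite (linD (X_linear _ ha)) => hz.
    have [ex|/eqP/hx] := eqVneq (X a (- z - 1) x) 0; last exact: lbd_catl.
    by apply: lbd_catr; apply: hy => ey; apply: hz; rewrite ex ey addr0.
  + move=> xi v hv; have [N hN] := EE_lb (fun w => Efin w ha) v.
    exists [seq (weight_at xi a - qf G a) + ((r : nat)%:R - N%:R) / p%:R | r <- iota 0 p] => x.
    rewrite (X_weight _ ha hv) => hx.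
    have /zextP[k hk hk'] : zext (EE F a v) (p%:R * (x - weight_at xi a + qf G a)) <> 0.
      by move=> e; apply: hx; rewrite e (lin0 (fe_lin _ ha)).
    have -> : x = weight_at xi a - qf G a + k%:~R / p%:R.
      by rewrite -hk; field; exact: p_neq0.
    by apply: lbd_frac; exact: hN.
Qed.

Lemma heis_zext b y v : heis b (- y - 1) v = zext (fun k => fh F (- k) b v) (p%:R * (y + 1)).
Proof.
rewrite /heis_op /zext; have -> : p%:R * (- y - 1) = - (p%:R * (y + 1)) by ring.
case: asboolP => [[k hk]|hn]; case: asboolP => [[m hm]|hn'] //; last 2 first.
- by case: hn'; exists (- k); rewrite rmorphN /= -hk opprK.
- by case: hn; exists (- m); rewrite rmorphN /= -hm.
by rewrite hm toint_int -(rmorphN _ m) /= toint_int.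
Qed.

Lemma isfld_heis b : isfld (heis b).
Proof.
split.
- move=> n k x y; rewrite /heis_op; case: ifP => _; last by rewrite scaler0 addr0.
  exact: fh_lin.
- exists [seq (r : nat)%:R / p%:R | r <- iota 0 p] => n v; rewrite /heis_op; case: asboolP => // hn _.
  by have [r hr hi] := coset_frac hn; exists (r%:R / p%:R) => //; apply/mapP; exists r.
- move=> v; have [N hN] := fh_restricted F v b.
  exists [seq - 1 + ((r : nat)%:R - (absz N)%:R) / p%:R | r <- iota 0 p] => x; rewrite heis_zext.
  move=> /zextP[k hk hk'].
  have -> : x = - 1 + k%:~R / p%:R by rewrite -hk; field; exact: p_neq0.
  apply: lbd_frac; rewrite leNgt; apply/negP => hk2; apply: hk'; apply: hN; lia.
Qed.

Lemma fh_X k b a n v : in_lattice L a ->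
  fh F k b (X a n v) - X a n (fh F k b v) = hpair G k b a *: X a (n + k%:~R / p%:R) v.
Proof.
move=> ha; move: v; apply: (weight_ind Hdiag).
- by do !rewrite ?(lin0 (X_linear _ ha)) ?(lin0 (fh_lin F _ _)); rewrite subrr scaler0.
- move=> x y hx hy; do !rewrite ?(linD (X_linear _ ha)) ?(linD (fh_lin F _ _)); rewrite scalerDr -hx -hy.
  by rewrite opprD addrACA.
move=> xi v hv; have hp := p_neq0 G.
rewrite [n]modeN; move: (- n - 1) => x.
have -> : - x - 1 + k%:~R / p%:R = - (x - k%:~R / p%:R) - 1 :> C by ring.
rewrite !(X_weight _ ha hv) (X_weight _ ha (ws_fh k b hv)).
have -> : p%:R * (x - k%:~R / p%:R - weight_at xi a + qf G a) = p%:R * (x - weight_at xi a + qf G a) - k%:~R by field.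
set y := p%:R * _.
case: (pselect (is_int y)) => [[z ->]|hy]; last first.
  rewrite /zext !asboolF //.
    by rewrite !(lin0 (fe_lin _ ha)) (lin0 (fh_lin F _ _)) subrr scaler0.
  by move=> hi; apply: hy; rewrite -[y](subrK (k%:~R)); apply: is_intD => //; exact: is_int_int.
rewrite -rmorphB /= !zext_int.
have [->|k0] := eqVneq k 0.
  rewrite -fh0_EE => [|w]; last exact: Efin.
  by rewrite fh_feE // eqxx subr0.
rewrite -fh_fe_com // -(linB (fe_lin _ ha)) fh_EE // => [|w]; last exact: Efin.
by rewrite (linZ (fe_lin _ ha)).
Qed.

(** By [fh_X] the commutator depends only on k modulo p and on the sum of the modes, so a unit moved
    from one mode to the other leaves it unchanged. *)
Lemma heis_X_local b a q : in_lattice L a -> local false q 1 (heis b) (X a).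
Proof.
move=> ha n m v; rewrite /= !big_ord_recl big_ord0 /= expr0 expr1 !bin0 binn !mul1r !scale1r addr0 /bump /=.
rewrite !subn0 subnn !addr0 add1n mulr1 scaleN1r.
have e : forall k : int, p%:R * n = k%:~R -> p%:R * (n + 1) = (k + p%:Z)%:~R :> C.
  by move=> k hk; rewrite mulrDr hk mulr1 rmorphD /= -pmulrn.
rewrite /heis_op; case: asboolP => [[k hk]|hn]; last first.
  rewrite asboolF; last first.
    move=> hi; apply: hn; rewrite -[p%:R * n](addrK (p%:R * 1)) -mulrDr; apply: is_intB => //.
    by rewrite mulr1; exact: is_int_nat.
  by rewrite !(lin0 (X_linear _ ha)) !subrr.
rewrite (e _ hk) asboolT ?toint_int; last exact: is_int_int.
rewrite hk toint_int !fh_X // (@hpair_eq _ _ _ _ G (k + p%:Z) k); last by rewrite addrAC subrr add0r.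
apply/eqP; rewrite subr_eq0; apply/eqP; congr (_ *: X a _ v).
by rewrite rmorphD /= -pmulrn; field; exact: p_neq0.
Qed.

(** The degree z = (z + j) - j is shared between E_- and E_+, whose recursions give the two sums.
    Together they are p times the current of [a] without its zero mode; [M0] makes both sums exhaust
    their nonzero terms. *)
Lemma EE_rec a v : in_lattice L a -> forall z : int, exists M0 : nat, forall M : nat, (M0 <= M)%N ->
  z%:~R *: EE F a v z = p%:R *: (\sum_(i < M) fh F (- (i : nat).+1%:Z) a (EE F a v (z - (i : nat).+1%:Z))
     + \sum_(i < M) EE F a (fh F (i : nat).+1%:Z a v) (z + (i : nat).+1%:Z)).
Proof.
move=> ha z; have fE w := Efin w ha.
have [N hN] := EE_bound fE v; have [N' hN'] := fh_restricted F v a.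
exists (absz z + N + absz N')%N => M hM.
have recm j : (z + j)%:~R *: Emz F a (z + j) (Epz F a j v) =
    \sum_(i < M) gm F a i.+1 (Emz F a (z + j - 1 - (i : nat)%:Z) (Epz F a j v)).
  have [jN|jN] := leP N%:Z j.
    rewrite hN // (lin0 (Emzl _ _ _)) scaler0 big1 // => i _.
    by rewrite (lin0 (Emzl _ _ _)) (lin0 (gml _ _ _)).
  by apply: (expz_rec (expz_Emz F a)); lia.
have recp j : j%:~R *: Epz F a j v = \sum_(i < M) gp F a i.+1 (Epz F a (j - 1 - (i : nat)%:Z) v).
  have [jM|jM] := leP j M%:Z; first by apply: (expz_rec (expz_Epz F a)).
  rewrite hN ?scaler0; last by lia.
  rewrite big1 // => i _; rewrite /gp fh_Epz_com //.
  have [iN|iN] := leP N' (i : nat).+1%:Z; first by rewrite hN' // (lin0 (Epzl _ _ _)) scaler0.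
  by rewrite -fh_Epz_com // hN ?(lin0 (fh_lin _ _ _)) ?scaler0 //; lia.
have fin1 (i : nat) : fin (fun j : int => gm F a i.+1 (Emz F a (z + j - 1 - i%:Z) (Epz F a j v))).
  exact: (EE_fin fE v (fun j => z + j - 1 - i%:Z) (lin0 (gml F a i.+1))).
have fin2 (i : nat) : fin (fun j : int => Emz F a (z + j) (gp F a i.+1 (Epz F a (j - 1 - i%:Z) v))).
  have := EE_fin fE (gp F a i.+1 v) (fun j => z + (j + 1 + i%:Z)) (f := id) erefl.
  move=> /(@fin_shift int V (- 1 - i%:Z)) hf; apply: (fin_sub hf) => j /=.
  rewrite /gp (linZ (Epzl _ _ _)) -fh_Epz_com //.
  have ez (k : int) : z + (k + (- 1 - i%:Z) + 1 + i%:Z) = z + k by lia.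
  have ez' (k : int) : k + (- 1 - i%:Z) = k - 1 - i%:Z by lia.
  by rewrite ez ez'.
have -> : z%:~R *: EE F a v z = fsum (fun j : int => \sum_(i < M) gm F a i.+1 (Emz F a (z + j - 1 - (i : nat)%:Z) (Epz F a j v))
    - \sum_(i < M) Emz F a (z + j) (gp F a i.+1 (Epz F a (j - 1 - (i : nat)%:Z) v))).
  rewrite /EE fsumZ; last exact: (EE_fin fE v _ (f := id)).
  apply: eq_fsum => j; rewrite -recm -(lin_sum (Emzl _ _ _)) -recp (linZ (Emzl _ _ _)) -scalerBl.
  by congr (_ *: _); rewrite -rmorphB /=; congr (_%:~R); lia.
rewrite fsumB; [|by apply: fin_sum => i _; exact: fin1|by apply: fin_sum => i _; exact: fin2].
rewrite !fsum_sum => [|i _|i _]; [|exact: fin2|exact: fin1].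
rewrite scalerDr -sumrN !scaler_sumr; congr (_ + _); apply: eq_bigr => i _.
  rewrite /EE -(lin_fsum (gml _ _ _)); last exact: (EE_fin fE v _ (f := id)).
  congr (gm F a _ _); apply: eq_fsum => j; congr (Emz F a _ _); lia.
rewrite /EE (fsum_shift i.+1%:Z) fsumN; last exact: (fin_shift i.+1%:Z (fin2 i)).
rewrite fsumZ; last exact: (EE_fin fE _ _ (f := id)).
apply: eq_fsum => j; rewrite /gp (linZ (Emzl _ _ _)) scaleNr opprK fh_Epz_com //.
by congr (_ *: Emz F a _ (Epz F a _ _)); lia.
Qed.

Section HeisX.
Variables (b a : h) (v : V) (q : bool).
Hypothesis ha : in_lattice L a.

(** [heisN] is the normally ordered product, with creation modes on the left and the zero mode on
    the right; [heisK] is the contraction, made of the commutators that this reordering costs. *)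
Definition heisK : C -> C -> V := fun x y => zext (fun j : int => if 0 < j then 0
  else hpair G (- j) b a *: X a (- y - 1 - j%:~R / p%:R) v) (p%:R * (x + 1)).
Definition heisN : C -> C -> V := fun x y => zext (fun j : int => if 0 < j then fh F (- j) b (X a (- y - 1) v)
  else X a (- y - 1) (fh F (- j) b v)) (p%:R * (x + 1)).

Lemma heis_X_split x y : prod2 (heis b) (X a) v x y = heisN x y + heisK x y.
Proof.
rewrite /prod2 heis_zext /heisN /heisK /zext; case: ifP => _; last by rewrite addr0.
set j := toint _; case: ifP => j0; first by rewrite addr0.
have := fh_X (- j) b (- y - 1) v ha; move/eqP; rewrite subr_eq [_ *: _ + _]addrC => /eqP ->; congr (_ + _ *: X a _ v).
by rewrite rmorphN /= mulNr.
Qed.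

Lemma heisN_reg2 : reg2 heisN.
Proof.
have [_ _ hlb] := isfld_X ha; have [ds hds] := hlb v; have [N hN] := fh_restricted F v b.
have [ds' hds'] : exists ds', forall i : nat, (i <= absz N)%N -> forall y, X a (- y - 1) (fh F i%:Z b v) <> 0 -> lbd ds' y.
  elim: (absz N) => [|K [d1 h1]].
    by have [d2 h2] := hlb (fh F 0 b v); exists d2 => i; rewrite leqn0 => /eqP ->.
  have [d2 h2] := hlb (fh F K.+1%:Z b v); exists (d1 ++ d2) => i; rewrite leq_eqVlt => /orP[/eqP->|iK] y hy.
    by apply: lbd_catr; exact: h2.
  by apply: lbd_catl; apply: h1 hy.
exists ([seq - 1 + ((r : nat)%:R - (absz N)%:R) / p%:R | r <- iota 0 p] ++ (ds ++ ds')) => x y.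
move=> /zextP[j hj hj'].
have hx : x = - 1 + j%:~R / p%:R by rewrite -hj; field; exact: p_neq0.
have hy : - (absz N)%:Z <= j /\ lbd (ds ++ ds') y.
  move: hj'; case: ifP => j0 hj'.
    split; first by lia.
    by apply: lbd_catl; apply: hds => e; apply: hj'; rewrite e (lin0 (fh_lin _ _ _)).
  have jN : - j < N by rewrite ltNge; apply/negP => hjN; apply: hj'; rewrite hN // (lin0 (X_linear _ ha)).
  split; first by lia.
  apply: lbd_catr; apply: (hds' (absz j)); first by lia.
  by have -> : (absz j)%:Z = - j by lia.
case: hy => hjN hy; split; last exact: lbd_catr.
by rewrite hx; apply: lbd_catl; apply: lbd_frac.
Qed.

(** The contraction is periodic in the mode with period p, so multiplication by w - z telescopes it
    to p terms, one for each class of Z/p modulo Z. *)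
Lemma md_heisK x y : md heisK x y = zext (fun i : int => if (- p%:Z < i) && (i <= 0)
   then hpair G (- i) b a *: X a (- y - 1 - i%:~R / p%:R) v else 0) (p%:R * x).
Proof.
have hp := p_neq0 G; have hp0 := gord_gt0 G.
rewrite /md /heisK subrK mulrDr mulr1 /zext.
case: asboolP => [[i ->]|hn]; last first.
  rewrite asboolF ?subrr // => hi; apply: hn; rewrite -[p%:R * x](addrK (p%:R)); apply: is_intB => //.
  exact: is_int_nat.
have -> : i%:~R + p%:R = (i + p%:Z)%:~R :> C by rewrite rmorphD /= -pmulrn.
rewrite asboolT; last exact: is_int_int.
rewrite !toint_int ltNge; case: (leP i 0) => /= i0; last by rewrite andbF ifT ?subrr //; lia.
have -> : hpair G (- (i + p%:Z)) b a = hpair G (- i) b a by apply: hpair_eq; rewrite opprD addrAC subrr add0r; apply/dvdzP; exists (-1); rewrite mulN1r.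
have -> : - (y - 1) - 1 - (i + p%:Z)%:~R / p%:R = - y - 1 - i%:~R / p%:R :> C.
  by rewrite rmorphD /= -pmulrn; field.
rewrite andbT; case: (ltP 0 (i + p%:Z)) => h1; [rewrite ifT ?subr0 //|rewrite ifF ?subrr //]; lia.
Qed.

Lemma heisK_dom x y : md heisK x y <> 0 -> exists2 r, (r < p)%N & x = - (r%:R / p%:R).
Proof.
rewrite md_heisK => /zextP[i hi]; case: ifP => // /andP[i1 i2] _; exists (absz i); first by lia.
have -> : (absz i)%:R = - i%:~R :> C by rewrite -rmorphN /= pmulrn; congr (_%:~R); lia.
by rewrite -hi; field; exact: p_neq0.
Qed.

Lemma fs2_heisK : fs2 (md heisK).
Proof.
move=> u; exists [seq - ((r : nat)%:R / p%:R) | r <- iota 0 p] => x /heisK_dom[r hr ->].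
by apply/mapP; exists r; rewrite // mem_iota.
Qed.

Lemma tau_heisK k u : tau k (md heisK) u = (\sum_(r < p) gbin (- ((r : nat)%:R / p%:R)) k * hpair G (r : nat)%:Z b a) *:
  X a (- (u + k%:R) - 1) v.
Proof.
have hp := p_neq0 G.
rewrite /tau (@fsum_sub _ _ _ (fun r : nat => - (r%:R / p%:R))); first last.
- by move=> x hx; have [|r _ ->] := @heisK_dom x (u + k%:R - x); [move=> e; apply: hx; rewrite e scaler0|exists r].
- by move=> r r' /oppr_inj /(mulIf (invr_neq0 hp)) /eqP; rewrite eqr_nat => /eqP.
have e r : p%:R * (- (r%:R / p%:R)) = (- r%:Z)%:~R :> C by rewrite rmorphN /= -pmulrn; field.
rewrite (@fsum_nat _ p) => [|r hr]; last first.
  by rewrite md_heisK e zext_int ifF ?scaler0 //; apply/negP; lia.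
rewrite scaler_suml; apply: eq_bigr => r _; rewrite md_heisK e zext_int ifT; last by have := ltn_ord r; lia.
rewrite scalerA opprK; congr (_ *: X a _ v).
by rewrite rmorphN /= -pmulrn; ring.
Qed.

Lemma op_prod_heis_X n u : op_prod false q n (heis b) (X a) (- u - 1) v =
  tauz (- n - 1) heisN u + (if - n is Posz k then (\sum_(r < p) gbin (- ((r : nat)%:R / p%:R)) k * hpair G (r : nat)%:Z b a) *:
  X a (- (u + k%:R) - 1) v else 0).
Proof.
rewrite (op_prod_tau _ (isfld_heis b) (isfld_X ha) (heis_X_local b q ha)) /=.
have -> : - (- u - 1) - 1 = u :> C by ring.
have fN := reg2_fs2 heisN_reg2.
rewrite (eq_tauz _ (B := fun x y => md heisN x y + md heisK x y)); last first.
  by move=> x y; rewrite /md !heis_X_split opprD addrACA.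
rewrite (tauzD _ _ (fs2_md fN) fs2_heisK).
rewrite tauz_md // (_ : 1%:Z - 1 - n = - n); last by lia.
congr (_ + _); rewrite /tauz; case: (- n) => // k; exact: tau_heisK.
Qed.

End HeisX.

Lemma heis_X_ge1 b a q n : in_lattice L a -> 1 <= n -> op_prod false q n (heis b) (X a) = 0.
Proof. by move=> ha; apply: op_prod_trunc (isfld_heis b) (isfld_X ha) (heis_X_local b q ha). Qed.

Lemma heis_X_0 b a q : in_lattice L a -> op_prod false q 0 (heis b) (X a) = bf b a *: X a.
Proof.
move=> ha; apply/funext => n; apply/funext => v; rewrite [n]modeN op_prod_heis_X //= add0r addr0.
rewrite -(hpair_sum G); congr (_ *: _); apply: eq_bigr => r _.
by rewrite gbin0 mul1r.
Qed.

(** The reflection r -> p - r fixes the summands [hpair r a a] and averages r/p to 1/2. The exponent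
    -(a'|a')/2 of the vertex operator is thus the contraction of a with itself, as [ddz_X]
    requires. *)
Lemma sum_qf a : \sum_(r < p) ((r : nat)%:R / p%:R) * hpair G (r : nat)%:Z a a = qf G a.
Proof.
have hp := p_neq0 G; have p0 := gord_gt0 G; have two0 : (2 : C) != 0 by rewrite pnatr_eq0.
have hq : bf (gprime G a) (gprime G a) = \sum_(1 <= r < p) hpair G r%:Z a a.
  have h00 x : bf (gpart0 G x) (x - gpart0 G x) = 0.
    rewrite bfDr bfNr; have := hpair0 G x x; rewrite /hpair => <-.
    by rewrite /gpart0 subrr.
  rewrite /gprime bfDl bfNl h00 subr0 bfDr bfNr -(hpair_sum G) [bf a _]bfC.
  rewrite -/(hproj G 0 a) -/(hpair G 0 a a) -(big_mkord xpredT (fun r => hpair G r%:Z a a)) big_ltn //.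
  by rewrite addrAC subrr add0r.
rewrite -(big_mkord xpredT (fun r => (r%:R / p%:R) * hpair G r%:Z a a)) big_ltn // mul0r mul0r add0r.
apply: (mulIf two0); rewrite /qf hq divfK // mulr_natr mulr2n.
rewrite {2}big_nat_rev /= -big_split /= big_nat [RHS]big_nat; apply: eq_bigr => r /andP[r1 r2].
have -> : hpair G (1 + p - r.+1)%N%:Z a a = hpair G r%:Z a a.
  by rewrite hpairC; apply: hpair_eq; rewrite (_ : _ - _ = - 1 * p%:Z) ?dvdz_mull //; lia.
have -> : (1 + p - r.+1)%N%:R = p%:R - r%:R :> C by rewrite -natrB; [congr (_%:R); lia|lia].
by field.
Qed.

(** The derivative of the exponentials is [EE_rec], that of z^(a(0)) is the zero mode, and that of
    z^(-(a'|a')/2) matches the contraction in the (-1)-product by [sum_qf]. *)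
Lemma ddz_X a q : in_lattice L a -> ddz (X a) = op_prod false q (-1) (heis a) (X a).
Proof.
move=> ha; have hp := p_neq0 G; have Xf := isfld_X ha.
apply/funext => n; apply/funext => v; rewrite [n]modeN; move: (- n - 1) => u {n}.
have loc := heis_X_local a q ha.
have hO : linear (op_prod false q (-1) (heis a) (X a) (- u - 1)).
  by have [] := isfld_op_prod (-1) (isfld_heis a) Xf loc.
have hDl : linear (ddz (X a) (- u - 1)) by have [] := isfld_ddz Xf.
move: v; apply: (weight_ind Hdiag); first by rewrite (lin0 hO) (lin0 hDl).
  by move=> x y hx hy; rewrite (linD hO) (linD hDl) hx hy.
move=> xi v hv; rewrite op_prod_heis_X // (_ : - (-1) = 1) // (_ : 1 - 1 = 0%:Z) //=.
rewrite (eq_bigr (fun r : 'I_p => - (((r : nat)%:R / p%:R) * hpair G (r : nat)%:Z a a))); last first.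
  by move=> r _; rewrite gbin1 mulNr.
rewrite sumrN sum_qf scaleNr; apply/eqP; rewrite eq_sym subr_eq; apply/eqP.
rewrite /ddz (_ : - u - 1 - 1 = - (u + 1) - 1); last by ring.
rewrite -scalerDl; set y := u + 1; have -> : - (- u - 1) + qf G a = y + qf G a by rewrite /y; ring.
rewrite /tau (eq_fsum (g := fun x => heisN a a v x (u - x))); last by move=> x; rewrite gbin0 scale1r addr0.
rewrite (@fsum_sub _ _ _ (fun j : int => - 1 + j%:~R / p%:R)); first last.
- by move=> x /zextP[j hj _]; exists j; rewrite -hj; field.
- by move=> j j' /addrI /(mulIf (invr_neq0 hp)) /intr_inj.
rewrite (X_weight _ ha hv); set Y := p%:R * _.
have eN j : heisN a a v (- 1 + j%:~R / p%:R) (u - (- 1 + j%:~R / p%:R)) =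
    if 0 < j then fh F (- j) a (fe F a (zext (EE F a v) (Y - j%:~R)))
    else fe F a (zext (EE F a (fh F (- j) a v)) (Y - j%:~R)).
  rewrite /heisN (_ : p%:R * (- 1 + j%:~R / p%:R + 1) = j%:~R); last by field.
  rewrite zext_int (X_weight _ ha hv) (X_weight _ ha (ws_fh (- j) a hv)).
  suff -> : p%:R * (u - (- 1 + j%:~R / p%:R) - weight_at xi a + qf G a) = Y - j%:~R by [].
  by rewrite /Y /y; field.
rewrite (eq_fsum eN) {eN}.
case: (pselect (is_int Y)) => [[z hz]|hY]; last first.
  have hY' j : ~ is_int (Y - j%:~R).
    by move=> hi; apply: hY; rewrite -[Y](subrK (j%:~R)); apply: is_intD => //; exact: is_int_int.
  rewrite fsum0 => [|j]; first by rewrite /zext asboolF // (lin0 (fe_lin _ ha)) scaler0.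
  by rewrite /zext !asboolF // !(lin0 (fe_lin _ ha)) (lin0 (fh_lin _ _ _)) if_same.
have -> : y + qf G a = weight_at xi a + z%:~R / p%:R by rewrite -hz /Y; field.
rewrite hz zext_int scalerDl.
have [M0 hM0] := EE_rec v ha z; have [N hN] := EE_lb (fun w => Efin w ha) v.
have [N' hN'] := fh_restricted F v a.
pose M := (M0 + N + absz z + absz N')%N.
have b1 (i : nat) : (M <= i)%N -> EE F a v (z - i.+1%:Z) = 0.
  move=> hi; apply: contrapT => /hN; rewrite /M in hi; lia.
have b2 (i : nat) : (M <= i)%N -> fh F i.+1%:Z a v = 0 by move=> hi; apply: hN'; rewrite /M in hi; lia.
have M0M : (M0 <= M)%N by rewrite /M; lia.
have E0 := EE_0 (fun w => Efin w ha).
rewrite fsum_int; last first.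
  apply: (@fin_int _ (- 1 - M%:Z) M%:Z) => j; rewrite -rmorphB /= !zext_int => hj; split; rewrite leNgt; apply/negP => hj2; apply: hj.
    rewrite ifF; last by lia.
    rewrite (_ : - j = (absz (- j - 1)%R).+1%:Z); last by lia.
    by rewrite b2 ?E0 ?(lin0 (fe_lin _ ha)) //; lia.
  rewrite ifT; last by lia.
  rewrite (_ : j = (absz (j - 1)%R).+1%:Z); last by lia.
  by rewrite b1 ?(lin0 (fe_lin _ ha)) ?(lin0 (fh_lin _ _ _)) //; lia.
rewrite fsum_natS; last first.
  apply: (@fin_nat _ M.+1) => -[//|i] hi; rewrite -rmorphB /= zext_int b1 //.
  by rewrite (lin0 (fe_lin _ ha)) (lin0 (fh_lin _ _ _)).
rewrite (@fsum_nat _ M) => [|i hi]; last first.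
  by rewrite -rmorphB /= zext_int b1 // (lin0 (fe_lin _ ha)) (lin0 (fh_lin _ _ _)).
rewrite (@fsum_nat _ M) => [|i hi]; last first.
  rewrite ifF; last by lia.
  by rewrite (_ : - (- 1 - i%:Z) = i.+1%:Z) ?b2 //; [rewrite -rmorphB /= zext_int E0 (lin0 (fe_lin _ ha))|lia].
rewrite /= oppr0 subr0 zext_int -addrA; congr (_ + _).
  have -> : fh F 0 a v = weight_at xi a *: v by exact: wsE.
  by rewrite (linZ (EE_lin (fun w => Efin w ha) _)) (linZ (fe_lin _ ha)).
rewrite mulrC -scalerA -(linZ (fe_lin _ ha)) (hM0 M M0M) (linZ (fe_lin _ ha)) scalerA mulVf // scale1r.
rewrite (linD (fe_lin _ ha)) !(lin_sum (fe_lin _ ha)); congr (_ + _); apply: eq_bigr => i _.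
  by rewrite -rmorphB /= zext_int fh_fe_com.
rewrite ifF; last by lia.
rewrite (_ : - (- 1 - (i : nat)%:Z) = i.+1%:Z); last by lia.
by rewrite -rmorphB /= zext_int; congr (fe F a (EE F a _ _)); lia.
Qed.

End FockFields.

Definition zseq (lo hi : int) : seq int := [seq lo + (i : nat)%:Z | i <- iota 0 (absz (hi - lo)%R).+1].

Lemma mem_zseq lo hi i : lo <= i -> i <= hi -> i \in zseq lo hi.
Proof.
by move=> h1 h2; apply/mapP; exists (absz (i - lo)%R); [rewrite mem_iota; lia|lia].
Qed.

Lemma fsum_exchZ (U : nmodType) (lo hi lo' hi' : int) (f : int -> int -> U) :
  (forall x y, f x y <> 0 -> [/\ lo <= x, x <= hi, lo' <= y & y <= hi']) ->
  fsum (fun x => fsum (f x)) = fsum (fun y => fsum (f^~ y)).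
Proof.
move=> hf; apply: (@fsum_exch _ _ _ (zseq lo hi) (zseq lo' hi')) => x y /hf[*].
by split; apply: mem_zseq.
Qed.

(** * Scalar exponentials and order of vanishing *)

Section ScalarExponentials.
Variable R : realType.
Local Notation C := R[i].

(* [c] is the coefficient sequence of [exp (- \sum_(i > 0) q i t^i / i)]. *)
Definition sexp (q : nat -> C) (c : int -> C) : Prop :=
  expz (U := (C^o : lmodType C)) (fun i v => - q i * v) (fun j v => c j * v).

Lemma mull_lin (c : C) : linear (fun v : C^o => c * v : C^o).
Proof. by move=> k x y; rewrite mulrDr /GRing.scale /= mulrCA. Qed.

Lemma sexp_exists q : exists c, sexp q c.
Proof.
pose f (i : nat) (v : C^o) : C^o := - (q i / i%:R) * v.
have fl i : linear (f i) by exact: mull_lin.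
have f0 v : f 0%N v = 0 by rewrite /f invr0 mulr0 oppr0 mul0r.
have fC i j v : f i (f j v) = f j (f i v) by rewrite /f mulrCA.
have hE := expz_ps_exp fl f0 fC.
have gl i : linear (fun v : C^o => (i%:R : C) *: f i v) by apply: linZl.
exists (fun j => ps_expz f j (1 : C^o)).
have eE j (v : C^o) : ps_expz f j v = ps_expz f j (1 : C^o) * v.
  have := linZ (expz_lin gl hE j) v (1 : C^o); rewrite /GRing.scale /= mulr1 => ->.
  by rewrite mulrC.
have hE' : expz (U := (C^o : lmodType C)) (fun i v => - q i * v) (ps_expz f).
  apply: expz_ext hE _ => i v i0; rewrite /f /GRing.scale /= mulrA; congr (_ * _).
  have hi : (i%:R : C) != 0 by rewrite pnatr_eq0 -lt0n.
  by field.
case: hE' => h1 h2 h3; split => [v|j v j0|M j v jM].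
- by rewrite -eE.
- by rewrite -eE h2.
apply: etrans (etrans (h3 M j v jM) _); first by rewrite [in RHS]eE.
by apply: eq_bigr => i _; rewrite [in LHS]eE.
Qed.

Section Props.
Variables (q : nat -> C) (c : int -> C).
Hypothesis hc : sexp q c.

Lemma sexp0 : c 0 = 1.
Proof. by case: hc => h _ _; rewrite -[c 0]mulr1 h. Qed.

Lemma sexp_lt0 j : j < 0 -> c j = 0.
Proof. by case: hc => _ h _ j0; rewrite -[c j]mulr1 h. Qed.

Lemma sexp_rec (M : nat) (j : int) : j <= M%:Z ->
  j%:~R * c j = - \sum_(i < M) q i.+1 * c (j - 1 - (i : nat)%:Z).
Proof.
case: hc => _ _ h jM; have := h M j (1 : C^o) jM; rewrite /GRing.scale /= mulr1 => ->.
by rewrite -sumrN; apply: eq_bigr => i _; rewrite mulr1 mulNr.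
Qed.

End Props.

Lemma sexp_ext q q' c : sexp q c -> (forall i, (0 < i)%N -> q i = q' i) -> sexp q' c.
Proof. by move=> h e; apply: expz_ext h _ => i v i0; rewrite e. Qed.

Lemma sexp_conv q q' c c' c'' : sexp q c -> sexp q' c' -> sexp (fun i => q i + q' i) c'' ->
  forall n, c'' n = fsum (fun i : int => c i * c' (n - i)).
Proof.
move=> h h' h'' n.
have gl (q1 : nat -> C) i : linear (fun v : C^o => - q1 i * v : C^o) by exact: mull_lin.
have e := @expz_conv _ (C^o : lmodType C) _ _ _ _ (gl q) (gl q') h h' _ _ (1 : C^o) _ n.
have := e _ (fun j v => c'' j * v); rewrite mulr1 => -> //.
- by apply: eq_fsum => i; rewrite mulr1.
- by move=> i j v _ _; rewrite mulrCA.
- by apply: expz_ext h'' _ => i v _; rewrite opprD mulrDl.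
Qed.

Definition cz (P : {poly C}) (j : int) : C := if j is Posz n then P`_n else 0.

Lemma cz_lt0 P j : j < 0 -> cz P j = 0. Proof. by case: j. Qed.

Lemma czM P Q n : cz (P * Q) n = fsum (fun i : int => cz P i * cz Q (n - i)).
Proof.
case: n => n; last first.
  apply: esym; apply: fsum0 => -[i|i]; last by rewrite mul0r.
  by rewrite (cz_lt0 Q) ?mulr0 //; lia.
rewrite (@fsum_sub _ _ _ Posz); first last.
- by move=> [j|j]; [exists j|rewrite mul0r].
- by move=> i j [].
rewrite (@fsum_nat _ n.+1) => [|i hi]; last by rewrite (cz_lt0 Q) ?mulr0 //; lia.
rewrite /= coefM; apply: eq_bigr => i _; rewrite -[Posz n - _]/(n%:Z - i%:Z).
by rewrite subzn; [|have := ltn_ord i; lia].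
Qed.

Lemma sexp_polyM q q' P Q : sexp q (cz P) -> sexp q' (cz Q) -> sexp (fun i => q i + q' i) (cz (P * Q)).
Proof.
move=> h h'; have [c hc] := sexp_exists (fun i => q i + q' i).
have -> : cz (P * Q) = c by apply/funext => n; rewrite (sexp_conv h h' hc) czM.
exact: hc.
Qed.

Lemma sexp_poly1 : sexp (fun=> 0) (cz 1).
Proof.
split => [v|j v j0|M j v jM]; first by rewrite /= coef1 mul1r.
  by rewrite cz_lt0 // mul0r.
rewrite big1 => [|i _]; last by rewrite oppr0 mul0r.
case: j jM => [[|j]|j] _; rewrite /= ?scale0r // /cz ?coef1 mul0r scaler0 //.
Qed.

(** The expansion log(1 - w t) = - sum w^i t^i / i. In the recursion at most two terms are nonzero,
    and from degree 2 on they cancel. *)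
Lemma sexp_lin (w : C) : sexp (fun i => w ^+ i) (cz (1 - w *: 'X)).
Proof.
have cE (j : nat) : (1 - w *: 'X : {poly C})`_j = (j == 0%N)%:R - w * (j == 1%N)%:R.
  by rewrite coefB coef1 coefZ coefX.
split => [v|j v j0|M j v jM]; first by rewrite /= cE /= mulr0 subr0 mul1r.
  by rewrite cz_lt0 // mul0r.
case: j jM => [[|j]|j] jM.
- by rewrite scale0r big1 // => i _; rewrite cz_lt0 ?mul0r ?mulr0 //; lia.
- case: M jM => [//|M] jM; rewrite /GRing.scale /=.
  have eM : forall K, (j < K)%N -> \sum_(i < K) - w ^+ (i : nat).+1 * (cz (1 - w *: 'X) (Posz j.+1 - 1 - (i : nat)%:Z) * v)
      = \sum_(i < j.+1) - w ^+ (i : nat).+1 * (cz (1 - w *: 'X) ((j - i)%N%:Z) * v).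
    move=> K jK; rewrite -(big_mkord xpredT (fun i => - w ^+ i.+1 * (cz (1 - w *: 'X) (Posz j.+1 - 1 - i%:Z) * v))).
    rewrite (big_cat_nat (n := j.+1)) //= [X in _ + X]big1_seq ?addr0; last first.
      by move=> i /andP[_]; rewrite mem_index_iota => /andP[i1 i2]; rewrite cz_lt0 ?mul0r ?mulr0 //; lia.
    rewrite big_mkord; apply: eq_bigr => i _; rewrite (_ : Posz j.+1 - 1 - (i : nat)%:Z = (j - i)%N%:Z) //.
    by have := ltn_ord i; lia.
  rewrite eM //= cE /=; case: j {jM eM} => [|j].
    by rewrite big_ord1 /= cE /= expr1 sub0r mulr1 mul1r mulr0 subr0 mul1r.
  rewrite !big_ord_recr /= big1 => [|i _].
    by rewrite !cE subSnn subnn /= !exprS; ring.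
  have hi := ltn_ord i; rewrite cE.
  have -> : (j.+1 - i)%N == 0%N = false by lia.
  have -> : (j.+1 - i)%N == 1%N = false by lia.
  by rewrite mulr0 subrr mul0r mulr0.
- rewrite mul0r scaler0 big1 // => i _; rewrite cz_lt0 ?mul0r ?mulr0 //; lia.
Qed.

Lemma sexp_polyX q P n : sexp q (cz P) -> sexp (fun i => n%:R * q i) (cz (P ^+ n)).
Proof.
move=> h; elim: n => [|n IH]; first by rewrite expr0; apply: sexp_ext sexp_poly1 _ => i _; rewrite mul0r.
by rewrite exprS; apply: sexp_ext (sexp_polyM h IH) _ => i _; rewrite -[n.+1]add1n natrD mulrDl mul1r.
Qed.

Lemma sexp_prod (K : nat) (w : nat -> C) (e : nat -> nat) :
  sexp (fun i => \sum_(s < K) w s ^+ i * (e s)%:R) (cz (\prod_(s < K) (1 - w s *: 'X) ^+ e s)).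
Proof.
elim: K => [|K IH].
  by rewrite big_ord0; apply: sexp_ext sexp_poly1 _ => i _; rewrite big_ord0.
rewrite big_ord_recr /=; apply: sexp_ext (sexp_polyM IH (sexp_polyX (e K) (sexp_lin (w K)))) _ => i _.
by rewrite big_ord_recr /= [X in _ + X]mulrC.
Qed.

Section Lead.
Variable y : C.

(* The coefficient of [T^e] in [P((1 + T)^y)], which at [y = 1/p] computes divided
   derivatives in [w] of functions of [(w/z)^(1/p)] at [w = z]. *)
Definition sgm (P : {poly C}) (e : nat) : C := fsum (fun k : nat => P`_k * gbin (k%:R * y) e).

Lemma sgm_fin (P : {poly C}) (f : nat -> C) : fin (fun k : nat => P`_k * f k).
Proof. by apply: (@fin_nat _ (size P)) => i hi; rewrite nth_default // mul0r. Qed.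

Lemma sgmX P e : sgm ('X * P) e = \sum_(i < e.+1) gbin y i * sgm P (e - i).
Proof.
rewrite /sgm fsum_natS; last exact: sgm_fin.
rewrite coefXM /= mul0r add0r (eq_fsum (g := fun k => \sum_(i < e.+1) gbin y i * (P`_k * gbin (k%:R * y) (e - i)))).
  rewrite fsum_sum => [|i _]; last first.
    by apply: (@fin_nat _ (size P)) => k hk; rewrite nth_default // mul0r mulr0.
  by apply: eq_bigr => i _; rewrite -(fsumZ (U := C^o)) //; exact: sgm_fin.
move=> k; rewrite coefXM /= -[k.+1]add1n natrD mulrDl mul1r gbin_add mulr_sumr.
by apply: eq_bigr => i _; rewrite mulrCA.
Qed.

Lemma sgmB P (w : C) e : sgm ((1 - w *: 'X) * P) e = sgm P e - w * sgm ('X * P) e.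
Proof.
have e2 := fsumZ (U := C^o) w (sgm_fin ('X * P) (fun k => gbin (k%:R * y) e)).
rewrite /sgm [w * _]e2 -fsumB; first last.
- by apply: (finZ (U := C^o) (fun=> w)); exact: sgm_fin.
- exact: sgm_fin.
by apply: eq_fsum => k; rewrite mulrBl mul1r coefB mulrBl -scalerAl coefZ -mulrA.
Qed.

(** P((1+T)^y) = kap T^M + higher terms. A factor 1 - w (1+T)^y contributes the constant 1 - w, and
    for w = 1 it contributes -y T; [leads_prod] collects these. *)
Definition leads (M : nat) (kap : C) P : Prop := (forall e, (e < M)%N -> sgm P e = 0) /\ sgm P M = kap.

Lemma leads1 : leads 0 1 1.
Proof.
split => //; rewrite /sgm (@fsum_nat _ 1) => [|i hi]; last by rewrite coef1 gtn_eqF // mul0r.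
by rewrite big_ord1 coef1 gbin0 mulr1.
Qed.

Lemma sgm_sum M kap P : leads M kap P ->
  (forall e, (e < M)%N -> sgm ('X * P) e = 0) /\ sgm ('X * P) M = kap.
Proof.
move=> [h0 h1]; split=> [e he|]; rewrite sgmX.
  by rewrite big1 // => i _; rewrite h0 ?mulr0 // (leq_ltn_trans (leq_subr _ _)).
rewrite big_ord_recl /= gbin0 mul1r subn0 h1 big1 ?addr0 // => i _.
by rewrite h0 ?mulr0 // /bump /=; have := ltn_ord i; lia.
Qed.

Lemma leadsM (w : C) M kap P : leads M kap P -> leads M ((1 - w) * kap) ((1 - w *: 'X) * P).
Proof.
move=> hP; have [h2 h3] := sgm_sum hP; case: hP => h0 h1; split=> [e he|]; rewrite sgmB.
  by rewrite h0 // h2 // mulr0 subrr.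
by rewrite h1 h3 mulrBl mul1r.
Qed.

Lemma leadsM1 M kap P : leads M kap P -> leads M.+1 (- y * kap) ((1 - 1 *: 'X) * P).
Proof.
move=> hP; have [h2 h3] := sgm_sum hP; case: hP => h0 h1; split=> [e he|]; rewrite sgmB mul1r.
  move: he; rewrite ltnS leq_eqVlt => /orP[/eqP ->|he]; first by rewrite h1 h3 subrr.
  by rewrite h0 // h2 // subrr.
rewrite sgmX big_ord_recl /= gbin0 mul1r subn0 big_ord_recl /= gbin1 subSS subn0 h1.
rewrite big1 ?addr0 => [|i _]; first by rewrite opprD addrA subrr add0r mulNr.
by rewrite h0 ?mulr0 // /bump /=; have := ltn_ord i; lia.
Qed.

Lemma leadsX (w : C) n M kap P : leads M kap P -> leads M ((1 - w) ^+ n * kap) ((1 - w *: 'X) ^+ n * P).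
Proof.
move=> hP; elim: n => [|n IH]; first by rewrite !expr0 !mul1r.
by rewrite !exprS -!mulrA; exact: leadsM.
Qed.

Lemma leadsX1 n M kap P : leads M kap P -> leads (n + M) ((- y) ^+ n * kap) ((1 - 1 *: 'X) ^+ n * P).
Proof.
move=> hP; elim: n => [|n IH]; first by rewrite !expr0 !mul1r.
by rewrite !exprS -!mulrA; exact: leadsM1.
Qed.

Lemma leads_prod (K : nat) (w : nat -> C) (e : nat -> nat) : w 0%N = 1 ->
  leads (e 0%N) ((- y) ^+ e 0%N * \prod_(1 <= s < K.+1) (1 - w s) ^+ e s)
    (\prod_(s < K.+1) (1 - w s *: 'X) ^+ e s).
Proof.
move=> w0; rewrite -(big_mkord xpredT (fun s => (1 - w s *: 'X) ^+ e s)) [X in leads _ _ X]big_ltn // w0.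
rewrite -[X in leads X]addn0; apply: leadsX1.
elim: K => [|K IH]; first by rewrite !big_geq //; exact: leads1.
by rewrite !(big_nat_recr K.+1) //= [X in leads _ X]mulrC [X in leads _ _ X]mulrC; exact: leadsX.
Qed.

End Lead.

Section HomogeneousAction.
Variable V : lmodType C.

(* Multiplication by the series [\sum_k c k w^(-k) z^k]. *)
Definition hact (c : int -> C) (A : int -> int -> V) : int -> int -> V :=
  fun i j => fsum (fun k : int => c k *: A (i + k) (j - k)).

Definition zbdr (A : int -> int -> V) := exists lo : int, forall i j, A i j <> 0 -> lo <= j.

Lemma hact_fin c A : (forall k, k < 0 -> c k = 0) -> zbdr A -> forall i j, fin (fun k : int => c k *: A (i + k) (j - k)).
Proof.
move=> c0 [lo hA] i j; apply: (@fin_int _ 0 (j - lo)) => k hk; split.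
  by rewrite leNgt; apply/negP => k0; apply: hk; rewrite c0 // scale0r.
have : lo <= j - k by apply: (hA (i + k)) => e; apply: hk; rewrite e scaler0.
lia.
Qed.

Lemma hact_bdr c A : (forall k, k < 0 -> c k = 0) -> zbdr A -> zbdr (hact c A).
Proof.
move=> c0 [lo hA]; exists lo => i j hij; rewrite leNgt; apply/negP => hj; apply: hij.
apply: fsum0 => k; have [k0|k0] := ltP k 0; first by rewrite c0 // scale0r.
have [->|/eqP/hA hk] := eqVneq (A (i + k) (j - k)) 0; first by rewrite scaler0.
by lia.
Qed.

Lemma fsum_scal (T : choiceType) (f : T -> C) (v : V) : fin f -> fsum f *: v = fsum (fun x => f x *: v).
Proof. by move=> hf; apply: (fsum_morph (g := fun c : C => c *: v)) => // [x y|]; rewrite ?scalerDl ?scale0r. Qed.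

Lemma hact_comp c c' c'' A : (forall k, k < 0 -> c k = 0) -> (forall k, k < 0 -> c' k = 0) -> zbdr A ->
  (forall n, c'' n = fsum (fun i : int => c i * c' (n - i))) ->
  forall i j, hact c (hact c' A) i j = hact c'' A i j.
Proof.
move=> c0 c0' hA hc i j; rewrite /hact.
rewrite (eq_fsum (g := fun k => fsum (fun n : int => (c k * c' (n - k)) *: A (i + n) (j - n)))); last first.
  move=> k; rewrite fsumZ; last exact: hact_fin.
  rewrite (fsum_shift (- k)); apply: eq_fsum => n; rewrite scalerA; congr (_ *: A _ _); lia.
case: hA => lo hA.
rewrite (@fsum_exchZ _ 0 (j - lo) 0 (j - lo)); last first.
  move=> k n hkn.
  have k0 : 0 <= k by rewrite leNgt; apply/negP => k0; apply: hkn; rewrite c0 // mul0r scale0r.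
  have nk : 0 <= n - k by rewrite leNgt; apply/negP => k1; apply: hkn; rewrite c0' // mulr0 scale0r.
  have hl : lo <= j - n by apply: (hA (i + n)) => e; apply: hkn; rewrite e scaler0.
  by split; lia.
apply: eq_fsum => n; rewrite hc fsum_scal //.
apply: (@fin_int _ 0 n) => k hk; split; rewrite leNgt; apply/negP => h; apply: hk.
  by rewrite c0 // mul0r.
by rewrite c0' ?mulr0 //; lia.
Qed.

End HomogeneousAction.
End ScalarExponentials.

(** * Locality of vertex operators *)

Section LocalityXX.
Variables (R : realType) (l : nat) (h : vectType R[i]) (L : lattice_data l h).
Variables (G : cyclic_grading L) (eps : h -> h -> R[i]) (V : lmodType R[i]).
Variable F : fock_space G eps V.
Hypotheses (Hdiag : h0_diagonalizable F) (Hdef : vertex_operators_defined F).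
Local Notation C := R[i].
Local Notation p := (gord G).
Local Notation bf := (bform L).
Local Notation X := (X_op F).

Section NormalOrder.
Variables (a b : h) (v : V).
Hypotheses (ha : in_lattice L a) (hb : in_lattice L b).

(* The normally ordered product [E_-(a,w) E_-(b,z) E_+(a,w) E_+(b,z)]. *)
Definition NO (i j : int) : V :=
  fsum (fun s : int => fsum (fun t : int => Emz F a (i + s) (Emz F b (j + t) (Epz F a s (Epz F b t v))))).

Lemma NO_box : exists N : nat, forall s t, Epz F a s (Epz F b t v) <> 0 ->
  [/\ 0 <= s, s <= N%:Z, 0 <= t & t <= N%:Z].
Proof.
have [Na hNa] := EE_bound (fun w => Efin Hdef w ha) v.
have [Nb hNb] := EE_bound (fun w => Efin Hdef w hb) v.
exists (Na + Nb)%N => s t hst; split.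
- by rewrite leNgt; apply/negP => h1; apply: hst; rewrite Epz_lt0.
- rewrite leNgt; apply/negP => h1; apply: hst; rewrite Epz_com hNa ?(lin0 (Epzl _ _ _)) //; lia.
- by rewrite leNgt; apply/negP => h1; apply: hst; rewrite (Epz_lt0 F b) // (lin0 (Epzl _ _ _)).
- rewrite leNgt; apply/negP => h1; apply: hst; rewrite hNb ?(lin0 (Epzl _ _ _)) //; lia.
Qed.

Lemma NO_term i j s t : Emz F a i (Emz F b j (Epz F a s (Epz F b t v))) <> 0 ->
  [/\ Epz F a s (Epz F b t v) <> 0, 0 <= i & 0 <= j].
Proof.
move=> hn; split.
- by move=> e; apply: hn; rewrite e !(lin0 (Emzl _ _ _)).
- by rewrite leNgt; apply/negP => h1; apply: hn; rewrite Emz_lt0.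
- by rewrite leNgt; apply/negP => h1; apply: hn; rewrite (Emz_lt0 F b) // (lin0 (Emzl _ _ _)).
Qed.

Lemma NO_bounds : exists N : nat, forall i j, NO i j <> 0 -> - N%:Z <= i /\ - N%:Z <= j.
Proof.
have [N hN] := NO_box; exists N => i j hij.
have [s [t hst]] : exists s t, Emz F a (i + s) (Emz F b (j + t) (Epz F a s (Epz F b t v))) <> 0.
  apply: contrapT => hno; apply: hij; apply: fsum0 => s; apply: fsum0 => t.
  by apply: contrapT => hst; apply: hno; exists s, t.
have [/hN[? ? ? ?] ? ?] := NO_term hst; split; lia.
Qed.

(** Moving E_+(a,w) past E_-(b,z) by [expz_kernel] produces [phi]. The rest interchanges sums whose
    supports are confined by [NO_box]. *)
Lemma EE_NO (q : nat -> C) (phi : int -> C) : sexp q phi ->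
  (forall m, (0 < m)%N -> q m = p%:R * hpair G m%:Z a b) ->
  forall i j, EE F a (EE F b v j) i = hact phi NO i j.
Proof.
move=> hphi hq i j; rewrite /EE.
have [N hN] := NO_box.
have ker s t w : Epz F a s (Emz F b t w) = fsum (fun k : int => phi k *: Emz F b (t - k) (Epz F a (s - k) w)).
  apply: (@expz_kernel _ _ (gm F b) _ _ q phi (gml F b) (expz_Emz F b) (Epzl F a)).
  - by move=> i' m w' m0; rewrite Epz_gm // hq.
  - exact: sexp0 hphi.
  - exact: sexp_lt0 hphi.
  - exact: sexp_rec hphi.
pose T s t k := phi k *: Emz F a (i + s) (Emz F b (j + t - k) (Epz F a (s - k) (Epz F b t v))).
have hT s t k : T s t k <> 0 -> [/\ 0 <= t, t <= N%:Z & [/\ 0 <= k, k <= j + N%:Z, 0 <= s & s <= j + N%:Z + N%:Z]].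
  rewrite /T => hst; have k0 : 0 <= k by rewrite leNgt; apply/negP => h1; apply: hst; rewrite (sexp_lt0 hphi) // scale0r.
  have /NO_term[/hN[? ? ? ?] ? ?] : Emz F a (i + s) (Emz F b (j + t - k) (Epz F a (s - k) (Epz F b t v))) <> 0.
    by move=> e; apply: hst; rewrite e scaler0.
  by split; [lia|lia|split; lia].
have eL s : Emz F a (i + s) (Epz F a s (fsum (fun t : int => Emz F b (j + t) (Epz F b t v)))) =
    fsum (fun k => fsum (fun t => T s t k)).
  have fb (f : V -> V) : f 0 = 0 -> fin (fun t : int => f (Emz F b (j + t) (Epz F b t v))).
    exact: (EE_fin (fun w => Efin Hdef w hb) v (fun t => j + t)).
  rewrite (lin_fsum (Epzl _ _ _)); last exact: (fb id).
  rewrite (lin_fsum (Emzl _ _ _)); last by apply: (fb (Epz F a s)); exact: (lin0 (Epzl _ _ _)).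
  rewrite (@fsum_exchZ _ 0 (j + N%:Z) 0 N%:Z) => [|k t /hT[? ? [*]]]; last by split.
  apply: eq_fsum => t; rewrite ker (lin_fsum (Emzl _ _ _)).
    by apply: eq_fsum => k; rewrite (linZ (Emzl _ _ _)).
  apply: (@fin_int _ 0 (j + t)) => k hk; split; rewrite leNgt; apply/negP => h1; apply: hk.
    by rewrite (sexp_lt0 hphi) // scale0r.
  by rewrite Emz_lt0 ?scaler0 //; lia.
rewrite (eq_fsum eL) (@fsum_exchZ _ 0 (j + N%:Z + N%:Z) 0 (j + N%:Z)); last first.
  move=> s k hsk; have [t ht] : exists t, T s t k <> 0.
    apply: contrapT => hno; apply: hsk; apply: fsum0 => t; apply: contrapT => h1.
    by apply: hno; exists t.
  by have [? ? [*]] := hT _ _ _ ht; split.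
rewrite /hact; apply: eq_fsum => k.
have fT s : fin (fun t => Emz F a (i + k + s) (Emz F b (j - k + t) (Epz F a s (Epz F b t v)))).
  apply: (@fin_int _ 0 N%:Z) => t /NO_term[/hN[*]]; by split.
rewrite /NO fsumZ; last first.
  apply: (@fin_int _ 0 N%:Z) => s hs.
  have [t ht] : exists t, Epz F a s (Epz F b t v) <> 0.
    apply: contrapT => hno; apply: hs; apply: fsum0 => t; apply: contrapT => h1.
    by have [h2 _ _] := NO_term h1; apply: hno; exists t.
  by have [*] := hN _ _ ht; split.
rewrite (fsum_shift k); apply: eq_fsum => s; rewrite fsumZ //; apply: eq_fsum => t.
by rewrite /T; congr (_ *: Emz F a _ (Emz F b _ (Epz F a _ _))); lia.
Qed.

(** At w = z the exponentials of a and b multiply to those of a + b, by [EmzD] and [EpzD]. *)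
Lemma NO_sum J : fsum (fun i : int => NO i (J - i)) = EE F (a + b) v J.
Proof.
have [N hN] := NO_box; rewrite /EE /NO.
pose T (i s t : int) := Emz F a i (Emz F b (J + s + t - i) (Epz F a s (Epz F b t v))).
have hT i s t : T i s t <> 0 -> [/\ 0 <= i, i <= J + N%:Z + N%:Z & [/\ 0 <= s, s <= N%:Z, 0 <= t & t <= N%:Z]].
  by move=> /NO_term[/hN[? ? ? ?] ? ?]; split; [lia|lia|split].
have hT2 s i : fsum (fun t => T i s t) <> 0 -> [/\ 0 <= s, s <= N%:Z, 0 <= i & i <= J + N%:Z + N%:Z].
  move=> hsi; have [t ht] : exists t, T i s t <> 0.
    apply: contrapT => hno; apply: hsi; apply: fsum0 => t; apply: contrapT => h1.
    by apply: hno; exists t.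
  by have [? ? [*]] := hT _ _ _ ht; split.
transitivity (fsum (fun s => fsum (fun t => fsum (fun i => T i s t)))).
  rewrite [LHS](@fsum_exchZ _ (- N%:Z) (J + N%:Z + N%:Z) 0 N%:Z); last first.
    move=> i s his; have [t ht] : exists t, T (i + s) s t <> 0.
      apply: contrapT => hno; apply: his; apply: fsum0 => t; apply: contrapT => h1.
      apply: hno; exists t; rewrite /T; by have -> : J + s + t - (i + s) = J - i + t by lia.
    by have [? ? [*]] := hT _ _ _ ht; split; lia.
  apply: eq_fsum => s; rewrite (fsum_shift (- s)).
  rewrite [LHS](@fsum_exchZ _ 0 (J + N%:Z + N%:Z) 0 N%:Z); last first.
    move=> i t; have -> : i - s + s = i by lia.
    have -> : J - (i - s) + t = J + s + t - i by lia.
    by move=> /hT[? ? [*]]; split.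
  apply: eq_fsum => t; apply: eq_fsum => i; rewrite /T.
  by congr (Emz F a _ (Emz F b _ _)); lia.
have eR r : Emz F (a + b) (J + r) (Epz F (a + b) r v) = fsum (fun s => fsum (fun i => T i s (r - s))).
  rewrite EmzD EpzD (@fsum_exchZ _ 0 N%:Z 0 (J + N%:Z + N%:Z)); last first.
    by move=> s i /hT[? ? [*]]; split.
  have fE : fin (fun s => Epz F a s (Epz F b (r - s) v)).
    by apply: (@fin_int _ 0 N%:Z) => s /hN[*]; split.
  apply: eq_fsum => i; rewrite (lin_fsum (Emzl _ _ _)) // (lin_fsum (Emzl _ _ _)); last first.
    by apply: (fin_sub fE) => s ->; rewrite (lin0 (Emzl _ _ _)).
  by apply: eq_fsum => s; rewrite /T; congr (Emz F a _ (Emz F b _ _)); lia.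
rewrite (eq_fsum eR) [RHS](@fsum_exchZ _ 0 (N%:Z + N%:Z) 0 N%:Z); last first.
  move=> r s hrs; have [i hi] : exists i, T i s (r - s) <> 0.
    apply: contrapT => hno; apply: hrs; apply: fsum0 => t; apply: contrapT => h1.
    by apply: hno; exists t.
  by have [? ? [*]] := hT _ _ _ hi; split; lia.
apply: eq_fsum => s; rewrite [RHS](fsum_shift s); apply: eq_fsum => r.
by rewrite addrK.
Qed.

End NormalOrder.

Lemma NO_sym a b v i j : in_lattice L a -> in_lattice L b -> NO a b v i j = NO b a v j i.
Proof.
move=> ha hb; have [N hN] := NO_box v ha hb.
rewrite /NO (@fsum_exchZ _ 0 N%:Z 0 N%:Z) => [|s t /NO_term[/hN //]].
by apply: eq_fsum => t; apply: eq_fsum => s; rewrite Emz_com Epz_com.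
Qed.

Section Lift.
Variables (alpha beta : C).

(** A series in w^(1/p) and z^(1/p) placed at the exponents alpha + i/p and beta + j/p, so that
    kernels in (z/w)^(1/p) can be treated with integer indices. *)
Definition lift2 (A : int -> int -> V) : C -> C -> V := fun x y =>
  zext (fun i => zext (A i) (p%:R * (y - beta))) (p%:R * (x - alpha)).

Lemma eq_lift2 A B x y : (forall i j, A i j = B i j) -> lift2 A x y = lift2 B x y.
Proof.
move=> e; rewrite /lift2 /zext; case: ifP => // _; case: ifP => // _; exact: e.
Qed.

Lemma zext_shift (f : int -> V) y : zext f (y - p%:R) = zext (fun i => f (i - p%:Z)) y.
Proof.
case: (pselect (is_int y)) => [[k ->]|hy].
  by rewrite -[p%:R]/(p%:Z%:~R) -rmorphB /= !zext_int.
rewrite /zext !asboolF //= => hi; apply: hy; rewrite -[y](subrK p%:R).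
by apply: is_intD => //; exact: is_int_nat.
Qed.

Lemma md_lift2 A x y : md (lift2 A) x y = lift2 (fun i j => A (i - p%:Z) j - A i (j - p%:Z)) x y.
Proof.
rewrite /md /lift2 [x - 1 - _]addrAC [y - 1 - _]addrAC !mulrBr !mulr1 !zext_shift.
set X1 := p%:R * x - _; set Y := p%:R * y - _.
case: (pselect (is_int X1)) => [[i ->]|hX]; last by rewrite /zext !asboolF // subrr.
by rewrite !zext_int zext_shift /zext; case: ifP => // _; rewrite subrr.
Qed.

Lemma cz_sub1X (j : int) : cz (1 - 'X^p : {poly C}) j = (j == 0)%:R - (j == p%:Z)%:R.
Proof.
case: j => [j|j]; last by rewrite /= subrr.
by rewrite /= coefB coef1 coefXn.
Qed.

Lemma hact_sub1X (A : int -> int -> V) i j : hact (cz (1 - 'X^p : {poly C})) A i j = A i j - A (i + p%:Z) (j - p%:Z).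
Proof.
have p0 := gord_gt0 G.
rewrite /hact (eq_fsum (g := fun k : int => (if k == 0 then A i j else 0) - (if k == p%:Z then A (i + p%:Z) (j - p%:Z) else 0))).
  rewrite fsumB; [|by exists [:: 0] => x; rewrite inE; case: ifP|by exists [:: p%:Z] => x; rewrite inE; case: ifP].
  by rewrite (@fsum1 _ _ 0) ?(@fsum1 _ _ p%:Z) ?eqxx // => x /eqP/negPf ->.
move=> k; rewrite cz_sub1X scalerBl; congr (_ - _); case: eqP => [->|_];
  by rewrite ?scale1r ?scale0r ?addr0 ?subr0.
Qed.

Lemma hact_polyM (P Q : {poly C}) (A : int -> int -> V) i j : zbdr A ->
  hact (cz P) (hact (cz Q) A) i j = hact (cz (P * Q)) A i j.
Proof.
move=> hA; apply: (@hact_comp R V (cz P) (cz Q) (cz (P * Q)) A) => //; try by move=> k k0; rewrite cz_lt0.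
exact: czM.
Qed.

(** With t = (z/w)^(1/p) one has w - z = w (1 - t^p): the N-th power shifts the index of w by pN and
    acts by (1 - X^p)^N. *)
Lemma iter_md_lift2 N A x y : zbdr A ->
  iter N (@md R V) (lift2 A) x y = lift2 (fun i j => hact (cz ((1 - 'X^p : {poly C}) ^+ N)) A (i - (p * N)%N%:Z) j) x y.
Proof.
move=> hA; elim: N x y => [|N IH] x y.
  apply: eq_lift2 => i j; rewrite muln0 subr0 expr0 /hact (@fsum1 _ _ 0).
    by rewrite /= coef1 scale1r addr0 subr0.
  by case=> [[|k]|k] // _; rewrite /= ?coef1 scale0r.
have -> : iter N.+1 (@md R V) (lift2 A) x y = md (iter N (@md R V) (lift2 A)) x y by [].
rewrite /md !IH -/(md (lift2 _) x y) md_lift2; apply: eq_lift2 => i j.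
have e := hact_polyM (1 - 'X^p) ((1 - 'X^p) ^+ N) (i - (p * N.+1)%N%:Z) j hA.
rewrite exprS -e hact_sub1X; rewrite mulnS PoszD.
have -> : i - p%:Z - (p * N)%N%:Z = i - (p%:Z + (p * N)%N%:Z) by rewrite opprD addrA.
by have -> : i - (p * N)%N%:Z = i - (p%:Z + (p * N)%N%:Z) + p%:Z by rewrite opprD addrA addrAC subrK.
Qed.

Lemma tau_lift2 d A u : tau d (lift2 A) u =
  zext (fun J : int => fsum (fun i : int => gbin (alpha + i%:~R / p%:R) d *: A i (J - i))) (p%:R * (u + d%:R - alpha - beta)).
Proof.
have hp := p_neq0 G.
rewrite /tau (@fsum_sub _ _ _ (fun i : int => alpha + i%:~R / p%:R)); first last.
- move=> x hx; have /zextP[i hi _] : lift2 A x (u + d%:R - x) <> 0 by move=> e; apply: hx; rewrite e scaler0.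
  by exists i; rewrite -hi; field.
- by move=> i j /addrI /(mulIf (invr_neq0 hp)) /intr_inj.
have e1 (i : int) : p%:R * (alpha + i%:~R / p%:R - alpha) = i%:~R :> C by field.
have e2 (i : int) : p%:R * (u + d%:R - (alpha + i%:~R / p%:R) - beta) = p%:R * (u + d%:R - alpha - beta) - i%:~R :> C by field.
rewrite (eq_fsum (g := fun i : int => gbin (alpha + i%:~R / p%:R) d *: zext (A i) (p%:R * (u + d%:R - alpha - beta) - i%:~R))); last first.
  by move=> i; rewrite /lift2 e1 zext_int e2.
set Y := p%:R * _; case: (pselect (is_int Y)) => [[J ->]|hY].
  by rewrite zext_int; apply: eq_fsum => i; rewrite -rmorphB /= zext_int.
rewrite fsum0 => [|i]; first by rewrite /zext asboolF.
rewrite /zext asboolF ?scaler0 // => hi; apply: hY; rewrite -[Y](subrK (i%:~R)).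
by apply: is_intD => //; exact: is_int_int.
Qed.

End Lift.
End LocalityXX.

(** * Signs and the reversal of kernels *)

Section SignedPowers.
Variable K : fieldType.

Lemma prod_oppX (w : K) (n : nat) (m : nat -> int) : w != 0 ->
  \prod_(s < n) (- w ^+ s) ^ m s = (-1) ^ (\sum_(s < n) m s) * w ^ (\sum_(s < n) (s : nat)%:Z * m s).
Proof.
move=> w0; have n10 : (-1 : K) != 0 by rewrite oppr_eq0 oner_eq0.
elim: n => [|n IH]; first by rewrite !big_ord0 !expr0z mulr1.
rewrite !big_ord_recr /= IH !expfzDr // -(mulN1r (w ^+ n)) expfzMl [w ^+ n]exprnP exprz_exp; ring.
Qed.

Lemma signz_odd (m : int) : (-1 : K) ^ m = (-1) ^+ odd (absz m).
Proof.
have n10 : (-1 : K) != 0 by rewrite oppr_eq0 oner_eq0.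
case: m => m; first by rewrite -exprnP signr_odd.
rewrite NegzE abszN -invr_expz -exprnP -[in LHS]signr_odd /=.
by case: (~~ _); rewrite ?expr0 ?expr1 ?invrN invr1.
Qed.

Lemma prod_expzD (n : nat) (f : nat -> K) (m : nat -> int) (N : nat) (e : nat -> nat) : (forall s, (s < n)%N -> f s != 0) ->
  (forall s, (s < n)%N -> (e s)%:Z = m s + N%:Z) ->
  \prod_(s < n) f s ^+ e s = (\prod_(s < n) f s ^ m s) * (\prod_(s < n) f s) ^+ N.
Proof.
elim: n => [|n IH] hf he; first by rewrite !big_ord0 expr1n mulr1.
rewrite !big_ord_recr /= IH; [|by move=> s hs; apply: hf; lia|by move=> s hs; apply: he; lia].
rewrite exprMn [f n ^+ e n]exprnP he // expfzDr ?hf // -exprnP; ring.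
Qed.

End SignedPowers.

Section Reversal.
Variable R : realType.
Local Notation C := R[i].

(* [t^D P(1/t) = c Q(t)]: this is how the exchange of [w] and [z] acts on kernels. *)
Definition rvs (D : int) (c : C) (P Q : {poly C}) : Prop := forall k : int, cz P (D - k) = c * cz Q k.

Lemma cz_fin (P : {poly C}) (f : int -> C) : fin (fun i : int => cz P i * f i).
Proof.
apply: (@fin_int _ 0 (size P)) => -[i|i] hi; split => //; rewrite ?leNgt; apply/negP => h; apply: hi; rewrite /= ?mul0r //.
by rewrite nth_default ?mul0r // ltnW.
Qed.

Lemma rvsM D D' c c' P Q P' Q' : rvs D c P Q -> rvs D' c' P' Q' -> rvs (D + D') (c * c') (P * P') (Q * Q').
Proof.
move=> h h' k; rewrite !czM (fsum_refl D).
rewrite [RHS](fsumZ (U := C^o)); last exact: cz_fin.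
apply: eq_fsum => i; rewrite h (_ : D + D' - k - (D - i) = D' - (k - i)) ?h'; last by lia.
by rewrite /GRing.scale /=; ring.
Qed.

Lemma rvs1 : rvs 0 1 1 1.
Proof. by move=> k; rewrite mul1r sub0r; case: k => [[|k]|k] //=; rewrite !coef1. Qed.

Lemma rvs_lin (w : C) : w != 0 -> rvs 1 (- w) (1 - w *: 'X) (1 - w^-1 *: 'X).
Proof.
move=> w0; have cE (u : C) (j : nat) : (1 - u *: 'X : {poly C})`_j = (j == 0%N)%:R - u * (j == 1%N)%:R.
  by rewrite coefB coef1 coefZ coefX.
case=> [[|[|k]]|k].
- by rewrite subr0 /= !cE /=; ring.
- by rewrite subrr /= !cE /= mulr0 subr0 mulr1 sub0r mulrN mulNr opprK mulfV.
- by rewrite (cz_lt0 (1 - w *: 'X)) /= ?cE /=; [ring|lia].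
- by rewrite NegzE opprK /= cE /=; ring.
Qed.

Lemma rvsX D c P Q n : rvs D c P Q -> rvs (n%:Z * D) (c ^+ n) (P ^+ n) (Q ^+ n).
Proof.
move=> h; elim: n => [|n IH]; first by rewrite mul0r !expr0; exact: rvs1.
by rewrite !exprS -[n.+1]add1n PoszD mulrDl mul1r; exact: rvsM.
Qed.

Lemma rvs_prod (n : nat) (w : nat -> C) (e : nat -> nat) : (forall s, w s != 0) ->
  rvs (\sum_(s < n) (e s)%:Z) (\prod_(s < n) (- w s) ^+ e s)
    (\prod_(s < n) (1 - w s *: 'X) ^+ e s) (\prod_(s < n) (1 - (w s)^-1 *: 'X) ^+ e s).
Proof.
move=> w0; elim: n => [|n IH]; first by rewrite !big_ord0; exact: rvs1.
rewrite !big_ord_recr /=; apply: rvsM => //.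
by rewrite -[(e n)%:Z]mulr1; apply: rvsX; exact: rvs_lin.
Qed.

Lemma sexp_uniq (q q' : nat -> C) c c' : sexp q c -> sexp q' c' -> (forall i, (0 < i)%N -> q i = q' i) -> c = c'.
Proof.
move=> h h' e; have h2 := sexp_ext h' (fun i i0 => esym (e i i0)); apply/funext => j.
have gl i : linear (fun v : C^o => - q i * v : C^o) by exact: mull_lin.
case: (h) => e0 e1 e2; case: (h2) => e0' e1' e2'.
rewrite -[c j]mulr1 -[c' j]mulr1.
apply: (@expz_uniq R (C^o : lmodType C) _ (fun j v => c j * v : C^o) (fun j v => c' j * v : C^o) (1 : C^o) (1 : C^o) gl).
- by move=> j'; exact: e1.
- by move=> j'; exact: e1'.
- by rewrite e0 e0'.
- by move=> M j'; exact: e2.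
- by move=> M j'; exact: e2'.
Qed.

End Reversal.

Section VertexLocality.
Variables (R : realType) (l : nat) (h : vectType R[i]) (L : lattice_data l h).
Variables (G : cyclic_grading L) (eps : h -> h -> R[i]) (V : lmodType R[i]).
Variable F : fock_space G eps V.
Hypotheses (Heps : cocycle L eps) (Hi : integral_pairings G) (Hii : cocycle_condition G eps).
Hypotheses (Hdiag : h0_diagonalizable F) (Hdef : vertex_operators_defined F).
Local Notation C := R[i].
Local Notation p := (gord G).
Local Notation bf := (bform L).
Local Notation X := (X_op F).
Local Notation om := (omega G).

Lemma mpairE s a b : (s < p)%N -> in_lattice L a -> in_lattice L b -> (mpair G s a b)%:~R = pairing G s a b.
Proof. by move=> hs ha hb; apply: tointK; exact: Hi. Qed.

Lemma bf_int a b : in_lattice L a -> in_lattice L b -> is_int (bf a b).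
Proof. by move=> ha hb; rewrite -(pairing0 G); apply: Hi => //; exact: gord_gt0. Qed.

Lemma mpair0 a b : mpair G 0 a b = toint (bf a b).
Proof. by rewrite /mpair pairing0. Qed.

(* Multiplied by [(w - z)^N = \prod_s (w^(1/p) - omega^s z^(1/p))^N], the kernel
   [\prod_s (1 - omega^s t)^(m_s)], [t = (z/w)^(1/p)], of [X_a(w) X_b(z)] becomes
   this polynomial in [t]. *)
Definition npow (N : nat) (a b : h) (s : nat) : nat := absz (mpair G s a b + N%:Z)%R.

Definition npoly N a b : {poly C} := \prod_(s < p) (1 - om ^+ s *: 'X) ^+ npow N a b s.

(** By [h0intE] this is p (a^[0]|b^[0]): the total exponent of the kernel, and in units of 1/p the
    shift that e(b) causes in w^(a(0)). *)
Definition h0int (a b : h) : int := \sum_(s < p) mpair G s a b.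

Section Pair.
Variables (a b : h) (N : nat).
Hypotheses (ha : in_lattice L a) (hb : in_lattice L b).
Hypothesis hN : forall s, (s < p)%N -> 0 <= mpair G s a b + N%:Z.

Lemma npowE s : (s < p)%N -> (npow N a b s)%:Z = mpair G s a b + N%:Z.
Proof. by move=> /hN hs; rewrite /npow gez0_abs. Qed.

Lemma h0intE : (h0int a b)%:~R = p%:R * hpair G 0 a b.
Proof.
rewrite hpair_pairing rmorph_sum /=; apply: eq_bigr => s _.
by rewrite mul0r expr0z mul1r mpairE.
Qed.

Definition qseq (i : nat) : C := p%:R * hpair G i%:Z a b + \sum_(s < p) om ^ (i%:Z * (s : nat)%:Z) * N%:R.

Lemma sexp_npoly : sexp qseq (cz (npoly N a b)).
Proof.
apply: sexp_ext (sexp_prod p (fun s => om ^+ s) (npow N a b)) _ => i _.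
rewrite /qseq hpair_pairing -big_split /=; apply: eq_bigr => s _.
rewrite -mulrDr -exprM mulnC exprnP -[(i * s)%N%:Z]/(i%:Z * (s : nat)%:Z); congr (_ * _).
by rewrite -mpairE // pmulrn npowE // rmorphD.
Qed.

Lemma sexp_npoly_inv : sexp (fun i => p%:R * hpair G i%:Z b a + \sum_(s < p) om ^ (- i%:Z * (s : nat)%:Z) * N%:R)
  (cz (\prod_(s < p) (1 - (om ^+ s)^-1 *: 'X) ^+ npow N a b s)).
Proof.
apply: sexp_ext (sexp_prod p (fun s => (om ^+ s)^-1) (npow N a b)) _ => i _.
rewrite hpairC hpair_pairing -big_split /=; apply: eq_bigr => s _.
rewrite -mulrDr -exprVn -exprM mulnC exprVn mulNr -invr_expz -[i%:Z * (s : nat)%:Z]/(i * s)%N%:Z -exprnP; congr (_ * _).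
by rewrite -mpairE // pmulrn npowE // rmorphD.
Qed.

Lemma npoly_conv (phi : int -> C) : sexp (fun i => p%:R * hpair G i%:Z a b) phi ->
  forall n, cz (npoly N a b) n = fsum (fun i : int => cz ((1 - 'X^p) ^+ N) i * phi (n - i)).
Proof.
move=> hphi; apply: sexp_conv hphi _.
  have -> : (1 - 'X^p) ^+ N = \prod_(s < p) (1 - om ^+ s *: 'X) ^+ N :> {poly C}.
    by rewrite prodrXl prod_one_sub_omega.
  exact: sexp_prod p (fun s => om ^+ s) (fun=> N).
apply: sexp_ext sexp_npoly _ => i _; rewrite /qseq addrC; congr (_ + _); apply: eq_bigr => s _.
by rewrite -exprM mulnC exprnP.
Qed.

Lemma sum_npow : \sum_(s < p) (npow N a b s)%:Z = h0int a b + (p * N)%N%:Z.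
Proof.
rewrite (eq_bigr (fun s : 'I_p => mpair G s a b + N%:Z)) => [|s _]; last exact: npowE.
by rewrite big_split /= sumr_const card_ord -mulr_natr mulrC natz.
Qed.

End Pair.

Lemma prod_opp_omega : \prod_(s < p) (- om ^+ s) = -1.
Proof.
have := @rvs_prod R p (fun s => om ^+ s) (fun=> 1%N) (fun s => omX_neq0 G s) 0.
have -> : \sum_(s < p) 1%N%:Z = p%:Z by rewrite sumr_const card_ord natz.
rewrite subr0; under eq_bigr do rewrite expr1; rewrite prod_one_sub_omega.
under [X in _ = X * _]eq_bigr do rewrite expr1.
have -> : cz (\prod_(s < p) (1 - (om ^+ s)^-1 *: 'X) ^+ 1) 0 = 1.
  by rewrite (sexp0 (sexp_prod p (fun s => (om ^+ s)^-1) (fun=> 1%N))).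
rewrite mulr1 => <-; have p0 := gord_gt0 G.
have pz : (p%:Z == 0) = false by lia.
by rewrite cz_sub1X eqxx pz sub0r.
Qed.

(** Reversal of 1 - omega^s t yields the scalar -omega^s and the factor 1 - omega^(-s) t. With
    exponents m_s(b,a) + N the scalars multiply to (-1)^N, a sign, and a power of omega, which the
    cocycle condition identifies with eps a b / eps b a up to the parity sign. *)
Lemma npoly_rev a b N : in_lattice L a -> in_lattice L b ->
  (forall s, (s < p)%N -> 0 <= mpair G s a b + N%:Z) -> (forall s, (s < p)%N -> 0 <= mpair G s b a + N%:Z) ->
  rvs (h0int b a + (p * N)%N%:Z) (eps a b / eps b a * (-1) ^+ (lparity L a && lparity L b) * (-1) ^+ N) (npoly N b a) (npoly N a b).
Proof.
move=> ha hb hN hN' k.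
have h1 := @rvs_prod R p (fun s => om ^+ s) (npow N b a) (fun s => omX_neq0 G s) k.
(* The reversed product is recognized as [npoly N a b] by its logarithmic derivative; no permutation
   of factors is needed. *)
have e := sexp_uniq (sexp_npoly_inv hb ha hN') (sexp_npoly ha hb hN) _.
rewrite sum_npow // in h1; rewrite {}h1 e; last first.
  move=> i _; rewrite /qseq; congr (_ + _); rewrite -!mulr_suml; congr (_ * _).
  by rewrite !sum_omega dvdzE abszN -dvdzE.
congr (_ * _).
have om0 := omega_neq0 G.
have -> := @prod_expzD C p (fun s => - om ^+ s) (fun s => mpair G s b a) N (npow N b a).
- rewrite prod_opp_omega (prod_oppX p (fun s => mpair G s b a) om0); congr (_ * _).
  have := Hii hb ha; have -> : toint (p%:R * bf (gpart0 G b) (gpart0 G a)) = h0int b a.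
    by rewrite -hpair0 -h0intE // toint_int.
  have -> : \sum_(s < p) (s : nat)%:Z * mpair G s b a = \sum_(1 <= s < p) s%:Z * mpair G s b a.
    rewrite -(big_mkord xpredT (fun s => s%:Z * mpair G s b a)) big_ltn ?gord_gt0 //.
    by rewrite mul0r add0r.
  set S := \sum_(1 <= s < p) _; move: S om om0 => S w w0 hc.
  have n10 : (-1 : C) != 0 by rewrite oppr_eq0 oner_eq0.
  have -> : eps a b / eps b a = (eps b a / eps a b)^-1 by rewrite invfM invrK mulrC.
  rewrite hc expfzDr // !invfM (invr_expz w) opprK !signz_odd -!exprVn invrN invr1 abszM oddM.
  rewrite -/(h0int b a) -!/(lparity L _) (andbC (lparity L a)); set u := (-1) ^+ (_ && _).
  have uu : u * u = 1 by rewrite /u -signr_addb addbb.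
  move: uu; move: u ((-1) ^+ _) (w ^ S) => u B A uu.
  by rewrite -[LHS]mulr1 -uu; ring.
- by move=> s _; rewrite oppr_eq0 omX_neq0.
- by move=> s hs; rewrite npowE.
Qed.

Lemma iter_md_map N (f : V -> V) A x y : linear f ->
  iter N (@md R V) (fun x y => f (A x y)) x y = f (iter N (@md R V) A x y).
Proof.
move=> fl; elim: N x y => [//|N IH] x y.
by rewrite /= /md !IH -(linB fl).
Qed.

Lemma zext_shiftz (f : int -> V) y (m : int) : zext f (y - m%:~R) = zext (fun i => f (i - m)) y.
Proof.
case: (pselect (is_int y)) => [[k ->]|hy]; first by rewrite -rmorphB /= !zext_int.
rewrite /zext !asboolF //= => hi; apply: hy; rewrite -[y](subrK (m%:~R)).
by apply: is_intD => //; exact: is_int_int.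
Qed.

Lemma lift2_sym (al be : C) (A : int -> int -> V) x y : lift2 G be al A y x = lift2 G al be (fun i j => A j i) x y.
Proof. by rewrite /lift2 /zext; case: ifP; case: ifP. Qed.

Definition expo (xi : weight G) (a : h) : C := weight_at xi a - qf G a.

(** The shift of i collects the pN from [iter_md_lift2] and the weight that e(b) adds to
    w^(a(0)). *)
Definition XXser N a b v : int -> int -> V := fun i j =>
  hact (cz (npoly N a b)) (NO F a b v) (i - (h0int a b + (p * N)%N%:Z)) j.

Lemma NO_zbdr a b v : in_lattice L a -> in_lattice L b -> zbdr (NO F a b v).
Proof. by move=> ha hb; have [M hM] := NO_bounds Hdef v ha hb; exists (- M%:Z) => i j /hM[]. Qed.

Lemma ws_zext xi (f : int -> V) y : (forall i, weight_space F xi (f i)) -> weight_space F xi (zext f y).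
Proof. by move=> hf; rewrite /zext; case: ifP => _ //; exact: ws0. Qed.

Lemma ws_EE xi a v x : in_lattice L a -> weight_space F xi v -> weight_space F xi (EE F a v x).
Proof. by move=> ha hv; apply: ws_fsum => j; apply: ws_Emz; exact: ws_Epz. Qed.

Lemma md_XX xi a b N v x y : in_lattice L a -> in_lattice L b ->
  (forall s, (s < p)%N -> 0 <= mpair G s a b + N%:Z) -> weight_space F xi v ->
  iter N (@md R V) (prod2 (X a) (X b) v) x y =
  eps a b *: fe F (a + b) (lift2 G (expo xi a) (expo xi b) (XXser N a b v) x y).
Proof.
move=> ha hb hN hv; have hab := latticeD ha hb.
have fl : linear (fun w => eps a b *: fe F (a + b) w) by apply: linZl; exact: fe_lin.
have hE0 i : EE F a 0 i = 0 by apply: EE_0 => w; exact: Efin.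
have [phi hphi] := sexp_exists (fun i => p%:R * hpair G i%:Z a b).
have e1 x' y' : prod2 (X a) (X b) v x' y' = eps a b *: fe F (a + b)
    (lift2 G (expo xi a + hpair G 0 a b) (expo xi b) (hact phi (NO F a b v)) x' y').
  rewrite /prod2 (X_weight Hdiag Hdef _ hb hv).
  set Z := zext _ _; have hZ : weight_space F xi Z by apply: ws_zext => j; exact: ws_EE.
  rewrite (X_weight Hdiag Hdef _ ha (ws_fe hb hZ)) weight_at_shift -fe_mul //; congr (fe F a _).
  rewrite /lift2 /expo; set x1 := p%:R * _; set x2 := p%:R * (x' - _).
  have -> : x1 = x2 by rewrite /x1 /x2; ring.
  rewrite /zext; case: ifP => _; last by rewrite (lin0 (fe_lin _ hb)).
  rewrite -fe_EE => [||//]; last by move=> w; exact: Efin.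
  congr (fe F b _); rewrite /Z; set y1 := p%:R * _; set y2 := p%:R * (y' - _).
  have -> : y1 = y2 by rewrite /y1 /y2; ring.
  rewrite /zext; case: ifP => _; last exact: hE0.
  exact: (EE_NO Hdef v ha hb hphi).
rewrite (iter_md_ext _ e1) (iter_md_map _ _ _ _ fl); congr (_ *: fe F _ _).
have zN := NO_zbdr v ha hb.
rewrite iter_md_lift2; last by apply: hact_bdr => //; exact: sexp_lt0 hphi.
rewrite /lift2 (_ : p%:R * (x - (expo xi a + hpair G 0 a b)) = p%:R * (x - expo xi a) - (h0int a b)%:~R).
  rewrite zext_shiftz /XXser; congr (zext _ _); apply/funext => i; congr (zext _ _); apply/funext => j.
  rewrite (hact_comp (c'' := cz (npoly N a b))) //; [|exact: cz_lt0|exact: sexp_lt0 hphi|exact: npoly_conv].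
  by rewrite opprD addrA.
by rewrite h0intE //; ring.
Qed.

(** On a weight vector both orders are kernels acting on the same normally ordered product
    ([NO_sym]). The scalar of [npoly_rev] exchanges the kernels, and it cancels the quotient of the
    values of [eps], the parity sign, and the (-1)^N from swapping w and z. *)
Lemma X_local a b N : in_lattice L a -> in_lattice L b ->
  (forall s, (s < p)%N -> 0 <= mpair G s a b + N%:Z) ->
  local (lparity L a) (lparity L b) N (X a) (X b).
Proof.
move=> ha hb hN.
have hN' s : (s < p)%N -> 0 <= mpair G s b a + N%:Z.
  move=> hs; rewrite /mpair pairingC //; apply: hN; rewrite ltn_mod; exact: gord_gt0.
apply/localP; move=> v; move: v; apply: (weight_ind Hdiag).
- move=> x y; rewrite !iter_md0 // => x' y'; rewrite ?/prod2 ?/prod2';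
  by rewrite ?(lin0 (X_linear Hdiag Hdef _ ha)) ?(lin0 (X_linear Hdiag Hdef _ hb)) ?(lin0 (X_linear Hdiag Hdef _ ha)) ?scaler0.
- move=> v w hv hw x y.
  rewrite (@iter_md_ext _ _ _ _ (fun x y => prod2 (X a) (X b) v x y + prod2 (X a) (X b) w x y)); last first.
    by move=> x' y'; rewrite /prod2 (linD (X_linear Hdiag Hdef _ hb)) (linD (X_linear Hdiag Hdef _ ha)).
  rewrite iter_mdD hv hw -iter_mdD; apply: iter_md_ext => x' y'.
  by rewrite /prod2' (linD (X_linear Hdiag Hdef _ ha)) (linD (X_linear Hdiag Hdef _ hb)) scalerDr.
move=> xi v hv x y; rewrite (md_XX _ _ ha hb hN hv) iter_mdZ.
rewrite (@iter_md_ext _ _ _ _ (fun x y => prod2 (X b) (X a) v y x)) // iter_md_flip (md_XX _ _ hb ha hN' hv).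
rewrite lift2_sym [b + a]addrC /lift2 /zext; case: ifP => _; last by rewrite !(lin0 (fe_lin _ (latticeD ha hb))) !scaler0.
case: ifP => _; last by rewrite !(lin0 (fe_lin _ (latticeD ha hb))) !scaler0.
move: (toint _) (toint _) => j i; rewrite /XXser.
have D0 : h0int a b = h0int b a.
  by apply: (@intr_inj C); rewrite !h0intE // hpairC oppr0.
have -> : hact (cz (npoly N b a)) (NO F b a v) (j - (h0int b a + (p * N)%N%:Z)) i =
   (eps a b / eps b a * (-1) ^+ (lparity L a && lparity L b) * (-1) ^+ N) *:
   hact (cz (npoly N a b)) (NO F a b v) (i - (h0int a b + (p * N)%N%:Z)) j.
  rewrite /hact fsumZ; last by apply: hact_fin; [exact: cz_lt0|exact: NO_zbdr].
  (* The substitution t -> 1/t is the reflection k -> D - k of the summation index. *)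
  rewrite (fsum_refl (h0int b a + (p * N)%N%:Z)); apply: eq_fsum => k.
  rewrite (npoly_rev ha hb hN hN') scalerA NO_sym // D0.
  set D := h0int b a + _.
  have e1 (k' : int) : i - (D - k') = i - D + k' by rewrite opprB addrA addrAC.
  have e2 (k' : int) : j - D + (D - k') = j - k' by rewrite addrA subrK.
  by rewrite e1 e2.
rewrite (linZ (fe_lin _ (latticeD ha hb))) !scalerA; congr (_ *: _).
have eps0 : eps b a != 0 by case: Heps => hz _; exact: hz.
set u := (-1) ^+ (_ && _); set n := (-1) ^+ N.
have uu : u * u = 1 by rewrite /u -signr_addb addbb.
have nn : n * n = 1 by rewrite /n -exprMn mulrNN mulr1 expr1n.
transitivity ((u * u) * (n * n) * eps a b); first by rewrite uu nn !mul1r.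
by field.
Qed.

End VertexLocality.

(** * Leading products of vertex operators *)

Section LeadingTerm.
Variables (R : realType) (V : lmodType R[i]).
Local Notation C := R[i].

Definition zbd2 (A : int -> int -> V) := exists lo : int, forall i j, A i j <> 0 -> lo <= i /\ lo <= j.

Lemma sgm_nat y (P : {poly C}) e : sgm y P e = \sum_(k < size P) P`_k * gbin ((k : nat)%:R * y) e.
Proof. by rewrite /sgm (@fsum_nat _ (size P)) // => k hk; rewrite nth_default // mul0r. Qed.

(** Leibniz's rule at w = z. After the shift of i by D - k the exponent is k y plus a part free of
    k, and [gbin_add] separates the contribution of the kernel from that of [A]. *)
Lemma tau_hact (y al : C) (P : {poly C}) A (D J : int) d : zbd2 A ->
  fsum (fun i : int => gbin (al - i%:~R * y) d *: hact (cz P) A (i - D) (J - i)) =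
  \sum_(e < d.+1) sgm y P e *: fsum (fun i : int => gbin (al - (i + D)%:~R * y) (d - e) *: A i (J - D - i)).
Proof.
move=> [lo hA].
have fA (c : int -> C) (J' : int) : fin (fun i : int => c i *: A i (J' - i)).
  apply: (@fin_int _ lo (J' - lo)) => i hi; have [|] := hA i (J' - i); last by lia.
  by move=> e; apply: hi; rewrite e scaler0.
have zA : zbdr A by exists lo => i j /hA[].
rewrite (eq_fsum (g := fun i : int => fsum (fun k : int => (gbin (al - i%:~R * y) d * cz P k) *: A (i - D + k) (J - i - k)))); last first.
  move=> i; rewrite /hact fsumZ; last by apply: hact_fin => //; exact: cz_lt0.
  by apply: eq_fsum => k; rewrite scalerA.
rewrite (@fsum_exchZ _ (lo + D - (size P)%:Z) (J - lo) 0 (size P)%:Z); last first.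
  move=> i k hik; have k0 : 0 <= k by rewrite leNgt; apply/negP => h0; apply: hik; rewrite (cz_lt0 P) // mulr0 scale0r.
  have k1 : k <= (size P)%:Z.
    rewrite leNgt; apply/negP => h0; apply: hik; case: k h0 {k0} => // k hk.
    by rewrite /= nth_default ?mulr0 ?scale0r //; apply: ltnW; rewrite -ltz_nat.
  have [|] := hA (i - D + k) (J - i - k); first by move=> e; apply: hik; rewrite e scaler0.
  by move=> ? ?; split; lia.
rewrite (@fsum_sub _ _ _ Posz); first last.
- move=> [k|k]; first by exists k.
  by case; apply: fsum0 => i; rewrite /= mulr0 scale0r.
- by move=> k k' [].
rewrite (@fsum_nat _ (size P)) => [|k hk]; last by apply: fsum0 => i; rewrite /= nth_default // mulr0 scale0r.
rewrite (eq_bigr (fun e : 'I_d.+1 => \sum_(k < size P) (P`_k * gbin ((k : nat)%:R * y) e) *: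
   fsum (fun i : int => gbin (al - (i + D)%:~R * y) (d - e) *: A i (J - D - i)))); last first.
  by move=> e _; rewrite sgm_nat scaler_suml.
rewrite exchange_big /=; apply: eq_bigr => k _.
under [RHS]eq_bigr do rewrite fsumZ //.
rewrite -fsum_sum => [|e _]; last by apply: (finZ (fun=> _)).
rewrite (fsum_shift (D - k%:Z)); apply: eq_fsum => i.
have e1 (i' : int) : i' + (D - k%:Z) - D + k = i' by lia.
have e2 (i' : int) : J - (i' + (D - k%:Z)) - k%:Z = J - D - i' by lia.
rewrite e1 e2.
have -> : al - (i + (D - k%:Z))%:~R * y = k%:R * y + (al - (i + D)%:~R * y).
  by rewrite addrA rmorphB /= -pmulrn; ring.
rewrite gbin_add mulr_suml scaler_suml; apply: eq_bigr => e _.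
by rewrite scalerA; congr (_ *: _); ring.
Qed.

Lemma tau_lead (y al : C) (P : {poly C}) A (D J : int) M kap : zbd2 A -> leads y M kap P ->
  (forall d, (d < M)%N -> fsum (fun i : int => gbin (al - i%:~R * y) d *: hact (cz P) A (i - D) (J - i)) = 0) /\
  fsum (fun i : int => gbin (al - i%:~R * y) M *: hact (cz P) A (i - D) (J - i)) = kap *: fsum (fun i : int => A i (J - D - i)).
Proof.
move=> hA [h0 h1]; split=> [d hd|]; rewrite tau_hact //.
  by rewrite big1 // => e _; rewrite h0 ?scale0r //; have := ltn_ord e; lia.
rewrite big_ord_recr /= h1 subnn big1 ?add0r => [|e _]; last by rewrite h0 ?scale0r //; have := ltn_ord e; lia.
by congr (_ *: _); apply: eq_fsum => i; rewrite gbin0 scale1r.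
Qed.

Lemma tau_map k (f : V -> V) A u : linear f -> fs2 A -> tauz k (fun x y => f (A x y)) u = f (tauz k A u).
Proof.
move=> fl hA; rewrite /tauz; case: k => k; last by rewrite (lin0 fl).
rewrite /tau (lin_fsum fl); last by apply: (finZ (fun x => gbin x k)); exact: hA.
by apply: eq_fsum => x; rewrite (linZ fl).
Qed.

Lemma zbd2_hact (P : {poly C}) A (D : int) : zbd2 A -> zbd2 (fun i j => hact (cz P) A (i - D) j).
Proof.
move=> [lo hA]; exists (Order.min lo (lo + D - (size P)%:Z)) => i j hij.
have [k hk] : exists k : int, cz P k *: A (i - D + k) (j - k) <> 0.
  apply: contrapT => hno; apply: hij; apply: fsum0 => k; apply: contrapT => hk; apply: hno; by exists k.
case: k hk => [k|k] hk; last by case: hk; rewrite /= scale0r.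
have k1 : (k < size P)%N.
  by rewrite ltnNge; apply/negP => h0; apply: hk; rewrite /= nth_default ?scale0r.
have [|] := hA (i - D + k) (j - k%:Z); first by move=> e; apply: hk; rewrite e scaler0.
move=> h1 h2; rewrite !ge_min; split; apply/orP; [right|left]; lia.
Qed.

End LeadingTerm.

Section LeadingProduct.
Variables (R : realType) (l : nat) (h : vectType R[i]) (L : lattice_data l h).
Variables (G : cyclic_grading L) (eps : h -> h -> R[i]) (V : lmodType R[i]).
Variable F : fock_space G eps V.
Hypotheses (Heps : cocycle L eps) (Hi : integral_pairings G) (Hii : cocycle_condition G eps).
Hypotheses (Hdiag : h0_diagonalizable F) (Hdef : vertex_operators_defined F).
Local Notation C := R[i].
Local Notation p := (gord G).
Local Notation bf := (bform L).
Local Notation X := (X_op F).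
Local Notation om := (omega G).

Lemma fs2_lift2 al be (A : int -> int -> V) : zbd2 A -> fs2 (lift2 G al be A).
Proof.
move=> [lo hA] u; pose Y := p%:R * (u - al - be); have hp := p_neq0 G.
exists [seq al + (i : int)%:~R / p%:R | i <- zseq lo (toint Y - lo)] => x.
rewrite /lift2 => /zextP[i hi] /zextP[j hj] /hA[h1 h2].
have hY : Y = (i + j)%:~R by rewrite rmorphD /= -hi -hj /Y; ring.
apply/mapP; exists i; last by rewrite -hi; field.
by apply: mem_zseq => //; rewrite hY toint_int; lia.
Qed.

(** Here y = -1/p, since t = (z/w)^(1/p) contains w to that power. Each factor 1 - t vanishes at w =
    z to first order with coefficient -y = 1/p. *)
Lemma leads_npoly N a b : leads (- (p%:R : C)^-1) (npow G N a b 0)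
  ((p%:R : C)^-1 ^+ npow G N a b 0 * \prod_(1 <= s < p) (1 - om ^+ s) ^+ npow G N a b s) (npoly G N a b).
Proof.
have := gord_gt0 G; rewrite /npoly; case: p => // K _.
by have := @leads_prod R (- (K.+1%:R)^-1) K (fun s => om ^+ s) (npow G N a b) (expr0 _); rewrite opprK.
Qed.

Lemma locality_orderP s a b : (s < p)%N -> 0 <= mpair G s a b + (locality_order G a b)%:Z.
Proof.
move=> hs; have [h0|h0] := leP 0 (mpair G s a b); first by lia.
have : (absz (mpair G s a b) <= locality_order G a b)%N.
  exact: (@leq_bigmax_cond _ (fun s : 'I_p => mpair G s a b < 0) (fun s : 'I_p => absz (mpair G s a b)) (Ordinal hs)).
lia.
Qed.

Section Pair.
Variables (a b : h).
Hypotheses (ha : in_lattice L a) (hb : in_lattice L b).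
Local Notation N := (locality_order G a b).
Let hN s : (s < p)%N -> 0 <= mpair G s a b + N%:Z.
Proof. exact: locality_orderP. Qed.

(** The N additional factors for each s >= 1 multiply to p^N by [prod_omega_sub]; this cancels
    p^(-N) in the contribution of s = 0, so the locality order drops out. *)
Lemma kappaE : kappa G eps a b = eps a b * ((p%:R : C)^-1 ^+ npow G N a b 0 * \prod_(1 <= s < p) (1 - om ^+ s) ^+ npow G N a b s).
Proof.
have hp := p_neq0 G; rewrite /kappa -mulrA; congr (_ * _).
have p0 := gord_gt0 G.
have e0 : (npow G N a b 0)%:Z = toint (bf a b) + N%:Z by rewrite npowE // mpair0.
have -> : \prod_(1 <= s < p) (1 - om ^+ s) ^+ npow G N a b s =
   \prod_(1 <= s < p) (1 - om ^+ s) ^ mpair G s a b * p%:R ^+ N.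
  rewrite -(prod_omega_sub G) -prodrXl -big_split /= big_nat [RHS]big_nat; apply: eq_bigr => s /andP[s1 s2].
  have h1 := one_sub_omega_neq0 s1 s2.
  move: (om ^+ s) h1 => w h1; by rewrite [LHS]exprnP npowE // expfzDr // -exprnP.
rewrite exprVn [_ ^+ npow _ _ _ _ _]exprnP e0 expfzDr // -exprnP invfM (invr_expz p%:R).
have hc : (p%:R : C) ^+ N != 0 by rewrite expf_neq0.
by move: hc; move: (_ ^+ N) (\prod_(_ <= _ < _) _) => c B hc; field.
Qed.

Lemma zbd2_NO v : zbd2 (NO F a b v).
Proof. by have [M hM] := NO_bounds Hdef v ha hb; exists (- M%:Z) => i j /hM. Qed.

Lemma X_prod_ws xi v n u : weight_space F xi v ->
  op_prod (lparity L a) (lparity L b) n (X a) (X b) (- u - 1) v =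
  eps a b *: fe F (a + b) (tauz (N%:Z - 1 - n) (lift2 G (expo xi a) (expo xi b) (XXser F N a b v)) u).
Proof.
move=> hv; rewrite (op_prod_tau _ (isfld_X Hdiag Hdef ha) (isfld_X Hdiag Hdef hb) (X_local Heps Hi Hii Hdiag Hdef ha hb hN)).
have -> : - (- u - 1) - 1 = u :> C by ring.
have fl : linear (fun w => eps a b *: fe F (a + b) w) by apply: linZl; apply: fe_lin; exact: latticeD.
rewrite (eq_tauz _ (fun x y => md_XX Hi Hdiag Hdef x y ha hb hN hv)) (tau_map _ _ fl) //.
by apply: fs2_lift2; apply: zbd2_hact; exact: zbd2_NO.
Qed.

Lemma X_tau_lead v al be u d : (d <= npow G N a b 0)%N ->
  tauz d%:Z (lift2 G al be (XXser F N a b v)) u =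
  if d == npow G N a b 0 then
   ((p%:R : C)^-1 ^+ npow G N a b 0 * \prod_(1 <= s < p) (1 - om ^+ s) ^+ npow G N a b s) *:
    zext (EE F (a + b) v) (p%:R * (u + d%:R - al - be) - (h0int G a b + (p * N)%N%:Z)%:~R)
  else 0.
Proof.
move=> hd; rewrite /tauz tau_lift2 zext_shiftz.
have eg (i : int) : al + i%:~R / p%:R = al - i%:~R * - (p%:R)^-1 :> C by rewrite mulrN opprK.
set D := h0int G a b + _.
have ef J : fsum (fun i : int => gbin (al + i%:~R / p%:R) d *: XXser F N a b v i (J - i)) =
    fsum (fun i : int => gbin (al - i%:~R * - (p%:R)^-1) d *: hact (cz (npoly G N a b)) (NO F a b v) (i - D) (J - i)).
  by apply: eq_fsum => i; rewrite eg.
have tl J := tau_lead al D J (zbd2_NO v) (leads_npoly N a b).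
case: eqP => [ed|/eqP nd]; rewrite /zext; case: ifP => _; rewrite ?scaler0 // ef.
  by have [_] := tl (toint (p%:R * (u + d%:R - al - be))); rewrite ed => ->; rewrite NO_sum.
have [h1 _] := tl (toint (p%:R * (u + d%:R - al - be))); apply: h1.
by rewrite ltn_neqAle nd.
Qed.

Lemma qfD : qf G (a + b) = qf G a + qf G b + (bf a b - hpair G 0 a b).
Proof.
have two0 : (2 : C) != 0 by rewrite pnatr_eq0.
have e : bf (gprime G a) (gprime G b) = bf a b - hpair G 0 a b.
  have h00 x y : bf (gpart0 G x) (y - gpart0 G y) = 0.
    rewrite bfDr bfNr; have := hpair0 G x y; rewrite /hpair => <-.
    by rewrite /gpart0 subrr.
  by rewrite /gprime bfDl bfNl h00 subr0 bfDr bfNr [bf a (gpart0 _ _)]bfC; congr (_ - _); rewrite hpairC oppr0.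
have gD : gprime G (a + b) = gprime G a + gprime G b.
  by rewrite /gprime /gpart0 linearD opprD addrACA.
have e' : bf (gprime G b) (gprime G a) = bf a b - hpair G 0 a b by rewrite bfC.
rewrite /qf gD; move: (gprime G a) (gprime G b) e e' => x y e e'.
by rewrite bfDl !bfDr e e'; field.
Qed.

Lemma X_prod_ge n : - toint (bf a b) <= n -> op_prod (lparity L a) (lparity L b) n (X a) (X b) = 0.
Proof.
move=> hn; have loc := X_local Heps Hi Hii Hdiag Hdef ha hb hN.
have hO k : linear (op_prod (lparity L a) (lparity L b) n (X a) (X b) k).
  by have [] := isfld_op_prod n (isfld_X Hdiag Hdef ha) (isfld_X Hdiag Hdef hb) loc.
apply/funext => k; apply/funext => v; move: v; apply: (weight_ind Hdiag).
- by rewrite (lin0 (hO _)).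
- by move=> x y hx hy; rewrite (linD (hO _)) hx hy addr0.
move=> xi v hv; rewrite [k]modeN (X_prod_ws _ _ hv).
have p0 := gord_gt0 G; have e0 : (npow G N a b 0)%:Z = toint (bf a b) + N%:Z by rewrite npowE // mpair0.
case E : (N%:Z - 1 - n) => [d|d]; last by rewrite (lin0 (fe_lin _ (latticeD ha hb))) scaler0.
rewrite X_tau_lead; last by lia.
by rewrite ifF ?(lin0 (fe_lin _ (latticeD ha hb))) ?scaler0 //; lia.
Qed.

(** The index -(a|b) - 1 corresponds to the Taylor order N + (a|b), the order of vanishing of the
    kernel at t = 1. There only the normally ordered product at w = z remains, and [qfD] matches the
    powers of z. *)
Lemma X_prod_lead : op_prod (lparity L a) (lparity L b) (- toint (bf a b) - 1) (X a) (X b) = kappa G eps a b *: X (a + b).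
Proof.
have loc := X_local Heps Hi Hii Hdiag Hdef ha hb hN; have hab := latticeD ha hb.
have hO k : linear (op_prod (lparity L a) (lparity L b) (- toint (bf a b) - 1) (X a) (X b) k).
  by have [] := isfld_op_prod (- toint (bf a b) - 1) (isfld_X Hdiag Hdef ha) (isfld_X Hdiag Hdef hb) loc.
apply/funext => k; apply/funext => v; move: v; apply: (weight_ind Hdiag).
- by rewrite (lin0 (hO _)) /= -[RHS]/(_ *: X (a + b) k 0) (lin0 (X_linear Hdiag Hdef _ hab)) scaler0.
- move=> x y hx hy; rewrite (linD (hO _)) hx hy.
  by rewrite -[RHS]/(_ *: X (a + b) k (x + y)) (linD (X_linear Hdiag Hdef _ hab)) scalerDr.
move=> xi v hv; rewrite [k]modeN (X_prod_ws _ _ hv); move: (- k - 1) => u.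
have p0 := gord_gt0 G; have e0 : (npow G N a b 0)%:Z = toint (bf a b) + N%:Z by rewrite npowE // mpair0.
have -> : N%:Z - 1 - (- toint (bf a b) - 1) = (npow G N a b 0)%:Z by rewrite e0; lia.
rewrite X_tau_lead // eqxx (linZ (fe_lin _ hab)) scalerA -kappaE.
rewrite -[RHS]/(kappa G eps a b *: X (a + b) (- u - 1) v) (X_weight Hdiag Hdef _ hab hv).
congr (_ *: fe F _ (zext _ _)); rewrite /expo weight_atD qfD.
rewrite (_ : (npow G N a b 0)%:R = bf a b + N%:R); last first.
  by rewrite pmulrn e0 rmorphD /= tointK //; exact: (bf_int Hi).
rewrite rmorphD /= h0intE // -pmulrn natrM; ring.
Qed.

End Pair.
End LeadingProduct.

(** * Lattice vertex algebras from operator product expansions *)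

Section LatticeSystems.
Variables (R : realType) (l : nat) (h : vectType R[i]) (L : lattice_data l h) (W : lmodType R[i]).
Local Notation C := R[i].
Local Notation field := (C -> W -> W).
Local Notation bf := (bform L).
Local Notation vac := (@vac_op R W).

Lemma lparityD a b : is_int (bf a a) -> is_int (bf b b) -> is_int (bf a b) ->
  lparity L (a + b) = lparity L a (+) lparity L b.
Proof.
move=> [i hi] [j hj] [k hk]; rewrite /lparity bfDl !bfDr [bf b a]bfC hi hj hk -!rmorphD /= !toint_int.
lia.
Qed.

Section System.
Variables (X A : h -> field) (kap : h -> h -> C).
Local Notation par := (lparity L).

(** The Heisenberg fields are included so that they act within the closure from the start; by
    [lattice_vsaE] the algebra is the one generated by the X_a. *)
Definition gens (q : bool) (x : field) : Prop :=
  [\/ q = false /\ x = vac, exists a, [/\ in_lattice L a, q = par a & x = X a]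
    | exists a, q = false /\ x = A a].

Definition act (a : h) (n : int) (x : field) : field := op_prod false false n (A a) x.

(* These relations hold in every twisted realization with the same [kap], and
   determine the vertex algebra. *)
Record lattice_system : Prop := {
  ls_family : local_family gens;
  ls_int : forall a b, in_lattice L a -> in_lattice L b -> is_int (bf a b);
  ls_A_lin : linear A;
  ls_AX0 : forall a b, in_lattice L b -> act a 0 (X b) = bf a b *: X b;
  ls_AX : forall a b n, in_lattice L b -> 1 <= n -> act a n (X b) = 0;
  ls_DX : forall b, in_lattice L b -> ddz (X b) = act b (-1) (X b);
  ls_XX0 : forall a b n, in_lattice L a -> in_lattice L b -> - toint (bf a b) <= n ->
    op_prod (par a) (par b) n (X a) (X b) = 0;
  ls_XX : forall a b, in_lattice L a -> in_lattice L b ->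
    op_prod (par a) (par b) (- toint (bf a b) - 1) (X a) (X b) = kap a b *: X (a + b);
  ls_kap : forall a b, in_lattice L a -> in_lattice L b -> kap a b != 0;
  ls_X0 : exists2 e, e != 0 & X 0 = e *: vac
}.

Hypothesis hL : lattice_system.
Local Notation S := (lclosure gens).

Lemma S_family : local_family S. Proof. exact: lclosure_local (ls_family hL). Qed.
Lemma S_fld q x : S q x -> isfld x. Proof. by case: S_family => h1 _; exact: h1. Qed.
Lemma S_local q r x y : S q x -> S r y -> exists N, local q r N x y.
Proof. by case: S_family => _ h1; exact: h1. Qed.
Lemma S_vac : S false vac. Proof. by apply: lcl_gen; apply: Or31. Qed.
Lemma S_X a : in_lattice L a -> S (par a) (X a).
Proof. by move=> ha; apply: lcl_gen; apply: Or32; exists a. Qed.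
Lemma S_A a : S false (A a). Proof. by apply: lcl_gen; apply: Or33; exists a. Qed.
Lemma S_lin q (k : C) x y : S q x -> S q y -> S q (k *: x + y). Proof. exact: lcl_lin. Qed.
Lemma S_prod q r n x y : S q x -> S r y -> S (q (+) r) (op_prod q r n x y).
Proof. by move=> hx hy; have [N hN] := S_local hx hy; exact: lcl_prod hx hy hN. Qed.
Lemma S_act a n q x : S q x -> S q (act a n x).
Proof. by move=> hx; exact: (S_prod n (S_A a) hx). Qed.
Lemma S_0 q : S q 0. Proof. exact: lcl_0. Qed.
Lemma S_Z q (k : C) x : S q x -> S q (k *: x).
Proof. by move=> hx; rewrite -[_ *: _]addr0; apply: S_lin => //; exact: S_0. Qed.

Lemma S_local2 q q' r x y z : S q x -> S q' y -> S r z -> exists N, local q r N x z /\ local q' r N y z.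
Proof.
move=> hx hy hz; have [N hN] := S_local hx hz; have [M hM] := S_local hy hz.
by exists (N + M)%N; split; [apply: (local_le _ hN)|apply: (local_le _ hM)]; lia.
Qed.

Lemma prod_linl q r n (k : C) x y z : S q x -> S q y -> S r z ->
  op_prod q r n (k *: x + y) z = k *: op_prod q r n x z + op_prod q r n y z.
Proof.
move=> hx hy hz; have [N [h1 h2]] := S_local2 hx hy hz.
exact: op_prod_linl (S_fld hx) (S_fld hy) (S_fld hz) h1 h2.
Qed.

Lemma prod_linr q r n (k : C) x y z : S q x -> S r y -> S r z ->
  op_prod q r n x (k *: y + z) = k *: op_prod q r n x y + op_prod q r n x z.
Proof.
move=> hx hy hz; have [N [h1 h2]] := S_local2 hy hz hx.
exact: op_prod_linr (S_fld hx) (S_fld hy) (S_fld hz) (local_sym h1) (local_sym h2).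
Qed.

Lemma prod0l q r n z : S r z -> op_prod q r n 0 z = 0.
Proof. by move=> hz; apply: op_prod0l; exact: S_fld hz. Qed.
Lemma prod0r q r n z : S q z -> op_prod q r n z 0 = 0.
Proof. by move=> hz; apply: op_prodr0; exact: S_fld hz. Qed.

Lemma prodZl q r n (k : C) x z : S q x -> S r z -> op_prod q r n (k *: x) z = k *: op_prod q r n x z.
Proof. by move=> hx hz; rewrite -[k *: x]addr0 (prod_linl _ _ hx (S_0 q) hz) prod0l // addr0. Qed.

Lemma prodZr q r n (k : C) x z : S q x -> S r z -> op_prod q r n x (k *: z) = k *: op_prod q r n x z.
Proof. by move=> hx hz; rewrite -[k *: z]addr0 (prod_linr _ _ hx hz (S_0 r)) prod0r // addr0. Qed.

Lemma act_lin q a n (k : C) x y : S q x -> S q y -> act a n (k *: x + y) = k *: act a n x + act a n y.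
Proof. by move=> hx hy; exact: (prod_linr n k (S_A a) hx hy). Qed.
Lemma actZ q a n (k : C) x : S q x -> act a n (k *: x) = k *: act a n x.
Proof. by move=> hx; exact: (prodZr n k (S_A a) hx). Qed.
Lemma act_0 a n : act a n 0 = 0.
Proof. exact: (prod0r false n (S_A a)). Qed.
Lemma act_linv q (k : C) a b n x : S q x -> act (k *: a + b) n x = k *: act a n x + act b n x.
Proof. by move=> hx; rewrite /act (ls_A_lin hL); exact: (prod_linl n k (S_A a) (S_A b) hx). Qed.
Lemma act_linv_fun q n x : S q x -> linear (fun a => act a n x).
Proof. by move=> hx k a b; exact: act_linv hx. Qed.

Lemma act_comm q r a (m n : int) x y : S q x -> S r y ->
  act a m (op_prod q r n x y) = op_prod q r n x (act a m y) +
    fsum (fun i : nat => gbin (m%:~R : C) i *: op_prod q r (m + n - i%:Z) (act a i%:Z x) y).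
Proof.
move=> hx hy; have := family_comm S_family m n (S_A a) hx hy.
by rewrite expr0 scale1r => /eqP; rewrite subr_eq addrC => /eqP.
Qed.

Lemma act_X_comm r a b (m n : int) y : in_lattice L b -> S r y ->
  act a m (op_prod (par b) r n (X b) y) =
    op_prod (par b) r n (X b) (act a m y) + bf a b *: op_prod (par b) r (m + n) (X b) y.
Proof.
move=> hb hy; rewrite (act_comm _ _ _ (S_X hb) hy) (@fsum_nat _ 1) => [|[//|i] _]; last first.
  by rewrite (ls_AX hL) // prod0l // scaler0.
by rewrite big_ord1 gbin0 scale1r subr0 (ls_AX0 hL) // (prodZl _ _ (S_X hb) hy).
Qed.

Lemma ddz_act q a n x : S q x -> ddz (act a n x) = act a n (ddz x) - n%:~R *: act a (n - 1) x.
Proof.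
move=> hx; have [N hN] := S_local (S_A a) hx.
exact: (ddz_op_prod (S_fld (S_A a)) (S_fld hx) hN).
Qed.

Lemma S_ddz q x : S q x -> S q (ddz x).
Proof.
move=> hx; rewrite -(op_prod_vacr_m2 q (S_fld hx)).
by have := S_prod (-2) hx S_vac; rewrite addbF.
Qed.

Lemma ddz_lin (k : C) (x y : field) : ddz (k *: x + y) = k *: ddz x + ddz y.
Proof.
apply/funext => n; apply/funext => v.
rewrite -[LHS]/(- n *: (k *: x (n - 1) v + y (n - 1) v)) -[RHS]/(k *: (- n *: x (n - 1) v) + - n *: y (n - 1) v).
by rewrite scalerDr !scalerA mulrC.
Qed.

Lemma ddzZ (k : C) (x : field) : ddz (k *: x) = k *: ddz x.
Proof.
apply/funext => n; apply/funext => v.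
by rewrite -[LHS]/(- n *: (k *: x (n - 1) v)) -[RHS]/(k *: (- n *: x (n - 1) v)) !scalerA mulrC.
Qed.

Definition Dm (b : h) (x : field) : field := ddz x - act b (-1) x.

Lemma S_Dm q b x : S q x -> S q (Dm b x).
Proof.
move=> hx; rewrite /Dm addrC -scaleN1r; apply: S_lin; [exact: S_act|exact: S_ddz].
Qed.

Lemma DmZ q b (k : C) x : S q x -> Dm b (k *: x) = k *: Dm b x.
Proof. by move=> hx; rewrite /Dm ddzZ (actZ _ _ _ hx) scalerBr. Qed.

Section Pair.
Variables (a b : h).
Hypotheses (ha : in_lattice L a) (hb : in_lattice L b).
Let hab := latticeD ha hb.

Lemma parD : par (a + b) = par a (+) par b.
Proof. by apply: lparityD; exact: ls_int. Qed.

(** D is a derivation and D X_b = b(-1) X_b. When b(-1) is moved out of the product it cancels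
    against the subtracted term, and its commutator with X_a adds (a|b) to the factor m. *)
Lemma Dm_XX (m : int) : Dm b (op_prod (par a) (par b) m (X a) (X b)) =
  - ((m + toint (bf a b))%:~R : C) *: op_prod (par a) (par b) (m - 1) (X a) (X b).
Proof.
have [N hN] := S_local (S_X ha) (S_X hb).
rewrite /Dm (ddz_op_prod (S_fld (S_X ha)) (S_fld (S_X hb)) hN) (ls_DX hL) // act_X_comm //; last exact: S_X.
rewrite [-1 + m]addrC bfC opprD addrA; set P := op_prod _ _ m _ _.
rewrite [P - _]addrC addrK -!scaleNr -scalerDl.
by congr (_ *: _); rewrite rmorphD /= tointK ?opprD //; apply: ls_int.
Qed.

Lemma XX_prod (n : nat) : op_prod (par a) (par b) (- toint (bf a b) - n%:Z - 1) (X a) (X b) =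
  kap a b *: ((n`!)%:R^-1 *: iter n (Dm b) (X (a + b))).
Proof.
elim: n => [|n IH]; first by rewrite subr0 (ls_XX hL) // fact0 invr1 scale1r.
have hS : S (par (a + b)) (iter n (Dm b) (X (a + b))).
  by elim: n {IH} => [|n IH]; [exact: S_X|exact: S_Dm].
have := Dm_XX (- toint (bf a b) - n%:Z - 1); rewrite {1}IH scalerA (DmZ _ _ hS).
have -> : - ((- toint (bf a b) - n%:Z - 1 + toint (bf a b))%:~R : C) = n.+1%:R.
  by rewrite -rmorphN /= pmulrn; congr (_%:~R); lia.
have -> : - toint (bf a b) - n%:Z - 1 - 1 = - toint (bf a b) - n.+1%:Z - 1 by lia.
have hn := natf_neq0 R n.
move=> e; apply: (scalerI hn); rewrite -e !scalerA /=; congr (_ *: _).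
by rewrite factS natrM invfM; move: (n`!%:R^-1) (n.+1%:R) hn => f u hu; field.
Qed.

End Pair.

Lemma lattice_span (P : h -> Prop) : (forall a, in_lattice L a -> P a) -> P 0 ->
  (forall (k : C) a b, P a -> P b -> P (k *: a + b)) -> forall a, P a.
Proof.
move=> Pl P0 PD a; have := @coord_basis _ _ _ _ (lbasis L) a (lbasisP L) (memvf a) => ->.
elim/big_ind: _ => // [x y hx hy|i _]; first by rewrite -[x]scale1r; exact: PD.
rewrite -[_ *: _]addr0; apply: PD => //; apply: Pl.
exists (fun j => (j == i)%:Z); rewrite (bigD1 i) //= eqxx mulr1z big1 ?addr0 => [|j /negPf ->].
  by rewrite (tnth_nth 0).
by rewrite mulr0z.
Qed.

Lemma ddz_vac : ddz vac = 0.
Proof.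
apply/funext => n; apply/funext => v; rewrite /ddz /vac_op subr_eq addNr.
by case: eqP => [->|_]; rewrite ?oppr0 ?scale0r ?scaler0.
Qed.

Lemma act_vac a : act a (-1) vac = A a.
Proof. by have := op_prod_vacr_lt0 false 0 (S_fld (S_A a)); rewrite fact0 invr1 scale1r. Qed.

(** The case n = 1 of [XX_prod] for the pair b, -b, where X_0 is a multiple of 1: as D 1 = 0, only
    b(-1) 1 = [A b] remains. *)
Lemma A_XX b : in_lattice L b -> exists2 c, c != 0 &
  A b = c *: op_prod (par b) (par (- b)) (toint (bf b b) - 2) (X b) (X (- b)) /\
  op_prod (par b) (par (- b)) (toint (bf b b) - 1) (X b) (X (- b)) = c^-1 *: vac.
Proof.
move=> hb; have hnb := latticeN hb; have [e e0 eX] := ls_X0 hL.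
have bfE : toint (bf b (- b)) = - toint (bf b b).
  have [i hi] := ls_int hL hb hb; rewrite bfNr hi -(rmorphN _ i) /=; by rewrite !toint_int.
exists (kap b (- b) * e)^-1; first by rewrite invr_eq0 mulf_neq0 // (ls_kap hL).
have h0 := XX_prod hb hnb 0; have h1 := XX_prod hb hnb 1.
rewrite bfE subrr eX /= opprK subr0 in h0 h1.
split; last by rewrite invrK h0 fact0 invr1 scale1r scalerA.
have -> : toint (bf b b) - 2 = toint (bf b b) - 1%:Z - 1 by lia.
rewrite h1 invr1 scale1r (DmZ _ _ S_vac) /Dm ddz_vac sub0r.
rewrite (linN (act_linv_fun (-1) S_vac)) act_vac opprK !scalerA -mulrA mulVf ?scale1r //.
by rewrite mulf_neq0 // (ls_kap hL).
Qed.

(** By linearity b may be taken in the lattice, where [A b] is a product of X_b and X_(-b). The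
    modes of a pass through it with charges (a|b) and -(a|b), so the Heisenberg relations follow
    from those of the X_a. *)
Lemma act_A a b n : 0 <= n -> act a n (A b) = if n == 1 then bf a b *: vac else 0.
Proof.
move=> hn; move: b; apply: lattice_span.
- move=> b hb; have hnb := latticeN hb; have [c c0 [-> eV]] := A_XX hb.
  have hS := S_prod (toint (bf b b) - 2) (S_X hb) (S_X hnb).
  rewrite (actZ _ _ _ hS) (act_X_comm _ _ _ hb (S_X hnb)).
  case: n hn => [[|[|n]]|//] _ /=.
  + rewrite (ls_AX0 hL) // (prodZr _ _ (S_X hb) (S_X hnb)) add0r bfNr -scalerDl addNr scale0r scaler0 //.
  + rewrite (ls_AX hL) // (prod0r _ _ (S_X hb)) add0r.
    have -> : 1 + (toint (bf b b) - 2) = toint (bf b b) - 1 by lia.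
    by rewrite eV !scalerA mulrAC mulfV // mul1r.
  + rewrite (ls_AX hL) // (prod0r _ _ (S_X hb)) add0r (ls_XX0 hL) ?scaler0 //.
    have [i hi] := ls_int hL hb hb; rewrite bfNr hi -(rmorphN _ i) /= !toint_int; lia.
- by have := lin0 (ls_A_lin hL) => ->; rewrite act_0; case: ifP => _ //; rewrite bf0r scale0r.
- move=> k b c hb hc; rewrite (ls_A_lin hL) (act_lin _ _ _ (S_A b) (S_A c)) hb hc.
  by case: ifP => _; rewrite ?scaler0 ?addr0 // bfDr bfZr scalerDl scalerA.
Qed.

Lemma act_act q a b (m n : int) x : S q x ->
  act a m (act b n x) = act b n (act a m x) + (if m + n == 0 then m%:~R * bf a b else 0) *: x.
Proof.
move=> hx; rewrite {1}/act {1}/act.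
have := act_comm a m n (S_A b) hx; rewrite /act => ->; congr (_ + _).
rewrite (@fsum_nat _ 2) => [|[|[|i]] // _]; last by rewrite -/(act a _ _) act_A // (prod0l _ _ hx) scaler0.
rewrite !big_ord_recl big_ord0 addr0 /= -!/(act a _ _) !act_A //= /bump /= (prod0l _ _ hx) scaler0 add0r.
rewrite gbin1 (prodZl _ _ S_vac hx) (op_prod_vacl _ _ (S_fld hx)).
have -> : (m + n - 1%Z == -1) = (m + n == 0) by lia.
by case: ifP => _; rewrite ?scaler0 ?scale0r ?scalerA ?addr0.
Qed.

Inductive Fock (al : h) : field -> Prop :=
| fock_X : Fock al (X al)
| fock_0 : Fock al 0
| fock_lin (k : C) x y : Fock al x -> Fock al y -> Fock al (k *: x + y)
| fock_act a n x : Fock al x -> Fock al (act a n x).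

Lemma fockZ al (k : C) x : Fock al x -> Fock al (k *: x).
Proof. by move=> hx; rewrite -[_ *: _]addr0; apply: fock_lin => //; exact: fock_0. Qed.
Lemma fockD al x y : Fock al x -> Fock al y -> Fock al (x + y).
Proof. by move=> hx hy; rewrite -[x]scale1r; exact: fock_lin. Qed.
Lemma fockB al x y : Fock al x -> Fock al y -> Fock al (x - y).
Proof. by move=> hx hy; rewrite addrC -scaleN1r; exact: fock_lin. Qed.

Lemma fock_S al x : in_lattice L al -> Fock al x -> S (par al) x.
Proof.
move=> hal; elim=> [||k y z _ hy _ hz|a n y _ hy]; [exact: S_X|exact: S_0|exact: S_lin|exact: S_act].
Qed.

Lemma fock_ddz al x : in_lattice L al -> Fock al x -> Fock al (ddz x).
Proof.
move=> hal; elim=> [||k y z hy hy' hz hz'|a n y hy hy'].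
- by rewrite (ls_DX hL) //; apply: fock_act; exact: fock_X.
- have -> : ddz (0 : field) = 0 by have := ddzZ 0 0; rewrite !scale0r.
  exact: fock_0.
- by rewrite ddz_lin; exact: fock_lin.
- rewrite (ddz_act _ _ (fock_S hal hy)); apply: fockB; first exact: fock_act.
  by apply: fockZ; exact: fock_act.
Qed.

Lemma fock_fsum al (T : choiceType) (D : set T) (f : T -> field) :
  (forall i, Fock al (f i)) -> Fock al (\sum_(i \in D) f i).
Proof.
by move=> hf; elim/big_ind: _ => [|x y hx hy|i _]; [exact: fock_0|exact: fockD|exact: hf].
Qed.

Lemma fock_XX al be n : in_lattice L al -> in_lattice L be ->
  Fock (al + be) (op_prod (par al) (par be) n (X al) (X be)).
Proof.
move=> hal hbe; have [hn|hn] := leP (- toint (bf al be)) n; first by rewrite (ls_XX0 hL) //; exact: fock_0.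
have -> : n = - toint (bf al be) - (absz (- toint (bf al be) - n - 1)%R)%:Z - 1 by lia.
rewrite XX_prod //; apply: fockZ; apply: fockZ.
elim: (absz _) => [|k IH]; first exact: fock_X.
have hab := latticeD hal hbe.
by apply: fockB; [exact: fock_ddz|exact: fock_act].
Qed.

(** Modes on the right factor are pulled out by [act_X_comm], those on the left factor by the
    associativity identity, down to products of two X. *)
Lemma fock_prod al be x y n : in_lattice L al -> in_lattice L be -> Fock al x -> Fock be y ->
  Fock (al + be) (op_prod (par al) (par be) n x y).
Proof.
move=> hal hbe hx; elim: hx n y => [||k x1 x2 h1 IH1 h2 IH2|a m x' hx' IH] n y hy.
- elim: hy n => [||k y1 y2 h1 IH1 h2 IH2|a m y' hy' IH] n; first exact: fock_XX.
  + by rewrite (prod0r _ _ (S_X hal)); exact: fock_0.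
  + by rewrite (prod_linr _ _ (S_X hal) (fock_S hbe h1) (fock_S hbe h2)); apply: fock_lin.
  + have -> : op_prod (par al) (par be) n (X al) (act a m y') = act a m (op_prod (par al) (par be) n (X al) y') -
      bf a al *: op_prod (par al) (par be) (m + n) (X al) y'.
      by rewrite (act_X_comm _ _ _ hal (fock_S hbe hy')) addrK.
    by apply: fockB; [apply: fock_act|apply: fockZ].
- by rewrite (prod0l _ _ (fock_S hbe hy)); exact: fock_0.
- by rewrite (prod_linl _ _ (fock_S hal h1) (fock_S hal h2) (fock_S hbe hy)); apply: fock_lin; [exact: IH1|exact: IH2].
- have := family_assoc S_family m n (S_A a) (fock_S hal hx') (fock_S hbe hy).
  rewrite expr0 scale1r => e; rewrite -[op_prod _ _ _ _ _]/(op_prod (false (+) par al) (par be) n (op_prod false (par al) m (A a) x') y) e.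
  apply: fockB; apply: fock_fsum => i; apply: fockZ.
    by apply: (@fock_act _ a (m - i%:Z)); exact: IH.
  by apply: IH; apply: (@fock_act _ a (m - i)).
Qed.

Inductive spanned (q : bool) : field -> Prop :=
| sp_0 : spanned q 0
| sp_lin (k : C) x y : spanned q x -> spanned q y -> spanned q (k *: x + y)
| sp_fock al x : in_lattice L al -> par al = q -> Fock al x -> spanned q x.

Lemma spanned_S q x : spanned q x -> S q x.
Proof.
elim=> [|k y z _ hy _ hz|al y hal <- hy]; [exact: S_0|exact: S_lin|exact: fock_S].
Qed.

Lemma par0 : par 0 = false.
Proof. by rewrite /lparity bf0l -[0 : C]/(0%:~R) toint_int. Qed.

Lemma fock_vac : Fock 0 vac.
Proof.
have [e e0 eX] := ls_X0 hL; rewrite -[vac]scale1r -(mulVf e0) -scalerA -eX.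
by apply: fockZ; exact: fock_X.
Qed.

Lemma fock_A a : Fock 0 (A a).
Proof. by rewrite -act_vac; apply: fock_act; exact: fock_vac. Qed.

Lemma S_spanned q x : S q x -> spanned q x.
Proof.
elim=> {q x} [q x [[-> ->]|[a [ha -> ->]]|[a [-> ->]]]|q|q k x y _ hx _ hy|q r n N x y _ hx _ hy _].
- by apply: (@sp_fock _ 0); [exact: lattice0|exact: par0|exact: fock_vac].
- by apply: (@sp_fock _ a) => //; exact: fock_X.
- by apply: (@sp_fock _ 0); [exact: lattice0|exact: par0|exact: fock_A].
- exact: sp_0.
- exact: sp_lin.
elim: hx => [|k x1 x2 h1 IH1 h2 IH2|al x' hal <- hx'].
- by rewrite (prod0l _ _ (spanned_S hy)); exact: sp_0.
- by rewrite (prod_linl _ _ (spanned_S h1) (spanned_S h2) (spanned_S hy)); exact: sp_lin.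
elim: hy => [|k y1 y2 h1 IH1 h2 IH2|be y' hbe <- hy'].
- by rewrite (prod0r _ _ (fock_S hal hx')); exact: sp_0.
- by rewrite (prod_linr _ _ (fock_S hal hx') (spanned_S h1) (spanned_S h2)); exact: sp_lin.
apply: (@sp_fock _ (al + be)); [exact: latticeD|exact: parD|exact: fock_prod].
Qed.

Lemma spanned_fsum q x : spanned q x -> exists y : h -> field, [/\ fin y, x = fsum y &
  forall al, y al = 0 \/ [/\ in_lattice L al, par al = q & Fock al (y al)]].
Proof.
elim=> [|k x1 x2 _ [y1 [f1 -> h1]] _ [y2 [f2 -> h2]]|al x' hal hp hx'].
- exists (fun=> 0); split; [by exists [::]|by rewrite fsum0|by left].
- exists (fun al => k *: y1 al + y2 al); split.
  + by apply: finD => //; exact: (finZ (fun=> k)).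
  + by rewrite fsumZ // fsumD //; exact: (finZ (fun=> k)).
  move=> al; have [e1|[a1 b1 c1]] := h1 al; have [e2|[a2 b2 c2]] := h2 al.
  + by left; rewrite e1 e2 scaler0 addr0.
  + by right; split => //; rewrite e1 scaler0 add0r.
  + by right; split => //; rewrite e2 addr0; exact: fockZ.
  + by right; split => //; exact: fock_lin.
- exists (fun be => if be == al then x' else 0); split.
  + by exists [:: al] => be; rewrite inE; case: ifP.
  + by rewrite (@fsum1 _ _ al) ?eqxx // => be /eqP/negPf ->.
  + by move=> be; case: eqP => [->|_]; [right|left].
Qed.

Lemma act0_fock al a x : in_lattice L al -> Fock al x -> act a 0 x = bf a al *: x.
Proof.
move=> hal; elim=> [||k y z hy IHy hz IHz|b n y hy IHy].
- exact: ls_AX0.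
- by rewrite act_0 scaler0.
- by rewrite (act_lin _ _ _ (fock_S hal hy) (fock_S hal hz)) IHy IHz scalerDr !scalerA mulrC.
- rewrite (act_act _ _ _ _ (fock_S hal hy)) IHy (actZ _ _ _ (fock_S hal hy)) mul0r if_same scale0r addr0 //.
Qed.

(** A space that contains both parities and on which every [act a n] is linear. [S_direct] needs it
    because it subtracts an odd element from an even one. *)
Definition actable (x : field) : Prop := isfld x /\ forall a, exists N, local false false N (A a) x.

Lemma S_actable q x : S q x -> actable x.
Proof.
by move=> hx; split; [exact: S_fld hx|move=> a; have [N hN] := S_local (S_A a) hx; exists N].
Qed.

Lemma actable_lin (k : C) x y : actable x -> actable y -> actable (k *: x + y).
Proof.
move=> [fx hx] [fy hy]; split; first exact: isfld_lin.
move=> a; have [N hN] := hx a; have [M hM] := hy a; exists (N + M)%N.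
apply: local_sym; apply: local_linl; first exact: S_fld (S_A a).
  by apply: local_sym; apply: (local_le _ hN); lia.
by apply: local_sym; apply: (local_le _ hM); lia.
Qed.

Lemma actable_act_lin a n (k : C) x y : actable x -> actable y ->
  act a n (k *: x + y) = k *: act a n x + act a n y.
Proof.
move=> [fx hx] [fy hy]; have [N hN] := hx a; have [M hM] := hy a.
apply: (@op_prod_linr _ _ _ _ _ (N + M)%N) => //; first exact: S_fld (S_A a).
  by apply: (local_le _ hN); lia.
by apply: (local_le _ hM); lia.
Qed.

Lemma charge_sep (al be : h) : al != be -> exists a, bf a al != bf a be.
Proof.
move=> hne; apply: contrapT => /forallNP hn; case/negP: hne; rewrite -subr_eq0; apply/eqP.
apply: (@bform_nondeg _ _ _ L) => b; rewrite bfC bfDr bfNr; apply/eqP; rewrite subr_eq0.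
by apply: contrapT => hc; apply: (hn b); apply/negP.
Qed.

Lemma charge_proj (P Q : field -> Prop) (y : h -> field) : P 0 ->
  (forall (k : C) x z, P x -> P z -> P (k *: x + z)) -> (forall x, P x -> actable x) -> Q 0 ->
  (forall (k : C) x z, Q x -> Q z -> Q (k *: x + z)) -> (forall a x, P x -> Q x -> Q (act a 0 x)) ->
  fin y -> (forall al, P (y al)) -> (forall al, y al = 0 \/ in_lattice L al /\ Fock al (y al)) ->
  Q (fsum y) -> forall al, Q (y al).
Proof.
move=> P0 Plin Pact Q0 Qlin Qact [s hs] Py hy.
rewrite (fsumE hs) => hQ al; have [als|als] := boolP (al \in undup s); last first.
  suff -> : y al = 0 by [].
  by apply: contrapT => /hs; rewrite -mem_undup (negPf als).
apply: (@eigen_proj _ _ P Q h h (fun a x => act a 0 x) (fun a al => bf a al) P0 Plin _ Q0 Qlin Qact (undup s) y) => //.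
- by move=> a c x z /Pact hx /Pact hz; exact: actable_act_lin.
- exact: undup_uniq.
- move=> be a _; have [->|[hb1 hb2]] := hy be; first by rewrite act_0 scaler0.
  exact: act0_fock.
- by move=> be ga _ _; exact: charge_sep.
Qed.

(** The charge determines the parity. If an even sum equals an odd one, their components of equal
    charge agree by [charge_proj], and at each charge one of the two is zero. *)
Lemma S_direct x : S false x -> S true x -> x = 0.
Proof.
move=> /S_spanned/spanned_fsum[y [fy -> hy]] /S_spanned/spanned_fsum[z [fz e hz]].
suff hyz al : y al - z al = 0.
  apply: fsum0 => al; have := hyz al; have [//|[_ py _]] := hy al; have [->|[_ pz _]] := hz al; first by rewrite subr0.
  by rewrite py in pz.
apply: (@charge_proj actable (fun x => x = 0) (fun al => y al - z al)) => //.
- exact: S_actable (S_0 false).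
- exact: actable_lin.
- by move=> k x1 x2 -> ->; rewrite scaler0 addr0.
- by move=> a x1 _ ->; rewrite act_0.
- by apply: finD => //; exact: finN.
- move=> be; rewrite addrC -scaleN1r; apply: actable_lin.
    by have [->|[b1 _ b2]] := hz be; [exact: S_actable (S_0 false)|exact: S_actable (fock_S b1 b2)].
  by have [->|[b1 _ b2]] := hy be; [exact: S_actable (S_0 false)|exact: S_actable (fock_S b1 b2)].
- move=> be; have [->|[b1 py b2]] := hy be; have [->|[c1 pz c2]] := hz be.
  + by left; rewrite subrr.
  + by right; split => //; apply: fockB => //; exact: fock_0.
  + by right; split => //; rewrite subr0.
  + by rewrite py in pz.
by rewrite fsumB // e subrr.
Qed.

Lemma dual_basis : exists u v : 'I_l -> h, forall a, a = \sum_i bf (v i) a *: u i.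
Proof.
pose e i := tnth (lbasis L) i; pose M : 'M[C]_l := \matrix_(i, j) bf (e i) (e j).
have hb := lbasisP L.
have eE a : a = \sum_i coord (lbasis L) i a *: e i.
  rewrite {1}(@coord_basis _ _ _ _ (lbasis L) a hb (memvf a)); apply: eq_bigr => i _.
  by rewrite /e (tnth_nth 0).
have Mu : M \in unitmx.
  rewrite -row_free_unit -kermx_eq0; apply/rowV0P => w /sub_kermxP hw.
  have hx : \sum_i w 0 i *: e i = 0.
    apply: (@bform_nondeg _ _ _ L) => b; rewrite (eE b) bf_sumr big1 // => j _.
    have hwj : (w *m M) 0 j = 0 by rewrite hw mxE.
    rewrite bfZr bf_suml (_ : \sum_i _ = 0) ?mulr0 // -[RHS]hwj mxE.
    by apply: eq_bigr => i _; rewrite bfZl mxE.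
  apply/rowP => i; rewrite mxE.
  have /freeP/(_ (w 0)) := basis_free hb; apply; rewrite -[RHS]hx; apply: eq_bigr => j _.
  by rewrite /e (tnth_nth 0).
have hv i k : bf (\sum_j invmx M i j *: e j) (e k) = (i == k)%:R.
  rewrite bf_suml; transitivity ((invmx M *m M) i k); last by rewrite mulVmx // mxE.
  by rewrite mxE; apply: eq_bigr => j _; rewrite bfZl mxE.
exists e, (fun i => \sum_j invmx M i j *: e j) => a; rewrite {1}(eE a); apply: eq_bigr => i _.
congr (_ *: _); rewrite [in RHS](eE a) bf_sumr; apply: esym.
rewrite (eq_bigr (fun k => coord (lbasis L) k a * (i == k)%:R)) => [|k _]; last by rewrite bfZr hv.
rewrite (bigD1 i) //= eqxx mulr1 big1 ?addr0 // => k /negPf ki.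
by rewrite eq_sym ki mulr0.
Qed.

Section Simplicity.
Variable al : h.
Hypothesis hal : in_lattice L al.

(* [Hom k] is spanned by the products of [k] creation operators applied to [X al]. *)
Inductive Hom : nat -> field -> Prop :=
| hom_X : Hom 0 (X al)
| hom_0 k : Hom k 0
| hom_lin k (c : C) x y : Hom k x -> Hom k y -> Hom k (c *: x + y)
| hom_act k a (n : nat) x : Hom k x -> Hom k.+1 (act a (- n.+1%:Z) x).

Lemma homZ k (c : C) x : Hom k x -> Hom k (c *: x).
Proof. by move=> hx; rewrite -[_ *: _]addr0; apply: hom_lin => //; exact: hom_0. Qed.
Lemma homD k x y : Hom k x -> Hom k y -> Hom k (x + y).
Proof. by move=> hx hy; rewrite -[x]scale1r; exact: hom_lin. Qed.

Lemma hom_fock k x : Hom k x -> Fock al x.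
Proof.
elim=> [|k'|k' c y z _ hy _ hz|k' a n y _ hy]; [exact: fock_X|exact: fock_0|exact: fock_lin|exact: fock_act].
Qed.

Lemma hom_S k x : Hom k x -> S (par al) x.
Proof. by move=> /hom_fock; exact: fock_S. Qed.

Lemma hom_lower k x : Hom k x -> forall b (m : nat),
  if k is k'.+1 then Hom k' (act b m.+1%:Z x) else act b m.+1%:Z x = 0.
Proof.
elim=> [|k'|k' c y z hy IHy hz IHz|k' a n y hy IHy] b m.
- by rewrite (ls_AX hL).
- by rewrite act_0; case: k' => // k'; exact: hom_0.
- rewrite (act_lin _ _ _ (hom_S hy) (hom_S hz)); move: (IHy b m) (IHz b m).
  by case: k' {hy IHy hz IHz} => [-> ->|k' h1 h2]; [rewrite scaler0 addr0|exact: hom_lin].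
- rewrite (act_act _ _ _ _ (hom_S hy)); apply: homD; last exact: homZ.
  move: (IHy b m); case: k' hy {IHy} => [_ ->|k' _]; first by rewrite act_0; exact: hom_0.
  exact: hom_act.
Qed.

Lemma hom0_line x : Hom 0 x -> exists c : C, x = c *: X al.
Proof.
move E : 0%N => k hx; elim: hx E => {k x} [|k|k c y z _ IHy _ IHz|//] E.
- by exists 1; rewrite scale1r.
- by exists 0; rewrite scale0r.
- have [c1 ->] := IHy E; have [c2 ->] := IHz E.
  by exists (c * c1 + c2); rewrite scalerA -scalerDl.
Qed.

Inductive graded : field -> Prop :=
| gr_0 : graded 0
| gr_lin (c : C) x y : graded x -> graded y -> graded (c *: x + y)
| gr_hom k x : Hom k x -> graded x.

Lemma graded_S x : graded x -> S (par al) x.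
Proof. by elim=> [|c y z _ hy _ hz|k y]; [exact: S_0|exact: S_lin|exact: hom_S]. Qed.

Lemma graded_act a n x : graded x -> graded (act a n x).
Proof.
elim=> [|c y z hy IHy hz IHz|k y hy].
- by rewrite act_0; exact: gr_0.
- by rewrite (act_lin _ _ _ (graded_S hy) (graded_S hz)); exact: gr_lin.
case: n => [[|n]|n].
- by rewrite (act0_fock _ hal (hom_fock hy)); apply: (@gr_hom k); exact: homZ.
- have := hom_lower hy a n; case: k hy => [_ ->|k _ hn]; first exact: gr_0.
  exact: gr_hom hn.
- by rewrite NegzE; apply: (@gr_hom k.+1); exact: hom_act.
Qed.

Lemma fock_graded x : Fock al x -> graded x.
Proof.
elim=> [||c y z _ hy _ hz|a n y _ hy]; [|exact: gr_0|exact: gr_lin|exact: graded_act].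
by apply: (@gr_hom 0%N); exact: hom_X.
Qed.

Lemma graded_fsum x : graded x -> exists z : nat -> field, [/\ fin z, x = fsum z & forall k, Hom k (z k)].
Proof.
elim=> [|c x1 x2 _ [y1 [f1 -> h1]] _ [y2 [f2 -> h2]]|k y hy].
- by exists (fun=> 0); split; [exists [::]|rewrite fsum0|move=> k; exact: hom_0].
- exists (fun k => c *: y1 k + y2 k); split.
  + by apply: finD => //; exact: (finZ (fun=> c)).
  + by rewrite fsumZ // fsumD //; exact: (finZ (fun=> c)).
  by move=> k; exact: hom_lin.
- exists (fun k' => if k' == k then y else 0); split.
  + by exists [:: k] => k'; rewrite inE; case: ifP.
  + by rewrite (@fsum1 _ _ k) ?eqxx // => k' /eqP/negPf ->.
  + by move=> k'; case: eqP => [->|_]; [|exact: hom_0].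
Qed.

Variables (u v : 'I_l -> h).
Hypothesis huv : forall a, a = \sum_i bf (v i) a *: u i.

(* For dual bases [u], [v] and large [d] this acts on [Hom k] by the scalar [k]; hence
   an element killed by all annihilation operators is a multiple of [X al]. *)
Definition euler (d : nat) (x : field) : field :=
  \sum_(n < d) \sum_(i < l) ((n : nat).+1%:R : C)^-1 *: act (u i) (- (n : nat).+1%:Z) (act (v i) (n : nat).+1%:Z x).

Lemma euler_lin d q (c : C) x y : S q x -> S q y -> euler d (c *: x + y) = c *: euler d x + euler d y.
Proof.
move=> hx hy; rewrite /euler scaler_sumr -big_split /=; apply: eq_bigr => n _.
rewrite scaler_sumr -big_split /=; apply: eq_bigr => i _.
rewrite (act_lin _ _ _ hx hy) (act_lin _ _ _ (S_act _ _ hx) (S_act _ _ hy)).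
by rewrite scalerDr !scalerA mulrC.
Qed.

Lemma act_sum a n q (I : Type) (r : seq I) (f : I -> field) : (forall i, S q (f i)) ->
  act a n (\sum_(i <- r) f i) = \sum_(i <- r) act a n (f i).
Proof.
move=> hf; elim: r => [|i r IH]; first by rewrite !big_nil act_0.
have hs : S q (\sum_(j <- r) f j).
  by elim/big_ind: _ => [|x y hx hy|j _]; [exact: S_0|rewrite -[x]scale1r; exact: S_lin|exact: hf].
by rewrite !big_cons -{1}[f i]scale1r (act_lin _ _ _ (hf i) hs) scale1r IH.
Qed.

Lemma euler_hom k x : Hom k x -> exists d0, forall d, (d0 <= d)%N -> euler d x = (k%:R : C) *: x.
Proof.
elim=> {k x} [|k|k c y z hy [d1 IHy] hz [d2 IHz]|k a m x hx [d0 IH]].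
- exists 0%N => d _; rewrite scale0r /euler big1 // => n _; rewrite big1 // => i _.
  by rewrite (ls_AX hL) // act_0 scaler0.
- exists 0%N => d _; rewrite scaler0 /euler big1 // => n _; rewrite big1 // => i _.
  by rewrite !act_0 scaler0.
- exists (d1 + d2)%N => d hd; rewrite (euler_lin _ _ (hom_S hy) (hom_S hz)) IHy ?IHz; [|lia|lia].
  by rewrite scalerDr !scalerA mulrC.
exists (d0 + m.+1)%N => d hd; have hS := hom_S hx.
pose t (n : nat) i := ((n.+1%:R : C)^-1 *: act (u i) (- n.+1%:Z) (act (v i) n.+1%:Z x)).
have ht n i : S (par al) (t n i) by apply: S_Z; apply: S_act; exact: S_act.
(* Commuting the annihilation operators past a(-m-1) leaves one extra term, at n = m. The dual bases
   reassemble it into a(-m-1) x, which raises the eigenvalue by one. *)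
have -> : euler d (act a (- m.+1%:Z) x) = \sum_(n < d) \sum_(i < l) (act a (- m.+1%:Z) (t n i) +
    (if (n : nat) == m then bf (v i) a *: act (u i) (- m.+1%:Z) x else 0)).
  apply: eq_bigr => n _; apply: eq_bigr => i _.
  rewrite (act_act _ _ _ _ hS) -[act a _ _]scale1r (act_lin _ _ _ (S_act _ _ (S_act _ _ hS)) (S_Z _ hS)) scale1r.
  rewrite (act_act _ _ _ _ (S_act _ _ hS)) (_ : (- n.+1%:Z + - m.+1%:Z == 0) = false); last by lia.
  rewrite scale0r addr0 (actZ _ _ _ hS) scalerDr /t (actZ _ _ _ (S_act _ _ (S_act _ _ hS))); congr (_ + _).
  case: (eqVneq (n : nat) m) => [->|nm].
    by rewrite subrr eqxx scalerA mulrA -pmulrn mulVf ?mul1r // natf_neq0.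
  by rewrite ifF ?scale0r ?scaler0 //; apply/negP; move/eqP: nm; lia.
under eq_bigr do rewrite big_split /= -(act_sum _ _ _ (ht _)).
have hts n : S (par al) (\sum_(i < l) t n i).
  by elim/big_ind: _ => [|y z hy hz|j _]; [exact: S_0|rewrite -[y]scale1r; exact: S_lin|exact: ht].
rewrite big_split /= -(act_sum a (- m.+1%:Z) (index_enum 'I_d) (fun n : 'I_d => hts n)).
rewrite -/(euler d x) IH; last by lia.
have md : (m < d)%N by lia.
rewrite (actZ _ _ _ hS) (bigD1 (Ordinal md)) //= eqxx [X in _ + (_ + X)]big1 ?addr0; last first.
  by move=> n nm; rewrite big1 // => i _; rewrite ifF //; apply: contraNF nm => /eqP nm; apply/eqP/val_inj.
have -> : \sum_(i < l) bf (v i) a *: act (u i) (- m.+1%:Z) x = act a (- m.+1%:Z) x.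
  rewrite [in RHS](huv a) (lin_sum (act_linv_fun (- m.+1%:Z) hS)).
  by apply: eq_bigr => i _; rewrite (linZ (act_linv_fun (- m.+1%:Z) hS)).
by rewrite -[k.+1]addn1 natrD scalerDl scale1r.
Qed.

Variable I : field -> Prop.
Hypotheses (I0 : I 0) (I_lin : forall (c : C) x y, I x -> I y -> I (c *: x + y)).
Hypothesis I_act : forall a n x, S (par al) x -> I x -> I (act a n x).

Lemma idealZ (c : C) x : I x -> I (c *: x).
Proof. by move=> hx; rewrite -[_ *: _]addr0; apply: I_lin. Qed.

Lemma euler_ideal d x : S (par al) x -> I x -> I (euler d x).
Proof.
move=> hS hx; rewrite /euler; elim/big_ind: _ => [//|y z hy hz|n _].
  by rewrite -[y]scale1r; exact: I_lin.
elim/big_ind: _ => [//|y z hy hz|i _]; first by rewrite -[y]scale1r; exact: I_lin.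
by apply: idealZ; apply: I_act; [exact: S_act|exact: I_act].
Qed.

(** The Euler operator multiplies a nonzero element of degree k+1 by a nonzero scalar, so some
    annihilation operator does not kill it; descent ends at a multiple of [X al]. *)
Lemma hom_ideal k x : Hom k x -> I x -> x <> 0 -> I (X al).
Proof.
elim: k x => [|k IH] x hx Ix x0.
  have [c ex] := hom0_line hx; have c0 : c != 0 by apply/eqP => c0; apply: x0; rewrite ex c0 scale0r.
  by have := idealZ c^-1 Ix; rewrite ex scalerA mulVf // scale1r.
have [d /(_ d (leqnn _)) ed] := euler_hom hx.
have [n [i hni]] : exists (n : nat) i, act (v i) n.+1%:Z x <> 0.
  apply: contrapT => hno; apply: x0; apply: (scalerI (natf_neq0 R k)); rewrite -ed scaler0 /euler.
  rewrite big1 // => n _; rewrite big1 // => i _.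
  have -> : act (v i) (n : nat).+1%:Z x = 0 by apply: contrapT => hh; apply: hno; exists n, i.
  by rewrite act_0 scaler0.
apply: (IH (act (v i) n.+1%:Z x)) => //; first exact: hom_lower hx (v i) n.
by apply: I_act => //; exact: hom_S hx.
Qed.

Lemma fock_ideal x : Fock al x -> I x -> x <> 0 -> I (X al).
Proof.
move=> /fock_graded/graded_fsum[z [[s hs] -> hz]] Ix x0.
have [k hk] : exists k, z k <> 0 by apply: contrapT => hno; apply: x0; apply: fsum0 => k; apply: contrapT => hk; apply: hno; exists k.
apply: (hom_ideal (hz k)) => //.
(* Each component has the right eigenvalue for all large [d], so one [d] serves the finitely many
   components. *)
have [d hd] : exists d, forall k, k \in s -> euler d (z k) = (k%:R : C) *: z k.
  elim: (s) => [|k1 s1 [d1 IH]]; first by exists 0%N.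
  have [d2 h2] := euler_hom (hz k1).
  suff [d hd] : exists d, forall d', (d <= d')%N -> forall k, k \in k1 :: s1 -> euler d' (z k) = (k%:R : C) *: z k.
    by exists d; exact: hd.
  clear d1 IH; elim: s1 => [|k3 s3 [d3 IH]].
    by exists d2 => d' hd' k'; rewrite inE => /eqP ->; exact: h2.
  have [d4 h4] := euler_hom (hz k3); exists (d3 + d4)%N => d' hd' k'.
  rewrite !inE orbCA => /orP[/eqP ->|hk']; first by apply: h4; lia.
  by apply: IH; [lia|rewrite inE].
have ks : k \in undup s by rewrite mem_undup; exact: hs.
apply: (@eigen_proj _ _ (Fock al) I unit nat (fun _ => euler d) (fun _ k => k%:R) _ _ _ _ _ _ (undup s) z) => //.
- exact: fock_0.
- exact: fock_lin.
- by move=> _ c y w hy hw; apply: (euler_lin _ _ (fock_S hal hy) (fock_S hal hw)).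
- by move=> _ y hy; apply: euler_ideal; exact: fock_S hy.
- exact: undup_uniq.
- by move=> k' _; exact: hom_fock (hz k').
- by move=> k' _; rewrite mem_undup; exact: hd.
- by move=> i j _ _ ij; exists tt; rewrite eqr_nat.
- by rewrite -(fsumE hs).
Qed.

End Simplicity.

(** Projection to one charge and descent in the Fock space put some X_al into [I]; the leading
    product with X_(-al) is a nonzero multiple of the identity. All factors are applied from the
    left. *)
Lemma S_simple (I : field -> Prop) q z : I 0 -> (forall (c : C) x y, I x -> I y -> I (c *: x + y)) ->
  (forall p q n x y, S p x -> S q y -> I y -> I (op_prod p q n x y)) ->
  S q z -> I z -> z <> 0 -> I vac.
Proof.
move=> I0 I_lin I_prod hz Iz z0; have [u [v huv]] := dual_basis.
have I_act r a n x : S r x -> I x -> I (act a n x) by move=> hx Ix; exact: (I_prod _ _ n _ _ (S_A a) hx Ix).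
have [y [fy ez hy]] := spanned_fsum (S_spanned hz).
have Iy : forall al, I (y al).
  apply: (@charge_proj (S q) I y) => //.
  - exact: S_0.
  - by move=> k x1 x2; exact: S_lin.
  - by move=> x; exact: S_actable.
  - by move=> a x; exact: I_act.
  - by move=> al; have [->|[h1 <- h2]] := hy al; [exact: S_0|exact: fock_S].
  - by move=> al; have [->|[h1 _ h2]] := hy al; [left|right].
  - by rewrite -ez.
have [al hal0] : exists al, y al <> 0.
  by apply: contrapT => hno; apply: z0; rewrite ez; apply: fsum0 => al; apply: contrapT => hk; apply: hno; exists al.
have [//|[hal _ hF]] := hy al.
have IX : I (X al) by apply: (fock_ideal hal huv I0 I_lin _ hF (Iy al) hal0) => a n x; exact: I_act.
have hnal := latticeN hal.
have [e e0 eX] := ls_X0 hL.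
have := I_prod _ _ (- toint (bf (- al) al) - 1) _ _ (S_X hnal) (S_X hal) IX.
rewrite (ls_XX hL) // addNr eX scalerA => hI.
have k0 : kap (- al) al * e != 0 by rewrite mulf_neq0 // (ls_kap hL).
by have := I_lin (kap (- al) al * e)^-1 _ 0 hI I0; rewrite addr0 scalerA mulVf // scale1r.
Qed.

End System.
End LatticeSystems.

(** * The vertex operators of a Fock space as a lattice system *)

Section FockSystem.
Variables (R : realType) (l : nat) (h : vectType R[i]) (L : lattice_data l h).
Variables (G : cyclic_grading L) (eps : h -> h -> R[i]) (V : lmodType R[i]).
Variable F : fock_space G eps V.
Hypotheses (Heps : cocycle L eps) (Hi : integral_pairings G) (Hii : cocycle_condition G eps).
Hypotheses (Hdiag : h0_diagonalizable F) (Hdef : vertex_operators_defined F).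
Local Notation C := R[i].
Local Notation p := (gord G).
Local Notation bf := (bform L).
Local Notation om := (omega G).
Local Notation vac := (@vac_op R V).

(** With the sum of the modes fixed, the commutator is a linear function of the first mode, and its
    second difference vanishes. *)
Lemma heis_local a b : local false false 2 (heis_op F a) (heis_op F b).
Proof.
have hp := p_neq0 G; move=> n m v.
have h0 (c : h) x : heis_op F c x 0 = 0 by rewrite /heis_op; case: ifP => _ //; rewrite (lin0 (fh_lin _ _ _)).
have hn (x : C) (c : h) (j : nat) w : ~ is_int (p%:R * x) -> heis_op F c (x + j%:R) w = 0.
  move=> hx; rewrite /heis_op asboolF // => hi; apply: hx.
  rewrite -[p%:R * x](addrK (p%:R * j%:R)) -mulrDr; apply: is_intB => //.
  by rewrite -natrM; exact: is_int_nat.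
case: (pselect (is_int (p%:R * n))) => [[k hk]|hk]; last first.
  by rewrite big1 // => s _; rewrite !(hn _ a) // h0 scaler0 subrr scaler0.
case: (pselect (is_int (p%:R * m))) => [[k' hk']|hk']; last first.
  by rewrite big1 // => s _; rewrite !(hn _ b) // h0 scaler0 subrr scaler0.
have hE (x : C) (c : h) (k1 : int) (j : nat) w : p%:R * x = k1%:~R -> heis_op F c (x + j%:R) w = fh F (k1 + (p * j)%N%:Z) c w.
  move=> e; have e2 : p%:R * (x + j%:R) = (k1 + (p * j)%N%:Z)%:~R :> C by rewrite mulrDr e rmorphD /= -pmulrn natrM.
  by rewrite /heis_op e2 asboolT ?toint_int //; exact: is_int_int.
have eh (j : nat) : hpair G (k + (p * j)%N%:Z) a b = hpair G k a b.
  by apply: hpair_eq; rewrite addrAC subrr add0r dvdzE /= dvdn_mulr.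
rewrite (eq_bigr (fun s : 'I_3 => (((-1) ^+ (s : nat) * 'C(2, s)%:R) *
   (if k + k' + (p * 2)%N%:Z == 0 then (k%:~R + p%:R * (s : nat)%:R) / p%:R * hpair G k a b else 0)) *: v)); last first.
  move=> s _; rewrite (hE _ a _ _ _ hk) !(hE _ b _ _ _ hk') (hE _ a _ _ _ hk) expr0 scale1r fh_commE eh scalerA.
  have -> : k + (p * s)%N%:Z + (k' + (p * (2 - s))%N%:Z) = k + k' + (p * 2)%N%:Z.
    by rewrite addrACA -PoszD -mulnDr subnKC // -ltnS.
  by congr ((_ * _) *: _); case: ifP => // _; rewrite rmorphD /= -pmulrn natrM.
rewrite -scaler_suml; case: eqP => _; last by rewrite big1 ?scale0r // => s _; rewrite mulr0.
rewrite (_ : \sum_i _ = 0) ?scale0r // !big_ord_recl big_ord0 /= /bump /= bin0 bin1 binn.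
by rewrite !addn0 !addn1 expr0 expr1; field.
Qed.

Lemma heis_linear : linear (heis_op F).
Proof.
move=> k a b; apply/funext => n; apply/funext => v.
rewrite -[RHS]/(k *: heis_op F a n v + heis_op F b n v) /heis_op; case: ifP => _.
  exact: fh_linear_vec.
by rewrite scaler0 addr0.
Qed.

Lemma EE_zero v x : EE F 0 v x = if x == 0 then v else 0.
Proof.
have Em0 (j : int) w : j != 0 -> Emz F 0 j w = 0.
  move=> j0; have [jl|jg] := ltP j 0; first exact: Emz_lt0.
  have := expz_rec (expz_Emz F 0) (M := absz j) (j := j) w; rewrite big1 => [e|i _].
    have /e : j <= (absz j)%:Z by lia.
    by move/eqP; rewrite scaler_eq0 intr_eq0 (negPf j0) => /eqP.
  by rewrite /gm (lin0 (fh_linear_vec F _ _)) scaler0.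
have Ep0 (j : int) w : j != 0 -> Epz F 0 j w = 0.
  move=> j0; have [jl|jg] := ltP j 0; first exact: Epz_lt0.
  have := expz_rec (expz_Epz F 0) (M := absz j) (j := j) w; rewrite big1 => [e|i _].
    have /e : j <= (absz j)%:Z by lia.
    by move/eqP; rewrite scaler_eq0 intr_eq0 (negPf j0) => /eqP.
  by rewrite /gp (lin0 (fh_linear_vec F _ _)) scaler0.
rewrite /EE (@fsum1 _ _ 0) => [|j /eqP j0]; last by rewrite (Ep0 _ _ j0) (lin0 (Emzl _ _ _)).
rewrite addr0 (expz0 (expz_Epz F 0)); case: eqP => [->|/eqP x0]; first by rewrite (expz0 (expz_Emz F 0)).
exact: Em0.
Qed.

Lemma X_zero : X_op F 0 = eps 0 0 *: vac.
Proof.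
have h0 := lattice0 L; have eps0 : eps 0 0 != 0 by case: Heps => hz _; exact: hz.
apply/funext => n; apply/funext => v; rewrite -[RHS]/(eps 0 0 *: vac_op n v).
move: v; apply: (weight_ind Hdiag).
- by rewrite (lin0 (X_linear Hdiag Hdef _ h0)) /vac_op if_same scaler0.
- move=> x y hx hy; rewrite (linD (X_linear Hdiag Hdef _ h0)) hx hy -scalerDr /vac_op.
  by case: ifP => _; rewrite ?addr0.
move=> xi v hv; rewrite [n]modeN (X_weight Hdiag Hdef _ h0 hv); move: (- n - 1) => x.
have -> : weight_at xi 0 = 0 by rewrite /weight_at /gpart0 !linear0.
have -> : qf G 0 = 0 by rewrite /qf /gprime /gpart0 linear0 subr0 bf0l mul0r.
rewrite subr0 addr0 /zext /vac_op; have hp := p_neq0 G.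
have -> : (- x - 1 == -1) = (x == 0) by rewrite -subr_eq0 opprK subrK oppr_eq0.
have fe0 w : fe F 0 w = eps 0 0 *: w by rewrite -[in RHS](fe_unit F w) scalerA mulfV // scale1r.
case: asboolP => [[k hk]|hx].
  rewrite hk toint_int EE_zero; have -> : (k == 0) = (x == 0).
    by rewrite -(intr_eq0 C) -hk mulf_eq0 (negPf hp).
  by case: ifP => _; rewrite fe0.
rewrite ifF ?fe0 //; apply/eqP => x0; apply: hx; rewrite x0 mulr0; exact: (is_int_int R 0).
Qed.

Lemma kappa_neq0 a b : in_lattice L a -> in_lattice L b -> kappa G eps a b != 0.
Proof.
move=> ha hb; rewrite /kappa !mulf_neq0 ?expfz_neq0 ?p_neq0 //; first by case: Heps => hz _; exact: hz.
rewrite prodf_seq_neq0; apply/allP => s; rewrite mem_index_iota => /andP[s1 s2]; apply/implyP => _.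
apply: expfz_neq0; rewrite subr_eq0 eq_sym -(expr0 om) (eq_prim_root_expr (omega_prim G)) eqn_mod_dvd // subn0.
by apply/negP => /dvdn_leq; lia.
Qed.

Lemma fock_system : lattice_system L (X_op F) (heis_op F) (kappa G eps).
Proof.
split.
- split=> [q x|q r x y].
    move=> [[_ ->]|[a [ha _ ->]]|[a [_ ->]]]; [exact: isfld_vac|exact: (isfld_X Hdiag Hdef)|exact: isfld_heis].
  have Xf a : in_lattice L a -> isfld (X_op F a) by exact: (isfld_X Hdiag Hdef).
  have Af a := isfld_heis F a.
  move=> [[-> ->]|[a [ha -> ->]]|[a [-> ->]]] [[-> ->]|[b [hb -> ->]]|[b [-> ->]]].
  + by exists 0%N; apply: local_vac; exact: isfld_vac.
  + by exists 0%N; apply: local_vac; exact: Xf.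
  + by exists 0%N; apply: local_vac.
  + by exists 0%N; apply: local_sym; apply: local_vac; exact: Xf.
  + by exists (locality_order G a b); apply: (X_local Heps Hi Hii Hdiag Hdef) => // s; exact: locality_orderP.
  + by exists 1%N; apply: local_sym; exact: (heis_X_local Hdiag Hdef).
  + by exists 0%N; apply: local_sym; apply: local_vac.
  + by exists 1%N; exact: (heis_X_local Hdiag Hdef).
  + by exists 2; exact: heis_local.
- by move=> a b; exact: (bf_int Hi).
- exact: heis_linear.
- by move=> a b hb; exact: (heis_X_0 Hdiag Hdef a false hb).
- by move=> a b n hb hn; exact: (heis_X_ge1 Hdiag Hdef a false hb hn).
- by move=> b hb; exact: (ddz_X Hdiag Hdef false hb).
- by move=> a b n ha hb; exact: (X_prod_ge Heps Hi Hii Hdiag Hdef ha hb).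
- by move=> a b ha hb; exact: (X_prod_lead Heps Hi Hii Hdiag Hdef ha hb).
- exact: kappa_neq0.
- exists (eps 0 0); last exact: X_zero.
  by case: Heps => hz _; apply: hz; exact: lattice0.
Qed.

(** One side forms all products, the other only products of local fields; as all elements are local,
    they agree. The Heisenberg fields lie in the left side by [A_XX] for lattice vectors and by
    linearity for the others. *)
Lemma lattice_vsaE : lattice_vsa F = lclosure (gens L (X_op F) (heis_op F)).
Proof.
have hs := fock_system.
apply/funext => q; apply/funext => x; apply/propext; split.
  elim=> {q x} [|a ha|q|q c x y _ hx _ hy|q r n x y _ hx _ hy].
  - exact: S_vac.
  - exact: S_X.
  - exact: lcl_0.
  - exact: lcl_lin.
  - exact: (S_prod hs).
elim=> {q x} [q x [[-> ->]|[a [ha -> ->]]|[a [-> ->]]]|q|q c x y _ hx _ hy|q r n N x y _ hx _ hy _].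
- exact: lvsa_vac.
- exact: lvsa_X.
- move: a; apply: (lattice_span (L := L)).
  + move=> b hb; have [c _ [-> _]] := A_XX hs hb; rewrite -[_ *: _]addr0.
    apply: lvsa_lin; last exact: lvsa_0.
    have -> : false = lparity L b (+) lparity L (- b).
      by rewrite -(parD hs) ?subrr ?par0 //; exact: latticeN.
    by apply: lvsa_prod; apply: lvsa_X => //; exact: latticeN.
  + by rewrite (lin0 heis_linear); exact: lvsa_0.
  + by move=> k b c hb hc; rewrite heis_linear; exact: lvsa_lin.
- exact: lvsa_0.
- exact: lvsa_lin.
- exact: lvsa_prod.
Qed.

Lemma mpairDl s a b c : (s < p)%N -> in_lattice L a -> in_lattice L b -> in_lattice L c ->
  mpair G s (a + b) c = mpair G s a c + mpair G s b c.
Proof.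
move=> hs ha hb hc; apply: (@intr_inj C); rewrite rmorphD /= !mpairE //; last exact: latticeD.
rewrite !pairingE -big_split /=; apply: eq_bigr => i _; by rewrite hpairDl mulrDr.
Qed.

Lemma mpairDr s a b c : (s < p)%N -> in_lattice L a -> in_lattice L b -> in_lattice L c ->
  mpair G s c (a + b) = mpair G s c a + mpair G s c b.
Proof.
move=> hs ha hb hc; apply: (@intr_inj C); rewrite rmorphD /= !mpairE //; last exact: latticeD.
rewrite !pairingE -big_split /=; apply: eq_bigr => i _; by rewrite hpairDr mulrDr.
Qed.

(** [kappa] is [eps] times powers whose exponents are biadditive on the lattice, and such factors
    are cocycles. *)
Lemma kappa_cocycle a b c : in_lattice L a -> in_lattice L b -> in_lattice L c ->
  kappa G eps a b * kappa G eps (a + b) c = kappa G eps b c * kappa G eps a (b + c).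
Proof.
move=> ha hb hc; have hp := p_neq0 G; have p0 := gord_gt0 G.
have ec : eps a b * eps (a + b) c = eps b c * eps a (b + c) by case: Heps => _; apply.
have prodD f g : \prod_(1 <= s < p) (1 - om ^+ s) ^ (f s + g s : int) =
    \prod_(1 <= s < p) (1 - om ^+ s) ^ f s * \prod_(1 <= s < p) (1 - om ^+ s) ^ g s.
  rewrite -big_split /= big_nat [RHS]big_nat; apply: eq_bigr => s /andP[s1 s2].
  by rewrite expfzDr // one_sub_omega_neq0.
have eL : \prod_(1 <= s < p) (1 - om ^+ s) ^ mpair G s (a + b) c =
    \prod_(1 <= s < p) (1 - om ^+ s) ^ mpair G s a c * \prod_(1 <= s < p) (1 - om ^+ s) ^ mpair G s b c.
  by rewrite -prodD big_nat [RHS]big_nat; apply: eq_bigr => s /andP[s1 s2]; rewrite mpairDl.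
have eR : \prod_(1 <= s < p) (1 - om ^+ s) ^ mpair G s a (b + c) =
    \prod_(1 <= s < p) (1 - om ^+ s) ^ mpair G s a b * \prod_(1 <= s < p) (1 - om ^+ s) ^ mpair G s a c.
  by rewrite -prodD big_nat [RHS]big_nat; apply: eq_bigr => s /andP[s1 s2]; rewrite mpairDr.
rewrite /kappa -!(mpair0 G) (mpairDl p0 ha hb hc) (mpairDr p0 hb hc ha) eL eR !opprD !expfzDr //.
move: ec; move: (\prod_(_ <= _ < _) _) (\prod_(_ <= _ < _) _) (\prod_(_ <= _ < _) _) => P1 P2 P3.
move: (_ ^ _) (_ ^ _) (_ ^ _) => Q1 Q2 Q3 ec.
transitivity ((eps a b * eps (a + b) c) * (Q1 * Q2 * Q3 * P1 * P2 * P3)); first by ring.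
by rewrite ec; ring.
Qed.

(** Exchanging a and b replaces s by p - s, and 1 - omega^(-s) = -omega^(-s) (1 - omega^s). The
    powers of omega cancel those in the cocycle condition; the sign that remains involves only the
    form, hence is the same for every grading. *)
Lemma kappa_sym a b : in_lattice L a -> in_lattice L b ->
  kappa G eps a b = (-1) ^ (toint (bf a a) * toint (bf b b) - toint (bf a b)) * kappa G eps b a.
Proof.
move=> ha hb; have p0 := gord_gt0 G; have om0 := omega_neq0 G.
have n10 : (-1 : C) != 0 by rewrite oppr_eq0 oner_eq0.
have eps0 : eps b a != 0 by case: Heps => hz _; exact: hz.
have eab : eps a b = eps b a * ((-1) ^ (toint (bf a a) * toint (bf b b) + h0int G a b)
    * om ^ (- \sum_(1 <= s < p) s%:Z * mpair G s a b)).
  have := Hii ha hb; rewrite -hpair0 -h0intE // toint_int => <-.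
  by rewrite mulrC divfK.
have eprod : \prod_(1 <= s < p) (1 - om ^+ s) ^ mpair G s b a =
    \prod_(1 <= s < p) (- om^-1 ^+ s) ^ mpair G s a b * \prod_(1 <= s < p) (1 - om ^+ s) ^ mpair G s a b.
  rewrite big_nat_rev -big_split /= big_nat [RHS]big_nat; apply: eq_bigr => s /andP[s1 s2].
  have -> : mpair G (1 + p - s.+1) b a = mpair G s a b.
    rewrite /mpair pairingC; last by lia.
    by have -> : ((p - (1 + p - s.+1)) %% p)%N = s by rewrite modn_small; lia.
  rewrite -expfzMl; congr (_ ^ _).
  have -> : om ^+ (1 + p - s.+1) = om^-1 ^+ s.
    rewrite exprVn; apply: (mulIf (omX_neq0 G s)); rewrite mulVf ?omX_neq0 // -exprD.
    by rewrite (_ : (_ + _)%N = p) ?(prim_expr_order (omega_prim G)) //; lia.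
  by rewrite mulrBr mulr1 mulNr opprK exprVn mulVf ?omX_neq0 // addrC.
have eneg : \prod_(1 <= s < p) (- om^-1 ^+ s) ^ mpair G s a b =
    (-1) ^ (h0int G a b - mpair G 0 a b) * om ^ (- \sum_(1 <= s < p) s%:Z * mpair G s a b).
  have := prod_oppX p (fun s => mpair G s a b) (invr_neq0 om0).
  rewrite -(big_mkord xpredT (fun s => (- om^-1 ^+ s) ^ mpair G s a b)) big_ltn // expr0.
  rewrite -(big_mkord xpredT (fun s => s%:Z * mpair G s a b)) [in X in _ = _ * X]big_ltn // mul0r add0r.
  rewrite -/(h0int G a b); move: (\sum_(_ <= _ < _) _) (\prod_(_ <= _ < _) _) => S P e.
  rewrite expfzDr // -invr_expz -[P](mulKf (expfz_neq0 (mpair G 0 a b) n10)) e mulrA [_^-1 * _]mulrC.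
  by rewrite exprz_inv.
have ss m : (-1) ^ (- m) * (-1) ^ (- m) = 1 :> C by rewrite !signz_odd -signr_addb addbb.
rewrite /kappa eab eprod eneg [bf b a]bfC -!(mpair0 G) !expfzDr //.
move: (ss (mpair G 0 a b)); move: ((-1) ^ (- mpair G 0 a b)) => t tt.
move: (_ ^ _) (_ ^ _) (_ ^ _) (om ^ _) (\prod_(_ <= _ < _) _) => Q4 Q3 Q2 Q1 P1.
by rewrite -[LHS]mulr1 -tt; ring.
Qed.

End FockSystem.

(** * Independence of the grading *)

Section PairedFields.
Variables (R : realType) (V V' : lmodType R[i]).
Local Notation C := R[i].
Local Notation field := (C -> V -> V).
Local Notation field' := (C -> V' -> V').

Definition pairf (x : field) (y : field') : C -> V * V' -> V * V' := fun n w => (x n w.1, y n w.2).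

Lemma pairf_inj x y x' y' : pairf x y = pairf x' y' -> x = x' /\ y = y'.
Proof.
move=> e; split; apply/funext => n; apply/funext => v.
  by have := congr1 (fun f => (f n (v, 0)).1) e.
by have := congr1 (fun f => (f n (0, v)).2) e.
Qed.

Lemma pairf_lin (k : C) x y x' y' : k *: pairf x y + pairf x' y' = pairf (k *: x + x') (k *: y + y').
Proof. by []. Qed.

Lemma pairfZ (k : C) x y : k *: pairf x y = pairf (k *: x) (k *: y).
Proof. by []. Qed.

Lemma pairf0 : pairf 0 0 = 0.
Proof. by []. Qed.

Lemma vac_pairf : @vac_op R (V * V')%type = pairf (@vac_op R V) (@vac_op R V').
Proof. by apply/funext => n; apply/funext => -[v v']; rewrite /vac_op /pairf /=; case: ifP. Qed.

Lemma ddz_pairf x y : ddz (pairf x y) = pairf (ddz x) (ddz y).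
Proof. by []. Qed.

Lemma pair_neq0 (u : V * V') : u <> 0 -> u.1 <> 0 \/ u.2 <> 0.
Proof.
case: u => u1 u2 hu; have [e1|/eqP h1] := eqVneq u1 0; last by left.
by right=> /= e2; apply: hu; rewrite e1 e2.
Qed.

Lemma isfld_pairf x y : isfld x -> isfld y -> isfld (pairf x y).
Proof.
move=> [xl [cs hc] xb] [yl [cs' hc'] yb]; split.
- move=> n k u v; rewrite /pairf /= xl yl //.
- exists (cs ++ cs') => n w /pair_neq0[/hc[c h1 h2]|/hc'[c h1 h2]]; exists c => //; rewrite mem_cat h1 ?orbT //.
- move=> [v v']; have [ds hd] := xb v; have [ds' hd'] := yb v'; exists (ds ++ ds') => z.
  by move=> /pair_neq0[/hd|/hd'] hh; [exact: lbd_catl|exact: lbd_catr].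
Qed.

Lemma sum_pairE (I : Type) (r : seq I) (f : I -> V) (g : I -> V') :
  \sum_(i <- r) ((f i, g i) : V * V') = (\sum_(i <- r) f i, \sum_(i <- r) g i).
Proof. by elim: r => [|i r IH]; rewrite ?big_nil // !big_cons IH. Qed.

Lemma local_pairf p q N x x' y y' : local p q N x x' -> local p q N y y' -> local p q N (pairf x y) (pairf x' y').
Proof.
move=> hx hy n m [v v']; have := hx n m v; have := hy n m v'.
by move=> h1 h2; rewrite -[RHS]/(0, 0) -h1 -h2 -sum_pairE.
Qed.

Lemma fsum_pairE (T : choiceType) (f : T -> V * V') : fin f ->
  fsum f = (fsum (fun i => (f i).1), fsum (fun i => (f i).2)).
Proof.
move=> hf; rewrite [LHS]surjective_pairing; congr (_, _).
  by apply: (fsum_morph (g := @fst V V')).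
by apply: (fsum_morph (g := @snd V V')).
Qed.

Lemma iter_md_pair N (A : C -> C -> V) (B : C -> C -> V') x y :
  iter N (@md R (V * V')%type) (fun x y => (A x y, B x y)) x y = (iter N (@md R V) A x y, iter N (@md R V') B x y).
Proof. by elim: N x y => // N IH x y; rewrite /= /md !IH. Qed.

Lemma op_prod_pairf p q n N x x' y y' : isfld x -> isfld x' -> isfld y -> isfld y' ->
  local p q N x x' -> local p q N y y' ->
  op_prod p q n (pairf x y) (pairf x' y') = pairf (op_prod p q n x x') (op_prod p q n y y').
Proof.
move=> fx fx' fy fy' hx hy; apply/funext => k; apply/funext => -[v v'].
rewrite (op_prod_tau _ (isfld_pairf fx fy) (isfld_pairf fx' fy') (local_pairf hx hy)) /pairf /=.
rewrite (op_prod_tau _ fx fx' hx) (op_prod_tau _ fy fy' hy).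
rewrite (eq_tauz _ (B := fun a b => (iter N (@md R V) (prod2 x x' v) a b, iter N (@md R V') (prod2 y y' v') a b))); last first.
  by move=> a b; rewrite -iter_md_pair.
have r1 := reg2_fs2 (local_reg2 v fx fx' hx); have r2 := reg2_fs2 (local_reg2 v' fy fy' hy).
rewrite /tauz; case: (_ - n) => // d; rewrite /tau fsum_pairE //.
have [s1 h1] := r1 (- k - 1 + d%:R); have [s2 h2] := r2 (- k - 1 + d%:R).
exists (s1 ++ s2) => a; rewrite mem_cat => ha.
have /pair_neq0[/h1 -> //|/h2 ->] : (iter N (@md R V) (prod2 x x' v) a (- k - 1 + d%:R - a), iter N (@md R V') (prod2 y y' v') a (- k - 1 + d%:R - a)) <> 0.
  by move=> e; apply: ha; rewrite e scaler0.
by rewrite orbT.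
Qed.

End PairedFields.

(** * Symmetric cocycles on a free abelian group *)

Section CocycleTrivialization.
Variables (K : fieldType) (l : nat).
Local Notation N := 'rV[int]_l.

Record sym_cocycle (g : N -> N -> K) : Prop := {
  sc_neq0 : forall m n, g m n != 0;
  sc_sym : forall m n, g m n = g n m;
  sc_cocycle : forall m n k, g m n * g (m + n) k = g n k * g m (n + k)
}.

(* The extension of [N] by the units of [K] with symmetric cocycle [g] is abelian,
   and splits because [N] is free: a section exhibits [g] as a coboundary. *)
Definition ext (g : N -> N -> K) (hg : sym_cocycle g) : Type := ({x : K | x != 0} * N)%type.

Section Ext.
Variables (g : N -> N -> K) (hg : sym_cocycle g).
Local Notation E := (ext hg).

HB.instance Definition _ := Choice.on E.

Definition mkE (x : K) (hx : x != 0) (n : N) : E := (exist _ x hx, n).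

Lemma extP (u v : E) : val u.1 = val v.1 -> u.2 = v.2 -> u = v.
Proof. by case: u v => [u m] [v n] /= /val_inj -> ->. Qed.

Fact add_neq0 (u v : E) : val u.1 * val v.1 * g u.2 v.2 != 0.
Proof. by rewrite !mulf_neq0 ?(valP u.1) ?(valP v.1) ?(sc_neq0 hg). Qed.
Definition extadd (u v : E) : E := mkE (add_neq0 u v) (u.2 + v.2).

Fact zero_neq0 : (g 0 0)^-1 != 0.
Proof. by rewrite invr_eq0 (sc_neq0 hg). Qed.
Definition ext0 : E := mkE zero_neq0 0.

Fact opp_neq0 (u : E) : (val u.1 * g (- u.2) u.2 * g 0 0)^-1 != 0.
Proof. by rewrite invr_eq0 !mulf_neq0 ?(valP u.1) ?(sc_neq0 hg). Qed.
Definition extopp (u : E) : E := mkE (opp_neq0 u) (- u.2).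

Lemma cocycle0 n : g 0 n = g 0 0.
Proof.
have := sc_cocycle hg 0 0 n; rewrite !add0r mulrC => /(mulfI (sc_neq0 hg _ _)) ->.
by [].
Qed.

Fact extaddA : associative extadd.
Proof.
move=> u v w; apply: extP => /=; last by rewrite addrA.
have := sc_cocycle hg u.2 v.2 w.2 => e.
transitivity (sval u.1 * sval v.1 * sval w.1 * (g v.2 w.2 * g u.2 (v.2 + w.2))); first by ring.
by rewrite -e; ring.
Qed.

Fact extaddC : commutative extadd.
Proof. by move=> u v; apply: extP; [rewrite /= (sc_sym hg) (mulrC (sval u.1))|exact: addrC]. Qed.

Fact extadd0 : left_id ext0 extadd.
Proof.
move=> u; apply: extP => /=; last by rewrite add0r.
by rewrite cocycle0 mulrAC mulVf ?mul1r // (sc_neq0 hg).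
Qed.

Fact extaddN : left_inverse ext0 extopp extadd.
Proof.
move=> u; apply: extP => /=; last by rewrite addNr.
have h1 := valP u.1; have h2 := sc_neq0 hg (- u.2) u.2; have h3 := sc_neq0 hg 0 0.
by move: h1 h2 h3 => /= h1 h2 h3; field; rewrite h1 h2 h3.
Qed.

HB.instance Definition _ := GRing.isZmodule.Build E extaddA extaddC extadd0 extaddN.

Definition extsnd (u : E) : N := u.2.

Fact extsnd_additive : {morph extsnd : x y / x - y}.
Proof. by []. Qed.

HB.instance Definition _ := GRing.isZmodMorphism.Build E N extsnd extsnd_additive.

Definition section (n : N) : E := \sum_(i < l) mkE (oner_neq0 K) (delta_mx 0 i) *~ n 0 i.

Lemma sectionD m n : section (m + n) = section m + section n.
Proof. by rewrite /section -big_split /=; apply: eq_bigr => i _; rewrite mxE mulrzDr. Qed.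

Lemma section_snd n : (section n).2 = n.
Proof.
rewrite -[LHS]/(extsnd (section n)) /section raddf_sum [RHS]row_sum_delta; apply: eq_bigr => i _.
by rewrite raddfMz -scaler_int intz.
Qed.

End Ext.

Lemma cocycle_trivial (g : N -> N -> K) : sym_cocycle g -> exists c : N -> K,
  (forall n, c n != 0) /\ forall m n, c (m + n) = c m * c n * g m n.
Proof.
move=> hg; exists (fun n => val (section hg n).1); split=> [n|m n]; first exact: (valP (section hg n).1).
by rewrite sectionD /= !section_snd.
Qed.

End CocycleTrivialization.

(** * The isomorphism between two realizations *)

Section PairedSystems.
Variables (R : realType) (l : nat) (h : vectType R[i]) (L : lattice_data l h) (V V' : lmodType R[i]).
Local Notation C := R[i].
Local Notation bf := (bform L).
Local Notation par := (lparity L).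
Variables (X A : h -> C -> V -> V) (X' A' : h -> C -> V' -> V') (kap kap' : h -> h -> C).
Hypotheses (hs : lattice_system L X A kap) (hs' : lattice_system L X' A' kap').
Hypotheses (vac0 : @vac_op R V <> 0) (vac0' : @vac_op R V' <> 0).
Variable c : h -> C.
Hypothesis c_neq0 : forall a, in_lattice L a -> c a != 0.
Hypothesis c_kap : forall a b, in_lattice L a -> in_lattice L b ->
  c a * c b * kap' a b = c (a + b) * kap a b.
Local Notation S := (lclosure (gens L X A)).
Local Notation S' := (lclosure (gens L X' A')).

(* The vertex algebra generated by these fields on [V * V'] projects onto both
   factors, and is the graph of an isomorphism because both are simple. *)
Definition PX (a : h) := pairf (X a) (c a *: X' a).
Definition PA (a : h) := pairf (A a) (A' a).
Local Notation Gam := (lclosure (gens L PX PA)).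

Lemma pair_local q r x y x' y' : S q x -> S r x' -> S' q y -> S' r y' ->
  exists N, local q r N x x' /\ local q r N y y'.
Proof.
move=> hx hx' hy hy'; have [N hN] := S_local hs hx hx'; have [M hM] := S_local hs' hy hy'.
by exists (N + M)%N; split; [apply: (local_le _ hN)|apply: (local_le _ hM)]; lia.
Qed.

Lemma pair_prod q r n x y x' y' : S q x -> S r x' -> S' q y -> S' r y' ->
  op_prod q r n (pairf x y) (pairf x' y') = pairf (op_prod q r n x x') (op_prod q r n y y').
Proof.
move=> hx hx' hy hy'; have [N [h1 h2]] := pair_local hx hx' hy hy'.
exact: op_prod_pairf (S_fld hs hx) (S_fld hs hx') (S_fld hs' hy) (S_fld hs' hy') h1 h2.
Qed.

Lemma pair_gens q z : gens L PX PA q z -> exists x y, [/\ z = pairf x y, S q x & S' q y].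
Proof.
move=> [[-> ->]|[a [ha -> ->]]|[a [-> ->]]].
- by exists (@vac_op R V), (@vac_op R V'); split; [exact: vac_pairf|exact: S_vac|exact: S_vac].
- exists (X a), (c a *: X' a); split => //; first exact: S_X.
  by apply: S_Z; exact: S_X.
- by exists (A a), (A' a); split => //; exact: S_A.
Qed.

(** If X_0 = e 1 with 1 nonzero, the leading product of X_0 with itself forces e = kap 0 0. Then
    [c_kap] at (0,0) is the normalization that makes [PX 0] a multiple of the paired identity. *)
Lemma kap00 : exists e e', [/\ X 0 = e *: @vac_op R V, X' 0 = e' *: @vac_op R V' & c 0 * e' = e].
Proof.
have h0 := lattice0 L; have [e e0 eX] := ls_X0 hs; have [e' e0' eX'] := ls_X0 hs'.
exists e, e'; split => //.
have bf0 : toint (bf 0 0) = 0 by rewrite bf0l -[0 : C]/(0%:~R) toint_int.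
have key (W : lmodType C) (Y B : h -> C -> W -> W) k d : lattice_system L Y B k -> Y 0 = d *: @vac_op R W -> d != 0 ->
    @vac_op R W <> 0 -> d = k 0 0.
  move=> hW eY d0 hv; have := ls_XX hW h0 h0; rewrite bf0 sub0r addr0 eY par0.
  rewrite (prodZl hW _ _ (S_vac L Y B) (S_Z _ (S_vac L Y B))) (prodZr hW _ _ (S_vac L Y B) (S_vac L Y B)).
  rewrite (op_prod_vacl _ _ (S_fld hW (S_vac L Y B))) eqxx !scalerA => /eqP.
  rewrite -subr_eq0 -scalerBl scaler_eq0 => /orP[|/eqP //].
  by rewrite subr_eq0 => /eqP /(mulIf d0).
have := c_kap h0 h0; rewrite addr0 (key _ _ _ _ _ hs eX e0 vac0) (key _ _ _ _ _ hs' eX' e0' vac0') -mulrA.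
by move/(mulfI (c_neq0 h0)).
Qed.

(** By [c_kap] the rescaled second components multiply with the same constants [kap] as the first,
    so each relation holds in both components at once. *)
Lemma pair_system : lattice_system L PX PA kap.
Proof.
have SZ' a : in_lattice L a -> S' (par a) (c a *: X' a) by move=> ha; apply: S_Z; exact: S_X.
split.
- split=> [q z /pair_gens[x [y [-> hx hy]]]|q r z z' /pair_gens[x [y [-> hx hy]]] /pair_gens[x' [y' [-> hx' hy']]]].
    by apply: isfld_pairf; [exact: (S_fld hs hx)|exact: (S_fld hs' hy)].
  by have [N [h1 h2]] := pair_local hx hx' hy hy'; exists N; exact: local_pairf.
- exact: ls_int hs.
- move=> k a b; rewrite /PA (ls_A_lin hs) (ls_A_lin hs') pairf_lin //.
- move=> a b hb; rewrite /act /PA /PX.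
  apply: etrans (pair_prod 0 (S_A L X A a) (S_X X A hb) (S_A L X' A' a) (SZ' _ hb)) _.
  rewrite pairfZ; congr pairf; first exact: ls_AX0 hs a b hb.
  rewrite -[LHS]/(act A' a 0 (c b *: X' b)) (actZ hs' _ _ _ (S_X X' A' hb)) (ls_AX0 hs') // !scalerA mulrC //.
- move=> a b n hb hn; rewrite /act /PA /PX.
  apply: etrans (pair_prod n (S_A L X A a) (S_X X A hb) (S_A L X' A' a) (SZ' _ hb)) _.
  rewrite -pairf0; congr pairf; first exact: ls_AX hs a b n hb hn.
  by rewrite -[LHS]/(act A' a n (c b *: X' b)) (actZ hs' _ _ _ (S_X X' A' hb)) (ls_AX hs') // scaler0.
- move=> b hb; rewrite /act /PA /PX ddz_pairf.
  apply: etrans _ (esym (pair_prod (-1) (S_A L X A b) (S_X X A hb) (S_A L X' A' b) (SZ' _ hb))).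
  congr pairf; first exact: ls_DX hs b hb.
  by rewrite -[RHS]/(act A' b (-1) (c b *: X' b)) (actZ hs' _ _ _ (S_X X' A' hb)) ddzZ (ls_DX hs').
- move=> a b n ha hb hn; rewrite /PX (pair_prod n (S_X X A ha) (S_X X A hb) (SZ' _ ha) (SZ' _ hb)).
  rewrite -pairf0; congr pairf; first exact: ls_XX0 hs a b n ha hb hn.
  by rewrite (prodZl hs' _ _ (S_X X' A' ha) (SZ' _ hb)) (prodZr hs' _ _ (S_X X' A' ha) (S_X X' A' hb)) (ls_XX0 hs') // !scaler0.
- move=> a b ha hb; rewrite /PX (pair_prod _ (S_X X A ha) (S_X X A hb) (SZ' _ ha) (SZ' _ hb)).
  rewrite pairfZ; congr pairf; first exact: ls_XX hs a b ha hb.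
  rewrite (prodZl hs' _ _ (S_X X' A' ha) (SZ' _ hb)) (prodZr hs' _ _ (S_X X' A' ha) (S_X X' A' hb)) (ls_XX hs') // !scalerA.
  by rewrite c_kap // mulrC.
- exact: ls_kap hs.
- have [e [e' [eX eX' ee]]] := kap00; have [d d0 dX] := ls_X0 hs.
  exists e; last by rewrite /PX eX eX' scalerA ee vac_pairf.
  apply/eqP => e0; move: dX; rewrite eX e0 scale0r => /esym/eqP; rewrite scaler_eq0 (negPf d0) /=.
  by move/eqP.
Qed.

Lemma Gam_pair q z : Gam q z -> exists x y, [/\ z = pairf x y, S q x & S' q y].
Proof.
elim=> {q z} [q z|q|q k z z' _ [x [y [-> hx hy]]] _ [x' [y' [-> hx' hy']]]|q r n N z z' _ [x [y [-> hx hy]]] _ [x' [y' [-> hx' hy']]] _].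
- exact: pair_gens.
- by exists 0, 0; split; [|exact: S_0|exact: S_0].
- by exists (k *: x + x'), (k *: y + y'); split; [|exact: S_lin|exact: S_lin].
- by exists (op_prod q r n x x'), (op_prod q r n y y'); split; [exact: pair_prod|exact: (S_prod hs)|exact: (S_prod hs')].
Qed.

Lemma Gam_in q x y : Gam q (pairf x y) -> S q x /\ S' q y.
Proof. by move=> /Gam_pair[x' [y' [/pairf_inj[-> ->] ? ?]]]. Qed.

Let ps := pair_system.

Lemma Gam_left q x : S q x -> exists y, Gam q (pairf x y).
Proof.
elim=> {q x} [q x [[-> ->]|[a [ha -> ->]]|[a [-> ->]]]|q|q k x x' _ [y hy] _ [y' hy']|q r n N x x' _ [y hy] _ [y' hy'] _].
- by exists (@vac_op R V'); rewrite -vac_pairf; exact: (S_vac _ _ _).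
- by exists (c a *: X' a); exact: (S_X _ _ ha).
- by exists (A' a); exact: (S_A _ _ _ a).
- by exists 0; rewrite pairf0; exact: S_0.
- by exists (k *: y + y'); rewrite -pairf_lin; exact: S_lin.
- exists (op_prod q r n y y'); have [h1 h2] := Gam_in hy; have [h3 h4] := Gam_in hy'.
  by rewrite -(pair_prod n h1 h3 h2 h4); exact: (S_prod ps).
Qed.

Lemma Gam_right q y : S' q y -> exists x, Gam q (pairf x y).
Proof.
elim=> {q y} [q y [[-> ->]|[a [ha -> ->]]|[a [-> ->]]]|q|q k y y' _ [x hx] _ [x' hx']|q r n N y y' _ [x hx] _ [x' hx'] _].
- by exists (@vac_op R V); rewrite -vac_pairf; exact: (S_vac _ _ _).
- exists ((c a)^-1 *: X a).
  have -> : pairf ((c a)^-1 *: X a) (X' a) = (c a)^-1 *: PX a.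
    by rewrite /PX pairfZ scalerA mulVf ?scale1r // c_neq0.
  by apply: S_Z; exact: S_X.
- by exists (A a); exact: (S_A _ _ _ a).
- by exists 0; rewrite pairf0; exact: S_0.
- by exists (k *: x + x'); rewrite -pairf_lin; exact: S_lin.
- exists (op_prod q r n x x'); have [h1 h2] := Gam_in hx; have [h3 h4] := Gam_in hx'.
  by rewrite -(pair_prod n h1 h3 h2 h4); exact: (S_prod ps).
Qed.

(** The pairs (0, y) are stable under products from the left. A nonzero one would by [S_simple]
    bring the identity into this form, but the first component of the identity is nonzero. *)
Lemma Gam_zerol q y : Gam q (pairf 0 y) -> y = 0.
Proof.
move=> hy; apply: contrapT => y0.
have [] // : exists z, @vac_op R (V * V')%type = pairf 0 z; last by move=> z; rewrite vac_pairf => /pairf_inj[].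
apply: (S_simple ps (I := fun z => exists y, z = pairf 0 y) (q := q) (z := pairf 0 y)) => //.
- by exists 0; rewrite pairf0.
- by move=> k z z' [x ->] [x' ->]; exists (k *: x + x'); rewrite pairf_lin scaler0 addr0.
- move=> p' q' n z z' /Gam_pair[x [x' [-> hx hx']]] hz [u eu]; rewrite eu in hz *.
  have [h1 h2] := Gam_in hz; exists (op_prod p' q' n x' u).
  by rewrite (pair_prod n hx h1 hx' h2) (prod0r hs _ _ hx).
- by exists y.
- by rewrite -pairf0 => /pairf_inj[].
Qed.

Lemma Gam_zeror q x : Gam q (pairf x 0) -> x = 0.
Proof.
move=> hx; apply: contrapT => x0.
have [] // : exists z, @vac_op R (V * V')%type = pairf z 0; last by move=> z; rewrite vac_pairf => /pairf_inj[].
apply: (S_simple ps (I := fun z => exists y, z = pairf y 0) (q := q) (z := pairf x 0)) => //.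
- by exists 0; rewrite pairf0.
- by move=> k z z' [y ->] [y' ->]; exists (k *: y + y'); rewrite pairf_lin scaler0 addr0.
- move=> p' q' n z z' /Gam_pair[y [y' [-> hy hy']]] hz [u eu]; rewrite eu in hz *.
  have [h1 h2] := Gam_in hz; exists (op_prod p' q' n y u).
  by rewrite (pair_prod n hy h1 hy' h2) (prod0r hs' _ _ hy').
- by exists x.
- by rewrite -pairf0 => /pairf_inj[].
Qed.

(** [iso_map] does not record the parity, so two parities may have to be compared; if they differ, x
    is even and odd, hence zero. *)
Lemma Gam_fun q q' x y y' : Gam q (pairf x y) -> Gam q' (pairf x y') -> y = y'.
Proof.
move=> hy hy'; have [qq|qq] := eqVneq q q'.
  rewrite -{}qq in hy'; apply/eqP; rewrite -subr_eq0; apply/eqP; apply: (@Gam_zerol q).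
  have := S_lin (-1) hy' hy; rewrite pairf_lin scaleN1r addNr scaleN1r addrC //.
have [h1 _] := Gam_in hy; have [h2 _] := Gam_in hy'.
have x0 : x = 0.
  by apply: (S_direct hs); move: qq h1 h2; case: q {hy}; case: q' {hy'}.
by rewrite x0 in hy hy'; rewrite (Gam_zerol hy) (Gam_zerol hy').
Qed.

Definition iso_map (x : C -> V -> V) : C -> V' -> V' := xget 0 [set y | exists q, Gam q (pairf x y)].

Lemma iso_mapE q x y : Gam q (pairf x y) -> iso_map x = y.
Proof.
move=> hy; rewrite /iso_map; case: xgetP => [z _ [q' hz]|/(_ y)[]]; first exact: Gam_fun hz hy.
by exists q.
Qed.

Lemma iso_mapP q x : S q x -> Gam q (pairf x (iso_map x)).
Proof. by move=> /Gam_left[y hy]; rewrite (iso_mapE hy). Qed.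

Lemma paired_iso : vsa_isomorphism S (@op_prod R V) (@vac_op R V) S' (@op_prod R V') (@vac_op R V') iso_map.
Proof.
split.
- move=> q k x y hx hy; apply: (@iso_mapE q); rewrite -pairf_lin.
  by apply: S_lin; exact: iso_mapP.
- by move=> q x hx e; have := iso_mapP hx; rewrite e; exact: Gam_zeror.
- move=> q; apply/seteqP; split=> [_ [x hx <-]|y /Gam_right[x hx]].
    by have [] := Gam_in (iso_mapP hx).
  by exists x; [have [] := Gam_in hx|exact: iso_mapE hx].
- by apply: (@iso_mapE false); rewrite -vac_pairf; exact: (S_vac _ _ _).
- move=> q r n x y hx hy; apply: (@iso_mapE (q (+) r)).
  have gx := iso_mapP hx; have gy := iso_mapP hy.
  have [h1 h2] := Gam_in gx; have [h3 h4] := Gam_in gy.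
  by rewrite -(pair_prod n h1 h3 h2 h4); exact: (S_prod ps).
Qed.

Lemma iso_map_X a : in_lattice L a -> iso_map (X a) = c a *: X' a.
Proof. by move=> ha; apply: (@iso_mapE (par a)); exact: (S_X _ _ ha). Qed.

End PairedSystems.

Section LatticeCocycles.
Variables (R : realType) (l : nat) (h : vectType R[i]) (L : lattice_data l h).
Local Notation C := R[i].

Definition lvec (n : 'rV[int]_l) : h := \sum_(i < l) tnth (lbasis L) i *~ n 0 i.

Lemma lvec_in n : in_lattice L (lvec n).
Proof. by exists (fun i => n 0 i). Qed.

Lemma lvecD m n : lvec (m + n) = lvec m + lvec n.
Proof. by rewrite /lvec -big_split /=; apply: eq_bigr => i _; rewrite mxE mulrzDr. Qed.

Definition lcoord (a : h) : 'rV[int]_l := \row_i toint (coord (lbasis L) i a).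

Lemma lvecK a : in_lattice L a -> lvec (lcoord a) = a.
Proof.
move=> [n ->]; rewrite /lvec; apply: eq_bigr => i _; congr (_ *~ _); rewrite mxE.
have -> : \sum_(j < l) tnth (lbasis L) j *~ n j = \sum_(j < l) (n j)%:~R *: (lbasis L)`_j.
  by apply: eq_bigr => j _; rewrite scaler_int (tnth_nth 0).
by rewrite coord_sum_free ?toint_int //; exact: basis_free (lbasisP L).
Qed.

Lemma lcoordD a b : in_lattice L a -> in_lattice L b -> lcoord (a + b) = lcoord a + lcoord b.
Proof.
have cint x i : in_lattice L x -> is_int (coord (lbasis L) i x).
  move=> [n ->].
  have -> : \sum_(j < l) tnth (lbasis L) j *~ n j = \sum_(j < l) (n j)%:~R *: (lbasis L)`_j.
    by apply: eq_bigr => j _; rewrite scaler_int (tnth_nth 0).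
  rewrite coord_sum_free; first exact: is_int_int.
  exact: basis_free (lbasisP L).
move=> ha hb; apply/rowP => i; rewrite !mxE linearD /=.
have [m hm] := cint _ i ha; have [n hn] := cint _ i hb.
by rewrite hm hn -rmorphD /= !toint_int.
Qed.

Lemma lattice_cocycle_trivial (f : h -> h -> C) :
  (forall a b, in_lattice L a -> in_lattice L b -> f a b != 0) ->
  (forall a b, in_lattice L a -> in_lattice L b -> f a b = f b a) ->
  (forall a b c, in_lattice L a -> in_lattice L b -> in_lattice L c ->
     f a b * f (a + b) c = f b c * f a (b + c)) ->
  exists c : h -> C, (forall a, c a != 0) /\
    forall a b, in_lattice L a -> in_lattice L b -> c (a + b) = c a * c b * f a b.
Proof.
move=> f0 fC fA; have [c [c0 cD]] : exists c : 'rV[int]_l -> C, (forall n, c n != 0) /\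
    forall m n, c (m + n) = c m * c n * f (lvec m) (lvec n).
  apply: (@cocycle_trivial C l (fun m n => f (lvec m) (lvec n))); split.
  - by move=> m n; apply: f0; exact: lvec_in.
  - by move=> m n; apply: fC; exact: lvec_in.
  - by move=> m n k; rewrite !lvecD; apply: fA; exact: lvec_in.
exists (fun a => c (lcoord a)); split=> [a|a b ha hb]; first exact: c0.
by rewrite lcoordD // cD !lvecK.
Qed.

End LatticeCocycles.

Lemma divf_mul_eq (K : fieldType) (a b c d a' b' c' d' : K) : a * b = c * d -> a' * b' = c' * d' ->
  a' / a * (b' / b) = c' / c * (d' / d).
Proof. by move=> e e'; rewrite mulrACA -invfM e e' invfM mulrACA. Qed.

Theorem theorem2 (R : realType) (l : nat) (h : vectType R[i])
    (L : lattice_data l h) (G : cyclic_grading L) (eps : h -> h -> R[i])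
    (V : lmodType R[i]) (F : fock_space G eps V)
    (Hagree : lattice_agrees G) (Heps : cocycle L eps)
    (Hdiag : h0_diagonalizable F) (Hdef : vertex_operators_defined F)
    (Hi : integral_pairings G) (Hii : cocycle_condition G eps) :
  [/\ (* the operators X_a lie in F{V} and are local *)
      (forall a, in_lattice L a -> gen_vertex_operator (X_op F a)),
      (forall a b, in_lattice L a -> in_lattice L b ->
         local (lparity L a) (lparity L b) (locality_order G a b)
           (X_op F a) (X_op F b)),
      (* they generate a vertex superalgebra in F{V} *)
      [/\ (forall q x, lattice_vsa F q x -> gen_vertex_operator x),
          (forall q r x y, lattice_vsa F q x -> lattice_vsa F r y ->
             exists N, local q r N x y)
        & vertex_superalgebra (lattice_vsa F) (@op_prod R V) (@vac_op R V)],
      (* which does not depend on the grading *)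
      (forall (G' : cyclic_grading L) (eps' : h -> h -> R[i])
          (V' : lmodType R[i]) (F' : fock_space G' eps' V'),
         lattice_agrees G' -> cocycle L eps' ->
         h0_diagonalizable F' -> vertex_operators_defined F' ->
         integral_pairings G' -> cocycle_condition G' eps' ->
         (exists v : V, v != 0) -> (exists v : V', v != 0) ->
         exists phi : (R[i] -> V -> V) -> (R[i] -> V' -> V'),
           vsa_isomorphism (lattice_vsa F) (@op_prod R V) (@vac_op R V)
             (lattice_vsa F') (@op_prod R V') (@vac_op R V') phi /\
           forall a, in_lattice L a ->
             exists2 c : R[i], c != 0 & phi (X_op F a) = c *: X_op F' a)
    & (* the products of the generators *)
      forall a b, in_lattice L a -> in_lattice L b ->
        (forall n : nat,
           op_prod (lparity L a) (lparity L b)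
             (- toint (bform L a b) - n%:Z - 1) (X_op F a) (X_op F b) =
           kappa G eps a b *: ((n`!)%:R^-1 *:
             iter n (D_minus F b (lparity L (a + b))) (X_op F (a + b)))) /\
        (forall n : int, - toint (bform L a b) <= n ->
           op_prod (lparity L a) (lparity L b) n (X_op F a) (X_op F b) = 0)].
Proof.
have hs := fock_system Heps Hi Hii Hdiag Hdef.
have vsaE := lattice_vsaE Heps Hi Hii Hdiag Hdef.
have SF := S_family hs.
split.
- by move=> a ha; apply: isfld_gen; exact: isfld_X.
- move=> a b ha hb; apply: (X_local Heps Hi Hii Hdiag Hdef) => // s; exact: locality_orderP.
- rewrite vsaE; split.
  + by move=> q x hx; apply: isfld_gen; exact: (S_fld hs hx).
  + by move=> q r x y; exact: (S_local hs).
  + apply: (family_vsa SF) => //.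
    * exact: S_vac.
    * exact: S_0.
    * by move=> q k x y; exact: S_lin.
    * by move=> q r n x y; exact: (S_prod hs).
    * by move=> x; exact: (S_direct hs).
- move=> G' eps' V' F' _ Heps' Hdiag' Hdef' Hi' Hii' [v v0] [v' v0'].
  have hs' := fock_system Heps' Hi' Hii' Hdiag' Hdef'.
  have k0 := kappa_neq0 G Heps; have k0' := kappa_neq0 G' Heps'.
  (* The sign of [kappa_sym] is common to both gradings and cancels in the quotient, which is
     therefore a symmetric cocycle; [c] rescales the second family of generators. *)
  have [c [c0 cD]] : exists c : h -> R[i], (forall a, c a != 0) /\
      forall a b, in_lattice L a -> in_lattice L b -> c (a + b) = c a * c b * (kappa G' eps' a b / kappa G eps a b).
    apply: lattice_cocycle_trivial => [a b ha hb|a b ha hb|a b c ha hb hc].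
    + by rewrite mulf_neq0 ?invr_eq0 ?k0 ?k0'.
    + rewrite (kappa_sym Heps Hi Hii ha hb) (kappa_sym Heps' Hi' Hii' ha hb) invfM mulrACA mulfV ?mul1r //.
      by rewrite expfz_neq0 // oppr_eq0 oner_eq0.
    + exact: divf_mul_eq (kappa_cocycle Heps Hi ha hb hc) (kappa_cocycle Heps' Hi' ha hb hc).
  have ck a b : in_lattice L a -> in_lattice L b -> c a * c b * kappa G' eps' a b = c (a + b) * kappa G eps a b.
    by move=> ha hb; rewrite (cD a b ha hb) -(mulrA (c a * c b)) (divfK (k0 _ _ ha hb)).
  (* A nonzero vector makes the identity field nonzero, as [kap00] and the simplicity argument
     require. *)
  have vac0 (W : lmodType R[i]) (w : W) : w != 0 -> @vac_op R W <> 0.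
    by move=> /eqP w0 /(congr1 (fun f => f (-1) w)); rewrite /vac_op eqxx.
  rewrite vsaE (lattice_vsaE Heps' Hi' Hii' Hdiag' Hdef').
  exists (iso_map L (X_op F) (heis_op F) (X_op F') (heis_op F') c); split.
    by apply: (paired_iso hs hs') => //; [exact: vac0 v0|exact: vac0 v0'].
  move=> a ha; exists (c a); first exact: c0.
  by apply: (iso_map_X hs hs') => //; [exact: vac0 v0|exact: vac0 v0'].
- move=> a b ha hb; split=> [n|n hn]; first exact: (XX_prod hs ha hb n).
  exact: (ls_XX0 hs ha hb hn).
Qed.
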